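(* For every $\nu\ge0$, $$\det\nolimits_\zeta L_\nu=\frac{\sqrt{2\pi}}{2^\nu\,\Gamma(\nu+1)}.$$
   Context: For $\nu\ge0$, $L_\nu$ denotes the Friedrichs extension in $L^2[0,1]$ of $l_\nu=-\frac{d^2}{dx^2}+(\nu^2-1/4)x^{-2}$ on $C_c^\infty((0,1))$ (equivalently: the Friedrichs condition at $0$ and the Dirichlet condition $f(1)=0$ at $1$; for $\nu=1/2$ this is $-d^2/dx^2$ with Dirichlet conditions at both ends). It is positive and invertible with discrete spectrum. $\zeta_{L}(s)=\sum_{\lambda\in\mathrm{spec}(L)}\lambda^{-s}$ (with multiplicity), convergent for $\mathrm{Re}\,s$ large, extends meromorphically to $\mathbb C$, regular at $0$, and $\det_\zeta L:=\exp(-\zeta_L'(0))$. *)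

(* Defs.v *)
From Stdlib Require Import Reals.
From Coquelicot Require Import Coquelicot.
Open Scope R_scope.

Definition Gamma (a : R) : R :=
  RInt_gen (fun t => Rpower t (a - 1) * exp (- t)) (at_point 0) (Rbar_locally p_infty).

Definition cexp (z : C) : C := (exp (Re z) * cos (Im z), exp (Re z) * sin (Im z)).

(* f (real valued, defined on (0,1]) solves l_nu f = lam f on (0,1), satisfies the
   Dirichlet condition f(1)=0 (f continuous from the left at 1) and the Friedrichs
   condition at 0 (f is in the principal branch: f(x) = O(x^(nu+1/2)) as x -> 0+). *)
Definition bessel_sol (nu lam : R) (f : R -> R) : Prop :=
  (forall x, 0 < x < 1 ->
     ex_derive f x /\ ex_derive (Derive f) x /\
     - Derive (Derive f) x + (nu ^ 2 - 1 / 4) / x ^ 2 * f x = lam * f x) /\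
  filterlim f (at_left 1) (locally (f 1)) /\ f 1 = 0 /\
  (exists K delta, 0 < delta /\
     forall x, 0 < x < delta -> Rabs (f x) <= K * Rpower x (nu + 1 / 2)).

Fixpoint fsum (k : nat) (g : nat -> R) : R :=
  match k with O => 0 | S k' => fsum k' g + g k' end.

Definition lin_indep (k : nat) (f : nat -> R -> R) : Prop :=
  forall c : nat -> R,
    (forall x, 0 < x < 1 -> fsum k (fun i => c i * f i x) = 0) ->
    forall i, (i < k)%nat -> c i = 0.

(* the eigenspace of L_nu for lam has dimension exactly k (k = 0: not an eigenvalue) *)
Definition eig_mult (nu lam : R) (k : nat) : Prop :=
  (exists f : nat -> R -> R, (forall i, (i < k)%nat -> bessel_sol nu lam (f i)) /\ lin_indep k f) /\
  ~ (exists f : nat -> R -> R, (forall i, (i < S k)%nat -> bessel_sol nu lam (f i)) /\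
                               lin_indep (S k) f).

Definition spec_enum (nu : R) (lam : nat -> R) : Prop :=
  (forall n, lam n <= lam (S n)) /\
  forall l : R, exists k m, eig_mult nu l k /\
    forall n, lam n = l <-> (m <= n < m + k)%nat.

Definition cpow_neg (lam : R) (s : C) : C := cexp (Cmult (Copp s) (RtoC (ln lam))).

(* F : C -> C is a meromorphic continuation (holomorphic off a closed discrete set
   of exceptional points, 0 not among them) of the spectral zeta function of L_nu,
   i.e. of s |-> sum_n lam_n^(-s), which converges for Re s large. *)
Definition zeta_continuation (nu : R) (F : C -> C) : Prop :=
  exists lam : nat -> R, spec_enum nu lam /\
  (exists s0 : R, forall s : C, s0 < Re s ->
      is_series (fun n => cpow_neg (lam n) s) (F s)) /\
  exists P : C -> Prop, ~ P (RtoC 0) /\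
    (forall z : C, exists eps, 0 < eps /\
        forall w, P w -> Cmod (Cminus w z) < eps -> w = z) /\
    (forall z : C, ~ P z -> @ex_derive C_AbsRing C_NormedModule F z).

(* Main.v *)
(* Put theta(v) = d/dv ln B(e^v), where B(z) = sum_k z^k / (4^k k! (nu+1)_k) is the normalised Bessel
   function; the eigenvalues lam_k of L_nu are the zeros of B(-lam).  B is the limit of rescaled Laguerre
   polynomials, which are real-rooted, so B(z) = prod_k (1 + z / lam_k) and theta(v) = sum_k 1/(1 + lam_k e^{-v}).
   Taking two-sided Laplace transforms, zeta(s) pi / sin(pi s) = int theta(v) e^{-sv} dv for 1/2 < Re s < 1.
   The Riccati equation of theta gives its expansion in powers of e^{-v/2} at +oo; subtracting it continues
   the integral, hence zeta, to the plane, and zeta'(0) is the limit of ln B(e^v) - e^{v/2} + (nu + 1/2) v / 2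
   as v tends to +oo.  The exponential of this limit is log-convex in nu and satisfies the functional equation of
   2^nu Gamma(nu+1), so by Bohr-Mollerup it is a multiple of it; nu = 1/2, where B is elementary, together with
   Wallis' product fixes the factor 1/sqrt(2 pi).  Two continuations agree near 0 by the identity theorem,
   applied along a strip that avoids the exceptional points. *)
Require Import Defs.
From Stdlib Require Import Reals ZArith List Lra Lia Classical ClassicalEpsilon FunctionalExtensionality.
From Coquelicot Require Import Coquelicot.
Open Scope R_scope.

(** Real-rootedness replaces a factorisation theorem for entire functions. Each rescaled Laguerre
    polynomial is a product of factors 1 + a_i z with a_i >= 0 decreasing, and the sum s of the a_i
    is the coefficient of z, the same in every degree. Hence a_k <= s/(k+1) uniformly and a diagonal
    subsequence converges. As 1/(k+1) is not summable, mass may escape into a factor e^{cz}; only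
    the quadratic part of the logarithmic derivative passes to the limit at once, and the growth
    theta ~ e^{v/2}/2 read off the Riccati equation then forces c = 0. The same growth gives
    infinitely many zeros and (k+1)^2 <= C lam_k, hence convergence for Re s > 1/2. The transform of
    theta has residue -(2 nu + 1)/4 at s = 0; the zero of sin(pi s) cancels this pole, so zeta'(0)
    is a finite part. The Friedrichs condition acts through a Wronskian: the quotient of a second
    solution by the regular one has derivative of size at least 1/x, so it diverges logarithmically,
    for nu = 0 as well. A continuation is arbitrary at its exceptional points, so uniqueness is
    carried only to a segment of the imaginary axis ending at 0, which is enough for a
    derivative. *)

(** * Moduli of complex numbers *)

Lemma C_eq (a b : C) : Re a = Re b -> Im a = Im b -> a = b.
Proof. destruct a, b; simpl; congruence. Qed.

Ltac ceq := apply C_eq; unfold Re, Im; simpl.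

Lemma Cmod_minus_sym (a b : C) : Cmod (a - b) = Cmod (b - a).
Proof. rewrite <- Cmod_opp. f_equal. ring. Qed.

Lemma im_le_Cmod (z : C) : Rabs (Im z) <= Cmod z.
Proof. eapply Rle_trans; [ | apply Rmax_Cmod ]. apply Rmax_r. Qed.

Lemma Cmod_le_abs (z : C) : Cmod z <= Rabs (Re z) + Rabs (Im z).
Proof.
  replace z with (RtoC (Re z) + Ci * RtoC (Im z))%C at 1
    by (ceq; ring).
  eapply Rle_trans; [ apply Cmod_triangle | ].
  rewrite Cmod_mult, Cmod_Ci, !Cmod_R. lra.
Qed.

Lemma Cmod_triangle_rev (a b : C) : Cmod a - Cmod b <= Cmod (a - b).
Proof.
  assert (H := Cmod_triangle (a - b) b).
  replace (a - b + b)%C with a in H by ring. lra.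
Qed.

Lemma Cmod_triangle3 (a b c : C) : Cmod (a + b + c) <= Cmod a + Cmod b + Cmod c.
Proof.
  eapply Rle_trans; [ apply Cmod_triangle | ].
  pose proof (Cmod_triangle a b). lra.
Qed.

(** * Complex differentiability *)

(** The final bound is non-strict, so that w = z needs no exception. *)
Definition cder (f : C -> C) (z l : C) : Prop :=
  forall eps, 0 < eps -> exists del, 0 < del /\
    forall w, Cmod (w - z) < del -> Cmod (f w - f z - l * (w - z)) <= eps * Cmod (w - z).

Lemma cder_is_derive (f : C -> C) (z l : C) :
  cder f z l <-> @is_derive C_AbsRing C_NormedModule f z l.
Proof.
  split.
  - intros H. split; [ apply is_linear_scal_l | ].
    intros x Hx.
    assert (E : z = x).
    { apply (@is_filter_lim_locally_unique C_AbsRing (AbsRing_NormedModule C_AbsRing)). exact Hx. }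
    subst x. intros eps.
    destruct (H eps (cond_pos eps)) as [d [Hd Hw]].
    exists (mkposreal d Hd). intros w Hb.
    assert (Hb' : Cmod (w - z) < d) by exact Hb.
    specialize (Hw w Hb').
    rewrite <- (Cmult_comm (w - z)) in Hw. exact Hw.
  - intros [_ H] eps He.
    specialize (H z (fun P HP => HP) (mkposreal eps He)).
    destruct H as [d Hd]. exists d. split; [ apply cond_pos | ].
    intros w Hw. specialize (Hd w Hw).
    rewrite (Cmult_comm l). exact Hd.
Qed.

Lemma ex_cder_ex_derive (f : C -> C) (z : C) :
  (exists l, cder f z l) <-> @ex_derive C_AbsRing C_NormedModule f z.
Proof.
  split; intros [l H]; exists l; apply cder_is_derive; exact H.
Qed.

Lemma cder_lip (f : C -> C) (z l : C) : cder f z l ->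
  exists d, 0 < d /\ forall w, Cmod (w - z) < d -> Cmod (f w - f z) <= (Cmod l + 1) * Cmod (w - z).
Proof.
  intros H. destruct (H 1 Rlt_0_1) as [d [Hd Hw]]. exists d; split; auto.
  intros w Hz. specialize (Hw w Hz).
  replace (f w - f z)%C with ((f w - f z - l * (w - z)) + l * (w - z))%C by ring.
  eapply Rle_trans; [ apply Cmod_triangle | ]. rewrite Cmod_mult. lra.
Qed.

Lemma cder_cont (f : C -> C) (z l : C) : cder f z l ->
  forall eps, 0 < eps -> exists d, 0 < d /\ forall w, Cmod (w - z) < d -> Cmod (f w - f z) < eps.
Proof.
  intros H eps He. destruct (cder_lip _ _ _ H) as [d [Hd Hw]].
  assert (Hl := Cmod_ge_0 l).
  assert (Hq : 0 < eps / (Cmod l + 1)) by (apply Rdiv_lt_0_compat; lra).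
  exists (Rmin d (eps / (Cmod l + 1))). split; [ apply Rmin_pos; auto | ].
  intros w Hm.
  eapply Rle_lt_trans; [ apply Hw; eapply Rlt_le_trans; [ exact Hm | apply Rmin_l ] | ].
  assert (Cmod (w - z) < eps / (Cmod l + 1)) by (eapply Rlt_le_trans; [ exact Hm | apply Rmin_r ]).
  apply (Rmult_lt_compat_l (Cmod l + 1)) in H0; [ | lra ].
  replace ((Cmod l + 1) * (eps / (Cmod l + 1))) with eps in H0 by (field; lra). lra.
Qed.

Lemma cder_ext_loc (f g : C -> C) (z l : C) d : 0 < d ->
  (forall w, Cmod (w - z) < d -> f w = g w) -> cder f z l -> cder g z l.
Proof.
  intros Hd He H eps Hp. destruct (H eps Hp) as [d1 [Hd1 Hw]].
  exists (Rmin d d1). split; [ apply Rmin_pos; auto | ].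
  intros w Hm. rewrite <- !He.
  - apply Hw. eapply Rlt_le_trans; [ exact Hm | apply Rmin_r ].
  - replace (z - z)%C with (RtoC 0) by ring. rewrite Cmod_0. exact Hd.
  - eapply Rlt_le_trans; [ exact Hm | apply Rmin_l ].
Qed.

Lemma cder_ext (f g : C -> C) (z l : C) :
  (forall w, f w = g w) -> cder f z l -> cder g z l.
Proof. intros H. apply (cder_ext_loc f g z l 1); [ lra | auto ]. Qed.

Lemma cder_const (c z : C) : cder (fun _ => c) z 0.
Proof.
  intros eps He. exists 1. split; [ lra | ]. intros w _.
  replace (c - c - 0 * (w - z))%C with (RtoC 0) by ring. rewrite Cmod_0.
  apply Rmult_le_pos; [ lra | apply Cmod_ge_0 ].
Qed.

Lemma cder_id (z : C) : cder (fun w => w) z 1.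
Proof.
  intros eps He. exists 1. split; [ lra | ]. intros w _.
  replace (w - z - 1 * (w - z))%C with (RtoC 0) by ring. rewrite Cmod_0.
  apply Rmult_le_pos; [ lra | apply Cmod_ge_0 ].
Qed.

Lemma cder_plus (f g : C -> C) (z l m : C) :
  cder f z l -> cder g z m -> cder (fun w => f w + g w)%C z (l + m)%C.
Proof.
  intros Hf Hg eps He.
  destruct (Hf (eps / 2) ltac:(lra)) as [d1 [H1 K1]].
  destruct (Hg (eps / 2) ltac:(lra)) as [d2 [H2 K2]].
  exists (Rmin d1 d2). split; [ apply Rmin_pos; auto | ].
  intros w Hw.
  specialize (K1 w (Rlt_le_trans _ _ _ Hw (Rmin_l _ _))).
  specialize (K2 w (Rlt_le_trans _ _ _ Hw (Rmin_r _ _))).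
  replace (f w + g w - (f z + g z) - (l + m) * (w - z))%C
    with ((f w - f z - l * (w - z)) + (g w - g z - m * (w - z)))%C by ring.
  eapply Rle_trans; [ apply Cmod_triangle | ]. lra.
Qed.

Lemma cder_mult (f g : C -> C) (z l m : C) :
  cder f z l -> cder g z m -> cder (fun w => f w * g w)%C z (l * g z + f z * m)%C.
Proof.
  intros Hf Hg eps He.
  assert (Hl := Cmod_ge_0 l). assert (Hfz := Cmod_ge_0 (f z)). assert (Hgz := Cmod_ge_0 (g z)).
  (* One constant dominates l, f z and g z, so that each of the three error terms is at most eps/3
     times |w - z|. *)
  set (M := Cmod l + Cmod (f z) + Cmod (g z) + 1).
  assert (HM : 1 <= M) by (unfold M; lra).
  assert (He3 : 0 < eps / (3 * M)) by (apply Rdiv_lt_0_compat; lra).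
  destruct (Hf _ He3) as [d1 [H1 K1]].
  destruct (Hg _ He3) as [d2 [H2 K2]].
  destruct (cder_lip _ _ _ Hf) as [d3 [H3 K3]].
  destruct (cder_cont _ _ _ Hg _ He3) as [d4 [H4 K4]].
  exists (Rmin (Rmin d1 d2) (Rmin d3 d4)).
  split; [ repeat apply Rmin_pos; auto | ].
  intros w Hw.
  assert (A1 := Rlt_le_trans _ _ _ Hw (Rmin_l _ _)).
  assert (A2 := Rlt_le_trans _ _ _ Hw (Rmin_r _ _)).
  specialize (K1 w (Rlt_le_trans _ _ _ A1 (Rmin_l _ _))).
  specialize (K2 w (Rlt_le_trans _ _ _ A1 (Rmin_r _ _))).
  specialize (K3 w (Rlt_le_trans _ _ _ A2 (Rmin_l _ _))).
  specialize (K4 w (Rlt_le_trans _ _ _ A2 (Rmin_r _ _))).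
  replace (f w * g w - f z * g z - (l * g z + f z * m) * (w - z))%C
    with ((f w - f z - l * (w - z)) * g z + f z * (g w - g z - m * (w - z))
           + (f w - f z) * (g w - g z))%C by ring.
  eapply Rle_trans; [ apply Cmod_triangle3 | ].
  rewrite !Cmod_mult.
  assert (Hd := Cmod_ge_0 (w - z)).
  assert (P1 : Cmod (f w - f z - l * (w - z)) * Cmod (g z) <= eps / (3 * M) * Cmod (w - z) * M).
  { apply Rmult_le_compat; auto; try apply Cmod_ge_0. unfold M; lra. }
  assert (P2 : Cmod (f z) * Cmod (g w - g z - m * (w - z)) <= M * (eps / (3 * M) * Cmod (w - z))).
  { apply Rmult_le_compat; auto; try apply Cmod_ge_0. unfold M; lra. }
  assert (P3 : Cmod (f w - f z) * Cmod (g w - g z) <= (M * Cmod (w - z)) * (eps / (3 * M))).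
  { apply Rmult_le_compat; auto; try apply Cmod_ge_0; [ | lra ].
    eapply Rle_trans; [ exact K3 | ]. apply Rmult_le_compat_r; auto. unfold M; lra. }
  replace (eps / (3 * M) * Cmod (w - z) * M) with (eps / 3 * Cmod (w - z)) in P1 by (field; lra).
  replace (M * (eps / (3 * M) * Cmod (w - z))) with (eps / 3 * Cmod (w - z)) in P2 by (field; lra).
  replace (M * Cmod (w - z) * (eps / (3 * M))) with (eps / 3 * Cmod (w - z)) in P3 by (field; lra).
  lra.
Qed.

Lemma cder_scal (c : C) (f : C -> C) (z l : C) :
  cder f z l -> cder (fun w => c * f w)%C z (c * l)%C.
Proof.
  intros H.
  assert (H1 := cder_mult _ _ _ _ _ (cder_const c z) H). simpl in H1.
  replace (c * l)%C with (0 * f z + c * l)%C by ring. exact H1.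
Qed.

Lemma cder_minus (f g : C -> C) (z l m : C) :
  cder f z l -> cder g z m -> cder (fun w => f w - g w)%C z (l - m)%C.
Proof.
  intros Hf Hg. apply (cder_ext (fun w => f w + (-1) * g w)%C); [ intros; ring | ].
  replace (l - m)%C with (l + (-1) * m)%C by ring.
  apply cder_plus; auto. apply cder_scal; auto.
Qed.

Lemma cder_comp (f g : C -> C) (z l m : C) :
  cder g z m -> cder f (g z) l -> cder (fun w => f (g w)) z (l * m)%C.
Proof.
  intros Hg Hf eps He.
  assert (Hl := Cmod_ge_0 l). assert (Hm := Cmod_ge_0 m).
  assert (E1 : 0 < eps / (2 * (Cmod m + 1))) by (apply Rdiv_lt_0_compat; lra).
  assert (E2 : 0 < eps / (2 * (Cmod l + 1))) by (apply Rdiv_lt_0_compat; lra).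
  destruct (Hf _ E1) as [d1 [H1 K1]].
  destruct (Hg _ E2) as [d2 [H2 K2]].
  destruct (cder_lip _ _ _ Hg) as [d3 [H3 K3]].
  destruct (cder_cont _ _ _ Hg _ H1) as [d4 [H4 K4]].
  exists (Rmin d2 (Rmin d3 d4)).
  split; [ repeat apply Rmin_pos; auto | ].
  intros w Hw.
  assert (A2 := Rlt_le_trans _ _ _ Hw (Rmin_r _ _)).
  specialize (K2 w (Rlt_le_trans _ _ _ Hw (Rmin_l _ _))).
  specialize (K3 w (Rlt_le_trans _ _ _ A2 (Rmin_l _ _))).
  specialize (K4 w (Rlt_le_trans _ _ _ A2 (Rmin_r _ _))).
  specialize (K1 (g w) K4).
  replace (f (g w) - f (g z) - l * m * (w - z))%C
    with ((f (g w) - f (g z) - l * (g w - g z)) + l * (g w - g z - m * (w - z)))%C by ring.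
  eapply Rle_trans; [ apply Cmod_triangle | ]. rewrite Cmod_mult.
  assert (Hd := Cmod_ge_0 (w - z)).
  assert (P1 : eps / (2 * (Cmod m + 1)) * Cmod (g w - g z) <=
               eps / (2 * (Cmod m + 1)) * ((Cmod m + 1) * Cmod (w - z))).
  { apply Rmult_le_compat_l; lra. }
  assert (P2 : Cmod l * Cmod (g w - g z - m * (w - z)) <=
               (Cmod l + 1) * (eps / (2 * (Cmod l + 1)) * Cmod (w - z))).
  { apply Rmult_le_compat; auto; try apply Cmod_ge_0. lra. }
  replace (eps / (2 * (Cmod m + 1)) * ((Cmod m + 1) * Cmod (w - z)))
    with (eps / 2 * Cmod (w - z)) in P1 by (field; lra).
  replace ((Cmod l + 1) * (eps / (2 * (Cmod l + 1)) * Cmod (w - z)))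
    with (eps / 2 * Cmod (w - z)) in P2 by (field; lra).
  lra.
Qed.

Lemma cder_inv (z : C) : z <> RtoC 0 -> cder (fun w => / w)%C z (- / (z * z))%C.
Proof.
  intros Hz eps He.
  assert (Hp : 0 < Cmod z) by (apply Cmod_gt_0; exact Hz).
  (* The first radius keeps |w| > |z|/2; the remainder |w - z|^2 / (|w| |z|^2) is then at most eps
     |w - z| as soon as |w - z| <= eps |z|^3 / 2. *)
  exists (Rmin (Cmod z / 2) (eps * Cmod z ^ 3 / 2)).
  assert (0 < Cmod z ^ 3) by (apply pow_lt; auto).
  split; [ apply Rmin_pos; [ lra | apply Rmult_lt_0_compat; [ apply Rmult_lt_0_compat; lra | lra ] ] | ].
  intros w Hw.
  assert (A1 := Rlt_le_trans _ _ _ Hw (Rmin_l _ _)).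
  assert (A2 := Rlt_le_trans _ _ _ Hw (Rmin_r _ _)).
  assert (Hw2 : Cmod z / 2 < Cmod w).
  { assert (T := Cmod_triangle_rev z w). rewrite Cmod_minus_sym in T. lra. }
  assert (Hw0 : w <> RtoC 0) by (apply Cmod_gt_0; lra).
  replace (/ w - / z - - / (z * z) * (w - z))%C
    with ((w - z) * (w - z) / (w * (z * z)))%C by (field; split; auto).
  rewrite Cmod_div by (repeat apply Cmult_neq_0; auto).
  rewrite !Cmod_mult.
  apply (Rmult_le_reg_r (Cmod w * (Cmod z * Cmod z))); [ nra | ].
  unfold Rdiv. rewrite Rmult_assoc, Rinv_l, Rmult_1_r by nra.
  assert (Hd := Cmod_ge_0 (w - z)).
  replace (eps * Cmod (w - z) * (Cmod w * (Cmod z * Cmod z)))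
    with (Cmod (w - z) * (eps * Cmod z * Cmod z * Cmod w)) by ring.
  apply Rmult_le_compat_l; auto.
  apply Rle_trans with (eps * Cmod z ^ 3 / 2); [ lra | ].
  replace (eps * Cmod z ^ 3 / 2) with (eps * Cmod z * Cmod z * (Cmod z / 2)) by (field).
  apply Rmult_le_compat_l; [ | lra ]. apply Rmult_le_pos; [ apply Rmult_le_pos | ]; lra.
Qed.

Lemma cder_inv_comp (f : C -> C) (z l : C) : cder f z l -> f z <> RtoC 0 ->
  cder (fun w => / f w)%C z (- / (f z * f z) * l)%C.
Proof.
  intros Hf Hz. apply (cder_comp (fun w => / w)%C f); auto. apply cder_inv; auto.
Qed.

Lemma ex_cder_div (f g : C -> C) (z : C) : (exists l, cder f z l) -> (exists l, cder g z l) ->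
  g z <> RtoC 0 -> exists l, cder (fun w => f w / g w)%C z l.
Proof.
  intros [l Hl] [m Hm] H. eexists. unfold Cdiv.
  apply cder_mult; [ exact Hl | apply cder_inv_comp; eauto ].
Qed.

Lemma cder_pow (z : C) (n : nat) : exists l, cder (fun w => w ^ n)%C z l.
Proof.
  induction n as [ | n [l IH]]; simpl.
  - exists (RtoC 0). apply cder_const.
  - eexists. apply cder_mult; [ apply cder_id | exact IH ].
Qed.

(** * The exponential *)

Lemma cexp_0 : cexp 0 = RtoC 1.
Proof. unfold cexp. simpl. rewrite exp_0, cos_0, sin_0. ceq; ring. Qed.

Lemma cexp_plus (a b : C) : cexp (a + b) = (cexp a * cexp b)%C.
Proof.
  unfold cexp. ceq; rewrite exp_plus; [ rewrite cos_plus | rewrite sin_plus ]; ring.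
Qed.

Lemma cexp_RtoC (x : R) : cexp (RtoC x) = RtoC (exp x).
Proof. unfold cexp. simpl. rewrite cos_0, sin_0. ceq; ring. Qed.

Lemma Cmod_cexp (z : C) : Cmod (cexp z) = exp (Re z).
Proof.
  unfold Cmod, cexp. simpl.
  replace (exp (Re z) * cos (Im z) * (exp (Re z) * cos (Im z) * 1) +
    exp (Re z) * sin (Im z) * (exp (Re z) * sin (Im z) * 1))
    with (exp (Re z) * exp (Re z) * (Rsqr (sin (Im z)) + Rsqr (cos (Im z))))
    by (unfold Rsqr; ring).
  rewrite sin2_cos2, Rmult_1_r. apply sqrt_square. left; apply exp_pos.
Qed.

Lemma cexp_neq_0 (z : C) : cexp z <> RtoC 0.
Proof. apply Cmod_gt_0. rewrite Cmod_cexp. apply exp_pos. Qed.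

(* Apply the real mean value theorem to the component of f along f 1 - f 0. *)
Lemma complex_mvt_bound (u v u' v' : R -> R) (M : R) :
  (forall t, 0 <= t <= 1 -> is_derive u t (u' t)) ->
  (forall t, 0 <= t <= 1 -> is_derive v t (v' t)) ->
  (forall t, 0 <= t <= 1 -> Cmod (u' t, v' t) <= M) ->
  Cmod (u 1 - u 0, v 1 - v 0) <= M.
Proof.
  intros Hu Hv HM.
  set (a := u 1 - u 0). set (b := v 1 - v 0).
  destruct (Rle_lt_dec (Cmod (a, b)) 0) as [H0 | H0].
  { eapply Rle_trans; [ exact H0 | ]. eapply Rle_trans; [ apply Cmod_ge_0 | apply (HM 0); lra ]. }
  assert (HD : forall t, 0 <= t <= 1 -> is_derive (fun t => a * u t + b * v t) t (a * u' t + b * v' t)).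
  { intros t Ht. apply (is_derive_plus (fun t => a * u t) (fun t => b * v t)); apply is_derive_scal; auto. }
  destruct (MVT_gen (fun t => a * u t + b * v t) 0 1 (fun t => a * u' t + b * v' t)) as [c [Hc E]].
  - intros x Hx. rewrite Rmin_left, Rmax_right in Hx by lra. apply HD; lra.
  - intros x Hx. rewrite Rmin_left, Rmax_right in Hx by lra.
    apply continuity_pt_filterlim.
    apply (ex_derive_continuous (fun t => a * u t + b * v t)).
    eexists. apply HD; lra.
  - rewrite Rmin_left, Rmax_right in Hc by lra.
    assert (E2 : Cmod (a, b) * Cmod (a, b) = a * a + b * b).
    { unfold Cmod. rewrite sqrt_sqrt; simpl; nra. }
    assert (E3 : a * u' c + b * v' c = a * a + b * b) by (unfold a, b in *; lra).
    assert (E4 : a * u' c + b * v' c <= Cmod (a, b) * Cmod (u' c, v' c)).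
    { replace (a * u' c + b * v' c) with (Re (Cconj (a, b) * (u' c, v' c))) by (unfold Re; simpl; ring).
      eapply Rle_trans; [ apply Rle_abs | ]. eapply Rle_trans; [ apply re_le_Cmod | ].
      rewrite Cmod_mult, Cmod_conj. lra. }
    specialize (HM c Hc).
    apply (Rmult_le_reg_l (Cmod (a, b))); auto. 
    assert (Cmod (a, b) * Cmod (u' c, v' c) <= Cmod (a,b) * M) by (apply Rmult_le_compat_l; lra).
    lra.
Qed.

Lemma exp_le_compat (x y : R) : x <= y -> exp x <= exp y.
Proof. intros [H | H]; [ left; apply exp_increasing; auto | right; congruence ]. Qed.

Lemma Cmod_scal_le (t : R) (w : C) : 0 <= t <= 1 -> Cmod (RtoC t * w) <= Cmod w.
Proof.
  intros H. rewrite Cmod_mult, Cmod_R, Rabs_right by lra.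
  pose proof (Cmod_ge_0 w). nra.
Qed.

Lemma cexp_bound0 (w : C) : Cmod (cexp w) <= exp (Cmod w).
Proof.
  rewrite Cmod_cexp. apply exp_le_compat.
  eapply Rle_trans; [ apply Rle_abs | apply re_le_Cmod ].
Qed.

(** The three Taylor remainders follow from one another: the derivative of each along t -> t w is w
    times the preceding one. Factorials are dropped, which costs only constants. *)
Lemma cexp_bound1 (w : C) : Cmod (cexp w - 1) <= Cmod w * exp (Cmod w).
Proof.
  replace (cexp w - 1)%C with
    ((fun t => Re (cexp (RtoC t * w))) 1 - (fun t => Re (cexp (RtoC t * w))) 0,
     (fun t => Im (cexp (RtoC t * w))) 1 - (fun t => Im (cexp (RtoC t * w))) 0).
  2: { rewrite Cmult_1_l, Cmult_0_l, cexp_0. ceq; ring. }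
  apply (complex_mvt_bound (fun t => Re (cexp (RtoC t * w))) (fun t => Im (cexp (RtoC t * w)))
    (fun t => Re (w * cexp (RtoC t * w))) (fun t => Im (w * cexp (RtoC t * w)))).
  - intros t Ht. unfold cexp, Re, Im; simpl. auto_derive; auto. unfold Rminus. ring.
  - intros t Ht. unfold cexp, Re, Im; simpl. auto_derive; auto. unfold Rminus. ring.
  - intros t Ht. replace (Re (w * cexp (t * w)), Im (w * cexp (t * w))) with (w * cexp (t * w))%C
      by (apply C_eq; reflexivity).
    rewrite Cmod_mult. apply Rmult_le_compat_l; [ apply Cmod_ge_0 | ].
    eapply Rle_trans; [ apply cexp_bound0 | apply exp_le_compat, Cmod_scal_le; auto ].
Qed.

Lemma cexp_bound2 (w : C) : Cmod (cexp w - 1 - w) <= Cmod w ^ 2 * exp (Cmod w).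
Proof.
  replace (cexp w - 1 - w)%C with
    ((fun t => Re (cexp (RtoC t * w)) - t * Re w) 1 - (fun t => Re (cexp (RtoC t * w)) - t * Re w) 0,
     (fun t => Im (cexp (RtoC t * w)) - t * Im w) 1 - (fun t => Im (cexp (RtoC t * w)) - t * Im w) 0).
  2: { rewrite Cmult_1_l, Cmult_0_l, cexp_0. ceq; ring. }
  apply (complex_mvt_bound (fun t => Re (cexp (RtoC t * w)) - t * Re w) (fun t => Im (cexp (RtoC t * w)) - t * Im w)
    (fun t => Re (w * (cexp (RtoC t * w) - 1)))
           (fun t => Im (w * (cexp (RtoC t * w) - 1)))).
  - intros t Ht. unfold cexp, Re, Im; simpl. auto_derive; auto. unfold Rminus. ring.
  - intros t Ht. unfold cexp, Re, Im; simpl. auto_derive; auto. unfold Rminus. ring.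
  - intros t Ht. replace (Re (w * (cexp (t * w) - 1)), Im (w * (cexp (t * w) - 1)))
      with (w * (cexp (t * w) - 1))%C by (apply C_eq; reflexivity).
    rewrite Cmod_mult. simpl. rewrite Rmult_1_r, Rmult_assoc.
    apply Rmult_le_compat_l; [ apply Cmod_ge_0 | ].
    eapply Rle_trans; [ apply cexp_bound1 | ].
    apply Rmult_le_compat; try apply Cmod_ge_0; try (left; apply exp_pos).
    apply Cmod_scal_le; auto. apply exp_le_compat, Cmod_scal_le; auto.
Qed.

Lemma cexp_bound3 (w : C) : Cmod (cexp w - 1 - w - w * w / 2) <= Cmod w ^ 3 * exp (Cmod w).
Proof.
  replace (cexp w - 1 - w - w * w / 2)%C with
    ((fun t => Re (cexp (RtoC t * w)) - t * Re w - t * t * Re (w * w) / 2) 1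
      - (fun t => Re (cexp (RtoC t * w)) - t * Re w - t * t * Re (w * w) / 2) 0,
     (fun t => Im (cexp (RtoC t * w)) - t * Im w - t * t * Im (w * w) / 2) 1
     - (fun t => Im (cexp (RtoC t * w)) - t * Im w - t * t * Im (w * w) / 2) 0).
  2: { rewrite Cmult_1_l, Cmult_0_l, cexp_0. ceq; field. }
  apply (complex_mvt_bound (fun t => Re (cexp (RtoC t * w)) - t * Re w - t * t * Re (w * w) / 2)
    (fun t => Im (cexp (RtoC t * w)) - t * Im w - t * t * Im (w * w) / 2)
    (fun t => Re (w * (cexp (RtoC t * w) - 1 - RtoC t * w)))
           (fun t => Im (w * (cexp (RtoC t * w) - 1 - RtoC t * w)))).
  - intros t Ht. unfold cexp, Re, Im; simpl. auto_derive; auto. unfold Rminus. field.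
  - intros t Ht. unfold cexp, Re, Im; simpl. auto_derive; auto. unfold Rminus. field.
  - intros t Ht.
    replace (Re (w * (cexp (t * w) - 1 - t * w)), Im (w * (cexp (t * w) - 1 - t * w)))
      with (w * (cexp (t * w) - 1 - t * w))%C by (apply C_eq; reflexivity).
    rewrite Cmod_mult. change (Cmod w ^ 3) with (Cmod w * Cmod w ^ 2). rewrite Rmult_assoc.
    apply Rmult_le_compat_l; [ apply Cmod_ge_0 | ].
    eapply Rle_trans; [ apply cexp_bound2 | ].
    apply Rmult_le_compat; try (left; apply exp_pos).
    + apply pow_le, Cmod_ge_0.
    + apply pow_incr. split; [ apply Cmod_ge_0 | apply Cmod_scal_le; auto ].
    + apply exp_le_compat, Cmod_scal_le; auto.
Qed.

Lemma cder_cexp (z : C) : cder cexp z (cexp z).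
Proof.
  intros eps He.
  assert (Hz : 0 < exp (Re z)) by apply exp_pos.
  set (K := exp (Re z) * exp 1).
  assert (HK : 0 < K) by (apply Rmult_lt_0_compat; apply exp_pos).
  exists (Rmin 1 (eps / K)). split; [ apply Rmin_pos; [ lra | apply Rdiv_lt_0_compat; auto ] | ].
  intros w Hw.
  assert (A1 := Rlt_le_trans _ _ _ Hw (Rmin_l _ _)).
  assert (A2 := Rlt_le_trans _ _ _ Hw (Rmin_r _ _)).
  replace (cexp w - cexp z - cexp z * (w - z))%C with (cexp z * (cexp (w - z) - 1 - (w - z)))%C.
  2: { replace w with (z + (w - z))%C at 3 by ring. rewrite cexp_plus. ring. }
  rewrite Cmod_mult, Cmod_cexp.
  assert (H2 := cexp_bound2 (w - z)).
  assert (H3 : exp (Cmod (w - z)) <= exp 1) by (apply exp_le_compat; lra).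
  assert (Hd := Cmod_ge_0 (w - z)).
  apply Rle_trans with (exp (Re z) * (Cmod (w - z) ^ 2 * exp 1)).
  { apply Rmult_le_compat_l; [ lra | ]. eapply Rle_trans; [ exact H2 | ].
    apply Rmult_le_compat_l; [ apply pow_le; auto | auto ]. }
  replace (exp (Re z) * (Cmod (w - z) ^ 2 * exp 1)) with (K * Cmod (w - z) * Cmod (w - z))
    by (unfold K; ring).
  apply Rmult_le_compat_r; auto.
  apply (Rmult_lt_compat_l K) in A2; auto.
  replace (K * (eps / K)) with eps in A2 by (field; lra). lra.
Qed.

Lemma cder_cexp_comp (f : C -> C) (z l : C) : cder f z l ->
  cder (fun w => cexp (f w)) z (cexp (f z) * l)%C.
Proof. intros H. apply (cder_comp cexp f); auto. apply cder_cexp. Qed.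

(** * Integrals of complex-valued functions of a real variable *)

Definition CInt (f : R -> C) (a b : R) : C :=
  (RInt (fun t => Re (f t)) a b, RInt (fun t => Im (f t)) a b).

Definition cex (f : R -> C) (a b : R) : Prop :=
  ex_RInt (fun t => Re (f t)) a b /\ ex_RInt (fun t => Im (f t)) a b.

Definition ccont (f : R -> C) (t : R) : Prop :=
  continuous (fun t => Re (f t)) t /\ continuous (fun t => Im (f t)) t.

Lemma continuous_eps (f : R -> R) (t : R) :
  continuous f t <-> forall eps, 0 < eps -> exists d, 0 < d /\
    forall u, Rabs (u - t) < d -> Rabs (f u - f t) < eps.
Proof.
  split.
  - intros H eps He.
    destruct (proj1 (filterlim_locally f (f t)) H (mkposreal eps He)) as [d Hd].
    exists d. split; [ apply cond_pos | ]. intros u Hu. apply Hd. exact Hu.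
  - intros H. apply filterlim_locally. intros eps.
    destruct (H eps (cond_pos eps)) as [d [Hd K]].
    exists (mkposreal d Hd). intros u Hu. apply K. exact Hu.
Qed.

Lemma ccont_eps (f : R -> C) (t : R) :
  ccont f t <-> forall eps, 0 < eps -> exists d, 0 < d /\
    forall u, Rabs (u - t) < d -> Cmod (f u - f t) < eps.
Proof.
  split.
  - intros [H1 H2] eps He.
    destruct (proj1 (continuous_eps _ _) H1 (eps / 2) ltac:(lra)) as [d1 [P1 K1]].
    destruct (proj1 (continuous_eps _ _) H2 (eps / 2) ltac:(lra)) as [d2 [P2 K2]].
    exists (Rmin d1 d2). split; [ apply Rmin_pos; auto | ]. intros u Hu.
    specialize (K1 u (Rlt_le_trans _ _ _ Hu (Rmin_l _ _))).
    specialize (K2 u (Rlt_le_trans _ _ _ Hu (Rmin_r _ _))).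
    eapply Rle_lt_trans; [ apply Cmod_le_abs | ].
    change (Re (f u - f t)) with (Re (f u) - Re (f t)).
    change (Im (f u - f t)) with (Im (f u) - Im (f t)). lra.
  - intros H. split; apply continuous_eps; intros eps He;
      destruct (H eps He) as [d [Hd K]]; exists d; split; auto; intros u Hu;
      specialize (K u Hu); eapply Rle_lt_trans; [ | exact K | | exact K ].
    + apply (re_le_Cmod (f u - f t)).
    + apply (im_le_Cmod (f u - f t)).
Qed.

Lemma ccont_const (c : C) (t : R) : ccont (fun _ => c) t.
Proof. split; apply continuous_const. Qed.

Lemma ccont_R (f : R -> R) (t : R) : continuous f t -> ccont (fun t => RtoC (f t)) t.
Proof. intros H. split; [ exact H | apply continuous_const ]. Qed.

Lemma ccont_pair (f g : R -> R) (t : R) : continuous f t -> continuous g t -> ccont (fun t => (f t, g t)) t.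
Proof. intros H1 H2. split; auto. Qed.

Lemma ccont_plus (f g : R -> C) (t : R) : ccont f t -> ccont g t -> ccont (fun t => f t + g t)%C t.
Proof.
  intros [H1 H2] [H3 H4]. split.
  - apply (continuous_plus (fun t => Re (f t)) (fun t => Re (g t))); auto.
  - apply (continuous_plus (fun t => Im (f t)) (fun t => Im (g t))); auto.
Qed.

Lemma ccont_mult (f g : R -> C) (t : R) : ccont f t -> ccont g t -> ccont (fun t => f t * g t)%C t.
Proof.
  intros [H1 H2] [H3 H4]. split.
  - apply (continuous_minus (fun t => Re (f t) * Re (g t)) (fun t => Im (f t) * Im (g t)));
      [ apply (continuous_mult (fun t => Re (f t)) (fun t => Re (g t))); auto
      | apply (continuous_mult (fun t => Im (f t)) (fun t => Im (g t))); auto ].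
  - apply (continuous_plus (fun t => Re (f t) * Im (g t)) (fun t => Im (f t) * Re (g t)));
      [ apply (continuous_mult (fun t => Re (f t)) (fun t => Im (g t))); auto
      | apply (continuous_mult (fun t => Im (f t)) (fun t => Re (g t))); auto ].
Qed.

Lemma ccont_comp (F : C -> C) (p : R -> C) (t : R) l :
  cder F (p t) l -> ccont p t -> ccont (fun t => F (p t)) t.
Proof.
  intros HF Hp. apply ccont_eps. intros eps He.
  destruct (cder_cont _ _ _ HF eps He) as [d1 [P1 K1]].
  destruct (proj1 (ccont_eps _ _) Hp d1 P1) as [d [Hd K]].
  exists d. split; auto.
Qed.

Lemma ccont_cexp (p : R -> C) (t : R) : ccont p t -> ccont (fun t => cexp (p t)) t.
Proof. intros H. eapply ccont_comp; [ apply cder_cexp | exact H ]. Qed.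

Lemma cex_cont (f : R -> C) (a b : R) :
  (forall t, Rmin a b <= t <= Rmax a b -> ccont f t) -> cex f a b.
Proof.
  intros H. split; apply (ex_RInt_continuous (V:=R_CompleteNormedModule)); intros t Ht;
    apply H; auto.
Qed.

Lemma cex_cont_all (f : R -> C) (a b : R) : (forall t, ccont f t) -> cex f a b.
Proof. intros H. apply cex_cont. auto. Qed.

Lemma cex_cont_le (f : R -> C) (a b : R) : a <= b ->
  (forall t, a <= t <= b -> ccont f t) -> cex f a b.
Proof. intros Hab H. apply cex_cont. rewrite Rmin_left, Rmax_right; auto. Qed.

Lemma CInt_Chasles (f : R -> C) (a b c : R) : cex f a b -> cex f b c ->
  (CInt f a b + CInt f b c)%C = CInt f a c.
Proof.
  intros [H1 H2] [H3 H4]. unfold CInt. ceq.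
  - apply (RInt_Chasles (V:=R_CompleteNormedModule) (fun t => Re (f t))); auto.
  - apply (RInt_Chasles (V:=R_CompleteNormedModule) (fun t => Im (f t))); auto.
Qed.

Lemma CInt_plus (f g : R -> C) (a b : R) : cex f a b -> cex g a b ->
  CInt (fun t => f t + g t)%C a b = (CInt f a b + CInt g a b)%C.
Proof.
  intros [H1 H2] [H3 H4]. unfold CInt. ceq.
  - apply (RInt_plus (V:=R_CompleteNormedModule) (fun t => Re (f t)) (fun t => Re (g t))); auto.
  - apply (RInt_plus (V:=R_CompleteNormedModule) (fun t => Im (f t)) (fun t => Im (g t))); auto.
Qed.

Lemma cex_plus (f g : R -> C) (a b : R) : cex f a b -> cex g a b -> cex (fun t => f t + g t)%C a b.
Proof.
  intros [H1 H2] [H3 H4]. split.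
  - apply (ex_RInt_plus (V:=R_NormedModule) (fun t => Re (f t)) (fun t => Re (g t))); auto.
  - apply (ex_RInt_plus (V:=R_NormedModule) (fun t => Im (f t)) (fun t => Im (g t))); auto.
Qed.

Lemma cex_scal (c : C) (f : R -> C) (a b : R) : cex f a b -> cex (fun t => c * f t)%C a b.
Proof.
  intros [H1 H2]. split.
  - apply (ex_RInt_minus (V:=R_NormedModule) (fun t => Re c * Re (f t)) (fun t => Im c * Im (f t)));
      [ apply (ex_RInt_scal (V:=R_NormedModule) (fun t => Re (f t))); auto
      | apply (ex_RInt_scal (V:=R_NormedModule) (fun t => Im (f t))); auto ].
  - apply (ex_RInt_plus (V:=R_NormedModule) (fun t => Re c * Im (f t)) (fun t => Im c * Re (f t)));
      [ apply (ex_RInt_scal (V:=R_NormedModule) (fun t => Im (f t))); auto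
      | apply (ex_RInt_scal (V:=R_NormedModule) (fun t => Re (f t))); auto ].
Qed.

Lemma CInt_scal (c : C) (f : R -> C) (a b : R) : cex f a b ->
  CInt (fun t => c * f t)%C a b = (c * CInt f a b)%C.
Proof.
  intros [H1 H2]. unfold CInt. apply C_eq.
  - change (RInt (fun t => Re c * Re (f t) - Im c * Im (f t)) a b =
            Re c * RInt (fun t => Re (f t)) a b - Im c * RInt (fun t => Im (f t)) a b).
    rewrite (RInt_minus (V:=R_CompleteNormedModule) (fun t => Re c * Re (f t)) (fun t => Im c * Im (f t))).
    + rewrite (RInt_scal (V:=R_CompleteNormedModule) (fun t => Re (f t))),
        (RInt_scal (V:=R_CompleteNormedModule) (fun t => Im (f t))); auto.
    + apply (ex_RInt_scal (V:=R_NormedModule) (fun t => Re (f t))); auto.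
    + apply (ex_RInt_scal (V:=R_NormedModule) (fun t => Im (f t))); auto.
  - change (RInt (fun t => Re c * Im (f t) + Im c * Re (f t)) a b =
            Re c * RInt (fun t => Im (f t)) a b + Im c * RInt (fun t => Re (f t)) a b).
    rewrite (RInt_plus (V:=R_CompleteNormedModule) (fun t => Re c * Im (f t)) (fun t => Im c * Re (f t))).
    + rewrite (RInt_scal (V:=R_CompleteNormedModule) (fun t => Re (f t))),
        (RInt_scal (V:=R_CompleteNormedModule) (fun t => Im (f t))); auto.
    + apply (ex_RInt_scal (V:=R_NormedModule) (fun t => Im (f t))); auto.
    + apply (ex_RInt_scal (V:=R_NormedModule) (fun t => Re (f t))); auto.
Qed.

Lemma CInt_ext (f g : R -> C) (a b : R) :
  (forall t, Rmin a b < t < Rmax a b -> f t = g t) -> CInt f a b = CInt g a b.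
Proof.
  intros H. unfold CInt. f_equal; apply RInt_ext; intros t Ht; rewrite H; auto.
Qed.

Lemma cex_ext (f g : R -> C) (a b : R) :
  (forall t, Rmin a b < t < Rmax a b -> f t = g t) -> cex f a b -> cex g a b.
Proof.
  intros H [H1 H2]. split; [ eapply ex_RInt_ext; [ | exact H1 ] | eapply ex_RInt_ext; [ | exact H2 ] ];
    intros t Ht; simpl; rewrite H; auto.
Qed.

Lemma CInt_minus (f g : R -> C) (a b : R) : cex f a b -> cex g a b ->
  CInt (fun t => f t - g t)%C a b = (CInt f a b - CInt g a b)%C.
Proof.
  intros H1 H2.
  rewrite (CInt_ext _ (fun t => f t + (-1) * g t)%C) by (intros; ring).
  rewrite CInt_plus, CInt_scal; auto. 2: apply cex_scal; auto. ring.
Qed.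

Lemma cex_minus (f g : R -> C) (a b : R) : cex f a b -> cex g a b -> cex (fun t => f t - g t)%C a b.
Proof.
  intros H1 H2.
  apply (cex_ext (fun t => f t + (-1) * g t)%C); [ intros; ring | ].
  apply cex_plus; auto. apply cex_scal; auto.
Qed.

(** Multiplying by the conjugate of the integral I turns |I|^2 into the integral of a real part, to
    which monotonicity applies; no constant is lost, unlike in a componentwise estimate. *)
Lemma CInt_bound (f : R -> C) (g : R -> R) (a b : R) : a <= b -> cex f a b -> ex_RInt g a b ->
  (forall t, a < t < b -> Cmod (f t) <= g t) -> Cmod (CInt f a b) <= RInt g a b.
Proof.
  intros Hab Hf Hg H.
  destruct (Rle_lt_dec (Cmod (CInt f a b)) 0) as [H0 | H0].
  { eapply Rle_trans; [ exact H0 | ].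
    replace 0 with (RInt (fun _ => 0) a b) by (rewrite RInt_const; apply Rmult_0_r).
    apply RInt_le; auto; [ apply ex_RInt_const | ].
    intros x Hx. eapply Rle_trans; [ apply Cmod_ge_0 | apply H; auto ]. }
  set (I := CInt f a b) in *.
  apply (Rmult_le_reg_l (Cmod I)); auto.
  assert (E : Cmod I * Cmod I = Re (CInt (fun t => Cconj I * f t)%C a b)).
  { rewrite CInt_scal by auto. fold I. rewrite Cmult_comm, <- Cmod2_conj. simpl. ring. }
  rewrite E. change (Re (CInt (fun t => Cconj I * f t)%C a b)) with (RInt (fun t => Re (Cconj I * f t)) a b).
  replace (Cmod I * RInt g a b) with (RInt (fun t => Cmod I * g t) a b)
    by (apply (RInt_scal (V:=R_CompleteNormedModule)); auto).
  apply RInt_le; auto.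
  - apply (cex_scal (Cconj I) f); auto.
  - apply (ex_RInt_scal (V:=R_NormedModule)); auto.
  - intros t Ht. eapply Rle_trans; [ apply Rle_abs | ]. eapply Rle_trans; [ apply re_le_Cmod | ].
    rewrite Cmod_mult, Cmod_conj. apply Rmult_le_compat_l; [ lra | apply H; auto ].
Qed.

Lemma CInt_bound_const (f : R -> C) (M a b : R) : a <= b -> cex f a b ->
  (forall t, a < t < b -> Cmod (f t) <= M) -> Cmod (CInt f a b) <= (b - a) * M.
Proof.
  intros Hab Hf H.
  replace ((b - a) * M) with (RInt (fun _ => M) a b) by (rewrite RInt_const; reflexivity).
  apply CInt_bound; auto. apply ex_RInt_const.
Qed.

Lemma CInt_const (c : C) (a b : R) : CInt (fun _ => c) a b = (RtoC (b - a) * c)%C.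
Proof. unfold CInt. rewrite !RInt_const. apply C_eq; unfold scal, Re, Im; simpl; unfold mult; simpl; ring. Qed.

Lemma CInt_swap (f : R -> C) (a b : R) : cex f a b -> CInt f b a = (- CInt f a b)%C.
Proof.
  intros [H1 H2]. unfold CInt. ceq.
  - symmetry; apply (opp_RInt_swap (V:=R_CompleteNormedModule) (fun t => Re (f t))); auto.
  - symmetry; apply (opp_RInt_swap (V:=R_CompleteNormedModule) (fun t => Im (f t))); auto.
Qed.

Lemma cex_swap (f : R -> C) (a b : R) : cex f a b -> cex f b a.
Proof. intros [H1 H2]. split; apply (ex_RInt_swap (V:=R_NormedModule)); auto. Qed.

Lemma CInt_comp_lin (f : R -> C) (u v a b : R) : cex f (u * a + v) (u * b + v) ->
  CInt (fun t => RtoC u * f (u * t + v)%R)%C a b = CInt f (u * a + v) (u * b + v).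
Proof.
  intros [H1 H2]. unfold CInt. apply C_eq.
  - rewrite <- (RInt_comp_lin (V:=R_CompleteNormedModule) (fun t => Re (f t)) u v a b) by exact H1.
    apply RInt_ext. intros x _. unfold scal, Re; simpl; unfold mult; simpl. ring.
  - rewrite <- (RInt_comp_lin (V:=R_CompleteNormedModule) (fun t => Im (f t)) u v a b) by exact H2.
    apply RInt_ext. intros x _. unfold scal, Im; simpl; unfold mult; simpl. ring.
Qed.

Lemma CInt_shift (f : R -> C) (v a b : R) : cex f (a + v) (b + v) ->
  CInt (fun t => f (t + v)) a b = CInt f (a + v) (b + v).
Proof.
  intros H. replace (a + v) with (1 * a + v) in * by ring. replace (b + v) with (1 * b + v) in * by ring.
  rewrite <- CInt_comp_lin by auto. apply CInt_ext. intros. rewrite Rmult_1_l. ring.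
Qed.

Lemma CInt_reflect (f : R -> C) (a b : R) : cex f (-b) (-a) ->
  CInt (fun t => f (- t)) a b = CInt f (-b) (-a).
Proof.
  intros H. replace (- b) with (-1 * b + 0) in * by ring. replace (- a) with (-1 * a + 0) in * by ring.
  assert (K := CInt_comp_lin f (-1) 0 a b (cex_swap _ _ _ H)).
  rewrite (CInt_swap f (-1 * b + 0) (-1 * a + 0)) in K by auto.
  rewrite (CInt_ext _ (fun t => RtoC (-1) * f (- t)%R)%C) in K.
  2: { intros t _. do 2 f_equal. ring. }
  rewrite CInt_scal in K.
  { replace (CInt (fun t => f (- t)) a b) with (- (RtoC (-1) * CInt (fun t => f (- t)%R) a b))%C.
    - rewrite K. ring.
    - ceq; ring. }
  apply cex_swap in H.
  destruct H as [H1 H2].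
  split.
  - apply (ex_RInt_ext (fun y => scal (-1) (scal (-1) (Re (f (-1 * y + 0)))))).
    + intros t _. replace (- t) with (-1 * t + 0) by ring.
      unfold scal; simpl; unfold mult; simpl. ring.
    + apply (ex_RInt_scal (V:=R_NormedModule)).
      apply (ex_RInt_comp_lin (V:=R_NormedModule) (fun t => Re (f t))); auto.
  - apply (ex_RInt_ext (fun y => scal (-1) (scal (-1) (Im (f (-1 * y + 0)))))).
    + intros t _. replace (- t) with (-1 * t + 0) by ring.
      unfold scal; simpl; unfold mult; simpl. ring.
    + apply (ex_RInt_scal (V:=R_NormedModule)).
      apply (ex_RInt_comp_lin (V:=R_NormedModule) (fun t => Im (f t))); auto.
Qed.

Lemma CInt_RtoC (f : R -> R) (a b : R) : CInt (fun t => RtoC (f t)) a b = RtoC (RInt f a b).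
Proof.
  unfold CInt. unfold RtoC at 3. f_equal.
  rewrite (RInt_ext _ (fun _ => 0)) by reflexivity.
  rewrite RInt_const. unfold scal; simpl; unfold mult; simpl. ring.
Qed.

Lemma RInt_id (a b : R) : RInt (fun x => x) a b = (b * b - a * a) / 2.
Proof.
  apply is_RInt_unique.
  replace ((b * b - a * a) / 2) with (minus (b * b / 2) (a * a / 2))
    by (unfold minus, plus, opp; simpl; field).
  apply (is_RInt_derive (V:=R_CompleteNormedModule) (fun x => x * x / 2) (fun x => x)).
  - intros x _. auto_derive; auto. field.
  - intros x _. apply continuous_id.
Qed.

(** * Goursat's theorem on rectangles *)

(** The integral of F(z) dz along the boundary of [a,b] x [c,d], counterclockwise. *)
Definition rect_int (F : C -> C) (a b c d : R) : C :=
  (CInt (fun x => F (x, c)) a b - CInt (fun x => F (x, d)) a b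
   + Ci * (CInt (fun y => F (b, y)) c d - CInt (fun y => F (a, y)) c d))%C.

Definition holo_rect (F : C -> C) (a b c d : R) : Prop :=
  forall z : C, a <= Re z <= b -> c <= Im z <= d -> exists l, cder F z l.

Lemma ccont_hline (y t : R) : ccont (fun x => (x, y) : C) t.
Proof. apply ccont_pair; [ apply continuous_id | apply continuous_const ]. Qed.

Lemma ccont_vline (x t : R) : ccont (fun y => (x, y) : C) t.
Proof. apply ccont_pair; [ apply continuous_const | apply continuous_id ]. Qed.

Lemma holo_hline (F : C -> C) (a b c d y t : R) : holo_rect F a b c d ->
  c <= y <= d -> a <= t <= b -> ccont (fun x => F (x, y)) t.
Proof.
  intros H Hy Ht. destruct (H (t, y) Ht Hy) as [l Hl].
  apply (ccont_comp F (fun x => (x, y)) t l); auto. apply ccont_hline.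
Qed.

Lemma holo_vline (F : C -> C) (a b c d x t : R) : holo_rect F a b c d ->
  a <= x <= b -> c <= t <= d -> ccont (fun y => F (x, y)) t.
Proof.
  intros H Hx Ht. destruct (H (x, t) Hx Ht) as [l Hl].
  apply (ccont_comp F (fun y => (x, y)) t l); auto. apply ccont_vline.
Qed.

Lemma holo_cex_h (F : C -> C) (a b c d y u v : R) : holo_rect F a b c d ->
  c <= y <= d -> a <= u -> u <= v -> v <= b -> cex (fun x => F (x, y)) u v.
Proof.
  intros H Hy H1 H2 H3. apply cex_cont_le; auto. intros t Ht.
  apply (holo_hline F a b c d); auto. lra.
Qed.

Lemma holo_cex_v (F : C -> C) (a b c d x u v : R) : holo_rect F a b c d ->
  a <= x <= b -> c <= u -> u <= v -> v <= d -> cex (fun y => F (x, y)) u v.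
Proof.
  intros H Hy H1 H2 H3. apply cex_cont_le; auto. intros t Ht.
  apply (holo_vline F a b c d); auto. lra.
Qed.

Lemma rect_int_split (F : C -> C) (a m b c n d : R) : holo_rect F a b c d ->
  a <= m <= b -> c <= n <= d ->
  rect_int F a b c d = (rect_int F a m c n + rect_int F m b c n
                        + rect_int F a m n d + rect_int F m b n d)%C.
Proof.
  intros H Hm Hn. unfold rect_int.
  assert (Hh := holo_cex_h F a b c d). assert (Hv := holo_cex_v F a b c d).
  rewrite <- (CInt_Chasles (fun x => F (x, c)) a m b) by (apply Hh; auto; lra).
  rewrite <- (CInt_Chasles (fun x => F (x, d)) a m b) by (apply Hh; auto; lra).
  rewrite <- (CInt_Chasles (fun y => F (b, y)) c n d) by (apply Hv; auto; lra).
  rewrite <- (CInt_Chasles (fun y => F (a, y)) c n d) by (apply Hv; auto; lra).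
  ring.
Qed.

Lemma rect_int_affine (al l : C) (a b c d : R) : rect_int (fun z => al + l * z)%C a b c d = RtoC 0.
Proof.
  unfold rect_int.
  assert (Hh : forall y, CInt (fun x => al + l * (x, y))%C a b
     = (RtoC (b - a) * al + l * (((b * b - a * a) / 2)%R, ((b - a) * y)%R))%C).
  { intros y. rewrite CInt_plus.
    - rewrite CInt_const, CInt_scal by (apply cex_cont_all; intros; apply ccont_hline).
      do 2 f_equal. unfold CInt. simpl. rewrite RInt_id, RInt_const. reflexivity.
    - apply cex_cont_all; intros; apply ccont_const.
    - apply cex_scal, cex_cont_all; intros; apply ccont_hline. }
  assert (Hv : forall x, CInt (fun y => al + l * (x, y))%C c d
     = (RtoC (d - c) * al + l * (((d - c) * x)%R, ((d * d - c * c) / 2)%R))%C).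
  { intros y. rewrite CInt_plus.
    - rewrite CInt_const, CInt_scal by (apply cex_cont_all; intros; apply ccont_vline).
      do 2 f_equal. unfold CInt. simpl. rewrite RInt_id, RInt_const. reflexivity.
    - apply cex_cont_all; intros; apply ccont_const.
    - apply cex_scal, cex_cont_all; intros; apply ccont_vline. }
  rewrite !Hh, !Hv. ceq; field.
Qed.

Lemma rect_int_minus (F G : C -> C) (a b c d : R) : a <= b -> c <= d ->
  holo_rect F a b c d -> holo_rect G a b c d ->
  rect_int (fun z => F z - G z)%C a b c d = (rect_int F a b c d - rect_int G a b c d)%C.
Proof.
  intros Hab Hcd HF HG. unfold rect_int.
  assert (Hh := fun y => holo_cex_h F a b c d y a b HF). assert (Hv := fun x => holo_cex_v F a b c d x c d HF).
  assert (Gh := fun y => holo_cex_h G a b c d y a b HG). assert (Gv := fun x => holo_cex_v G a b c d x c d HG).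
  assert (E1 : forall y, c <= y <= d -> CInt (fun x => F (x, y) - G (x, y))%C a b
    = (CInt (fun x => F (x, y)) a b - CInt (fun x => G (x, y)) a b)%C).
  { intros y Hy. apply (CInt_minus (fun x => F (x, y)) (fun x => G (x, y))); [ apply Hh | apply Gh ]; lra. }
  assert (E2 : forall x, a <= x <= b -> CInt (fun y => F (x, y) - G (x, y))%C c d
    = (CInt (fun y => F (x, y)) c d - CInt (fun y => G (x, y)) c d)%C).
  { intros x Hx. apply (CInt_minus (fun y => F (x, y)) (fun y => G (x, y))); [ apply Hv | apply Gv ]; lra. }
  rewrite (E1 c), (E1 d), (E2 a), (E2 b) by lra.
  ring.
Qed.

Lemma rect_int_bound (F : C -> C) (a b c d M : R) : a <= b -> c <= d -> holo_rect F a b c d ->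
  (forall z, a <= Re z <= b -> c <= Im z <= d -> Cmod (F z) <= M) ->
  Cmod (rect_int F a b c d) <= 2 * ((b - a) + (d - c)) * M.
Proof.
  intros Hab Hcd HF HM. unfold rect_int.
  assert (Hh : forall y, c <= y <= d -> Cmod (CInt (fun x => F (x, y)) a b) <= (b - a) * M).
  { intros y Hy. apply CInt_bound_const; auto.
    - apply (holo_cex_h F a b c d); auto; lra.
    - intros t Ht. apply HM; simpl; lra. }
  assert (Hv : forall x, a <= x <= b -> Cmod (CInt (fun y => F (x, y)) c d) <= (d - c) * M).
  { intros x Hx. apply CInt_bound_const; auto.
    - apply (holo_cex_v F a b c d); auto; lra.
    - intros t Ht. apply HM; simpl; lra. }
  assert (A1 := Hh c ltac:(lra)). assert (A2 := Hh d ltac:(lra)).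
  assert (A3 := Hv a ltac:(lra)). assert (A4 := Hv b ltac:(lra)).
  unfold Cminus.
  eapply Rle_trans; [ apply Cmod_triangle | ]. rewrite Cmod_mult, Cmod_Ci.
  eapply Rle_trans; [ apply Rplus_le_compat; [ apply Cmod_triangle
    | apply Rmult_le_compat_l; [ lra | apply Cmod_triangle ] ] | ].
  rewrite !Cmod_opp. lra.
Qed.

Lemma cder_affine (al l z : C) : cder (fun z => al + l * z)%C z (0 + l * 1)%C.
Proof. apply cder_plus; [ apply cder_const | apply cder_scal, cder_id ]. Qed.

(** The affine approximation at z0 integrates to 0 around the rectangle, so only the error counts;
    |w - z0| is at most half the perimeter. *)
Lemma rect_int_local (F : C -> C) (a b c d eps : R) (z0 l : C) : a <= b -> c <= d ->
  holo_rect F a b c d -> 0 < eps -> a <= Re z0 <= b -> c <= Im z0 <= d ->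
  (forall w, a <= Re w <= b -> c <= Im w <= d ->
     Cmod (F w - F z0 - l * (w - z0)) <= eps * Cmod (w - z0)) ->
  Cmod (rect_int F a b c d) <= 2 * eps * ((b - a) + (d - c)) ^ 2.
Proof.
  intros Hab Hcd HF He H1 H2 Hw.
  set (al := (F z0 - l * z0)%C).
  assert (E : rect_int F a b c d = rect_int (fun z => F z - (al + l * z))%C a b c d).
  { rewrite (rect_int_minus F (fun z => al + l * z)%C), rect_int_affine; auto. ring.
    intros z _ _. eexists. apply cder_affine. }
  rewrite E.
  eapply Rle_trans; [ apply (rect_int_bound _ a b c d (eps * ((b - a) + (d - c)))); auto | ].
  - intros z Hz1 Hz2. destruct (HF z Hz1 Hz2) as [m Hm]. eexists. apply cder_minus; [ exact Hm | apply cder_affine ].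
  - intros z Hz1 Hz2. replace (F z - (al + l * z))%C with (F z - F z0 - l * (z - z0))%C
      by (unfold al; ring).
    eapply Rle_trans; [ apply Hw; auto | ]. apply Rmult_le_compat_l; [ lra | ].
    eapply Rle_trans; [ apply Cmod_le_abs | ].
    change (Re (z - z0)) with (Re z - Re z0). change (Im (z - z0)) with (Im z - Im z0).
    unfold Rabs; destruct (Rcase_abs (Re z - Re z0)); destruct (Rcase_abs (Im z - Im z0)); lra.
  - right; ring.
Qed.

Lemma holo_sub (F : C -> C) (a b c d a' b' c' d' : R) : holo_rect F a b c d ->
  a <= a' -> b' <= b -> c <= c' -> d' <= d -> holo_rect F a' b' c' d'.
Proof. intros H H1 H2 H3 H4 z Hz1 Hz2. apply H; lra. Qed.

(** The last quarter is the default: it is bad whenever some quarter is and the three others are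
    not. *)
Definition bisect (bad : R -> R -> R -> R -> Prop) (q : R * R * R * R) : R * R * R * R :=
  let '(a, b, c, d) := q in
  let m := (a + b) / 2 in let n := (c + d) / 2 in
  if excluded_middle_informative (bad a m c n) then (a, m, c, n)
  else if excluded_middle_informative (bad m b c n) then (m, b, c, n)
  else if excluded_middle_informative (bad a m n d) then (a, m, n, d)
  else (m, b, n, d).

(** A compactness principle used twice: for Goursat's theorem, where bad means a large boundary
    integral, and for the existence of maxima on a disc, where bad means that the rectangle comes up
    to every value. *)
Lemma bisection_principle (bad : R -> R -> R -> R -> Prop) (a b c d : R) : a <= b -> c <= d ->
  (forall a' b' c' d', a <= a' -> a' <= b' -> b' <= b -> c <= c' -> c' <= d' -> d' <= d ->
     let m := (a' + b') / 2 in let n := (c' + d') / 2 in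
     bad a' b' c' d' -> bad a' m c' n \/ bad m b' c' n \/ bad a' m n d' \/ bad m b' n d') ->
  bad a b c d ->
  exists x y, a <= x <= b /\ c <= y <= d /\ forall del, 0 < del -> exists a' b' c' d',
    a <= a' <= x /\ x <= b' <= b /\ c <= c' <= y /\ y <= d' <= d /\
    (b' - a') + (d' - c') < del /\ bad a' b' c' d'.
Proof.
  intros Hab Hcd Hstep Hbad.
  set (q := fun n => Nat.iter n (bisect bad) (a, b, c, d)).
  set (A := fun n => fst (fst (fst (q n)))). set (B := fun n => snd (fst (fst (q n)))).
  set (Cc := fun n => snd (fst (q n))). set (D := fun n => snd (q n)).
  assert (Hq : forall n, q n = (A n, B n, Cc n, D n)).
  { intros n. unfold A, B, Cc, D. destruct (q n) as [[[? ?] ?] ?]. reflexivity. }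
  (* Monotonicity relates stages n and n + 1, so the invariant carries a full description of the
     next stage, from which the induction continues. *)
  assert (Inv : forall n, a <= A n /\ A n <= B n /\ B n <= b /\ c <= Cc n /\ Cc n <= D n /\ D n <= d /\
     B n - A n = (b - a) / 2 ^ n /\ D n - Cc n = (d - c) / 2 ^ n /\ bad (A n) (B n) (Cc n) (D n) /\
     A n <= A (S n) /\ B (S n) <= B n /\ Cc n <= Cc (S n) /\ D (S n) <= D n /\
     (A n <= A (S n) /\ A (S n) <= B (S n) /\ B (S n) <= B n /\ Cc n <= Cc (S n) /\ Cc (S n) <= D (S n) /\ D (S n) <= D n /\
     B (S n) - A (S n) = (b - a) / 2 ^ S n /\ D (S n) - Cc (S n) = (d - c) / 2 ^ S n /\
     bad (A (S n)) (B (S n)) (Cc (S n)) (D (S n)))).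
  { assert (Key : forall n, a <= A n -> A n <= B n -> B n <= b -> c <= Cc n -> Cc n <= D n -> D n <= d ->
       B n - A n = (b - a) / 2 ^ n -> D n - Cc n = (d - c) / 2 ^ n -> bad (A n) (B n) (Cc n) (D n) ->
       A n <= A (S n) /\ A (S n) <= B (S n) /\ B (S n) <= B n /\ Cc n <= Cc (S n) /\ Cc (S n) <= D (S n) /\ D (S n) <= D n /\
     B (S n) - A (S n) = (b - a) / 2 ^ S n /\ D (S n) - Cc (S n) = (d - c) / 2 ^ S n /\
     bad (A (S n)) (B (S n)) (Cc (S n)) (D (S n))).
    { intros n h1 h2 h3 h4 h5 h6 h7 h8 h9.
      assert (E : q (S n) = bisect bad (A n, B n, Cc n, D n)) by (rewrite <- Hq; reflexivity).
      rewrite Hq in E. unfold bisect in E.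
      specialize (Hstep (A n) (B n) (Cc n) (D n) h1 h2 h3 h4 h5 h6 h9).
      assert (E1 : (b - a) / 2 ^ S n = (B n - A n) / 2).
      { rewrite h7. simpl. field. apply pow_nonzero. lra. }
      assert (E2 : (d - c) / 2 ^ S n = (D n - Cc n) / 2).
      { rewrite h8. simpl. field. apply pow_nonzero. lra. }
      rewrite E1, E2.
      repeat destruct excluded_middle_informative in E; injection E as -> -> -> ->;
        repeat split; try lra; try assumption.
      tauto. }
    induction n.
    - assert (K := Key 0%nat).
      change (A 0%nat) with a in *. change (B 0%nat) with b in *.
      change (Cc 0%nat) with c in *. change (D 0%nat) with d in *.
      assert (K' := K ltac:(lra) ltac:(lra) ltac:(lra) ltac:(lra) ltac:(lra) ltac:(lra)
               ltac:(simpl; field) ltac:(simpl; field) Hbad).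
      repeat split; try lra; try apply K'; try (simpl; field); auto.
    - destruct IHn as (i1&i2&i3&i4&i5&i6&i7&i8&i9&i10&i11&i12&i13&j1&j2&j3&j4&j5&j6&j7&j8&j9).
      assert (K' := Key (S n) ltac:(lra) ltac:(lra) ltac:(lra) ltac:(lra) ltac:(lra) ltac:(lra) j7 j8 j9).
      repeat split; try lra; try apply K'; auto. }
  assert (MA : forall n k, A n <= A (n + k)%nat).
  { intros n k. induction k; [ rewrite Nat.add_0_r; lra | ].
    rewrite Nat.add_succ_r. destruct (Inv (n + k)%nat) as (_&_&_&_&_&_&_&_&_&h&_). lra. }
  assert (MB : forall n k, B (n + k)%nat <= B n).
  { intros n k. induction k; [ rewrite Nat.add_0_r; lra | ].
    rewrite Nat.add_succ_r. destruct (Inv (n + k)%nat) as (_&_&_&_&_&_&_&_&_&_&h&_). lra. }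
  assert (MC : forall n k, Cc n <= Cc (n + k)%nat).
  { intros n k. induction k; [ rewrite Nat.add_0_r; lra | ].
    rewrite Nat.add_succ_r. destruct (Inv (n + k)%nat) as (_&_&_&_&_&_&_&_&_&_&_&h&_). lra. }
  assert (MD : forall n k, D (n + k)%nat <= D n).
  { intros n k. induction k; [ rewrite Nat.add_0_r; lra | ].
    rewrite Nat.add_succ_r. destruct (Inv (n + k)%nat) as (_&_&_&_&_&_&_&_&_&_&_&_&h&_). lra. }
  assert (AB : forall m n, A m <= B n).
  { intros m n. specialize (MA m n). specialize (MB n m). rewrite Nat.add_comm in MB.
    destruct (Inv (m + n)%nat) as (_&h&_). lra. }
  assert (CD : forall m n, Cc m <= D n).
  { intros m n. specialize (MC m n). specialize (MD n m). rewrite Nat.add_comm in MD.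
    destruct (Inv (m + n)%nat) as (_&_&_&_&h&_). lra. }
  destruct (completeness (fun x => exists n, x = A n)) as [x [Hx1 Hx2]].
  { exists (B 0%nat). intros x [n ->]. apply AB. }
  { exists (A 0%nat). exists 0%nat. reflexivity. }
  destruct (completeness (fun x => exists n, x = Cc n)) as [y [Hy1 Hy2]].
  { exists (D 0%nat). intros y [n ->]. apply CD. }
  { exists (Cc 0%nat). exists 0%nat. reflexivity. }
  assert (X1 : forall n, A n <= x) by (intros n; apply Hx1; exists n; auto).
  assert (X2 : forall n, x <= B n) by (intros n; apply Hx2; intros z [k ->]; apply AB).
  assert (Y1 : forall n, Cc n <= y) by (intros n; apply Hy1; exists n; auto).
  assert (Y2 : forall n, y <= D n) by (intros n; apply Hy2; intros z [k ->]; apply CD).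
  exists x, y.
  split; [ exact (conj (X1 0%nat) (X2 0%nat)) | ].
  split; [ exact (conj (Y1 0%nat) (Y2 0%nat)) | ].
  intros del Hdel.
  destruct (pow_lt_1_zero (/ 2) ltac:(rewrite Rabs_right; lra) (del / (b - a + (d - c) + 1))
     ltac:(apply Rdiv_lt_0_compat; lra)) as [N HN].
  specialize (HN N (Nat.le_refl _)).
  destruct (Inv N) as (i1&i2&i3&i4&i5&i6&i7&i8&i9&_).
  exists (A N), (B N), (Cc N), (D N).
  specialize (X1 N). specialize (X2 N). specialize (Y1 N). specialize (Y2 N).
  repeat split; try lra; auto.
  rewrite i7, i8. rewrite pow_inv in HN.
  assert (0 < / 2 ^ N) by (apply Rinv_0_lt_compat, pow_lt; lra).
  rewrite Rabs_right in HN by lra.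
  apply (Rmult_lt_compat_r (b - a + (d - c) + 1)) in HN; [ | lra ].
  replace (del / (b - a + (d - c) + 1) * (b - a + (d - c) + 1)) with del in HN by (field; lra).
  unfold Rdiv. nra.
Qed.

Theorem Goursat (F : C -> C) (a b c d : R) : a <= b -> c <= d -> holo_rect F a b c d ->
  rect_int F a b c d = RtoC 0.
Proof.
  intros Hab Hcd HF.
  apply Cmod_eq_0. apply Rle_antisym; [ | apply Cmod_ge_0 ].
  (* The added 1 keeps p positive for a degenerate rectangle. *)
  set (p := (b - a) + (d - c) + 1).
  assert (Hp : 1 <= p) by (unfold p; lra).
  apply le_epsilon. intros eps0 He0. rewrite Rplus_0_l.
  set (eps := eps0 / (2 * p ^ 2)).
  assert (Hp2 : 0 < p ^ 2) by (apply pow_lt; lra).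
  assert (He : 0 < eps) by (apply Rdiv_lt_0_compat; lra).
  destruct (Rle_lt_dec (Cmod (rect_int F a b c d)) (2 * eps * ((b - a) + (d - c)) ^ 2)) as [Hok | Hbad].
  { eapply Rle_trans; [ exact Hok | ].
    replace eps0 with (2 * eps * p ^ 2) by (unfold eps; field; lra).
    apply Rmult_le_compat_l; [ lra | ]. apply pow_incr. unfold p; lra. }
  exfalso.
  (* The threshold is quadratic in the half-perimeter, so halving both sides divides it by 4: four
     good quarters make a good rectangle. *)
  set (bad := fun a b c d => 2 * eps * ((b - a) + (d - c)) ^ 2 < Cmod (rect_int F a b c d)).
  destruct (bisection_principle bad a b c d) as [x [y [Hx [Hy K]]]]; auto.
  - intros a' b' c' d' h1 h2 h3 h4 h5 h6 m n Hb.
    apply NNPP. intros Hn.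
    apply not_or_and in Hn. destruct Hn as [n1 Hn].
    apply not_or_and in Hn. destruct Hn as [n2 Hn].
    apply not_or_and in Hn. destruct Hn as [n3 n4].
    unfold bad in *. apply Rnot_lt_le in n1, n2, n3, n4.
    rewrite (rect_int_split F a' m b' c' n d') in Hb;
      [ | apply (holo_sub F a b c d); auto | unfold m; lra | unfold n; lra ].
    assert (T1 := Cmod_triangle (rect_int F a' m c' n + rect_int F m b' c' n
             + rect_int F a' m n d') (rect_int F m b' n d')).
    assert (T2 := Cmod_triangle3 (rect_int F a' m c' n) (rect_int F m b' c' n) (rect_int F a' m n d')).
    replace (m - a' + (n - c')) with ((b' - a' + (d' - c')) / 2) in n1 by (unfold m, n; field).
    replace (b' - m + (n - c')) with ((b' - a' + (d' - c')) / 2) in n2 by (unfold m, n; field).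
    replace (m - a' + (d' - n)) with ((b' - a' + (d' - c')) / 2) in n3 by (unfold m, n; field).
    replace (b' - m + (d' - n)) with ((b' - a' + (d' - c')) / 2) in n4 by (unfold m, n; field).
    replace ((((b' - a' + (d' - c')) / 2)) ^ 2) with ((b' - a' + (d' - c')) ^ 2 / 4) in n1, n2, n3, n4 by field.
    lra.
  - destruct (HF (x, y) Hx Hy) as [l Hl].
    destruct (Hl eps He) as [del [Hdel Hw]].
    destruct (K del Hdel) as (a'&b'&c'&d'&h1&h2&h3&h4&h5&h6).
    unfold bad in h6. apply (Rlt_irrefl (Cmod (rect_int F a' b' c' d'))).
    eapply Rle_lt_trans; [ | exact h6 ].
    apply (rect_int_local F a' b' c' d' eps (x, y) l); simpl; try lra.
    + apply (holo_sub F a b c d); auto; lra.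
    + intros w Hw1 Hw2. apply Hw.
      eapply Rle_lt_trans; [ apply Cmod_le_abs | ].
      change (Re (w - (x, y))) with (Re w - x). change (Im (w - (x, y))) with (Im w - y).
      eapply Rle_lt_trans; [ | exact h5 ].
      unfold Rabs; destruct (Rcase_abs (Re w - x)); destruct (Rcase_abs (Im w - y)); lra.
Qed.

(** * Maximum principle and identity theorem *)

Lemma cder_translate (F : C -> C) (c z l : C) : cder F (c + z) l -> cder (fun w => F (c + w)%C) z l.
Proof.
  intros H. replace l with (l * (0 + 1))%C by ring.
  apply (cder_comp F (fun w => c + w)%C); auto. apply cder_plus; [ apply cder_const | apply cder_id ].
Qed.

Lemma cexp_2PI (x : R) : cexp (x, 2 * PI) = cexp (x, 0).
Proof. unfold cexp. simpl. rewrite cos_2PI, sin_2PI, cos_0, sin_0. reflexivity. Qed.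

(* Goursat for F(c + e^w) on [a,b] x [0,2pi] shows that the circular means of F do not depend on the radius. *)
Lemma circle_mean (F : C -> C) (c : C) (R0 b : R) :
  (forall z, Cmod (z - c) < R0 -> exists l, cder F z l) -> exp b < R0 ->
  CInt (fun t => F (c + cexp (b, t))%C) 0 (2 * PI) = (RtoC (2 * PI) * F c)%C.
Proof.
  intros HF Hb. assert (HPI := PI_RGT_0).
  set (G := fun w => F (c + cexp w)%C).
  assert (HG : forall w, Re w <= b -> exists l, cder G w l).
  { intros w Hw. destruct (HF (c + cexp w)%C) as [l Hl].
    - replace (c + cexp w - c)%C with (cexp w) by ring. rewrite Cmod_cexp.
      eapply Rle_lt_trans; [ apply exp_le_compat, Hw | exact Hb ].
    - exists (l * (0 + cexp w))%C. apply (cder_comp F (fun w => c + cexp w)%C); auto.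
      apply cder_plus; [ apply cder_const | apply cder_cexp ]. }
  assert (HC : forall a, a <= b -> CInt (fun t => G (a, t)) 0 (2 * PI) = CInt (fun t => G (b, t)) 0 (2 * PI)).
  { intros a Ha.
    assert (K := Goursat G a b 0 (2 * PI) Ha ltac:(lra)).
    rewrite <- (Cplus_0_r (CInt (fun t => G (a, t)) _ _)).
    replace (RtoC 0) with (- Ci * rect_int G a b 0 (2 * PI))%C.
    - unfold rect_int.
      replace (CInt (fun x => G (x, 2 * PI)) a b) with (CInt (fun x => G (x, 0)) a b).
      + match goal with |- (?A + - Ci * (?X - ?X + Ci * (?Y - ?A)))%C = _ =>
          replace (A + - Ci * (X - X + Ci * (Y - A)))%C with (A - (Ci * Ci) * (Y - A))%C by ring end.
        replace (Ci * Ci)%C with (RtoC (-1)) by (ceq; ring). ring.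
      + apply CInt_ext. intros t _. unfold G. rewrite cexp_2PI. reflexivity.
    - rewrite K. ring. intros z Hz _. apply HG. lra. }
  assert (H0 : exists l, cder F c l).
  { apply HF. replace (c - c)%C with (RtoC 0) by ring. rewrite Cmod_0.
    pose proof (exp_pos b). lra. }
  destruct H0 as [l Hl].
  change (CInt (fun t => G (b, t)) 0 (2 * PI) = RtoC (2 * PI) * F c)%C.
  apply Ceq_minus, Cmod_eq_0, Rle_antisym; [ | apply Cmod_ge_0 ].
  apply le_epsilon. intros eps He. rewrite Rplus_0_l.
  destruct (cder_cont _ _ _ Hl (eps / (2 * PI)) ltac:(apply Rdiv_lt_0_compat; lra)) as [d [Hd K]].
  set (a := Rmin b (ln (d / 2))).
  rewrite <- (HC a) by apply Rmin_l.
  assert (Hc : forall t, ccont (fun t => G (a, t)) t).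
  { intros t. destruct (HG (a, t)) as [m Hm]; [ apply Rmin_l | ].
    apply (ccont_comp G (fun y => (a, y)) t m); auto. apply ccont_vline. }
  replace (2 * PI) with (2 * PI - 0) at 2 by ring.
  rewrite <- (CInt_const (F c) 0 (2 * PI)).
  rewrite <- (CInt_minus (fun t => G (a, t)) (fun _ => F c)).
  2: apply cex_cont_all; auto.
  2: apply cex_cont_all; intros; apply ccont_const.
  replace eps with ((2 * PI - 0) * (eps / (2 * PI))) by (field; lra).
  apply CInt_bound_const; [ lra | | ].
  - apply cex_minus; apply cex_cont_all; auto. intros; apply ccont_const.
  - intros t _. left. apply K.
    replace (c + cexp (a, t) - c)%C with (cexp (a, t)) by ring. rewrite Cmod_cexp. simpl.
    apply Rle_lt_trans with (d / 2); [ | lra ].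
    rewrite <- (exp_ln (d / 2)) by lra. apply exp_le_compat. apply Rmin_r.
Qed.

Lemma max_attained (u : C -> R) (r : R) : 0 <= r ->
  (forall z, Cmod z <= r -> forall eps, 0 < eps -> exists d, 0 < d /\
     forall w, Cmod w <= r -> Cmod (w - z) < d -> Rabs (u w - u z) < eps) ->
  exists z0, Cmod z0 <= r /\ forall z, Cmod z <= r -> u z <= u z0.
Proof.
  intros Hr Hu.
  (* A rectangle is bad when its part in the disc reaches at least every value of u on the disc. If
     no quarter were bad, the largest of the four witnessing values would not be reached in the
     whole rectangle. *)
  set (bad := fun a b c d => forall z1, Cmod z1 <= r ->
    exists z, Cmod z <= r /\ a <= Re z <= b /\ c <= Im z <= d /\ u z1 <= u z).
  assert (Hin : forall z, Cmod z <= r -> -r <= Re z <= r /\ -r <= Im z <= r).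
  { intros z Hz. assert (H1 := re_le_Cmod z). assert (H2 := im_le_Cmod z).
    apply Rabs_le_between in H1. apply Rabs_le_between in H2. lra. }
  destruct (bisection_principle bad (-r) r (-r) r) as [x [y [Hx [Hy K]]]]; try lra.
  - intros a b c d _ h1 _ _ h2 _ m n Hb.
    apply NNPP. intros Hn.
    apply not_or_and in Hn. destruct Hn as [n1 Hn].
    apply not_or_and in Hn. destruct Hn as [n2 Hn].
    apply not_or_and in Hn. destruct Hn as [n3 n4].
    assert (Hnot : forall a b c d, ~ bad a b c d -> exists z1, Cmod z1 <= r /\
       forall z, Cmod z <= r -> a <= Re z <= b -> c <= Im z <= d -> u z < u z1).
    { clear. intros a b c d H. apply not_all_ex_not in H. destruct H as [z1 H].
      apply imply_to_and in H. destruct H as [H1 H2]. exists z1. split; auto.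
      intros z h1 h2 h3. apply Rnot_le_lt. intros h4. apply H2. exists z. auto. }
    apply Hnot in n1, n2, n3, n4.
    destruct n1 as [z1 [p1 q1]], n2 as [z2 [p2 q2]], n3 as [z3 [p3 q3]], n4 as [z4 [p4 q4]].
    set (mx := Rmax (Rmax (u z1) (u z2)) (Rmax (u z3) (u z4))).
    assert (M1 : u z1 <= mx) by (eapply Rle_trans; [ apply Rmax_l | apply Rmax_l ]).
    assert (M2 : u z2 <= mx) by (eapply Rle_trans; [ apply Rmax_r | apply Rmax_l ]).
    assert (M3 : u z3 <= mx) by (eapply Rle_trans; [ apply Rmax_l | apply Rmax_r ]).
    assert (M4 : u z4 <= mx) by (eapply Rle_trans; [ apply Rmax_r | apply Rmax_r ]).
    assert (exists zs, Cmod zs <= r /\ u zs = mx) as [zs [ps es]].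
    { unfold mx, Rmax. destruct (Rle_dec (u z1) (u z2)); destruct (Rle_dec (u z3) (u z4));
        destruct Rle_dec; eauto. }
    destruct (Hb zs ps) as [z [g1 [g2 [g3 g4]]]].
    rewrite es in g4.
    destruct (Rle_lt_dec (Re z) m); destruct (Rle_lt_dec (Im z) n).
    + specialize (q1 z g1 ltac:(lra) ltac:(lra)). lra.
    + specialize (q3 z g1 ltac:(lra) ltac:(lra)). lra.
    + specialize (q2 z g1 ltac:(lra) ltac:(lra)). lra.
    + specialize (q4 z g1 ltac:(lra) ltac:(lra)). lra.
  - intros z1 Hz1. exists z1. destruct (Hin z1 Hz1). repeat split; try lra.
  - assert (Near : forall d, 0 < d -> forall z1, Cmod z1 <= r -> exists z, Cmod z <= r /\ Cmod (z - (x, y)) < d /\ u z1 <= u z).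
    { intros d Hd z1 Hz1. destruct (K d Hd) as (a&b&c&e&h1&h2&h3&h4&h5&h6).
      destruct (h6 z1 Hz1) as [z [g1 [g2 [g3 g4]]]].
      exists z. repeat split; auto.
      eapply Rle_lt_trans; [ apply Cmod_le_abs | ].
      change (Re (z - (x, y))) with (Re z - x). change (Im (z - (x, y))) with (Im z - y).
      unfold Rabs; destruct (Rcase_abs (Re z - x)); destruct (Rcase_abs (Im z - y)); lra. }
    assert (Hp : Cmod (x, y) <= r).
    { apply le_epsilon. intros eps He.
      destruct (Near eps He 0) as [z [g1 [g2 _]]]; [ rewrite Cmod_0; lra | ].
      assert (T := Cmod_triangle_rev (x, y) z). rewrite Cmod_minus_sym in T. lra. }
    exists (x, y). split; auto.
    intros z1 Hz1. apply Rnot_lt_le. intros Hlt.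
    destruct (Hu (x, y) Hp (u z1 - u (x, y)) ltac:(lra)) as [d [Hd Kd]].
    destruct (Near d Hd z1 Hz1) as [z [g1 [g2 g3]]].
    specialize (Kd z g1 g2). apply Rabs_def2 in Kd. lra.
Qed.

Lemma Cmod_sqr (z : C) : Cmod z ^ 2 = Re z * Re z + Im z * Im z.
Proof. rewrite Cmod2_alt. ring. Qed.

Lemma Cmod_continuous (z : C) (r : R) : 0 <= r -> Cmod z <= r -> forall eps, 0 < eps ->
  exists d, 0 < d /\ forall w, Cmod w <= r -> Cmod (w - z) < d -> Rabs (Cmod w ^ 2 - Cmod z ^ 2) < eps.
Proof.
  intros Hr Hz eps He. exists (eps / (2 * r + 1)). split; [ apply Rdiv_lt_0_compat; lra | ].
  intros w Hw Hd.
  replace (Cmod w ^ 2 - Cmod z ^ 2) with ((Cmod w - Cmod z) * (Cmod w + Cmod z)) by ring.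
  rewrite Rabs_mult.
  assert (H0 := Cmod_ge_0 w). assert (H1 := Cmod_ge_0 z).
  rewrite (Rabs_right (Cmod w + Cmod z)) by lra.
  assert (H2 : Rabs (Cmod w - Cmod z) <= Cmod (w - z)).
  { assert (T1 := Cmod_triangle_rev w z). assert (T2 := Cmod_triangle_rev z w).
    rewrite (Cmod_minus_sym z w) in T2. apply Rabs_le. lra. }
  apply Rle_lt_trans with (Cmod (w - z) * (2 * r + 1)).
  - apply Rmult_le_compat; try lra. apply Rabs_pos.
  - apply (Rmult_lt_compat_r (2 * r + 1)) in Hd; [ | lra ].
    replace (eps / (2 * r + 1) * (2 * r + 1)) with eps in Hd by (field; lra). exact Hd.
Qed.

(* |F(z)| + eps |z|^2 violates the mean value property at an interior maximum, so its maximum lies on the boundary. *)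
Lemma max_principle (F : C -> C) (R0 r m : R) : 0 < r < R0 ->
  (forall z, Cmod z < R0 -> exists l, cder F z l) ->
  (forall z, Cmod z = r -> Cmod (F z) <= m) ->
  forall z, Cmod z <= r -> Cmod (F z) <= m.
Proof.
  intros Hr HF Hm z Hz. assert (HPI := PI_RGT_0).
  apply le_epsilon. intros eps0 He0.
  assert (Hr2 : 0 < r ^ 2) by (apply pow_lt; lra).
  set (eps := eps0 / r ^ 2).
  assert (He : 0 < eps) by (apply Rdiv_lt_0_compat; auto).
  destruct (max_attained (fun z => Cmod (F z) + eps * Cmod z ^ 2) r) as [z0 [Hz0 Hmax]]; [ lra | | ].
  { intros w Hw e Hep.
    destruct (HF w ltac:(lra)) as [l Hl].
    destruct (cder_cont _ _ _ Hl (e / 2) ltac:(lra)) as [d1 [D1 K1]].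
    destruct (Cmod_continuous w r ltac:(lra) Hw (e / (2 * eps)) ltac:(apply Rdiv_lt_0_compat; lra)) as [d2 [D2 K2]].
    exists (Rmin d1 d2). split; [ apply Rmin_pos; auto | ].
    intros v Hv Hd.
    specialize (K1 v (Rlt_le_trans _ _ _ Hd (Rmin_l _ _))).
    specialize (K2 v Hv (Rlt_le_trans _ _ _ Hd (Rmin_r _ _))).
    assert (T1 := Cmod_triangle_rev (F v) (F w)). assert (T2 := Cmod_triangle_rev (F w) (F v)).
    rewrite (Cmod_minus_sym (F w)) in T2.
    apply Rabs_def2 in K2. destruct K2 as [K2 K3].
    apply (Rmult_lt_compat_l eps) in K2; auto. apply (Rmult_lt_compat_l eps) in K3; auto.
    replace (eps * (e / (2 * eps))) with (e / 2) in K2 by (field; lra).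
    replace (eps * - (e / (2 * eps))) with (- (e / 2)) in K3 by (field; lra).
    apply Rabs_def1; lra. }
  assert (Hb : Cmod z0 = r).
  { apply Rle_antisym; auto. apply Rnot_lt_le. intros Hlt.
    (* The radius of the largest circle about z0 inside the disc of maximisation. *)
    set (rho := r - Cmod z0). assert (Hrho : 0 < rho) by (unfold rho; lra).
    assert (K := circle_mean F z0 (R0 - Cmod z0) (ln rho)).
    rewrite exp_ln in K by auto.
    assert (HFz : forall w, Cmod (w - z0) < R0 - Cmod z0 -> exists l, cder F w l).
    { intros w Hw. apply HF. assert (T := Cmod_triangle_rev w z0). lra. }
    specialize (K HFz ltac:(unfold rho; lra)).
    assert (Hcirc : forall t, Cmod (z0 + cexp (ln rho, t)) <= r).
    { intros t. eapply Rle_trans; [ apply Cmod_triangle | ]. rewrite Cmod_cexp. simpl.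
      rewrite exp_ln by auto. unfold rho; lra. }
    set (x0 := Re z0). set (y0 := Im z0).
    (* Maximality at z0, with |z0 + rho e^{it}|^2 expanded, bounds |F| on the circle by g. The
       trigonometric terms have mean 0, so the mean of g is |F(z0)| - eps rho^2, which is too
       small. *)
    set (g := fun t => Cmod (F z0) - eps * rho ^ 2 - 2 * eps * rho * (x0 * cos t + y0 * sin t)).
    assert (Hg : is_RInt g 0 (2 * PI) (2 * PI * (Cmod (F z0) - eps * rho ^ 2))).
    { set (Q := fun t => (Cmod (F z0) - eps * rho ^ 2) * t - 2 * eps * rho * (x0 * sin t - y0 * cos t)).
      replace (2 * PI * (Cmod (F z0) - eps * rho ^ 2)) with (minus (Q (2 * PI)) (Q 0)).
      2: { unfold Q, minus, plus, opp; simpl. rewrite cos_2PI, sin_2PI, cos_0, sin_0. ring. }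
      apply (is_RInt_derive (V:=R_CompleteNormedModule) Q g).
      - intros t _. unfold Q, g. auto_derive; auto. ring.
      - intros t _. apply (ex_derive_continuous (V:=R_NormedModule)). unfold g. auto_derive. auto. }
    assert (Hle : Cmod (RtoC (2 * PI) * F z0) <= 2 * PI * (Cmod (F z0) - eps * rho ^ 2)).
    { rewrite <- K. rewrite <- (is_RInt_unique _ _ _ _ Hg).
      apply CInt_bound; [ lra | | eexists; exact Hg | ].
      - apply cex_cont_all. intros t.
        destruct (HF (z0 + cexp (ln rho, t))%C) as [l Hl]; [ specialize (Hcirc t); lra | ].
        apply (ccont_comp F (fun t => z0 + cexp (ln rho, t))%C t l); auto.
        apply ccont_plus; [ apply ccont_const | apply ccont_cexp, ccont_vline ].
      - intros t _. specialize (Hmax _ (Hcirc t)). cbn beta in Hmax.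
        assert (E : Cmod (z0 + cexp (ln rho, t)) ^ 2 =
          Cmod z0 ^ 2 + rho ^ 2 + 2 * rho * (x0 * cos t + y0 * sin t)).
        { assert (Er : Re (z0 + cexp (ln rho, t)) = x0 + rho * cos t)
            by (unfold cexp, x0, Re; simpl; rewrite exp_ln; auto).
          assert (Ei : Im (z0 + cexp (ln rho, t)) = y0 + rho * sin t)
            by (unfold cexp, y0, Re, Im; simpl; rewrite exp_ln; auto).
          rewrite !Cmod_sqr, Er, Ei. fold x0 y0.
          assert (S := sin2_cos2 t). unfold Rsqr in S.
          replace (rho ^ 2) with (rho * rho * (sin t * sin t + cos t * cos t)) by (rewrite S; ring).
          ring. }
        rewrite E in Hmax. unfold g. lra. }
    rewrite Cmod_mult, Cmod_R, Rabs_right in Hle by lra.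
    apply Rmult_le_reg_l in Hle; [ | lra ].
    assert (0 < eps * rho ^ 2) by (apply Rmult_lt_0_compat; [ auto | apply pow_lt; auto ]). lra. }
  specialize (Hmax z Hz). cbn beta in Hmax.
  specialize (Hm z0 Hb).
  rewrite Hb in Hmax.
  replace (eps * r ^ 2) with eps0 in Hmax by (unfold eps; field; lra).
  assert (0 <= eps * Cmod z ^ 2) by (apply Rmult_le_pos; [ lra | apply pow_le, Cmod_ge_0 ]). lra.
Qed.

(* The maximum principle for F(z)/z^k gives |F(z)| <= m (|z|/r)^k for all k. *)
Lemma zero_near_center_0 (F : C -> C) (R0 r1 : R) : 0 < r1 ->
  (forall z, Cmod z < R0 -> exists l, cder F z l) ->
  (forall z, Cmod z < r1 -> F z = RtoC 0) ->
  forall z, Cmod z < R0 -> F z = RtoC 0.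
Proof.
  intros Hr1 HF Hz z Hz0.
  destruct (Ceq_dec z 0) as [-> | Hne]; [ apply Hz; rewrite Cmod_0; auto | ].
  assert (Hzp : 0 < Cmod z) by (apply Cmod_gt_0; auto).
  set (r := (Cmod z + R0) / 2).
  assert (Hr : 0 < r < R0 /\ Cmod z < r) by (unfold r; lra). destruct Hr as [Hr Hzr].
  destruct (max_attained (fun z => Cmod (F z)) r) as [z0 [Hz0' Hmax]]; [ lra | | ].
  { intros w Hw e Hep. destruct (HF w ltac:(lra)) as [l Hl].
    destruct (cder_cont _ _ _ Hl e Hep) as [d [D1 K1]].
    exists d. split; auto. intros v Hv Hd. specialize (K1 v Hd).
    assert (T1 := Cmod_triangle_rev (F v) (F w)). assert (T2 := Cmod_triangle_rev (F w) (F v)).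
    rewrite (Cmod_minus_sym (F w)) in T2. apply Rabs_def1; lra. }
  set (m := Cmod (F z0)). assert (Hm0 : 0 <= m) by apply Cmod_ge_0.
  assert (Hk : forall k, Cmod (F z) <= m * (Cmod z / r) ^ k).
  { intros k.
    assert (Hrk : 0 < r ^ k) by (apply pow_lt; lra).
    assert (K := max_principle (fun w => F w * (/ w) ^ k)%C R0 r (m * (/ r) ^ k) Hr).
    assert (K' : Cmod (F z * (/ z) ^ k) <= m * (/ r) ^ k).
    { apply K; [ | | lra ].
      - intros w Hw. destruct (HF w Hw) as [l Hl].
        destruct (Rlt_le_dec (Cmod w) r1) as [Hw1 | Hw1].
        (* Near 0 the quotient vanishes identically because F does, whatever value the inverse of 0
           takes. *)
        + exists (RtoC 0). apply (cder_ext_loc (fun _ => RtoC 0) _ w 0 (r1 - Cmod w)); [ lra | | apply cder_const ].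
          intros v Hv. rewrite Hz; [ ring | ].
          assert (T := Cmod_triangle_rev v w). lra.
        + destruct (cder_pow (/ w) k) as [n Hn].
          eexists. apply cder_mult; [ exact Hl | ].
          apply (cder_comp (fun u => u ^ k)%C (fun w => / w)%C); [ apply cder_inv | exact Hn ].
          apply Cmod_gt_0. lra.
      - intros w Hw. rewrite Cmod_mult, Cmod_pow, Cmod_inv by (apply Cmod_gt_0; lra).
        rewrite Hw. apply Rmult_le_compat_r; [ apply pow_le; left; apply Rinv_0_lt_compat; lra | ].
        apply Hmax. lra. }
    rewrite Cmod_mult, Cmod_pow, Cmod_inv in K' by auto.
    assert (Hzk : 0 < Cmod z ^ k) by (apply pow_lt; auto).
    apply (Rmult_le_compat_r (Cmod z ^ k)) in K'; [ | lra ].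
    rewrite Rmult_assoc, <- Rpow_mult_distr, Rinv_l, pow1, Rmult_1_r in K' by lra.
    rewrite Rmult_assoc, <- Rpow_mult_distr in K'.
    unfold Rdiv. rewrite (Rmult_comm (Cmod z)). exact K'. }
  apply Cmod_eq_0, Rle_antisym; [ | apply Cmod_ge_0 ].
  apply le_epsilon. intros eps He. rewrite Rplus_0_l.
  assert (Hq : 0 <= Cmod z / r < 1).
  { split; [ apply Rdiv_le_0_compat; lra | ]. apply (Rmult_lt_reg_r r); [ lra | ].
    unfold Rdiv. rewrite Rmult_assoc, Rinv_l by lra. lra. }
  destruct (pow_lt_1_zero (Cmod z / r) ltac:(rewrite Rabs_right; lra) (eps / (m + 1))
     ltac:(apply Rdiv_lt_0_compat; lra)) as [N HN].
  specialize (HN N (Nat.le_refl _)). apply Rabs_def2 in HN.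
  assert (0 <= (Cmod z / r) ^ N) by (apply pow_le; lra).
  eapply Rle_trans; [ apply (Hk N) | ].
  apply Rle_trans with ((m + 1) * (eps / (m + 1))); [ | right; field; lra ].
  apply Rmult_le_compat; lra.
Qed.

Lemma zero_near_center (F : C -> C) (c : C) (R0 r1 : R) : 0 < r1 ->
  (forall z, Cmod (z - c) < R0 -> exists l, cder F z l) ->
  (forall z, Cmod (z - c) < r1 -> F z = RtoC 0) ->
  forall z, Cmod (z - c) < R0 -> F z = RtoC 0.
Proof.
  intros Hr HF H0 z Hz.
  replace z with (c + (z - c))%C by ring.
  apply (zero_near_center_0 (fun w => F (c + w)%C) R0 r1); auto.
  - intros w Hw. destruct (HF (c + w)%C) as [l Hl]; [ replace (c + w - c)%C with w by ring; auto | ].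
    exists l. apply cder_translate; auto.
  - intros w Hw. apply H0. replace (c + w - c)%C with w by ring; auto.
Qed.

(** The centre moves by half a radius, so the disc of radius rho/2 about the new centre lies in the
    old disc, and [zero_near_center] extends the zeros from it. *)
Lemma zero_propagates_left (F : C -> C) (rho tau x0 : R) : 0 < rho ->
  (forall x z, 0 <= x <= x0 -> Cmod (z - (x, tau)) < rho -> exists l, cder F z l) ->
  (forall z, Cmod (z - (x0, tau)) < rho -> F z = RtoC 0) -> 0 <= x0 ->
  forall n : nat, 0 <= x0 - INR n * (rho / 2) ->
  forall z, Cmod (z - (x0 - INR n * (rho / 2), tau)) < rho -> F z = RtoC 0.
Proof.
  intros Hrho HF H0 Hx0. induction n as [ | n IH ]; intros Hn.
  - simpl in *. replace (x0 - 0 * (rho / 2)) with x0 by ring. exact H0.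
  - rewrite S_INR in *.
    assert (Hpos := pos_INR n).
    assert (Hn' : 0 <= x0 - INR n * (rho / 2)) by lra.
    specialize (IH Hn').
    apply (zero_near_center F _ rho (rho / 2)); [ lra | | ].
    + intros z Hz. apply (HF (x0 - (INR n + 1) * (rho / 2))); auto.
      split; auto. assert (0 <= INR n * (rho / 2)) by (apply Rmult_le_pos; lra). lra.
    + intros z Hz. apply IH.
      replace (z - ((x0 - INR n * (rho / 2))%R, tau))%C with
        ((z - ((x0 - (INR n + 1) * (rho / 2))%R, tau)) + RtoC (- (rho / 2)))%C
        by (ceq; ring).
      eapply Rle_lt_trans; [ apply Cmod_triangle | ].
      rewrite Cmod_R, Rabs_left by lra. lra.
Qed.

(* By compactness of a real segment, Q avoids a thin strip just above it; the zeros then propagate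
   along the strip from the far right down to the imaginary axis. *)
Lemma identity_near_0 (D : C -> C) (Q : C -> Prop) (s1 : R) :
  (forall z : C, exists eps, 0 < eps /\ forall w, Q w -> Cmod (w - z) < eps -> w = z) ->
  (forall z, ~ Q z -> exists l, cder D z l) ->
  (forall z, s1 < Re z -> D z = RtoC 0) ->
  exists d, 0 < d /\ forall t, 0 < t < d -> D (0, t) = RtoC 0.
Proof.
  intros HQ HD H0.
  set (S := Rmax s1 0 + 1).
  assert (HS : s1 < S /\ 0 < S).
  { unfold S. pose proof (Rmax_l s1 0). pose proof (Rmax_r s1 0). lra. }
  (* The factor 2 prepares the estimate below, where the horizontal and the vertical distance to a
     centre are each less than its radius. *)
  assert (Hch : forall x : R, exists eps : posreal, forall w, Q w -> Cmod (w - (x, 0)) < 2 * eps -> w = (x, 0)).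
  { intros x. destruct (HQ (x, 0)) as [e [He K]]. 
    exists (mkposreal (e / 2) ltac:(lra)). simpl. intros w Hw Hd. apply K; auto. lra. }
  set (del := fun x => proj1_sig (constructive_indefinite_description _ (Hch x))).
  assert (Hdel : forall x w, Q w -> Cmod (w - (x, 0)) < 2 * del x -> w = (x, 0)).
  { intros x. unfold del. destruct (constructive_indefinite_description _ (Hch x)). simpl. auto. }
  (* The margins of 1 around [0, S] leave room for discs of radius rho < t < 1. *)
  destruct (compactness_value_1d (-1) (S + 1) del) as [d Hd].
  assert (Hfree : forall x y, -1 <= x <= S + 1 -> 0 < y < d -> ~ Q (x, y)).
  { intros x y Hx Hy HQxy. apply (Hd x Hx). intros [t [Ht1 [Ht2 Ht3]]].
    assert (E : (x, y) = (t, 0)).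
    { apply (Hdel t); auto. eapply Rle_lt_trans; [ apply Cmod_le_abs | ].
      unfold Re, Im; simpl. rewrite (Rabs_right (y + -0)) by lra.
      unfold Rminus in Ht2. lra. }
    injection E. intros. lra. }
  exists (Rmin 1 (d / 2)). split; [ apply Rmin_pos; [ lra | destruct d; simpl; lra ] | ].
  intros t Ht.
  assert (Ht1 : t < 1) by (eapply Rlt_le_trans; [ apply Ht | apply Rmin_l ]).
  assert (Ht2 : t < d / 2) by (eapply Rlt_le_trans; [ apply Ht | apply Rmin_r ]).
  destruct Ht as [Ht _].
  destruct (archimed_cor1 (t / (2 * S)) ltac:(apply Rdiv_lt_0_compat; lra)) as [N [HN HNpos]].
  assert (HNr : 0 < INR N) by (apply lt_0_INR; auto).
  (* With this radius N half-steps lead from S exactly to 0; rho < t < d/2 keeps the discs at height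
     t inside the free strip. *)
  set (rho := 2 * S / INR N).
  assert (Hrho : 0 < rho < t).
  { unfold rho. split; [ apply Rdiv_lt_0_compat; lra | ].
    apply (Rmult_lt_compat_l (2 * S)) in HN; [ | lra ].
    replace (2 * S * (t / (2 * S))) with t in HN by (field; lra). exact HN. }
  assert (E : S - INR N * (rho / 2) = 0) by (unfold rho; field; lra).
  assert (HFd : forall x z, 0 <= x <= S -> Cmod (z - (x, t)) < rho -> exists l, cder D z l).
  { intros x z Hx Hz. apply HD.
    assert (H1 := re_le_Cmod (z - (x, t))). assert (H2 := im_le_Cmod (z - (x, t))).
    change (Re (z - (x, t))) with (Re z - x) in H1. change (Im (z - (x, t))) with (Im z - t) in H2.
    apply Rabs_le_between in H1. apply Rabs_le_between in H2.
    destruct z as [a b]. unfold Re, Im in *; simpl in *. apply Hfree; lra. }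
  apply (zero_propagates_left D rho t S ltac:(lra) HFd) with N; try lra.
  - apply (zero_near_center D _ rho (Rmin rho (S - s1))); [ apply Rmin_pos; lra | | ].
    + intros z Hz. apply (HFd S); auto; lra.
    + intros z Hz. apply H0.
      assert (Hz2 := Rlt_le_trans _ _ _ Hz (Rmin_r _ _)).
      assert (H1 := re_le_Cmod (z - (S, t))).
      change (Re (z - (S, t))) with (Re z - S) in H1. apply Rabs_le_between in H1. lra.
  - rewrite E. replace ((0, t) - (0, t))%C with (RtoC 0) by (ceq; ring). rewrite Cmod_0. lra.
Qed.

(** Agreement is known only on a segment above 0. Continuity extends it to the value at 0, and a
    complex derivative is determined by difference quotients along any one ray. *)
Lemma cder_unique_axis (F G : C -> C) (l m : C) (d : R) : 0 < d ->
  (forall t, 0 < t < d -> F (0, t) = G (0, t)) -> cder F 0 l -> cder G 0 m -> l = m.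
Proof.
  intros Hd HE HF HG.
  set (D := fun z => (F z - G z)%C).
  assert (HD : cder D 0 (l - m)) by (apply cder_minus; auto).
  assert (Hm : forall t, 0 < t -> Cmod (0, t) = t).
  { intros t Ht. replace ((0, t) : C) with (Ci * RtoC t)%C by (ceq; ring).
    rewrite Cmod_mult, Cmod_Ci, Cmod_R, Rabs_right by lra. ring. }
  assert (Hz : forall w : C, (w - 0)%C = w) by (intros; ring).
  assert (D0 : D 0 = RtoC 0).
  { apply Cmod_eq_0, Rle_antisym; [ | apply Cmod_ge_0 ]. apply le_epsilon. intros eps He. rewrite Rplus_0_l.
    destruct (cder_cont _ _ _ HD eps He) as [d1 [Hd1 K]].
    set (t := Rmin d d1 / 2). assert (Ht : 0 < Rmin d d1) by (apply Rmin_pos; auto).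
    pose proof (Rmin_l d d1). pose proof (Rmin_r d d1).
    specialize (K (0, t)). rewrite Hz, Hm in K by (unfold t; lra).
    specialize (K ltac:(unfold t; lra)).
    replace (D (0, t)) with (RtoC 0) in K.
    - rewrite Cmod_minus_sym, Hz in K. lra.
    - unfold D. rewrite HE by (unfold t; lra). ring. }
  apply Ceq_minus, Cmod_eq_0, Rle_antisym; [ | apply Cmod_ge_0 ]. apply le_epsilon. intros eps He. rewrite Rplus_0_l.
  destruct (HD eps He) as [d1 [Hd1 K]].
  set (t := Rmin d d1 / 2). assert (Ht : 0 < Rmin d d1) by (apply Rmin_pos; auto).
  pose proof (Rmin_l d d1). pose proof (Rmin_r d d1).
  assert (Htp : 0 < t) by (unfold t; lra).
  specialize (K (0, t)). rewrite Hz, Hm in K by auto.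
  specialize (K ltac:(unfold t; lra)).
  rewrite D0 in K. replace (D (0, t)) with (RtoC 0) in K.
  - replace (0 - 0 - (l - m) * (0, t))%C with (- ((l - m) * (0, t)))%C in K by ring.
    rewrite Cmod_opp, Cmod_mult, Hm in K by auto. apply Rmult_le_reg_r in K; auto.
  - unfold D. rewrite HE by (unfold t; lra). ring.
Qed.

(** * Laplace transforms *)

Definition lker (h : R -> R) (s : C) (u : R) : C := (cexp (- (s * RtoC u)) * RtoC (h u))%C.

Definition is_LT (h : R -> R) (s l : C) : Prop :=
  forall eps, 0 < eps -> exists M, forall X, M <= X -> Cmod (CInt (lker h s) 0 X - l) < eps.

(** Choosing the limit makes the transform a total function of s, so that its derivative can be
    stated without proofs of convergence inside the function. *)
Definition LT (h : R -> R) (s : C) : C := epsilon (inhabits (RtoC 0)) (is_LT h s).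

Lemma Re_sR (s : C) (u : R) : Re (- (s * RtoC u)) = - (Re s * u).
Proof. unfold Re; simpl. ring. Qed.

Lemma Cmod_lker (h : R -> R) (s : C) (u : R) : Cmod (lker h s u) = exp (- (Re s * u)) * Rabs (h u).
Proof. unfold lker. rewrite Cmod_mult, Cmod_cexp, Cmod_R, Re_sR. reflexivity. Qed.

Lemma cder_lin (c z : C) : cder (fun w => c * w)%C z c.
Proof. assert (H := cder_scal c _ z 1 (cder_id z)). rewrite Cmult_1_r in H. exact H. Qed.

Lemma ccont_lin (s : C) (t : R) : ccont (fun u => - (s * RtoC u))%C t.
Proof.
  apply (ccont_comp (fun z => - (s * z))%C (fun u => RtoC u) t (- s)).
  - apply (cder_ext (fun z => (- s) * z)%C); [ intros; ring | ].
    apply cder_lin.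
  - apply ccont_R, continuous_id.
Qed.

Lemma ccont_lker (h : R -> R) (s : C) (t : R) : continuous h t -> ccont (lker h s) t.
Proof.
  intros H. apply ccont_mult; [ apply ccont_cexp, ccont_lin | apply ccont_R; auto ].
Qed.

Lemma cex_lker (h : R -> R) (s : C) (a b : R) : (forall t, continuous h t) -> cex (lker h s) a b.
Proof. intros H. apply cex_cont_all. intros; apply ccont_lker; auto. Qed.

Lemma is_LT_unique (h : R -> R) (s l m : C) : is_LT h s l -> is_LT h s m -> l = m.
Proof.
  intros H1 H2. apply Ceq_minus, Cmod_eq_0, Rle_antisym; [ | apply Cmod_ge_0 ].
  apply le_epsilon. intros eps He. rewrite Rplus_0_l.
  destruct (H1 (eps / 2) ltac:(lra)) as [M1 K1]. destruct (H2 (eps / 2) ltac:(lra)) as [M2 K2].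
  specialize (K1 (Rmax M1 M2) (Rmax_l _ _)). specialize (K2 (Rmax M1 M2) (Rmax_r _ _)).
  set (I := CInt (lker h s) 0 (Rmax M1 M2)) in *.
  replace (l - m)%C with ((I - m) + - (I - l))%C by ring.
  eapply Rle_trans; [ apply Cmod_triangle | ]. rewrite Cmod_opp. lra.
Qed.

Lemma LT_correct (h : R -> R) (s l : C) : is_LT h s l -> is_LT h s (LT h s).
Proof. intros H. apply (epsilon_spec (inhabits (RtoC 0)) (is_LT h s)). exists l; auto. Qed.

Lemma LT_eq (h : R -> R) (s l : C) : is_LT h s l -> LT h s = l.
Proof. intros H. eapply is_LT_unique; [ eapply LT_correct; eauto | auto ]. Qed.

Lemma is_LT_plus (h k : R -> R) (s l m : C) : (forall t, continuous h t) -> (forall t, continuous k t) ->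
  is_LT h s l -> is_LT k s m -> is_LT (fun u => h u + k u) s (l + m)%C.
Proof.
  intros Hh Hk H1 H2 eps He.
  destruct (H1 (eps / 2) ltac:(lra)) as [M1 K1]. destruct (H2 (eps / 2) ltac:(lra)) as [M2 K2].
  exists (Rmax M1 M2). intros X HX.
  specialize (K1 X (Rle_trans _ _ _ (Rmax_l _ _) HX)). specialize (K2 X (Rle_trans _ _ _ (Rmax_r _ _) HX)).
  rewrite (CInt_ext _ (fun u => lker h s u + lker k s u)%C).
  2: { intros u _. unfold lker. rewrite RtoC_plus. ring. }
  rewrite CInt_plus by (apply cex_lker; auto).
  replace (CInt (lker h s) 0 X + CInt (lker k s) 0 X - (l + m))%C
    with ((CInt (lker h s) 0 X - l) + (CInt (lker k s) 0 X - m))%C by ring.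
  eapply Rle_lt_trans; [ apply Cmod_triangle | ]. lra.
Qed.

Lemma is_LT_scal (c : R) (h : R -> R) (s l : C) : (forall t, continuous h t) ->
  is_LT h s l -> is_LT (fun u => c * h u) s (RtoC c * l)%C.
Proof.
  intros Hh H1 eps He.
  assert (Hc := Rabs_pos c).
  destruct (H1 (eps / (Rabs c + 1)) ltac:(apply Rdiv_lt_0_compat; lra)) as [M1 K1].
  exists M1. intros X HX. specialize (K1 X HX).
  rewrite (CInt_ext _ (fun u => RtoC c * lker h s u)%C).
  2: { intros u _. unfold lker. rewrite RtoC_mult. ring. }
  rewrite CInt_scal by (apply cex_lker; auto).
  replace (c * CInt (lker h s) 0 X - c * l)%C with (RtoC c * (CInt (lker h s) 0 X - l))%C by ring.
  rewrite Cmod_mult, Cmod_R.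
  pose proof (Cmod_ge_0 (CInt (lker h s) 0 X - l)).
  apply Rle_lt_trans with ((Rabs c + 1) * Cmod (CInt (lker h s) 0 X - l)); [ nra | ].
  apply (Rmult_lt_compat_l (Rabs c + 1)) in K1; [ | lra ].
  replace ((Rabs c + 1) * (eps / (Rabs c + 1))) with eps in K1 by (field; lra). exact K1.
Qed.

Lemma is_LT_ext (h k : R -> R) (s l : C) : (forall u, 0 < u -> h u = k u) -> is_LT h s l -> is_LT k s l.
Proof.
  intros E H eps He. destruct (H eps He) as [M K]. exists (Rmax M 0). intros X HX.
  rewrite <- (CInt_ext (lker h s)).
  - apply K. eapply Rle_trans; [ apply Rmax_l | exact HX ].
  - intros u Hu. unfold lker. rewrite E; auto.
    rewrite Rmin_left in Hu; [ apply Hu | ]. eapply Rle_trans; [ apply Rmax_r | exact HX ].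
Qed.

Lemma is_RInt_exp_scal (q a b : R) : q <> 0 ->
  is_RInt (fun u => exp (- (q * u))) a b ((exp (- (q * a)) - exp (- (q * b))) / q).
Proof.
  intros Hq.
  replace ((exp (- (q * a)) - exp (- (q * b))) / q)
    with (minus ((fun u => - exp (- (q * u)) / q) b) ((fun u => - exp (- (q * u)) / q) a))
    by (unfold minus, plus, opp; simpl; field; auto).
  apply (is_RInt_derive (V:=R_CompleteNormedModule) (fun u => - exp (- (q * u)) / q)).
  - intros x _. auto_derive; auto. field; auto.
  - intros x _. apply (ex_derive_continuous (V:=R_NormedModule)). auto_derive. auto.
Qed.

(** Here p is a rate of decay, negative p allowing growth; the transform converges for Re s > -p. *)
Definition exp_bounded (h : R -> R) (K p : R) : Prop :=
  (forall t, continuous h t) /\ 0 <= K /\ forall u, 0 <= u -> Rabs (h u) <= K * exp (- (p * u)).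

Lemma lker_tail (h : R -> R) (K p : R) (s : C) (a b : R) : exp_bounded h K p -> 0 < Re s + p ->
  0 <= a <= b ->
  Cmod (CInt (lker h s) a b) <= K / (Re s + p) * exp (- ((Re s + p) * a)).
Proof.
  intros [Hc [HK Hb]] Hq Hab. set (q := Re s + p) in *.
  assert (HI := is_RInt_exp_scal q a b ltac:(lra)).
  assert (HI2 : is_RInt (fun u => K * exp (- (q * u))) a b (K * ((exp (- (q * a)) - exp (- (q * b))) / q)))
    by exact (is_RInt_scal _ a b K _ HI).
  eapply Rle_trans; [ apply (CInt_bound _ (fun u => K * exp (- (q * u))) a b) | ]; try lra.
  - apply cex_lker; auto.
  - eexists; exact HI2.
  - intros u Hu. rewrite Cmod_lker.
    apply Rle_trans with (exp (- (Re s * u)) * (K * exp (- (p * u)))).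
    + apply Rmult_le_compat_l; [ left; apply exp_pos | apply Hb; lra ].
    + replace (- (q * u)) with (- (Re s * u) + - (p * u)) by (unfold q; ring).
      rewrite exp_plus. right; ring.
  - rewrite (is_RInt_unique _ _ _ _ HI2).
    unfold Rdiv. rewrite Rmult_assoc. apply Rmult_le_compat_l; auto.
    rewrite Rmult_comm. apply Rmult_le_compat_l; [ left; apply Rinv_0_lt_compat; auto | ].
    pose proof (exp_pos (- (q * b))). lra.
Qed.

(** Real completeness is applied to each component along the integers, and the Cauchy condition
    extends the limit to real X. *)
Lemma C_Cauchy_lim (f : R -> C) :
  (forall eps, 0 < eps -> exists M, forall X Y, M <= X -> X <= Y -> Cmod (f Y - f X) < eps) ->
  exists l, forall eps, 0 < eps -> exists M, forall X, M <= X -> Cmod (f X - l) < eps.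
Proof.
  intros H.
  assert (Hcomp : forall g : R -> R, (forall X Y, Rabs (g Y - g X) <= Cmod (f Y - f X)) ->
     exists l, forall eps, 0 < eps -> exists M, forall X, M <= X -> Rabs (g X - l) < eps).
  { intros g Hg.
    assert (HC : Cauchy_crit (fun n => g (INR n))).
    { intros eps He. destruct (H eps He) as [M HM].
      destruct (INR_unbounded M) as [N HN].
      assert (W : forall n m, (n >= N)%nat -> (n <= m)%nat -> Rabs (g (INR m) - g (INR n)) < eps).
      { intros n m Hn Hm. eapply Rle_lt_trans; [ apply Hg | ]. apply HM.
        - apply le_INR in Hn. lra.
        - apply le_INR; auto. }
      exists N. intros n m Hn Hm. unfold Rdist.
      destruct (Nat.le_ge_cases n m); [ rewrite Rabs_minus_sym | ]; apply W; auto. }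
    destruct (Rcomplete.R_complete _ HC) as [l Hl]. exists l.
    intros eps He. destruct (H (eps / 2) ltac:(lra)) as [M HM].
    destruct (Hl (eps / 2) ltac:(lra)) as [N HN].
    exists M. intros X HX.
    destruct (INR_unbounded X) as [k Hk].
    set (n := max k N).
    assert (Hn1 : X <= INR n).
    { apply Rle_trans with (INR k); [ lra | apply le_INR; unfold n; lia ]. }
    specialize (HN n ltac:(unfold n; lia)). unfold Rdist in HN.
    specialize (HM X (INR n) HX Hn1). specialize (Hg X (INR n)).
    replace (g X - l) with ((g (INR n) - l) - (g (INR n) - g X)) by ring.
    eapply Rle_lt_trans; [ apply Rabs_triang | ]. rewrite Rabs_Ropp. lra. }
  destruct (Hcomp (fun X => Re (f X))) as [l1 H1].
  { intros X Y. apply (re_le_Cmod (f Y - f X)). }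
  destruct (Hcomp (fun X => Im (f X))) as [l2 H2].
  { intros X Y. apply (im_le_Cmod (f Y - f X)). }
  exists (l1, l2). intros eps He.
  destruct (H1 (eps / 2) ltac:(lra)) as [M1 K1]. destruct (H2 (eps / 2) ltac:(lra)) as [M2 K2].
  exists (Rmax M1 M2). intros X HX.
  specialize (K1 X (Rle_trans _ _ _ (Rmax_l _ _) HX)). specialize (K2 X (Rle_trans _ _ _ (Rmax_r _ _) HX)).
  eapply Rle_lt_trans; [ apply Cmod_le_abs | ].
  change (Re (f X - (l1, l2))) with (Re (f X) - l1). change (Im (f X - (l1, l2))) with (Im (f X) - l2). lra.
Qed.

Lemma exp_small (c q eps : R) : 0 <= c -> 0 < q -> 0 < eps -> exists M, 0 <= M /\ forall X, M <= X -> c * exp (- (q * X)) < eps.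
Proof.
  intros Hc Hq He. exists (Rmax 0 ((c + 1) / (q * eps))). split; [ apply Rmax_l | ].
  intros X HX.
  assert (HX2 := Rle_trans _ _ _ (Rmax_r _ _) HX).
  assert (HX1 := Rle_trans _ _ _ (Rmax_l _ _) HX).
  assert (E := exp_ineq1_le (q * X)). rewrite exp_Ropp.
  assert (Hqx : c + 1 <= q * X * eps).
  { apply (Rmult_le_compat_r (q * eps)) in HX2; [ | nra ].
    replace ((c + 1) / (q * eps) * (q * eps)) with (c + 1) in HX2 by (field; lra). lra. }
  pose proof (exp_pos (q * X)).
  apply (Rmult_lt_reg_r (exp (q * X))); auto. rewrite Rmult_assoc, Rinv_l by lra.
  nra.
Qed.

Lemma LT_exists (h : R -> R) (K p : R) (s : C) : exp_bounded h K p -> 0 < Re s + p ->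
  is_LT h s (LT h s).
Proof.
  intros Hh Hq.
  destruct (C_Cauchy_lim (fun X => CInt (lker h s) 0 X)) as [l Hl].
  - intros eps He.
    assert (HK : 0 <= K / (Re s + p)).
    { apply Rdiv_le_0_compat; auto. apply Hh. }
    destruct (exp_small _ _ _ HK Hq He) as [M [HM0 HM]].
    exists M. intros X Y HX HY.
    rewrite <- (CInt_Chasles (lker h s) 0 X Y) by (apply cex_lker, Hh).
    replace (CInt (lker h s) 0 X + CInt (lker h s) X Y - CInt (lker h s) 0 X)%C
      with (CInt (lker h s) X Y) by ring.
    eapply Rle_lt_trans; [ apply (lker_tail h K p s X Y) | apply HM; auto ]; auto. lra.
  - apply (LT_correct h s l). exact Hl.
Qed.

Lemma LT_bound (h : R -> R) (K p : R) (s l : C) : exp_bounded h K p -> 0 < Re s + p ->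
  is_LT h s l -> Cmod l <= K / (Re s + p).
Proof.
  intros Hh Hq Hl. apply le_epsilon. intros eps He.
  destruct (Hl eps He) as [M HM]. specialize (HM (Rmax M 0) (Rmax_l _ _)).
  assert (T := lker_tail h K p s 0 (Rmax M 0) Hh Hq ltac:(split; [ lra | apply Rmax_r ])).
  rewrite Rmult_0_r, Ropp_0, exp_0, Rmult_1_r in T.
  assert (T2 := Cmod_triangle_rev l (CInt (lker h s) 0 (Rmax M 0))).
  rewrite Cmod_minus_sym in T2. lra.
Qed.

Lemma mult_exp_le (u e : R) : 0 <= u -> 0 < e -> u <= / e * exp (e * u).
Proof.
  intros Hu He. assert (E := exp_ineq1_le (e * u)).
  apply (Rmult_le_reg_l e); auto. rewrite <- Rmult_assoc, Rinv_r by lra. lra.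
Qed.

Definition umul (h : R -> R) (u : R) : R := u * h u.

(** A factor u costs an arbitrarily small part e of the rate of decay, since u <= e^{eu}/e.
    Derivatives of a transform therefore converge in the same open half-plane. *)
Lemma exp_bounded_mult (h : R -> R) (K p e : R) : 0 < e -> exp_bounded h K p ->
  exp_bounded (umul h) (K / e) (p - e).
Proof.
  intros He [Hc [HK Hb]]. split; [ | split ].
  - intros t. apply (continuous_mult (fun u : R => u) h); [ apply continuous_id | apply Hc ].
  - apply Rdiv_le_0_compat; auto.
  - intros u Hu. unfold umul. rewrite Rabs_mult, (Rabs_right u) by lra.
    replace (- ((p - e) * u)) with (e * u + - (p * u)) by ring. rewrite exp_plus.
    replace (K / e * (exp (e * u) * exp (- (p * u)))) with ((/ e * exp (e * u)) * (K * exp (- (p * u)))) by (field; lra).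
    apply Rmult_le_compat; auto; [ apply Rabs_pos | apply mult_exp_le; auto ].
Qed.

(** The available rate q = Re s + p is split into quarters: two pay for the factor u^2 of the
    second-order remainder, one for exp(|w - s| u), and the last keeps the integral convergent. The
    estimate is made on [0, X], uniformly in X. *)
Lemma LT_cder (h : R -> R) (K p : R) (s : C) : exp_bounded h K p -> 0 < Re s + p ->
  cder (LT h) s (- LT (umul h) s)%C.
Proof.
  intros Hh Hq eps He. set (q := Re s + p) in *.
  assert (Hh1 := exp_bounded_mult h K p (q / 2) ltac:(lra) Hh).
  assert (HL1 := LT_exists _ _ _ s Hh1 ltac:(unfold q in *; lra)).
  assert (Hh2 := exp_bounded_mult _ _ _ (q / 4) ltac:(lra) (exp_bounded_mult h K p (q / 4) ltac:(lra) Hh)).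
  set (K2 := K / (q / 4) / (q / 4)) in *.
  assert (HK2 : 0 <= K2) by apply Hh2.
  assert (HL := LT_exists h K p s Hh Hq).
  set (A := K2 / (q / 4)).
  assert (HA : 0 <= A) by (apply Rdiv_le_0_compat; lra).
  exists (Rmin (q / 4) (eps / (A + 1))).
  split; [ apply Rmin_pos; [ lra | apply Rdiv_lt_0_compat; lra ] | ].
  intros w Hw.
  assert (A1 := Rlt_le_trans _ _ _ Hw (Rmin_l _ _)).
  assert (A2 := Rlt_le_trans _ _ _ Hw (Rmin_r _ _)).
  set (d := (w - s)%C) in *. assert (Hd := Cmod_ge_0 d).
  assert (Hrew : - Cmod d <= Re w - Re s).
  { assert (T := re_le_Cmod d). apply Rabs_le_between in T. change (Re d) with (Re w - Re s) in T. lra. }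
  assert (HLw := LT_exists h K p w Hh ltac:(unfold q in *; lra)).
  apply Rle_trans with (A * Cmod d * Cmod d).
  2: { apply Rmult_le_compat_r; auto.
       apply (Rmult_lt_compat_l (A + 1)) in A2; [ | lra ].
       replace ((A + 1) * (eps / (A + 1))) with eps in A2 by (field; lra). nra. }
  apply le_epsilon. intros e Hep.
  destruct (HL (e / 3) ltac:(lra)) as [M1 N1].
  destruct (HLw (e / 3) ltac:(lra)) as [M2 N2].
  destruct (HL1 (e / (3 * (Cmod d + 1))) ltac:(apply Rdiv_lt_0_compat; lra)) as [M3 N3].
  set (X := Rmax (Rmax M1 M2) (Rmax M3 0)).
  assert (X1 : M1 <= X) by (eapply Rle_trans; [ apply Rmax_l | apply Rmax_l ]).
  assert (X2 : M2 <= X) by (eapply Rle_trans; [ apply Rmax_r | apply Rmax_l ]).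
  assert (X3 : M3 <= X) by (eapply Rle_trans; [ apply Rmax_l | apply Rmax_r ]).
  assert (X4 : 0 <= X) by (eapply Rle_trans; [ apply Rmax_r | apply Rmax_r ]).
  specialize (N1 X X1). specialize (N2 X X2). specialize (N3 X X3).
  set (I0 := CInt (lker h s) 0 X) in *. set (Iw := CInt (lker h w) 0 X) in *.
  set (I1 := CInt (lker (umul h) s) 0 X) in *.
  assert (Hc := proj1 Hh). assert (Hc1 := proj1 Hh1).
  assert (HI : Cmod (Iw - I0 + d * I1) <= A * Cmod d * Cmod d).
  { unfold Iw, I0, I1.
    rewrite <- CInt_scal by (apply cex_lker; auto).
    rewrite <- (CInt_minus (lker h w) (lker h s)) by (apply cex_lker; auto).
    rewrite <- (CInt_plus (fun t => lker h w t - lker h s t)%C (fun t => d * lker (umul h) s t)%C).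
    2: apply cex_minus; apply cex_lker; auto.
    2: apply cex_scal, cex_lker; auto.
    assert (HE : is_RInt (fun u => K2 * Cmod d ^ 2 * exp (- (q / 4 * u))) 0 X
        (K2 * Cmod d ^ 2 * ((exp (- (q / 4 * 0)) - exp (- (q / 4 * X))) / (q / 4))))
      by exact (is_RInt_scal _ 0 X (K2 * Cmod d ^ 2) _ (is_RInt_exp_scal (q / 4) 0 X ltac:(lra))).
    eapply Rle_trans; [ apply (CInt_bound _ (fun u => K2 * Cmod d ^ 2 * exp (- (q / 4 * u)))) | ]; auto.
    - apply cex_plus; [ apply cex_minus; apply cex_lker; auto | apply cex_scal, cex_lker; auto ].
    - eexists; exact HE.
    - intros u Hu.
      set (x := (- (d * RtoC u))%C).
      replace (lker h w u - lker h s u + d * lker (umul h) s u)%C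
        with (cexp (- (s * u)) * RtoC (h u) * (cexp x - 1 - x))%C.
      2: { unfold lker, umul. rewrite RtoC_mult.
           replace (- (w * u))%C with (- (s * u) + x)%C by (unfold x, d; ring).
           rewrite cexp_plus. unfold x. ring. }
      rewrite !Cmod_mult, Cmod_cexp, Cmod_R, Re_sR.
      assert (B2 := cexp_bound2 x).
      assert (Ex : Cmod x = Cmod d * u).
      { unfold x. rewrite Cmod_opp, Cmod_mult, Cmod_R, Rabs_right; lra. }
      rewrite Ex in B2.
      assert (B3 := proj2 (proj2 Hh2) u ltac:(lra)).
      unfold umul in B3. rewrite !Rabs_mult, (Rabs_right u) in B3 by lra.
      apply Rle_trans with (exp (- (Re s * u)) * Rabs (h u) * ((Cmod d * u) ^ 2 * exp (q / 4 * u))).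
      { apply Rmult_le_compat_l; [ apply Rmult_le_pos; [ left; apply exp_pos | apply Rabs_pos ] | ].
        eapply Rle_trans; [ exact B2 | ]. apply Rmult_le_compat_l; [ apply pow2_ge_0 | ].
        apply exp_le_compat. apply Rmult_le_compat_r; lra. }
      replace (exp (- (Re s * u)) * Rabs (h u) * ((Cmod d * u) ^ 2 * exp (q / 4 * u)))
        with (Cmod d ^ 2 * (exp (- (Re s * u)) * exp (q / 4 * u)) * (u * (u * Rabs (h u)))) by ring.
      apply Rle_trans with (Cmod d ^ 2 * (exp (- (Re s * u)) * exp (q / 4 * u)) * (K2 * exp (- ((p - q / 4 - q / 4) * u)))).
      { apply Rmult_le_compat_l; auto. apply Rmult_le_pos; [ apply pow2_ge_0 | ].
        left; apply Rmult_lt_0_compat; apply exp_pos. }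
      replace (Cmod d ^ 2 * (exp (- (Re s * u)) * exp (q / 4 * u)) * (K2 * exp (- ((p - q / 4 - q / 4) * u))))
        with (K2 * Cmod d ^ 2 * (exp (- (Re s * u)) * exp (q / 4 * u) * exp (- ((p - q / 4 - q / 4) * u)))) by ring.
      rewrite <- !exp_plus. right. unfold Rdiv, pow. repeat f_equal. unfold q. field.
    - rewrite (is_RInt_unique _ _ _ _ HE). simpl.
      rewrite Rmult_0_r, Ropp_0, exp_0.
      replace (K2 * (Cmod d * (Cmod d * 1)) * ((1 - exp (- (q / 4 * X))) / (q / 4)))
        with (A * Cmod d * Cmod d * (1 - exp (- (q / 4 * X)))) by (unfold A; field; lra).
      rewrite <- (Rmult_1_r (A * Cmod d * Cmod d)) at 2.
      apply Rmult_le_compat_l; [ apply Rmult_le_pos; auto; apply Rmult_le_pos; auto | ].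
      pose proof (exp_pos (- (q / 4 * X))). lra. }
  set (L0 := LT h s) in *. set (Lw := LT h w) in *. set (L1 := LT (umul h) s) in *.
  replace (Lw - L0 - - L1 * d)%C with ((Iw - I0 + d * I1) + - (Iw - Lw) + ((I0 - L0) + - (d * (I1 - L1))))%C by ring.
  eapply Rle_trans; [ apply Cmod_triangle3 | ].
  assert (T := Cmod_triangle (I0 - L0) (- (d * (I1 - L1)))).
  rewrite Cmod_opp, Cmod_mult in T. rewrite Cmod_opp.
  assert (T3 : Cmod d * Cmod (I1 - L1) <= e / 3).
  { apply Rle_trans with ((Cmod d + 1) * (e / (3 * (Cmod d + 1)))); [ | right; field; lra ].
    apply Rmult_le_compat; try lra; auto. apply Cmod_ge_0. }
  lra.
Qed.

Lemma CInt_derive (F f : R -> C) (a b : R) :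
  (forall t, is_derive (fun t => Re (F t)) t (Re (f t))) ->
  (forall t, is_derive (fun t => Im (F t)) t (Im (f t))) ->
  (forall t, ccont f t) -> CInt f a b = (F b - F a)%C.
Proof.
  intros H1 H2 Hc. unfold CInt. apply C_eq.
  - change (RInt (fun t => Re (f t)) a b = Re (F b) - Re (F a)).
    apply is_RInt_unique. apply (is_RInt_derive (V:=R_CompleteNormedModule) (fun t => Re (F t))); intros; [ apply H1 | apply Hc ].
  - change (RInt (fun t => Im (f t)) a b = Im (F b) - Im (F a)).
    apply is_RInt_unique. apply (is_RInt_derive (V:=R_CompleteNormedModule) (fun t => Im (F t))); intros; [ apply H2 | apply Hc ].
Qed.

Lemma is_LT_exp (p : R) (s : C) : 0 < Re s + p -> is_LT (fun u => exp (- (p * u))) s (/ (s + RtoC p))%C.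
Proof.
  intros Hq. set (w := (s + RtoC p)%C).
  assert (Hw : Re w = Re s + p) by (unfold w, Re; simpl; ring).
  assert (Hw0 : w <> RtoC 0) by (intros E; rewrite E in Hw; simpl in Hw; lra).
  assert (Hm : 0 < Cmod w) by (apply Cmod_gt_0; auto).
  intros eps He.
  destruct (exp_small (/ Cmod w) (Re s + p) eps ltac:(left; apply Rinv_0_lt_compat; auto) Hq He) as [M [_ HM]].
  exists M. intros X HX.
  rewrite (CInt_ext _ (fun u => (- / w) * (- w * cexp (- (w * RtoC u))))%C).
  2: { intros u _. unfold lker. rewrite <- cexp_RtoC, <- cexp_plus.
       replace (- (s * u) + RtoC (- (p * u)))%C with (- (w * u))%C by (unfold w; ceq; ring).
       field; auto. }
  assert (Hcc : forall t, ccont (fun u => - w * cexp (- (w * RtoC u)))%C t).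
  { intros t. apply ccont_mult; [ apply ccont_const | apply ccont_cexp, ccont_lin ]. }
  rewrite CInt_scal by (apply cex_cont_all; auto).
  rewrite (CInt_derive (fun u => cexp (- (w * RtoC u)))); auto.
  - rewrite Cmult_0_r. replace (- RtoC 0)%C with (RtoC 0) by ring. rewrite cexp_0.
    replace (- / w * (cexp (- (w * X)) - 1) - / w)%C with (- (/ w * cexp (- (w * X))))%C by ring.
    rewrite Cmod_opp, Cmod_mult, Cmod_inv, Cmod_cexp, Re_sR, Hw by auto. apply HM; auto.
  - intros t. unfold cexp, Re, Im; simpl. auto_derive; auto. unfold Rminus. ring.
  - intros t. unfold cexp, Re, Im; simpl. auto_derive; auto. unfold Rminus. ring.
Qed.

(** * Two-sided transforms *)

(** The bilateral Laplace transform, with both halves convergent separately; the negative half-line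
    is reflected into a one-sided transform at -s. *)
Definition is_BL (f : R -> R) (s l : C) : Prop :=
  exists l1 l2, is_LT f s l1 /\ is_LT (fun u => f (- u)) (- s)%C l2 /\ l = (l1 + l2)%C.

Lemma CInt_lker_shift (f : R -> R) (s : C) (c a b : R) : (forall t, continuous f t) ->
  CInt (lker (fun u => f (u - c)) s) a b = (cexp (- (s * RtoC c)) * CInt (lker f s) (a - c) (b - c))%C.
Proof.
  intros Hf. rewrite <- CInt_scal by (apply cex_lker; auto).
  unfold Rminus.
  rewrite <- (CInt_shift (fun v => cexp (- (s * RtoC c)) * lker f s v)%C (- c) a b).
  2: apply cex_scal, cex_lker; auto.
  apply CInt_ext. intros u _. unfold lker. rewrite Cmult_assoc, <- cexp_plus.
  f_equal. f_equal. ceq; ring.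
Qed.

Lemma CInt_lker_reflect (f : R -> R) (s : C) (X : R) : (forall t, continuous f t) ->
  CInt (lker (fun u => f (- u)) (- s)%C) 0 X = CInt (lker f s) (- X) 0.
Proof.
  intros Hf. replace 0 with (- 0) at 2 by ring.
  rewrite <- (CInt_reflect (lker f s) 0 X) by (apply cex_lker; auto).
  apply CInt_ext. intros u _. unfold lker. do 2 f_equal. ceq; ring.
Qed.

Lemma continuous_reflect (f : R -> R) (t : R) : (forall t, continuous f t) -> continuous (fun u => f (- u)) t.
Proof.
  intros H. apply (continuous_comp (fun u : R => - u) f); [ | apply H ].
  apply (continuous_opp (fun u : R => u)), continuous_id.
Qed.

Lemma continuous_shift (f : R -> R) (c t : R) : (forall t, continuous f t) -> continuous (fun u => f (u - c)) t.
Proof.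
  intros H. apply (continuous_comp (fun u : R => u - c) f); [ | apply H ].
  apply (continuous_minus (fun u : R => u) (fun _ => c)); [ apply continuous_id | apply continuous_const ].
Qed.

Lemma is_BL_shift (f : R -> R) (s l : C) (c : R) : (forall t, continuous f t) ->
  is_BL f s l -> is_BL (fun u => f (u - c)) s (cexp (- (s * RtoC c)) * l)%C.
Proof.
  intros Hf [l1 [l2 [H1 [H2 ->]]]].
  (* [Z] is the contribution between -c and 0, which changes sides when the splitting point
     moves. *)
  set (E := cexp (- (s * RtoC c))). set (Z := CInt (lker f s) (- c) 0).
  assert (HE : 0 < Cmod E) by (apply Cmod_gt_0, cexp_neq_0).
  exists (E * (l1 + Z))%C, (E * (l2 - Z))%C. split; [ | split ]; [ | | ring ].
  - intros eps He. destruct (H1 (eps / Cmod E) ltac:(apply Rdiv_lt_0_compat; auto)) as [M HM].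
    exists (M + c). intros X HX. specialize (HM (X - c) ltac:(lra)).
    rewrite CInt_lker_shift by auto. fold E.
    rewrite <- (CInt_Chasles (lker f s) (0 - c) 0 (X - c)) by (apply cex_lker; auto).
    replace (0 - c) with (- c) by ring. fold Z.
    replace (E * (Z + CInt (lker f s) 0 (X - c)) - E * (l1 + Z))%C
      with (E * (CInt (lker f s) 0 (X - c) - l1))%C by ring.
    rewrite Cmod_mult. apply (Rmult_lt_compat_l (Cmod E)) in HM; auto.
    replace (Cmod E * (eps / Cmod E)) with eps in HM by (field; lra). exact HM.
  - intros eps He. destruct (H2 (eps / Cmod E) ltac:(apply Rdiv_lt_0_compat; auto)) as [M HM].
    exists (M - c). intros X HX. specialize (HM (X + c) ltac:(lra)).
    rewrite CInt_lker_reflect in HM by auto.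
    assert (Er := CInt_lker_reflect (fun u => f (u - c)) s X). simpl in Er.
    rewrite Er by (intros; apply continuous_shift; auto). clear Er.
    rewrite CInt_lker_shift by auto. fold E.
    replace (CInt (lker f s) (- X - c) (0 - c)) with (CInt (lker f s) (- (X + c)) 0 - Z)%C.
    + replace (E * (CInt (lker f s) (- (X + c)) 0 - Z) - E * (l2 - Z))%C
        with (E * (CInt (lker f s) (- (X + c)) 0 - l2))%C by ring.
      rewrite Cmod_mult. apply (Rmult_lt_compat_l (Cmod E)) in HM; auto.
      replace (Cmod E * (eps / Cmod E)) with eps in HM by (field; lra). exact HM.
    + replace (- X - c) with (- (X + c)) by ring. replace (0 - c) with (- c) by ring.
      rewrite <- (CInt_Chasles (lker f s) (- (X + c)) (- c) 0) by (apply cex_lker; auto).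
      fold Z. ring.
Qed.

Lemma is_BL_plus (f g : R -> R) (s l m : C) : (forall t, continuous f t) -> (forall t, continuous g t) ->
  is_BL f s l -> is_BL g s m -> is_BL (fun u => f u + g u) s (l + m)%C.
Proof.
  intros Hf Hg [l1 [l2 [H1 [H2 ->]]]] [m1 [m2 [H3 [H4 ->]]]].
  exists (l1 + m1)%C, (l2 + m2)%C. split; [ | split ]; [ | | ring ].
  - apply is_LT_plus; auto.
  - apply (is_LT_plus (fun u => f (- u)) (fun u => g (- u))); auto; intros; apply continuous_reflect; auto.
Qed.

(** * The Mellin transform of 1/(1+t) *)

Lemma cder_segment (F : C -> C) (a h : C) (t : R) (l : C) : cder F (a + RtoC t * h)%C l ->
  is_derive (fun t => Re (F (a + RtoC t * h)%C)) t (Re (l * h)) /\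
  is_derive (fun t => Im (F (a + RtoC t * h)%C)) t (Im (l * h)).
Proof.
  intros H.
  assert (K : forall eps, 0 < eps -> exists d : posreal, forall k, k <> 0 -> Rabs k < d ->
     Cmod ((F (a + RtoC (t + k) * h) - F (a + RtoC t * h)) / RtoC k - l * h)%C < eps).
  { intros eps He. assert (Hh := Cmod_ge_0 h).
    destruct (H (eps / (Cmod h + 1)) ltac:(apply Rdiv_lt_0_compat; lra)) as [d [Hd Kd]].
    assert (Hd' : 0 < d / (Cmod h + 1)) by (apply Rdiv_lt_0_compat; lra).
    exists (mkposreal _ Hd'). simpl. intros k Hk0 Hk.
    assert (Hk0' : 0 < Rabs k) by (apply Rabs_pos_lt; auto).
    assert (E : (a + RtoC (t + k) * h - (a + RtoC t * h))%C = (RtoC k * h)%C) by (rewrite RtoC_plus; ring).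
    specialize (Kd (a + RtoC (t + k) * h)%C). rewrite E, Cmod_mult, Cmod_R in Kd.
    assert (Rabs k * Cmod h < d).
    { apply (Rmult_lt_compat_r (Cmod h + 1)) in Hk; [ | lra ].
      replace (d / (Cmod h + 1) * (Cmod h + 1)) with d in Hk by (field; lra). nra. }
    specialize (Kd H0).
    assert (Hkc : RtoC k <> RtoC 0) by (intros E2; apply RtoC_inj in E2; auto).
    replace ((F (a + RtoC (t + k) * h) - F (a + RtoC t * h)) / RtoC k - l * h)%C
      with ((F (a + RtoC (t + k) * h) - F (a + RtoC t * h) - l * (RtoC k * h)) / RtoC k)%C by (field; auto).
    rewrite Cmod_div, Cmod_R by auto.
    apply (Rmult_lt_reg_r (Rabs k)); auto. unfold Rdiv. rewrite Rmult_assoc, Rinv_l, Rmult_1_r by lra.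
    eapply Rle_lt_trans; [ exact Kd | ].
    replace (eps / (Cmod h + 1) * (Rabs k * Cmod h)) with (eps * Rabs k * (Cmod h / (Cmod h + 1))) by (field; lra).
    rewrite <- (Rmult_1_r (eps * Rabs k)) at 2.
    apply Rmult_lt_compat_l; [ apply Rmult_lt_0_compat; auto | ].
    apply (Rmult_lt_reg_r (Cmod h + 1)); [ lra | ].
    unfold Rdiv. rewrite Rmult_assoc, Rinv_l by lra. lra. }
  assert (Hdiv : forall (z : C) k, k <> 0 -> Re (z / RtoC k) = Re z / k /\ Im (z / RtoC k) = Im z / k).
  { intros [x y] k Hk. unfold Re, Im; simpl. split; field; auto. }
  split; apply is_derive_Reals; intros eps He; destruct (K eps He) as [d Kd]; exists d; intros k Hk0 Hk;
    specialize (Kd k Hk0 Hk); eapply Rle_lt_trans; try exact Kd.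
  - eapply Rle_trans; [ | apply re_le_Cmod ]. right. f_equal.
    match goal with |- _ = Re (?X / _ - _)%C => change (Re (X / RtoC k - l * h)) with (Re (X / RtoC k) - Re (l * h)) ;
      rewrite (proj1 (Hdiv X k Hk0)) end. reflexivity.
  - eapply Rle_trans; [ | apply im_le_Cmod ]. right. f_equal.
    match goal with |- _ = Im (?X / _ - _)%C => change (Im (X / RtoC k - l * h)) with (Im (X / RtoC k) - Im (l * h)) ;
      rewrite (proj2 (Hdiv X k Hk0)) end. reflexivity.
Qed.

Lemma cder_zero_segment (F : C -> C) (a b : C) :
  (forall t, 0 <= t <= 1 -> cder F (a + RtoC t * (b - a))%C 0) -> F a = F b.
Proof.
  intros H. symmetry. apply Ceq_minus, Cmod_eq_0, Rle_antisym; [ | apply Cmod_ge_0 ].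
  assert (E : (F b - F a)%C =
    ((fun t => Re (F (a + RtoC t * (b - a))%C)) 1 - (fun t => Re (F (a + RtoC t * (b - a))%C)) 0,
     (fun t => Im (F (a + RtoC t * (b - a))%C)) 1 - (fun t => Im (F (a + RtoC t * (b - a))%C)) 0)).
  { replace (a + RtoC 1 * (b - a))%C with b by ring. replace (a + RtoC 0 * (b - a))%C with a by ring.
    apply C_eq; reflexivity. }
  rewrite E.
  apply (complex_mvt_bound (fun t => Re (F (a + RtoC t * (b - a))%C)) (fun t => Im (F (a + RtoC t * (b - a))%C))
    (fun t => Re (0 * (b - a))) (fun t => Im (0 * (b - a)))).
  - intros t Ht. apply (cder_segment F a (b - a) t 0). auto.
  - intros t Ht. apply (cder_segment F a (b - a) t 0). auto.
  - intros t Ht. replace (Re (0 * (b - a)), Im (0 * (b - a))) with (RtoC 0) by (rewrite Cmult_0_l; reflexivity).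
    rewrite Cmod_0. lra.
Qed.

Definition csin (z : C) : C := ((cexp (Ci * z) - cexp (- (Ci * z))) / (2 * Ci))%C.
Definition ccos (z : C) : C := ((cexp (Ci * z) + cexp (- (Ci * z))) / 2)%C.

Lemma C2_neq_0 : RtoC 2 <> RtoC 0.
Proof. intros E. apply RtoC_inj in E. lra. Qed.

Lemma C2i_neq_0 : (2 * Ci)%C <> RtoC 0.
Proof. apply Cmult_neq_0; [ apply C2_neq_0 | apply Ci_nz ]. Qed.

Lemma cder_csin (z : C) : cder csin z (ccos z).
Proof.
  apply (cder_ext (fun z => / (2 * Ci) * (cexp (Ci * z) - cexp ((- Ci) * z)))%C).
  { intros w. unfold csin, Cdiv. rewrite Cmult_comm. do 3 f_equal. f_equal. ring. }
  replace (ccos z) with (/ (2 * Ci) * (cexp (Ci * z) * Ci - cexp ((- Ci) * z) * (- Ci)))%C.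
  - apply cder_scal. apply cder_minus; apply cder_cexp_comp, cder_lin.
  - unfold ccos. replace ((- Ci) * z)%C with (- (Ci * z))%C by ring.
    field; repeat split; first [ apply Ci_nz | apply C2_neq_0 ].
Qed.

Lemma csin_PI2 : csin (RtoC PI * RtoC (1 / 2)) = RtoC 1.
Proof.
  unfold csin.
  assert (E : (Ci * (RtoC PI * RtoC (1 / 2)))%C = (0, PI / 2)) by (ceq; field).
  rewrite E. replace (- (0, (PI / 2)%R))%C with ((0, (- (PI / 2))%R) : C) by (ceq; ring).
  unfold cexp, Re, Im; simpl. rewrite exp_0, cos_neg, sin_neg, cos_PI2, sin_PI2.
  match goal with |- (?X / _)%C = _ => replace X with (2 * Ci)%C by (ceq; ring) end.
  field; repeat split; first [ apply Ci_nz | apply C2_neq_0 ].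
Qed.

(** (1 - e^{-w})/w with its removable singularity filled. The kernel w e^{-sw}/(1 - e^{-w}) becomes
    a quotient by a function without zeros in the closed strip |Im w| <= pi. *)
Definition psi1 (w : C) : C := if Ceq_dec w 0 then RtoC 1 else ((1 - cexp (- w)) / w)%C.

Lemma cder_psi1 (w : C) : exists l, cder psi1 w l.
Proof.
  destruct (Ceq_dec w 0) as [-> | Hw].
  - exists (- / 2)%C. intros eps He.
    exists (Rmin 1 (eps / exp 1)). split; [ apply Rmin_pos; [ lra | apply Rdiv_lt_0_compat; auto; apply exp_pos ] | ].
    intros v Hv. replace (v - 0)%C with v in * by ring.
    assert (A1 := Rlt_le_trans _ _ _ Hv (Rmin_l _ _)).
    assert (A2 := Rlt_le_trans _ _ _ Hv (Rmin_r _ _)).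
    unfold psi1. destruct (Ceq_dec 0 0) as [_ | n]; [ | congruence ].
    destruct (Ceq_dec v 0) as [-> | Hv0].
    + replace (1 - 1 - - / 2 * 0)%C with (RtoC 0) by ring. rewrite Cmod_0. lra.
    + replace ((1 - cexp (- v)) / v - 1 - - / 2 * v)%C
        with (- ((cexp (- v) - 1 - (- v) - (- v) * (- v) / 2) / v))%C by (field; auto using C2_neq_0).
      rewrite Cmod_opp, Cmod_div by auto.
      assert (Hvp : 0 < Cmod v) by (apply Cmod_gt_0; auto).
      assert (B3 := cexp_bound3 (- v)). rewrite Cmod_opp in B3.
      apply (Rmult_le_reg_r (Cmod v)); auto. unfold Rdiv. rewrite Rmult_assoc, Rinv_l, Rmult_1_r by lra.
      eapply Rle_trans; [ exact B3 | ].
      assert (He1 : exp (Cmod v) <= exp 1) by (apply exp_le_compat; lra).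
      apply (Rmult_lt_compat_r (exp 1)) in A2; [ | apply exp_pos ].
      pose proof (exp_pos 1).
      replace (eps / exp 1 * exp 1) with eps in A2 by (field; lra).
      simpl. rewrite Rmult_1_r.
      apply Rle_trans with (Cmod v * Cmod v * (Cmod v * exp 1)).
      * rewrite <- !Rmult_assoc. apply Rmult_le_compat_l; auto. repeat apply Rmult_le_pos; lra.
      * replace (eps * Cmod v * Cmod v) with (Cmod v * Cmod v * eps) by ring.
        apply Rmult_le_compat_l; [ nra | lra ].
  - destruct (ex_cder_div (fun w => 1 - cexp (- w))%C (fun w => w) w) as [l Hl]; auto.
    + eexists. apply cder_minus; [ apply cder_const | ].
      apply (cder_ext (fun w => cexp ((- (1)) * w))%C); [ intros; f_equal; ring | ].
      apply cder_cexp_comp, cder_lin.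
    + eexists; apply cder_id.
    + exists l. apply (cder_ext_loc (fun w => (1 - cexp (- w)) / w)%C psi1 w l (Cmod w)); auto.
      * apply Cmod_gt_0; auto.
      * intros v Hv. unfold psi1. destruct (Ceq_dec v 0) as [-> | ]; auto.
        exfalso. replace (0 - w)%C with (- w)%C in Hv by ring. rewrite Cmod_opp in Hv. lra.
Qed.

(** The zeros are the nonzero multiples of 2 pi i. In coordinates, e^{-w} = 1 forces cos y = 1 and x
    = 0, and the half-angle formula leaves only y = 0 in the strip. *)
Lemma psi1_neq_0 (w : C) : - PI <= Im w <= PI -> psi1 w <> RtoC 0.
Proof.
  intros Hy. unfold psi1. destruct (Ceq_dec w 0) as [ | Hw]; [ intros E; apply RtoC_inj in E; lra | ].
  intros E.
  assert (E1 : cexp (- w) = RtoC 1).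
  { replace (cexp (- w)) with (1 - ((1 - cexp (- w)) / w) * w)%C by (field; auto). rewrite E. ring. }
  destruct w as [x y]. unfold cexp in E1. unfold Re, Im in *; simpl in *.
  injection E1 as Ec Es. rewrite cos_neg in Ec. rewrite sin_neg in Es.
  pose proof (exp_pos (- x)).
  assert (Hs : sin y = 0).
  { assert (exp (- x) * sin y = 0) by lra. apply Rmult_integral in H0. destruct H0; lra. }
  assert (S := sin2_cos2 y). unfold Rsqr in S. rewrite Hs in S.
  assert (Hcp : 0 < cos y) by (apply (Rmult_lt_reg_l (exp (- x))); lra).
  assert (Hc1 : cos y = 1) by nra.
  assert (Hx : x = 0).
  { rewrite Hc1, Rmult_1_r in Ec. rewrite <- exp_0 in Ec. apply exp_inv in Ec. lra. }
  assert (Hh : cos y = 1 - 2 * sin (y / 2) * sin (y / 2)).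
  { replace y with (2 * (y / 2)) at 1 by field. apply cos_2a_sin. }
  assert (Hh2 : sin (y / 2) = 0) by nra.
  assert (HPI := PI_RGT_0).
  destruct (Rtotal_order y 0) as [Hlt | [Heq | Hgt]].
  - assert (0 < sin (- (y / 2))) by (apply sin_gt_0; lra). rewrite sin_neg in H0. lra.
  - apply Hw. rewrite Hx, Heq. reflexivity.
  - assert (0 < sin (y / 2)) by (apply sin_gt_0; lra). lra.
Qed.

(** The logistic function: with t = e^{-v} it is 1/(1+t), and its bilateral transform is the
    integral of t^{s-1}/(1+t). The bounds 1 and e^v make both halves converge for 0 < Re s < 1. *)
Definition kap (v : R) : R := / (1 + exp (- v)).

Lemma kap_pos (v : R) : 0 < kap v.
Proof. apply Rinv_0_lt_compat. pose proof (exp_pos (- v)). lra. Qed.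

Lemma kap_le_1 (v : R) : kap v <= 1.
Proof.
  unfold kap. rewrite <- Rinv_1. apply Rinv_le_contravar; [ lra | ]. pose proof (exp_pos (- v)). lra.
Qed.

Lemma kap_le_exp (v : R) : kap v <= exp v.
Proof.
  unfold kap. replace (exp v) with (/ exp (- v)) by (rewrite exp_Ropp, Rinv_inv; auto).
  apply Rinv_le_contravar; [ apply exp_pos | lra ].
Qed.

Lemma kap_continuous (t : R) : continuous kap t.
Proof.
  apply (ex_derive_continuous (V:=R_NormedModule)). unfold kap. auto_derive.
  pose proof (exp_pos (- t)). lra.
Qed.

Lemma kap_bounded_pos : exp_bounded kap 1 0.
Proof.
  split; [ apply kap_continuous | ]. split; [ lra | ]. intros u _.
  rewrite Rmult_0_l, Ropp_0, exp_0, Rabs_right by (left; apply kap_pos). rewrite Rmult_1_r. apply kap_le_1.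
Qed.

Lemma kap_bounded_neg : exp_bounded (fun u => kap (- u)) 1 1.
Proof.
  split; [ intros; apply continuous_reflect, kap_continuous | ]. split; [ lra | ]. intros u _.
  rewrite Rabs_right by (left; apply kap_pos). rewrite !Rmult_1_l. apply kap_le_exp.
Qed.

Definition BLk (s : C) : C := (LT kap s + LT (fun u => kap (- u)) (- s))%C.

Lemma Re_opp_C (s : C) : Re (- s) = - Re s.
Proof. reflexivity. Qed.

Lemma BLk_correct (s : C) : 0 < Re s < 1 -> is_BL kap s (BLk s).
Proof.
  intros Hs. exists (LT kap s), (LT (fun u => kap (- u)) (- s)). split; [ | split ]; auto.
  - apply (LT_exists kap 1 0); [ apply kap_bounded_pos | lra ].
  - apply (LT_exists _ 1 1); [ apply kap_bounded_neg | rewrite Re_opp_C; lra ].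
Qed.

Lemma BLk_cder (s : C) : 0 < Re s < 1 ->
  cder BLk s (LT (umul (fun u => kap (- u))) (- s) - LT (umul kap) s)%C.
Proof.
  intros Hs.
  replace (LT (umul (fun u => kap (- u))) (- s) - LT (umul kap) s)%C
    with (- LT (umul kap) s + (- LT (umul (fun u => kap (- u))) (- s)) * (- (1)))%C by ring.
  apply (cder_plus (LT kap) (fun s => LT (fun u => kap (- u)) (- s)%C)).
  - apply (LT_cder kap 1 0); [ apply kap_bounded_pos | lra ].
  - apply (cder_comp (LT (fun u => kap (- u))) (fun s => - s)%C).
    + apply (cder_ext (fun s => (- (1)) * s)%C); [ intros; ring | ]. apply cder_lin.
    + apply (LT_cder _ 1 1); [ apply kap_bounded_neg | rewrite Re_opp_C; lra ].
Qed.

Lemma psi_vertical_bound (s : C) (x y : R) : 1 <= Rabs x -> - PI <= y <= PI ->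
  Cmod (cexp (- (s * (x, y))) / psi1 (x, y))%C
    <= 3 * (Rabs x + PI) * exp (Rabs (Im s) * PI) * (exp (- (Re s * x)) * kap x).
Proof.
  intros Hx Hy. assert (HPI := PI_RGT_0).
  assert (Hw : ((x, y) : C) <> RtoC 0).
  { intros E. injection E as -> ->. rewrite Rabs_R0 in Hx. lra. }
  assert (Hn := psi1_neq_0 (x, y) Hy).
  rewrite Cmod_div by auto. rewrite Cmod_cexp.
  unfold psi1 in *. destruct (Ceq_dec (x, y) 0); [ contradiction | ].
  rewrite Cmod_div by auto.
  pose proof (exp_pos (- x)) as Hep.
  (* For |x| >= 1 the number e^{-x} is at least 2 or at most 1/2, and in both cases |1 - e^{-x}| is
     at least a third of 1 + e^{-x}. *)
  assert (He : 1 + exp (- x) <= 3 * Cmod (1 - cexp (- (x, y)))).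
  { assert (T1 := Cmod_triangle_rev 1 (cexp (- (x, y)))).
    assert (T2 := Cmod_triangle_rev (cexp (- (x, y))) 1). rewrite (Cmod_minus_sym (cexp _)) in T2.
    rewrite Cmod_cexp, Cmod_1 in *. change (Re (- (x, y))) with (- x) in *.
    unfold Rabs in Hx. destruct (Rcase_abs x).
    - assert (2 <= exp (- x)) by (pose proof (exp_ineq1_le (- x)); lra). lra.
    - assert (E2 : exp (- x) <= / 2).
      { rewrite exp_Ropp. apply Rinv_le_contravar; [ lra | ]. pose proof (exp_ineq1_le x). lra. }
      lra. }
  assert (Hwm : Cmod (x, y) <= Rabs x + PI).
  { eapply Rle_trans; [ apply Cmod_le_abs | ]. unfold Re, Im; simpl.
    apply Rplus_le_compat_l. apply Rabs_le; lra. }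
  assert (Hex : exp (Re (- (s * (x, y)))) <= exp (Rabs (Im s) * PI) * exp (- (Re s * x))).
  { rewrite <- exp_plus. apply exp_le_compat.
    replace (Re (- (s * (x, y)))) with (- (Re s * x) + Im s * y) by (unfold Re, Im; simpl; ring).
    assert (Im s * y <= Rabs (Im s) * PI).
    { eapply Rle_trans; [ apply Rle_abs | ]. rewrite Rabs_mult.
      apply Rmult_le_compat_l; [ apply Rabs_pos | apply Rabs_le; lra ]. }
    lra. }
  set (D := Cmod (1 - cexp (- (x, y)))) in *.
  assert (HD : 0 < D) by lra.
  assert (Hwp : 0 < Cmod (x, y)) by (apply Cmod_gt_0; auto).
  unfold Rdiv. rewrite Rinv_mult, Rinv_inv.
  apply Rle_trans with ((exp (Rabs (Im s) * PI) * exp (- (Re s * x))) * (3 * kap x * (Rabs x + PI))).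
  - apply Rmult_le_compat; auto; [ left; apply exp_pos | | ].
    + apply Rmult_le_pos; [ left; apply Rinv_0_lt_compat; auto | lra ].
    + apply Rmult_le_compat; try lra; [ left; apply Rinv_0_lt_compat; auto | ].
      unfold kap. apply (Rmult_le_reg_l D); auto. rewrite Rinv_r by lra.
      apply (Rmult_le_reg_r (1 + exp (- x))); [ lra | ].
      replace (D * (3 * / (1 + exp (- x))) * (1 + exp (- x))) with (3 * D) by (field; lra). lra.
  - right; ring.
Qed.

Lemma vertical_decay (s : C) (eps : R) : 0 < Re s < 1 -> 0 < eps -> exists M, 1 <= M /\
  forall X x, M <= X -> Rabs x = X ->
   2 * PI * (3 * (Rabs x + PI) * exp (Rabs (Im s) * PI) * (exp (- (Re s * x)) * kap x)) < eps.
Proof.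
  intros Hs He. assert (HPI := PI_RGT_0).
  (* The two bounds on [kap] give decay e^{-q|x|} at both ends; half of that rate absorbs the linear
     factor |x| + pi. *)
  set (q := Rmin (Re s) (1 - Re s)).
  assert (Hq : 0 < q) by (apply Rmin_pos; lra).
  set (A := exp (Rabs (Im s) * PI)). assert (HA : 0 < A) by apply exp_pos.
  destruct (exp_small (6 * PI * A * (/ (q / 2) + PI)) (q / 2) eps) as [M [HM0 HM]]; auto; try lra.
  { assert (0 < / (q / 2)) by (apply Rinv_0_lt_compat; lra). 
    apply Rmult_le_pos; [ apply Rmult_le_pos | ]; lra. }
  exists (Rmax 1 M). split; [ apply Rmax_l | ].
  intros X x HX Hx.
  assert (HX1 := Rle_trans _ _ _ (Rmax_l _ _) HX).
  specialize (HM X (Rle_trans _ _ _ (Rmax_r _ _) HX)).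
  eapply Rle_lt_trans; [ | exact HM ]. rewrite Hx.
  assert (H1 : exp (- (Re s * x)) * kap x <= exp (- (q * X))).
  { pose proof (Rmin_l (Re s) (1 - Re s)). pose proof (Rmin_r (Re s) (1 - Re s)). fold q in H, H0.
    unfold Rabs in Hx. destruct (Rcase_abs x).
    - apply Rle_trans with (exp (- (Re s * x)) * exp x).
      + apply Rmult_le_compat_l; [ left; apply exp_pos | apply kap_le_exp ].
      + rewrite <- exp_plus. apply exp_le_compat. nra.
    - apply Rle_trans with (exp (- (Re s * x)) * 1).
      + apply Rmult_le_compat_l; [ left; apply exp_pos | apply kap_le_1 ].
      + rewrite Rmult_1_r. apply exp_le_compat. nra. }
  assert (H2 : X + PI <= (/ (q / 2) + PI) * exp (q / 2 * X)).
  { assert (T := mult_exp_le X (q / 2) ltac:(lra) ltac:(lra)).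
    assert (T2 := exp_ineq1_le (q / 2 * X)).
    assert (1 <= exp (q / 2 * X)) by nra. nra. }
  assert (E : exp (- (q / 2 * X)) = exp (q / 2 * X) * exp (- (q * X))).
  { rewrite <- exp_plus. f_equal. field. }
  rewrite E.
  apply Rle_trans with (2 * PI * (3 * ((/ (q / 2) + PI) * exp (q / 2 * X)) * A * exp (- (q * X)))); [ | right; ring ].
  apply Rmult_le_compat_l; [ lra | ].
  apply Rmult_le_compat; auto.
  - apply Rmult_le_pos; [ apply Rmult_le_pos | ]; lra.
  - apply Rmult_le_pos; left; [ apply exp_pos | apply kap_pos ].
  - apply Rmult_le_compat_r; lra.
Qed.

(** On Im w = pi and Im w = -pi one has e^{-w} = -e^{-x}, so 1 - e^{-w} turns into 1 + e^{-x}; the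
    factor w = x + i th splits into the kernels of u kap(u) and of kap. *)
Lemma kap_hline (s : C) (x th : R) : (th = PI \/ th = - PI) ->
  (cexp (- (s * (x, th))) / psi1 (x, th))%C
   = (cexp (- (s * (0, th))) * (lker (umul kap) s x + (0, th) * lker kap s x))%C.
Proof.
  intros Hth. assert (HPI := PI_RGT_0).
  assert (Hw : ((x, th) : C) <> RtoC 0).
  { intros E. injection E as E1 E2. destruct Hth; lra. }
  assert (E : cexp (- (x, th)) = (- RtoC (exp (- x)))%C).
  { unfold cexp, Re, Im; simpl. rewrite cos_neg, sin_neg.
    destruct Hth as [-> | ->]; rewrite ?cos_neg, ?sin_neg, cos_PI, sin_PI; ceq; ring. }
  unfold psi1. destruct (Ceq_dec (x, th) 0); [ contradiction | ]. rewrite E.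
  unfold lker, umul, kap. pose proof (exp_pos (- x)).
  rewrite RtoC_mult, RtoC_inv by lra. rewrite RtoC_plus.
  replace (- (s * (x, th)))%C with (- (s * (0, th)) + - (s * RtoC x))%C by (ceq; ring).
  rewrite cexp_plus.
  replace ((x, th) : C) with (RtoC x + (0, th))%C in * by (ceq; ring).
  assert (Hne : (1 + RtoC (exp (- x)))%C <> RtoC 0).
  { rewrite <- RtoC_plus. intros E2. apply RtoC_inj in E2. lra. }
  field. repeat split; auto; intros E2; apply Hne; rewrite <- E2; ring.
Qed.

(* Goursat for w e^{-sw}/(1-e^{-w}) on [-X,X] x [-pi,pi]: the horizontal sides give B' and B,
   and letting X tend to infinity yields the differential equation sin(pi s) B' + pi cos(pi s) B = 0. *)
Lemma BLk_ode (s : C) : 0 < Re s < 1 ->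
  (csin (RtoC PI * s) * (LT (umul (fun u => kap (- u))) (- s) - LT (umul kap) s)
    + RtoC PI * ccos (RtoC PI * s) * BLk s)%C = RtoC 0.
Proof.
  intros Hs. assert (HPI := PI_RGT_0).
  set (k := fun w => (cexp (- (s * w)) / psi1 w)%C).
  assert (Hk : forall X, 0 <= X -> holo_rect k (- X) X (- PI) PI).
  { intros X HX w _ Hy. apply ex_cder_div.
    - eexists. apply (cder_ext (fun w => cexp ((- s) * w))%C); [ intros; f_equal; ring | ].
      apply cder_cexp_comp, cder_lin.
    - apply cder_psi1.
    - apply psi1_neq_0; auto. }
  set (ep := cexp (- (s * (0, PI)))). set (em := cexp (- (s * (0, - PI)))).
  assert (Hkc := kap_continuous).
  assert (Hukc : forall t, continuous (umul kap) t).
  { apply (exp_bounded_mult kap 1 0 1 Rlt_0_1 kap_bounded_pos). }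
  set (I1 := fun X => CInt (lker (umul kap) s) (- X) X).
  set (I0 := fun X => CInt (lker kap s) (- X) X).
  assert (Hh : forall X th, th = PI \/ th = - PI ->
     CInt (fun x => k (x, th)) (- X) X = (cexp (- (s * (0, th))) * (I1 X + (0, th) * I0 X))%C).
  { intros X th Hth. unfold I1, I0.
    rewrite (CInt_ext _ (fun x => cexp (- (s * (0, th))) * (lker (umul kap) s x + (0, th) * lker kap s x))%C).
    2: { intros x _. apply kap_hline; auto. }
    rewrite (CInt_scal _ (fun x => lker (umul kap) s x + (0, th) * lker kap s x)%C).
    2: { apply cex_plus; [ apply cex_lker; auto | apply cex_scal, cex_lker; auto ]. }
    rewrite (CInt_plus (lker (umul kap) s) (fun x => (0, th) * lker kap s x)%C).
    2: apply cex_lker; auto.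
    2: apply cex_scal, cex_lker; auto.
    rewrite (CInt_scal (0, th) (lker kap s)) by (apply cex_lker; auto). reflexivity. }
  assert (Hsmall : forall eps, 0 < eps -> exists M, forall X, M <= X ->
     Cmod ((em - ep) * I1 X - (0, PI) * (em + ep) * I0 X)%C < eps).
  { intros eps He.
    destruct (vertical_decay s (eps / 2) Hs ltac:(lra)) as [M [HM1 HM]].
    exists M. intros X HX.
    assert (G := Goursat k (- X) X (- PI) PI ltac:(lra) ltac:(lra) (Hk X ltac:(lra))).
    unfold rect_int in G. rewrite (Hh X PI), (Hh X (- PI)) in G by auto. fold ep em in G.
    replace ((em - ep) * I1 X - (0, PI) * (em + ep) * I0 X)%C with
      (- (Ci * (CInt (fun y => k (X, y)) (- PI) PI - CInt (fun y => k ((- X)%R, y)) (- PI) PI)))%C.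
    2: { apply Ceq_minus. rewrite <- Copp_0, <- G.
         replace ((0, (- PI)%R) : C) with (- (0, PI))%C by (ceq; ring). ring. }
    rewrite Cmod_opp, Cmod_mult, Cmod_Ci, Rmult_1_l.
    assert (Hv : forall x, Rabs x = X -> Cmod (CInt (fun y => k (x, y)) (- PI) PI) < eps / 2).
    { intros x Hx. eapply Rle_lt_trans; [ | apply (HM X x HX Hx) ].
      replace (2 * PI) with (PI - - PI) by ring.
      apply CInt_bound_const; [ lra | | ].
      - apply (holo_cex_v k (- X) X (- PI) PI); try lra. apply Hk; lra.
        apply Rabs_le_between. lra.
      - intros t Ht. apply psi_vertical_bound; lra. }
    unfold Cminus. eapply Rle_lt_trans; [ apply Cmod_triangle | ]. rewrite Cmod_opp.
    assert (V1 := Hv X ltac:(apply Rabs_right; lra)).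
    assert (V2 := Hv (- X) ltac:(rewrite Rabs_Ropp; apply Rabs_right; lra)). lra. }
  set (L1 := (LT (umul kap) s - LT (umul (fun u => kap (- u))) (- s))%C).
  assert (P1 : is_LT (umul kap) s (LT (umul kap) s)).
  { apply (LT_exists _ _ _ s (exp_bounded_mult kap 1 0 (Re s / 2) ltac:(lra) kap_bounded_pos)). lra. }
  assert (P2 : is_LT (umul (fun u => kap (- u))) (- s) (LT (umul (fun u => kap (- u))) (- s))).
  { apply (LT_exists _ _ _ (- s)%C (exp_bounded_mult _ 1 1 ((1 - Re s) / 2) ltac:(lra) kap_bounded_neg)).
    rewrite Re_opp_C. lra. }
  assert (HI1 : forall eps, 0 < eps -> exists M, forall X, M <= X -> Cmod (I1 X - L1) < eps).
  { intros eps He.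
    destruct (P1 (eps / 2) ltac:(lra)) as [M1 K1]. destruct (P2 (eps / 2) ltac:(lra)) as [M2 K2].
    exists (Rmax M1 M2). intros X HX.
    specialize (K1 X (Rle_trans _ _ _ (Rmax_l _ _) HX)). specialize (K2 X (Rle_trans _ _ _ (Rmax_r _ _) HX)).
    unfold I1. rewrite <- (CInt_Chasles _ (- X) 0 X) by (apply cex_lker; auto).
    rewrite <- (CInt_lker_reflect (umul kap) s X Hukc).
    rewrite (CInt_ext _ (fun u => RtoC (-1) * lker (umul (fun u => kap (- u))) (- s) u)%C).
    2: { intros u _. unfold lker, umul. replace (- u * kap (- u)) with (-1 * (u * kap (- u))) by ring.
         rewrite (RtoC_mult (-1)). ring. }
    rewrite CInt_scal.
    2: { apply cex_lker. apply (exp_bounded_mult _ 1 1 1 Rlt_0_1 kap_bounded_neg). }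
    set (J := CInt (lker (umul (fun u => kap (- u))) (- s)) 0 X) in *.
    replace (RtoC (-1) * J + CInt (lker (umul kap) s) 0 X - L1)%C with
      ((CInt (lker (umul kap) s) 0 X - LT (umul kap) s) + - (J - LT (umul (fun u => kap (- u))) (- s)))%C.
    2: { unfold L1. replace (RtoC (-1)) with (- RtoC 1)%C by (ceq; ring). ring. }
    eapply Rle_lt_trans; [ apply Cmod_triangle | ]. rewrite Cmod_opp. lra. }
  assert (HI0 : forall eps, 0 < eps -> exists M, forall X, M <= X -> Cmod (I0 X - BLk s) < eps).
  { intros eps He.
    destruct (BLk_correct s Hs) as [l1 [l2 [K1' [K2' El]]]]. rewrite El.
    destruct (K1' (eps / 2) ltac:(lra)) as [M1 K1]. destruct (K2' (eps / 2) ltac:(lra)) as [M2 K2].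
    exists (Rmax M1 M2). intros X HX.
    specialize (K1 X (Rle_trans _ _ _ (Rmax_l _ _) HX)). specialize (K2 X (Rle_trans _ _ _ (Rmax_r _ _) HX)).
    unfold I0. rewrite <- (CInt_Chasles _ (- X) 0 X) by (apply cex_lker; auto).
    rewrite <- (CInt_lker_reflect kap s X Hkc).
    set (J := CInt (lker (fun u => kap (- u)) (- s)) 0 X) in *.
    replace (J + CInt (lker kap s) 0 X - (l1 + l2))%C with ((CInt (lker kap s) 0 X - l1) + (J - l2))%C by ring.
    eapply Rle_lt_trans; [ apply Cmod_triangle | ]. lra. }
  assert (Hlim : ((em - ep) * L1 - (0, PI) * (em + ep) * BLk s)%C = RtoC 0).
  { apply Cmod_eq_0, Rle_antisym; [ | apply Cmod_ge_0 ]. apply le_epsilon. intros eps He. rewrite Rplus_0_l.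
    set (a := (em - ep)%C). set (b := ((0, PI) * (em + ep))%C).
    pose proof (Cmod_ge_0 a) as Ha. pose proof (Cmod_ge_0 b) as Hb.
    destruct (Hsmall (eps / 3) ltac:(lra)) as [M1 K1].
    destruct (HI1 (eps / (3 * (Cmod a + 1))) ltac:(apply Rdiv_lt_0_compat; lra)) as [M2 K2].
    destruct (HI0 (eps / (3 * (Cmod b + 1))) ltac:(apply Rdiv_lt_0_compat; lra)) as [M3 K3].
    set (X := Rmax M1 (Rmax M2 M3)).
    specialize (K1 X (Rmax_l _ _)).
    specialize (K2 X (Rle_trans _ _ _ (Rmax_l _ _) (Rmax_r _ _))).
    specialize (K3 X (Rle_trans _ _ _ (Rmax_r _ _) (Rmax_r _ _))).
    fold a b in K1.
    replace (a * L1 - b * BLk s)%C with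
      ((a * I1 X - b * I0 X) + - (a * (I1 X - L1)) + b * (I0 X - BLk s))%C by ring.
    eapply Rle_trans; [ apply Cmod_triangle3 | ]. rewrite Cmod_opp, !Cmod_mult.
    assert (Q1 : Cmod a * Cmod (I1 X - L1) <= eps / 3).
    { apply Rle_trans with ((Cmod a + 1) * (eps / (3 * (Cmod a + 1)))); [ | right; field; lra ].
      apply Rmult_le_compat; try lra; apply Cmod_ge_0. }
    assert (Q2 : Cmod b * Cmod (I0 X - BLk s) <= eps / 3).
    { apply Rle_trans with ((Cmod b + 1) * (eps / (3 * (Cmod b + 1)))); [ | right; field; lra ].
      apply Rmult_le_compat; try lra; apply Cmod_ge_0. }
    lra. }
  assert (Eep : cexp (- (Ci * (RtoC PI * s))) = ep) by (unfold ep; f_equal; ceq; ring).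
  assert (Eem : cexp (Ci * (RtoC PI * s)) = em) by (unfold em; f_equal; ceq; ring).
  unfold csin, ccos. rewrite Eep, Eem.
  replace (LT (umul (fun u => kap (- u))) (- s) - LT (umul kap) s)%C with (- L1)%C by (unfold L1; ring).
  replace ((0, PI) : C) with (Ci * RtoC PI)%C in Hlim by (ceq; ring).
  replace ((em - ep) / (2 * Ci) * - L1 + PI * ((em + ep) / 2) * BLk s)%C with
    (- / (2 * Ci) * ((em - ep) * L1 - Ci * PI * (em + ep) * BLk s))%C.
  - rewrite Hlim. ring.
  - field; repeat split; first [ apply Ci_nz | apply C2_neq_0 ].
Qed.

Lemma atan_le (y : R) : 0 <= y -> atan y <= y.
Proof.
  intros Hy. destruct (Req_dec y 0) as [-> | Hn]; [ rewrite atan_0; lra | ].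
  destruct (MVT_gen atan 0 y (fun x => / (1 + x ^ 2))) as [c [Hc E]].
  - intros x _. auto_derive; auto. field. nra.
  - intros x _. apply continuity_pt_filterlim, (ex_derive_continuous atan). auto_derive. auto.
  - rewrite atan_0 in E. assert (/ (1 + c ^ 2) <= 1).
    { rewrite <- Rinv_1. apply Rinv_le_contravar; [ lra | ]. nra. }
    assert (0 <= / (1 + c ^ 2)) by (left; apply Rinv_0_lt_compat; nra). nra.
Qed.

(** The initial value for the differential equation: at s = 1/2 the integrand is even and has the
    primitive 2 atan(e^{u/2}). *)
Lemma BLk_half : BLk (RtoC (1 / 2)) = RtoC PI.
Proof.
  assert (Hint : forall X, RInt (fun u => exp (- (1 / 2 * u)) * kap u) 0 X = 2 * atan (exp (X / 2)) - PI / 2).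
  { intros X. apply is_RInt_unique.
    replace (2 * atan (exp (X / 2)) - PI / 2) with
      (minus ((fun u => 2 * atan (exp (u / 2))) X) ((fun u => 2 * atan (exp (u / 2))) 0)).
    2: { unfold minus, plus, opp; simpl. replace (0 / 2) with 0 by field. rewrite exp_0, atan_1. field. }
    assert (Hd : forall x, exp (- (1 / 2 * x)) * kap x = exp (x / 2) / (1 + exp (x / 2) ^ 2)).
    { intros x. unfold kap.
      replace (- x) with (- (x / 2) + - (x / 2)) by field. rewrite exp_plus.
      replace (1 / 2 * x) with (x / 2) by field. rewrite exp_Ropp.
      pose proof (exp_pos (x / 2)). field. split; nra. }
    apply (is_RInt_derive (V:=R_CompleteNormedModule) (fun u => 2 * atan (exp (u / 2)))).
    - intros x _. rewrite Hd. auto_derive; auto. unfold Rdiv; simpl. field. pose proof (exp_pos (x * / 2)). nra.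
    - intros x _. apply (continuous_mult (fun u => exp (- (1 / 2 * u))) kap); [ | apply kap_continuous ].
      apply (ex_derive_continuous (V:=R_NormedModule)). auto_derive. auto. }
  assert (Hlim : forall eps, 0 < eps -> exists M, forall X, M <= X ->
     Rabs (2 * atan (exp (X / 2)) - PI / 2 - PI / 2) < eps).
  { intros eps He. destruct (exp_small 2 (1 / 2) eps ltac:(lra) ltac:(lra) He) as [M [_ HM]].
    exists M. intros X HX. specialize (HM X HX).
    assert (Ei := atan_inv (exp (X / 2)) (exp_pos _)).
    rewrite <- exp_Ropp in Ei.
    assert (Hle := atan_le (exp (- (X / 2))) (Rlt_le _ _ (exp_pos _))).
    assert (0 <= atan (exp (- (X / 2)))).
    { rewrite <- atan_0. left; apply atan_increasing, exp_pos. }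
    replace (1 / 2 * X) with (X / 2) in HM by field.
    apply Rabs_def1; lra. }
  assert (H1 : is_LT kap (RtoC (1 / 2)) (RtoC (PI / 2))).
  { intros eps He. destruct (Hlim eps He) as [M HM]. exists M. intros X HX.
    rewrite (CInt_ext _ (fun u => RtoC (exp (- (1 / 2 * u)) * kap u))).
    2: { intros u _. unfold lker. rewrite RtoC_mult, <- cexp_RtoC. do 2 f_equal. ceq; ring. }
    rewrite CInt_RtoC, Hint, <- RtoC_minus, Cmod_R. auto. }
  assert (H2 : is_LT (fun u => kap (- u)) (- RtoC (1 / 2)) (RtoC (PI / 2))).
  { intros eps He. destruct (H1 eps He) as [M HM]. exists M. intros X HX.
    rewrite (CInt_ext _ (lker kap (RtoC (1 / 2)))); auto.
    intros u _. unfold lker.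
    replace (- (- RtoC (1 / 2) * RtoC u))%C with (RtoC (u / 2)) by (ceq; field).
    replace (- (RtoC (1 / 2) * RtoC u))%C with (RtoC (- (u / 2))) by (ceq; field).
    rewrite !cexp_RtoC, <- !RtoC_mult. f_equal. unfold kap. rewrite Ropp_involutive.
    replace u with (u / 2 + u / 2) at 2 by field. replace (- u) with (- (u / 2) + - (u / 2)) by field.
    rewrite !exp_plus, exp_Ropp. pose proof (exp_pos (u / 2)). field. split; nra. }
  unfold BLk. rewrite (LT_eq _ _ _ H1), (LT_eq _ _ _ H2), <- RtoC_plus. f_equal. field.
Qed.

(** By [BLk_ode] the product sin(pi s) B(s) has derivative 0, so it is constant along the segment
    from 1/2 to s. *)
Lemma kap_transform (s : C) : 0 < Re s < 1 -> exists b, is_BL kap s b /\ (csin (RtoC PI * s) * b)%C = RtoC PI.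
Proof.
  intros Hs. exists (BLk s). split; [ apply BLk_correct; auto | ].
  rewrite <- (cder_zero_segment (fun z => csin (RtoC PI * z) * BLk z)%C (RtoC (1 / 2)) s).
  - rewrite csin_PI2, BLk_half. ring.
  - intros t Ht. set (z := (RtoC (1 / 2) + RtoC t * (s - RtoC (1 / 2)))%C).
    assert (Hz : 0 < Re z < 1).
    { replace (Re z) with (1 / 2 + t * (Re s - 1 / 2)) by (unfold z, Re; simpl; ring). nra. }
    rewrite <- (BLk_ode z Hz).
    replace (csin (PI * z) * (LT (umul (fun u => kap (- u))) (- z) - LT (umul kap) z) + PI * ccos (PI * z) * BLk z)%C
      with (ccos (PI * z) * PI * BLk z + csin (PI * z) * (LT (umul (fun u => kap (- u))) (- z) - LT (umul kap) z))%C by ring.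
    apply (cder_mult (fun z => csin (RtoC PI * z))%C BLk).
    + apply (cder_comp csin (fun z => RtoC PI * z)%C); [ apply cder_lin | apply cder_csin ].
    + apply BLk_cder; auto.
Qed.

(** * Power series of the Bessel function *)

(* bess nu (-lam x^2) = Gamma(nu+1) (sqrt lam x / 2)^(-nu) J_nu(sqrt lam x). *)
Fixpoint bcoef (nu : R) (k : nat) : R :=
  match k with
  | O => 1
  | S k' => bcoef nu k' / (4 * (INR k' + 1) * (nu + 1 + INR k'))
  end.

Definition bess (nu z : R) : R := PSeries (bcoef nu) z.

Lemma bcoef_pos (nu : R) (k : nat) : 0 <= nu -> 0 < bcoef nu k.
Proof.
  intros Hnu. induction k as [ | k IH]; cbn [bcoef]; [ lra | ].
  pose proof (pos_INR k). apply Rdiv_lt_0_compat; auto. apply Rmult_lt_0_compat; lra.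
Qed.

Lemma bcoef_shift (nu : R) (k : nat) : 0 <= nu -> bcoef (nu + 1) k = bcoef nu k * (nu + 1) / (nu + 1 + INR k).
Proof.
  intros Hnu. induction k as [ | k IH].
  - simpl. field. lra.
  - cbn [bcoef]. rewrite IH, S_INR. pose proof (pos_INR k). field. repeat split; lra.
Qed.

Lemma bcoef_derive (nu : R) (k : nat) : 0 <= nu ->
  (INR k + 1) * bcoef nu (S k) = bcoef (nu + 1) k / (4 * (nu + 1)).
Proof.
  intros Hnu. rewrite bcoef_shift by auto. cbn [bcoef]. pose proof (pos_INR k). field. repeat split; lra.
Qed.

Lemma CV_radius_all (a : nat -> R) : (forall r, ex_series (fun n => Rabs (a n * r ^ n))) -> CV_radius a = p_infty.
Proof.
  intros H. unfold CV_radius, Lub.Lub_Rbar.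
  destruct (Lub.ex_lub_Rbar (CV_disk a)) as [l [H1 H2]]. simpl.
  destruct l as [r | | ]; auto; exfalso.
  - assert (K := H1 (r + 1) (H (r + 1))). simpl in K. lra.
  - apply (H1 0 (H 0)).
Qed.

Lemma ex_series_le_abs (a b : nat -> R) : (forall n, Rabs (a n) <= b n) -> ex_series b -> ex_series (fun n => Rabs (a n)).
Proof.
  intros H Hb. apply (ex_series_le (K:=R_AbsRing) (V:=R_CompleteNormedModule)) with b; auto.
  intros n. change (Rabs (Rabs (a n)) <= b n). rewrite Rabs_Rabsolu. auto.
Qed.

Lemma bcoef_le (nu : R) (k : nat) : 0 <= nu -> bcoef nu k <= / INR (fact k).
Proof.
  intros Hnu. induction k as [ | k IH].
  - simpl. lra.
  - cbn [bcoef]. pose proof (pos_INR k). pose proof (bcoef_pos nu k Hnu).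
    rewrite fact_simpl, mult_INR, S_INR, Rinv_mult.
    assert (H1 : 0 < / (4 * (INR k + 1) * (nu + 1 + INR k)) <= / (INR k + 1)).
    { split; [ apply Rinv_0_lt_compat; apply Rmult_lt_0_compat; lra | apply Rinv_le_contravar; nra ]. }
    unfold Rdiv. rewrite Rmult_comm. apply Rmult_le_compat; lra.
Qed.

Lemma ex_series_exp (x : R) : ex_series (fun k => / INR (fact k) * x ^ k).
Proof. exists (exp x). apply is_pseries_R. apply is_exp_Reals. Qed.

Lemma bcoef_CV (nu : R) : 0 <= nu -> CV_radius (bcoef nu) = p_infty.
Proof.
  intros Hnu. apply CV_radius_all. intros r.
  apply (ex_series_le_abs _ (fun k => / INR (fact k) * Rabs r ^ k)); [ | apply ex_series_exp ].
  intros k. rewrite Rabs_mult, RPow_abs. apply Rmult_le_compat_r; [ apply Rabs_pos | ].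
  rewrite Rabs_right; [ apply bcoef_le; auto | left; apply bcoef_pos; auto ].
Qed.

Lemma bess_ex_series (nu z : R) : 0 <= nu -> ex_series (fun k => bcoef nu k * z ^ k).
Proof.
  intros Hnu. apply ex_pseries_R, CV_radius_inside. rewrite bcoef_CV; simpl; auto.
Qed.

Lemma bess_derive (nu z : R) : 0 <= nu -> is_derive (bess nu) z (bess (nu + 1) z / (4 * (nu + 1))).
Proof.
  intros Hnu.
  assert (H := is_derive_PSeries (bcoef nu) z). rewrite bcoef_CV in H by auto. specialize (H I).
  replace (bess (nu + 1) z / (4 * (nu + 1))) with (PSeries (PS_derive (bcoef nu)) z); auto.
  unfold bess, Rdiv. rewrite Rmult_comm, <- PSeries_scal. apply PSeries_ext. intros n.
  unfold PS_derive, PS_scal. rewrite S_INR, bcoef_derive by auto.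
  unfold scal; simpl; unfold mult; simpl. unfold Rdiv. ring.
Qed.

Lemma bess_0 (nu : R) : bess nu 0 = 1.
Proof. unfold bess. rewrite PSeries_0. reflexivity. Qed.

(** The three-term recurrence of Bessel functions in the order, checked on coefficients. It stands
    in for Bessel's equation in the Riccati equation of [theta], in the equation of [eigf] and in
    the exclusion of common zeros. *)
Lemma bess_contiguous (nu z : R) : 0 <= nu ->
  bess nu z = bess (nu + 1) z + z * bess (nu + 2) z / (4 * (nu + 1) * (nu + 2)).
Proof.
  intros Hnu. unfold bess.
  rewrite (PSeries_decr_1 (bcoef nu)), (PSeries_decr_1 (bcoef (nu + 1))).
  2, 3: apply ex_pseries_R, bess_ex_series; lra.
  rewrite Rplus_assoc. f_equal.
  replace (z * PSeries (bcoef (nu + 2)) z / (4 * (nu + 1) * (nu + 2)))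
    with (z * (/ (4 * (nu + 1) * (nu + 2)) * PSeries (bcoef (nu + 2)) z)) by (field; lra).
  rewrite <- Rmult_plus_distr_l. f_equal.
  rewrite <- PSeries_scal, <- PSeries_plus.
  - apply PSeries_ext. intros n. unfold PS_decr_1, PS_plus, PS_scal, plus, scal; simpl; unfold mult; simpl.
    replace (nu + 2) with (nu + 1 + 1) by ring. pose proof (pos_INR n).
    rewrite !bcoef_shift by lra. field. repeat split; lra.
  - apply CV_radius_inside. rewrite CV_radius_decr_1, bcoef_CV by lra. exact I.
  - apply CV_radius_inside. rewrite CV_radius_scal, bcoef_CV by (try apply Rinv_neq_0_compat; nra). exact I.
Qed.

Lemma Series_zero (a : nat -> R) : (forall n, a n = 0) -> Series a = 0.
Proof.
  intros H. unfold Series. rewrite (Lim_seq_ext _ (fun _ => 0)); [ rewrite Lim_seq_const; reflexivity | ].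
  intros n. induction n as [ | n IH]; [ rewrite sum_O; auto | rewrite sum_Sn, IH, H; apply Rplus_0_r ].
Qed.

Lemma bess_ge_1 (nu z : R) : 0 <= nu -> 0 <= z -> 1 <= bess nu z.
Proof.
  intros Hnu Hz. unfold bess. rewrite PSeries_decr_1 by (apply ex_pseries_R, bess_ex_series; auto).
  simpl (bcoef nu 0). assert (0 <= PSeries (PS_decr_1 (bcoef nu)) z); [ | nra ].
  unfold PSeries. rewrite <- (Series_zero (fun _ => 0)) by auto.
  apply Series_le.
  - intros n. split; [ lra | ]. apply Rmult_le_pos; [ left; apply bcoef_pos; auto | apply pow_le; auto ].
  - apply ex_pseries_R, CV_radius_inside. rewrite CV_radius_decr_1, bcoef_CV by lra. exact I.
Qed.

(** * Polynomial functions *)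

(** Horner form of degree at most n. Coefficients stay hidden, since dividing out roots is the only
    operation required. *)
Fixpoint ispoly (n : nat) (f : R -> R) : Prop :=
  match n with
  | O => exists c, forall x, f x = c
  | S m => exists g c, ispoly m g /\ forall x, f x = c + x * g x
  end.

Lemma ispoly_factor (n : nat) : forall f a, ispoly (S n) f ->
  exists g, ispoly n g /\ forall x, f x = f a + (x - a) * g x.
Proof.
  induction n as [ | n IH]; intros f a [h [c [Hh Hf]]].
  - destruct Hh as [k Hk]. exists (fun _ => k). split; [ exists k; auto | ].
    intros x. rewrite !Hf, !Hk. ring.
  - destruct (IH h a Hh) as [k [Hk Ek]].
    exists (fun x => h a + x * k x). split; [ exists k, (h a); auto | ].
    intros x. rewrite !Hf. rewrite (Ek x) at 1. ring.
Qed.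

Fixpoint fprod (n : nat) (g : nat -> R) : R :=
  match n with O => 1 | S k => fprod k g * g k end.

Lemma ispoly_roots (n : nat) : forall f rho, ispoly n f ->
  (forall i j, (i < j < n)%nat -> rho i <> rho j) -> (forall i, (i < n)%nat -> f (rho i) = 0) ->
  exists c, forall x, f x = c * fprod n (fun i => x - rho i).
Proof.
  induction n as [ | n IH]; intros f rho Hf Hd Hr.
  - destruct Hf as [c Hc]. exists c. intros x. simpl. rewrite Hc. ring.
  - destruct (ispoly_factor n f (rho n) Hf) as [g [Hg Eg]].
    rewrite Hr in Eg by lia.
    destruct (IH g rho Hg) as [c Hc].
    + intros i j Hij. apply Hd. lia.
    + intros i Hi. assert (K := Eg (rho i)). rewrite Hr in K by lia.
      assert (rho i <> rho n) by (apply Hd; lia).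
      symmetry in K. rewrite Rplus_0_l in K. apply Rmult_integral in K. destruct K; auto. lra.
    + exists c. intros x. rewrite Eg, Hc. simpl. ring.
Qed.

Lemma ispoly_PSeries (n : nat) : forall a, (forall k, (n < k)%nat -> a k = 0) -> ispoly n (PSeries a).
Proof.
  assert (Hex : forall n a x, (forall k, (n < k)%nat -> a k = 0) -> ex_pseries a x).
  { clear. intros n a x H. apply ex_pseries_R.
    exists (sum_n (fun k => a k * x ^ k) n).
    apply filterlim_ext_loc with (fun _ => sum_n (fun k => a k * x ^ k) n); [ | apply filterlim_const ].
    exists n. intros m Hm. induction Hm as [ | m Hm IH]; auto.
    rewrite sum_Sn, <- IH, H, Rmult_0_l by lia. symmetry. apply Rplus_0_r. }
  induction n as [ | n IH]; intros a Ha.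
  - exists (a 0%nat). intros x. rewrite (PSeries_decr_1 a) by (apply (Hex 0%nat); auto).
    replace (PSeries (PS_decr_1 a) x) with 0; [ ring | ].
    unfold PSeries. symmetry. apply Series_zero. intros k. unfold PS_decr_1. rewrite Ha by lia. ring.
  - exists (PSeries (PS_decr_1 a)), (a 0%nat). split.
    + apply IH. intros k Hk. apply Ha. lia.
    + intros x. apply PSeries_decr_1, (Hex (S n)); auto.
Qed.

Lemma CV_radius_finite (n : nat) (a : nat -> R) : (forall k, (n < k)%nat -> a k = 0) -> CV_radius a = p_infty.
Proof.
  intros H. apply CV_radius_all. intros x.
  exists (sum_n (fun k => Rabs (a k * x ^ k)) n).
  apply filterlim_ext_loc with (fun _ => sum_n (fun k => Rabs (a k * x ^ k)) n); [ | apply filterlim_const ].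
  exists n. intros m Hm. induction Hm as [ | m Hm IH]; auto.
  rewrite sum_Sn, <- IH, H, Rmult_0_l, Rabs_R0 by lia. symmetry. apply Rplus_0_r.
Qed.

Lemma fprod_ext (n : nat) (f g : nat -> R) : (forall i, (i < n)%nat -> f i = g i) -> fprod n f = fprod n g.
Proof.
  induction n as [ | n IH]; intros H; simpl; auto. rewrite IH, H; auto.
Qed.

Lemma fprod_mult (n : nat) (f g : nat -> R) : fprod n (fun i => f i * g i) = fprod n f * fprod n g.
Proof. induction n as [ | n IH]; simpl; [ ring | rewrite IH; ring ]. Qed.

Lemma fprod_pos (n : nat) (f : nat -> R) : (forall i, (i < n)%nat -> 0 < f i) -> 0 < fprod n f.
Proof.
  induction n as [ | n IH]; intros H; simpl; [ lra | ]. apply Rmult_lt_0_compat; auto.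
Qed.

Lemma fprod_neq_0 (n : nat) (f : nat -> R) : (forall i, (i < n)%nat -> f i <> 0) -> fprod n f <> 0.
Proof.
  induction n as [ | n IH]; intros H; simpl; [ lra | ].
  apply Rmult_integral_contrapositive. split; [ apply IH | ]; auto.
Qed.

Lemma fprod_neg (n : nat) (f : nat -> R) : (forall i, (i < n)%nat -> f i < 0) -> 0 < (-1) ^ n * fprod n f.
Proof.
  intros H. replace ((-1) ^ n * fprod n f) with (fprod n (fun i => - f i)).
  - apply fprod_pos. intros i Hi. specialize (H i Hi). lra.
  - clear H. induction n as [ | n IH]; simpl; [ ring | rewrite IH; ring ].
Qed.

Lemma fprod_split (i m : nat) (g : nat -> R) :
  fprod (S i + m) g = fprod i g * g i * fprod m (fun j => g (S i + j)%nat).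
Proof.
  induction m as [ | m IH].
  - rewrite Nat.add_0_r. simpl. ring.
  - replace (S i + S m)%nat with (S (S i + m)) by lia.
    change (fprod (S (S i + m)) g) with (fprod (S i + m) g * g (S i + m)%nat). rewrite IH. simpl. ring.
Qed.

Lemma fprod_derive (n : nat) (a : nat -> R) (z : R) : (forall i, (i < n)%nat -> 1 + a i * z <> 0) ->
  is_derive (fun z => fprod n (fun i => 1 + a i * z)) z
    (fprod n (fun i => 1 + a i * z) * fsum n (fun i => a i / (1 + a i * z))).
Proof.
  induction n as [ | n IH]; intros H; simpl.
  - rewrite Rmult_0_r. apply (is_derive_const (K:=R_AbsRing) (V:=R_NormedModule)).
  - replace (fprod n (fun i => 1 + a i * z) * (1 + a n * z) * (fsum n (fun i => a i / (1 + a i * z)) + a n / (1 + a n * z)))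
      with (fprod n (fun i => 1 + a i * z) * fsum n (fun i => a i / (1 + a i * z)) * (1 + a n * z)
            + fprod n (fun i => 1 + a i * z) * a n) by (field; apply H; lia).
    apply (is_derive_mult (fun z => fprod n (fun i => 1 + a i * z)) (fun z => 1 + a n * z)).
    + apply IH. intros i Hi. apply H. lia.
    + auto_derive; auto. ring.
    + intros; apply Rmult_comm.
Qed.

Lemma fprod_differentiable (n : nat) (a : nat -> R) (z : R) : ex_derive (fun z => fprod n (fun i => 1 + a i * z)) z.
Proof.
  induction n as [ | n IH]; simpl.
  - apply (ex_derive_const (K:=R_AbsRing) (V:=R_NormedModule)).
  - apply (ex_derive_mult (fun z => fprod n (fun i => 1 + a i * z)) (fun z => 1 + a n * z)); auto.
    auto_derive; auto.
Qed.

(** * Real-rooted approximants *)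

Fixpoint ffall (x : R) (k : nat) : R := match k with O => 1 | S k' => ffall x k' * (x - INR k') end.

Lemma ffall_zero (n k : nat) : (n < k)%nat -> ffall (INR n) k = 0.
Proof.
  induction k as [ | k IH]; intros H; [ lia | ]. simpl.
  destruct (Nat.eq_dec n k) as [-> | Hn]; [ ring | rewrite IH by lia; ring ].
Qed.

Lemma ffall_succ (x : R) (k : nat) : ffall (x + 1) (S k) = (x + 1) * ffall x k.
Proof.
  induction k as [ | k IH]; [ simpl; ring | ].
  change (ffall (x + 1) (S (S k))) with (ffall (x + 1) (S k) * (x + 1 - INR (S k))). rewrite IH, S_INR. simpl. ring.
Qed.

Lemma ffall_succ2 (x : R) (k : nat) : ffall (x + 1) (S k) = ffall x (S k) + (INR k + 1) * ffall x k.
Proof. rewrite ffall_succ. simpl. ring. Qed.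

(* Laguerre polynomials, normalised to 1 at 0: lag n nu x = sum_k (-1)^k C(n,k) x^k / (nu+1)_k. *)
Definition lagc (n : nat) (nu : R) (k : nat) : R := bcoef nu k * ffall (INR n) k * (-4) ^ k.
Definition lag (n : nat) (nu x : R) : R := PSeries (lagc n nu) x.

Lemma lagc_zero (n : nat) (nu : R) (k : nat) : (n < k)%nat -> lagc n nu k = 0.
Proof. intros H. unfold lagc. rewrite ffall_zero by auto. ring. Qed.

Lemma lag_poly (n : nat) (nu : R) : ispoly n (lag n nu).
Proof. apply ispoly_PSeries. apply lagc_zero. Qed.

Lemma lag_0 (n : nat) (nu : R) : lag n nu 0 = 1.
Proof. unfold lag. rewrite PSeries_0. unfold lagc. simpl. ring. Qed.

Lemma lag_derive (n : nat) (nu x : R) : is_derive (lag n nu) x (PSeries (PS_derive (lagc n nu)) x).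
Proof.
  apply is_derive_PSeries. rewrite (CV_radius_finite n) by (apply lagc_zero). exact I.
Qed.

(** A comparison of coefficients. The degree rises while the parameter falls, so the existence of
    roots is proved by induction on n for all nu at once. *)
Lemma lag_rec (n : nat) (nu x : R) : 0 <= nu ->
  (nu + 1) * lag (S n) nu x =
  (nu + 1 - x) * lag n (nu + 1) x + x * PSeries (PS_derive (lagc n (nu + 1))) x.
Proof.
  intros Hnu. unfold lag.
  assert (CV : forall m mu, CV_radius (lagc m mu) = p_infty) by (intros; apply (CV_radius_finite m), lagc_zero).
  assert (Hp : forall a, CV_radius a = p_infty -> ex_pseries a x).
  { intros a Ha. apply CV_radius_inside. rewrite Ha. exact I. }
  rewrite (PSeries_decr_1 (lagc (S n) nu)) by (apply Hp, CV).
  replace ((nu + 1 - x) * PSeries (lagc n (nu + 1)) x) with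
    ((nu + 1) * PSeries (lagc n (nu + 1)) x - x * PSeries (lagc n (nu + 1)) x) by ring.
  rewrite (PSeries_decr_1 (lagc n (nu + 1))) at 1 by (apply Hp, CV).
  replace (lagc (S n) nu 0) with 1 by (unfold lagc; simpl; ring).
  replace (lagc n (nu + 1) 0) with 1 by (unfold lagc; simpl; ring).
  assert (E : (nu + 1) * PSeries (PS_decr_1 (lagc (S n) nu)) x =
     (nu + 1) * PSeries (PS_decr_1 (lagc n (nu + 1))) x - PSeries (lagc n (nu + 1)) x
     + PSeries (PS_derive (lagc n (nu + 1))) x).
  { rewrite <- !PSeries_scal.
    rewrite <- PSeries_minus, <- PSeries_plus.
    - apply PSeries_ext. intros k.
      change ((nu + 1) * (bcoef nu (S k) * ffall (INR (S n)) (S k) * (-4) ^ S k) =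
        ((nu + 1) * (bcoef (nu + 1) (S k) * ffall (INR n) (S k) * (-4) ^ S k)
          + - (bcoef (nu + 1) k * ffall (INR n) k * (-4) ^ k))
        + INR (S k) * (bcoef (nu + 1) (S k) * ffall (INR n) (S k) * (-4) ^ S k)).
      rewrite !S_INR. pose proof (pos_INR k).
      rewrite ffall_succ2, !bcoef_shift, S_INR by lra. cbn [bcoef ffall pow].
      field. repeat split; lra.
    - apply Hp. apply (CV_radius_finite n). intros k Hk.
      unfold PS_minus, PS_plus, PS_opp, PS_scal, PS_decr_1, plus, opp, scal; simpl; unfold mult; simpl.
      rewrite !lagc_zero by lia. ring.
    - apply Hp. rewrite CV_radius_derive. apply CV.
    - apply Hp. rewrite CV_radius_scal by lra. rewrite CV_radius_decr_1. apply CV.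
    - apply Hp, CV. }
  set (A := PSeries (PS_decr_1 (lagc (S n) nu)) x) in *. set (B := PSeries (PS_decr_1 (lagc n (nu + 1))) x) in *.
  replace ((nu + 1) * (1 + x * A)) with (nu + 1 + x * ((nu + 1) * A)) by ring. rewrite E. ring.
Qed.

Lemma fsum_ext (n : nat) (f g : nat -> R) : (forall i, (i < n)%nat -> f i = g i) -> fsum n f = fsum n g.
Proof. induction n as [ | n IH]; intros H; simpl; auto. rewrite IH, H; auto. Qed.

Lemma fsum_le (n : nat) (f g : nat -> R) : (forall i, (i < n)%nat -> f i <= g i) -> fsum n f <= fsum n g.
Proof.
  induction n as [ | n IH]; intros H; simpl; [ lra | ]. apply Rplus_le_compat; auto.
Qed.

Lemma fsum_const (n : nat) (c : R) : fsum n (fun _ => c) = INR n * c.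
Proof. induction n as [ | n IH]; [ simpl; ring | rewrite S_INR; simpl; rewrite IH; ring ]. Qed.

Lemma fsum_scal (n : nat) (c : R) (f : nat -> R) : fsum n (fun i => c * f i) = c * fsum n f.
Proof. induction n as [ | n IH]; simpl; [ ring | rewrite IH; ring ]. Qed.

Lemma fsum_plus (n : nat) (f g : nat -> R) : fsum n (fun i => f i + g i) = fsum n f + fsum n g.
Proof. induction n as [ | n IH]; simpl; [ ring | rewrite IH; ring ]. Qed.

Lemma pow_m1_pos (n : nat) (x y : R) : 0 < (-1) ^ n * x -> 0 < (-1) ^ S n * y -> x * y < 0.
Proof.
  intros H1 H2. simpl in H2.
  assert (E : (-1) ^ n * (-1) ^ n = 1).
  { rewrite <- Rpow_mult_distr. replace (-1 * -1) with 1 by ring. apply pow1. }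
  assert (0 < ((-1) ^ n * x) * (-1 * (-1) ^ n * y)) by (apply Rmult_lt_0_compat; auto).
  replace (((-1) ^ n * x) * (-1 * (-1) ^ n * y)) with (- (((-1) ^ n * (-1) ^ n) * (x * y))) in H by ring.
  rewrite E in H. lra.
Qed.

Lemma IVT_sign (f : R -> R) (a b : R) : (forall x, continuous f x) -> a < b -> f a * f b < 0 ->
  exists c, a < c < b /\ f c = 0.
Proof.
  intros Hf Hab Hs.
  destruct (IVT_gen f a b 0) as [c [Hc E]].
  - intros x. apply continuity_pt_filterlim, Hf.
  - unfold Rmin, Rmax. destruct (Rle_dec (f a) (f b)); nra.
  - rewrite Rmin_left, Rmax_right in Hc by lra. exists c. split; auto.
    assert (c <> a) by (intros ->; rewrite E in Hs; lra).
    assert (c <> b) by (intros ->; rewrite E in Hs; lra). lra.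
Qed.

Definition factored (n : nat) (q : R -> R) (r : nat -> R) : Prop :=
  (forall i, (i < n)%nat -> 0 < r i) /\ (forall i j, (i < j < n)%nat -> r i < r j) /\
  forall x, q x = fprod n (fun i => 1 - x / r i).

Lemma fprod_derive_neg (n : nat) (r : nat -> R) (x : R) : (forall i, (i < n)%nat -> 0 < r i) ->
  (forall i, (i < n)%nat -> x <> r i) ->
  is_derive (fun x => fprod n (fun i => 1 - x / r i)) x
    (fprod n (fun i => 1 - x / r i) * fsum n (fun i => / (x - r i))).
Proof.
  intros Hr Hx.
  assert (H := fprod_derive n (fun i => - / r i) x).
  assert (E : forall y, fprod n (fun i => 1 + - / r i * y) = fprod n (fun i => 1 - y / r i)).
  { intros y. apply fprod_ext. intros i _. unfold Rdiv. ring. }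
  rewrite E in H.
  apply (is_derive_ext (fun z => fprod n (fun i => 1 + - / r i * z))); [ intros; apply E | ].
  rewrite (fsum_ext n (fun i => / (x - r i)) (fun i => - / r i / (1 + - / r i * x))).
  - apply H. intros i Hi. specialize (Hr i Hi). specialize (Hx i Hi). intros E0. apply Hx.
    apply (Rmult_eq_compat_l (r i)) in E0. rewrite Rmult_plus_distr_l in E0.
    replace (r i * (- / r i * x)) with (- x) in E0 by (field; lra). lra.
  - intros i Hi. specialize (Hr i Hi). specialize (Hx i Hi). field. repeat split; try lra.
Qed.

(* (nu+1) L_{n+1}^nu = (nu+1-x) L_n^{nu+1} + x (L_n^{nu+1})' alternates in sign at 0, at the n roots
   of L_n^{nu+1} and at infinity. *)
Lemma lag_step_sign (n : nat) (nu : R) (r : nat -> R) : 0 <= nu -> factored n (lag n (nu + 1)) r ->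
  (forall i, (i < n)%nat -> 0 < (-1) ^ S i * lag (S n) nu (r i)) /\
  exists X, 0 < X /\ (forall i, (i < n)%nat -> r i < X) /\ 0 < (-1) ^ S n * lag (S n) nu X.
Proof.
  intros Hnu [Hr [Hinc Hq]]. split.
  - intros i Hi.
    destruct (Nat.le_exists_sub (S i) n Hi) as [m [Em _]]. rewrite Nat.add_comm in Em.
    (* The polynomial without its i-th factor. At r i the recurrence reduces to (nu+1) lag (S n) nu
       (r i) = - s (r i), and s (r i) has exactly i negative factors. *)
    set (s := fun x => fprod i (fun j => 1 - x / r j) * fprod m (fun j => 1 - x / r (S i + j)%nat)).
    assert (Eq : forall x, lag n (nu + 1) x = (1 - x / r i) * s x).
    { intros x. rewrite Hq, Em, fprod_split. unfold s. ring. }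
    assert (Hri : 0 < r i) by auto.
    assert (Hs : ex_derive s (r i)).
    { assert (W : forall n' (g : nat -> R) x, ex_derive (fun x => fprod n' (fun j => 1 - x / g j)) x).
      { intros n' g x. apply (ex_derive_ext (fun x => fprod n' (fun j => 1 + - / g j * x))).
        - intros y. apply fprod_ext. intros j _. unfold Rdiv. ring.
        - apply fprod_differentiable. }
      apply (ex_derive_mult (fun x => fprod i (fun j => 1 - x / r j))
               (fun x => fprod m (fun j => 1 - x / r (S i + j)%nat))); apply W. }
    destruct Hs as [s' Hs'].
    assert (D1 : is_derive (lag n (nu + 1)) (r i) (- / r i * s (r i) + (1 - r i / r i) * s')).
    { apply (is_derive_ext (fun x => (1 - x / r i) * s x)); [ intros; symmetry; apply Eq | ].
      apply (is_derive_mult (fun x => 1 - x / r i) s); auto.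
      - auto_derive; auto. unfold Rdiv. ring.
      - intros; apply Rmult_comm. }
    assert (E := is_derive_unique _ _ _ D1). rewrite (is_derive_unique _ _ _ (lag_derive n (nu + 1) (r i))) in E.
    assert (R := lag_rec n nu (r i) Hnu). rewrite E, Eq in R.
    replace ((nu + 1 - r i) * ((1 - r i / r i) * s (r i)) + r i * (- / r i * s (r i) + (1 - r i / r i) * s'))
      with (- s (r i)) in R by (field; lra).
    assert (Hsp : 0 < (-1) ^ i * s (r i)).
    { unfold s. rewrite <- Rmult_assoc. apply Rmult_lt_0_compat.
      - apply fprod_neg. intros j Hj. assert (Hj1 : r j < r i) by (apply Hinc; lia).
        assert (0 < r j) by (apply Hr; lia).
        apply (Rmult_lt_reg_r (r j)); auto. replace ((1 - r i / r j) * r j) with (r j - r i) by (field; lra). lra.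
      - apply fprod_pos. intros j Hj. assert (Hj1 : r i < r (S i + j)%nat) by (apply Hinc; lia).
        apply (Rmult_lt_reg_r (r (S i + j)%nat)); [ lra | ].
        replace ((1 - r i / r (S i + j)%nat) * r (S i + j)%nat) with (r (S i + j)%nat - r i) by (field; lra). lra. }
    apply (Rmult_lt_reg_l (nu + 1)); [ lra | ]. rewrite Rmult_0_r.
    replace ((nu + 1) * ((-1) ^ S i * lag (S n) nu (r i))) with ((-1) ^ S i * ((nu + 1) * lag (S n) nu (r i))) by ring.
    rewrite R. simpl. lra.
  - set (M := fsum n r).
    assert (HM : forall k, (k <= n)%nat -> 0 <= fsum k r /\ forall i, (i < k)%nat -> r i <= fsum k r).
    { induction k as [ | k IH]; intros Hk; simpl; [ split; [ lra | lia ] | ].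
      destruct IH as [I1 I2]; [ lia | ]. assert (0 < r k) by (apply Hr; lia). split; [ lra | ].
      intros i Hi. destruct (Nat.eq_dec i k) as [-> | Hne]; [ lra | ]. specialize (I2 i ltac:(lia)). lra. }
    destruct (HM n (Nat.le_refl n)) as [HM0 HMi]. fold M in HM0, HMi.
    pose proof (pos_INR n) as Hn.
    (* Beyond twice every root X/(X - r_i) <= 2, so the derivative contributes at most 2n times the
       polynomial; the summand nu + 2 + 2n then makes the coefficient X - (nu+1) dominate. *)
    set (X := 2 * M + nu + 2 + 2 * INR n).
    assert (HX : 0 < X) by (unfold X; lra).
    assert (HiX : forall i, (i < n)%nat -> 2 * r i < X).
    { intros i Hi. specialize (HMi i Hi). unfold X. lra. }
    exists X. split; auto. split.
    { intros i Hi. specialize (HiX i Hi). specialize (Hr i Hi). lra. }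
    assert (D1 : is_derive (lag n (nu + 1)) X (fprod n (fun i => 1 - X / r i) * fsum n (fun i => / (X - r i)))).
    { apply (is_derive_ext (fun x => fprod n (fun i => 1 - x / r i))); [ intros; symmetry; apply Hq | ].
      apply fprod_derive_neg; auto. intros i Hi. specialize (HiX i Hi). specialize (Hr i Hi). lra. }
    assert (E := is_derive_unique _ _ _ D1). rewrite (is_derive_unique _ _ _ (lag_derive n (nu + 1) X)) in E.
    assert (R := lag_rec n nu X Hnu). rewrite E, Hq in R.
    set (P := fprod n (fun i => 1 - X / r i)) in *.
    assert (HP : 0 < (-1) ^ n * P).
    { apply fprod_neg. intros i Hi. specialize (HiX i Hi). specialize (Hr i Hi).
      apply (Rmult_lt_reg_r (r i)); auto. replace ((1 - X / r i) * r i) with (r i - X) by (field; lra). lra. }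
    assert (HS : X * fsum n (fun i => / (X - r i)) <= 2 * INR n).
    { rewrite <- fsum_scal. rewrite (Rmult_comm 2), <- (fsum_const n 2). apply fsum_le.
      intros i Hi. specialize (HiX i Hi). specialize (Hr i Hi).
      apply (Rmult_le_reg_r (X - r i)); [ lra | ]. rewrite Rmult_assoc, Rinv_l by lra. lra. }
    apply (Rmult_lt_reg_l (nu + 1)); [ lra | ]. rewrite Rmult_0_r.
    replace ((nu + 1) * ((-1) ^ S n * lag (S n) nu X)) with ((-1) ^ S n * ((nu + 1) * lag (S n) nu X)) by ring.
    rewrite R.
    replace ((-1) ^ S n * ((nu + 1 - X) * P + X * (P * fsum n (fun i => / (X - r i)))))
      with (((-1) ^ n * P) * (X - (nu + 1) - X * fsum n (fun i => / (X - r i)))) by (simpl; ring).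
    apply Rmult_lt_0_compat; auto. unfold X in *. lra.
Qed.

(** Interlacing yields n + 1 distinct positive roots in degree n + 1, so only a constant factor is
    left, and the value 1 at 0 fixes it. *)
Lemma lag_roots (n : nat) : forall nu, 0 <= nu -> exists r, factored n (lag n nu) r.
Proof.
  induction n as [ | n IH]; intros nu Hnu.
  - exists (fun _ => 1). split; [ intros; lia | ]. split; [ intros; lia | ].
    intros x. destruct (lag_poly 0 nu) as [c Hc]. simpl. rewrite Hc, <- (Hc 0). apply lag_0.
  - destruct (IH (nu + 1) ltac:(lra)) as [r Hf].
    destruct (lag_step_sign n nu r Hnu Hf) as [Hs [X [HX0 [HX HXs]]]].
    destruct Hf as [Hr [Hinc _]].
    (* The points 0, the n roots one degree below, and X: n + 2 points of alternating sign enclosing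
       n + 1 gaps. *)
    set (b := fun i => match i with O => 0 | S j => if lt_dec j n then r j else X end).
    assert (Hb0 : forall i, (i <= n)%nat -> b i < b (S i)).
    { intros i Hi. unfold b. destruct i as [ | i].
      - destruct (lt_dec 0 n); auto.
      - destruct (lt_dec i n); [ | lia ]. destruct (lt_dec (S i) n); [ apply Hinc; lia | apply HX; auto ]. }
    assert (Hbs : forall i, (i <= S n)%nat -> 0 < (-1) ^ i * lag (S n) nu (b i)).
    { intros i Hi. unfold b. destruct i as [ | i].
      - rewrite lag_0. simpl. lra.
      - destruct (lt_dec i n); [ apply Hs; auto | ]. replace i with n by lia. exact HXs. }
    assert (Hcont : forall x, continuous (lag (S n) nu) x).
    { intros x. apply (ex_derive_continuous (V:=R_NormedModule)). eexists. apply lag_derive. }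
    assert (Hroot : forall i, exists c, (i <= n)%nat -> b i < c < b (S i) /\ lag (S n) nu c = 0).
    { intros i. destruct (le_dec i n) as [Hi | Hi]; [ | exists 0; lia ].
      destruct (IVT_sign (lag (S n) nu) (b i) (b (S i)) Hcont (Hb0 i Hi)) as [c Hc].
      - apply (pow_m1_pos i); apply Hbs; lia.
      - exists c. auto. }
    set (rho := fun i => proj1_sig (constructive_indefinite_description _ (Hroot i))).
    assert (Hrho : forall i, (i <= n)%nat -> b i < rho i < b (S i) /\ lag (S n) nu (rho i) = 0).
    { intros i. unfold rho. destruct (constructive_indefinite_description _ (Hroot i)). simpl. auto. }
    assert (Hbm : forall i j, (i <= j <= S n)%nat -> b i <= b j).
    { intros i j [Hij Hj]. induction Hij as [ | j Hij IHj]; [ lra | ]. specialize (Hb0 j ltac:(lia)).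
      specialize (IHj ltac:(lia)). lra. }
    assert (Hpos : forall i, (i < S n)%nat -> 0 < rho i).
    { intros i Hi. destruct (Hrho i ltac:(lia)) as [[h1 _] _]. specialize (Hbm 0%nat i ltac:(lia)). simpl in Hbm. lra. }
    assert (Hrinc : forall i j, (i < j < S n)%nat -> rho i < rho j).
    { intros i j Hij. destruct (Hrho i ltac:(lia)) as [[_ h1] _]. destruct (Hrho j ltac:(lia)) as [[h2 _] _].
      specialize (Hbm (S i) j ltac:(lia)). lra. }
    exists rho. split; auto. split; auto.
    destruct (ispoly_roots (S n) (lag (S n) nu) rho (lag_poly (S n) nu)) as [c Hc].
    + intros i j Hij. specialize (Hrinc i j Hij). lra.
    + intros i Hi. apply Hrho. lia.
    + intros x.
      assert (E : forall x, lag (S n) nu x = (c * fprod (S n) (fun i => - rho i)) * fprod (S n) (fun i => 1 - x / rho i)).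
      { intros y. rewrite Hc, Rmult_assoc, <- fprod_mult. f_equal. apply fprod_ext. intros i Hi.
        specialize (Hpos i Hi). field. lra. }
      rewrite E. assert (E0 := E 0). rewrite lag_0 in E0.
      rewrite (fprod_ext _ (fun i => 1 - 0 / rho i) (fun _ => 1)) in E0 by (intros; unfold Rdiv; ring).
      assert (E1 : forall k, fprod k (fun _ => 1) = 1) by (induction k as [ | k IHk]; simpl; [ | rewrite IHk ]; ring).
      rewrite E1, Rmult_1_r in E0. rewrite <- E0. ring.
Qed.

(** * Dominated convergence of series and a diagonal extraction *)

Lemma Series_tail (M : nat -> R) : ex_series M -> (forall k, 0 <= M k) ->
  forall eps, 0 < eps -> exists N, Series (fun k => M (N + k)%nat) < eps.
Proof.
  intros HM Hpos eps He.
  destruct HM as [l Hl].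
  destruct (proj1 (filterlim_locally _ _) Hl (mkposreal eps He)) as [N HN].
  exists (S N). specialize (HN N (Nat.le_refl _)).
  assert (E := Series_incr_n M (S N) ltac:(lia) (ex_intro _ l Hl)).
  rewrite (is_series_unique _ _ Hl) in E. simpl pred in E.
  rewrite sum_n_Reals in HN.
  change (Rabs (sum_f_R0 M N - l) < eps) in HN. apply Rabs_def2 in HN.
  lra.
Qed.

Lemma tannery (u : nat -> nat -> R) (v M : nat -> R) :
  (forall k, is_lim_seq (fun n => u n k) (v k)) -> (forall n k, Rabs (u n k) <= M k) -> ex_series M ->
  is_lim_seq (fun n => Series (u n)) (Series v).
Proof.
  intros Hu HM Hex.
  assert (HM0 : forall k, 0 <= M k) by (intros k; eapply Rle_trans; [ apply Rabs_pos | apply (HM 0%nat) ]).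
  assert (Hv : forall k, Rabs (v k) <= M k).
  { intros k. assert (L := is_lim_seq_abs _ _ (Hu k)).
    apply (is_lim_seq_le (fun n => Rabs (u n k)) (fun _ => M k) (Rabs (v k)) (M k)); auto.
    apply is_lim_seq_const. }
  assert (Eu : forall n, ex_series (u n)).
  { intros n. apply ex_series_Rabs, (ex_series_le_abs _ M); auto. }
  assert (Ev : ex_series v) by (apply ex_series_Rabs, (ex_series_le_abs _ M); auto).
  apply is_lim_seq_spec. intros eps. 
  assert (He := cond_pos eps).
  destruct (Series_tail M Hex HM0 (eps / 3) ltac:(lra)) as [N HN].
  assert (Hfin : exists n0, forall n, (n0 <= n)%nat -> fsum N (fun k => Rabs (u n k - v k)) < eps / 3).
  { clear HN. assert (forall e, 0 < e -> exists n0, forall n, (n0 <= n)%nat -> fsum N (fun k => Rabs (u n k - v k)) < e).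
    { induction N as [ | N IH]; intros e Hep; [ exists 0%nat; intros; simpl; lra | ].
      destruct (IH (e / 2) ltac:(lra)) as [n1 H1].
      destruct (proj2 (is_lim_seq_spec _ _) (Hu N) (mkposreal (e / 2) ltac:(lra))) as [n2 H2]. simpl in H2.
      exists (max n1 n2). intros n Hn. simpl. specialize (H1 n ltac:(lia)). specialize (H2 n ltac:(lia)). lra. }
    apply H; lra. }
  destruct Hfin as [n0 Hn0]. exists n0. intros n Hn. specialize (Hn0 n Hn).
  rewrite <- Series_minus by auto.
  assert (Ed : ex_series (fun k => Rabs (u n k - v k))).
  { apply (ex_series_le_abs _ (fun k => M k + M k)).
    - intros k. eapply Rle_trans; [ apply Rabs_triang | ]. rewrite Rabs_Ropp. apply Rplus_le_compat; auto.
    - apply (ex_series_plus M M); auto. }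
  eapply Rle_lt_trans; [ apply Series_Rabs; auto | ].
  assert (Esplit : forall (a : nat -> R) K, ex_series a -> Series a = fsum K a + Series (fun k => a (K + k)%nat)).
  { intros a K Ha. induction K as [ | K IH]; simpl; [ rewrite Rplus_0_l; reflexivity | ].
    rewrite IH, (Series_incr_1 (fun k => a (K + k)%nat)).
    - rewrite Nat.add_0_r, Rplus_assoc. f_equal. f_equal. apply Series_ext. intros k. f_equal. lia.
    - apply (ex_series_incr_n a K); auto. }
  eapply Rle_lt_trans; [ right; apply (Esplit _ N Ed) | ].
  assert (T : Series (fun k => Rabs (u n (N + k)%nat - v (N + k)%nat)) <= 2 * Series (fun k => M (N + k)%nat)).
  { rewrite <- Series_scal_l. apply Series_le.
    - intros k. split; [ apply Rabs_pos | ].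
      eapply Rle_trans; [ apply Rabs_triang | ]. rewrite Rabs_Ropp.
      specialize (HM n (N + k)%nat). specialize (Hv (N + k)%nat). lra.
    - apply (ex_series_scal (K:=R_AbsRing) 2 (fun k => M (N + k)%nat)), (ex_series_incr_n M N); auto. }
  lra.
Qed.

Lemma bounded_cluster (u : nat -> R) (B : R) : (forall n, 0 <= u n <= B) ->
  exists l, forall eps N, 0 < eps -> exists n, (N <= n)%nat /\ Rabs (u n - l) < eps.
Proof.
  intros Hu.
  destruct (ex_LimSup_seq u) as [l Hl]. destruct l as [l | | ].
  - exists l. intros eps N He. destruct (Hl (mkposreal eps He)) as [H1 [N2 H2]]. simpl in *.
    destruct (H1 (max N N2)) as [n [Hn Hn2]]. exists n. split; [ lia | ].
    specialize (H2 n ltac:(lia)). apply Rabs_def1; lra.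
  - exfalso. destruct (Hl B 0%nat) as [n [_ Hn]]. specialize (Hu n). lra.
  - exfalso. destruct (Hl 0) as [n Hn]. specialize (Hn n (Nat.le_refl _)). specialize (Hu n). lra.
Qed.

(** One index n has to serve all coordinates below K simultaneously; this is what allows the next
    coordinate to be chosen along a subsequence. *)
Definition clusters (u : nat -> nat -> R) (K : nat) (l : nat -> R) : Prop :=
  forall eps N, 0 < eps -> exists n, (N <= n)%nat /\ forall k, (k < K)%nat -> Rabs (u n k - l k) < eps.

Lemma clusters_step (u : nat -> nat -> R) (B : nat -> R) (K : nat) (l : nat -> R) :
  (forall n k, 0 <= u n k <= B k) -> clusters u K l ->
  exists L, clusters u (S K) (fun k => if Nat.eq_dec k K then L else l k).
Proof.
  intros HB Hl.
  assert (Hch : forall m : nat, exists n, (m <= n)%nat /\ forall k, (k < K)%nat -> Rabs (u n k - l k) < / INR (S m)).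
  { intros m. apply Hl. apply Rinv_0_lt_compat, lt_0_INR. lia. }
  set (f := fun m => proj1_sig (constructive_indefinite_description _ (Hch m))).
  assert (Hf : forall m, (m <= f m)%nat /\ forall k, (k < K)%nat -> Rabs (u (f m) k - l k) < / INR (S m)).
  { intros m. unfold f. destruct (constructive_indefinite_description _ (Hch m)). auto. }
  destruct (bounded_cluster (fun m => u (f m) K) (B K)) as [L HL]; [ intros; apply HB | ].
  exists L. intros eps N He.
  destruct (archimed_cor1 eps He) as [N2 [HN2 HN2p]].
  destruct (HL eps (max N N2) He) as [m [Hm1 Hm2]].
  destruct (Hf m) as [Hf1 Hf2].
  exists (f m). split; [ lia | ]. intros k Hk.
  destruct (Nat.eq_dec k K) as [-> | Hne]; auto.
  eapply Rlt_trans; [ apply Hf2; lia | ]. eapply Rle_lt_trans; [ | exact HN2 ].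
  apply Rinv_le_contravar; [ apply lt_0_INR; lia | apply le_INR; lia ].
Qed.

Lemma diagonal_extraction (u : nat -> nat -> R) (B : nat -> R) : (forall n k, 0 <= u n k <= B k) ->
  exists (l : nat -> R) (phi : nat -> nat), forall k, is_lim_seq (fun n => u (phi n) k) (l k) /\ forall n, (n <= phi n)%nat.
Proof.
  intros HB.
  assert (Hc0 : clusters u 0 (fun _ => 0)).
  { intros eps N He. exists N. split; [ lia | intros; lia ]. }
  (* Stage K + 1 alters only coordinate K, so the stages are coherent and [l] can be read off the
     diagonal. *)
  set (st := fix st K : {l | clusters u K l} := match K with
    | O => exist _ (fun _ => 0) Hc0
    | S K' => let s := st K' in
        let d := constructive_indefinite_description _ (clusters_step u B K' (proj1_sig s) HB (proj2_sig s)) in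
        exist _ (fun k => if Nat.eq_dec k K' then proj1_sig d else proj1_sig s k) (proj2_sig d) end).
  set (l := fun k => proj1_sig (st (S k)) k).
  assert (Hst : forall K k, (k < K)%nat -> proj1_sig (st K) k = l k).
  { induction K as [ | K IH]; intros k Hk; [ lia | ].
    destruct (Nat.eq_dec k K) as [-> | Hne]; [ reflexivity | ].
    rewrite <- IH by lia. simpl. destruct (Nat.eq_dec k K); [ contradiction | reflexivity ]. }
  assert (Hl : forall K, clusters u K l).
  { intros K eps N He. destruct (proj2_sig (st K) eps N He) as [n [Hn Hk]].
    exists n. split; auto. intros k Hlt. rewrite <- (Hst K) by auto. auto. }
  assert (Hch : forall m : nat, exists n, (m <= n)%nat /\ forall k, (k < m)%nat -> Rabs (u n k - l k) < / INR (S m)).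
  { intros m. apply Hl. apply Rinv_0_lt_compat, lt_0_INR. lia. }
  set (phi := fun m => proj1_sig (constructive_indefinite_description _ (Hch m))).
  assert (Hphi : forall m, (m <= phi m)%nat /\ forall k, (k < m)%nat -> Rabs (u (phi m) k - l k) < / INR (S m)).
  { intros m. unfold phi. destruct (constructive_indefinite_description _ (Hch m)). auto. }
  exists l, phi. intros k. split; [ | apply Hphi ].
  apply is_lim_seq_spec. intros eps. destruct (archimed_cor1 eps (cond_pos eps)) as [N [HN HNp]].
  exists (max N (S k)). intros m Hm. destruct (Hphi m) as [_ H2].
  eapply Rlt_trans; [ apply H2; lia | ]. eapply Rle_lt_trans; [ | exact HN ].
  apply Rinv_le_contravar; [ apply lt_0_INR; lia | apply le_INR; lia ].
Qed.

(** * Factorisation of the Bessel function *)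

(** The confluent rescaling x = -z/(4(n+1)): its factors (n+1)(-4) cancel those of [lagc], and the
    sign makes positive roots into factors 1 + a z with a > 0. The degree n + 1 avoids division by
    0. *)
Definition papp (n : nat) (nu z : R) : R := lag (S n) nu (- z / (4 * INR (S n))).

Lemma INR_S_pos (n : nat) : 0 < INR (S n).
Proof. apply lt_0_INR. lia. Qed.

(** N(N-1)...(N-k+1)/N^k for N = n + 1. It lies in [0, 1] and tends to 1, so the series of [bess]
    dominates its approximants. *)
Definition fratio (n k : nat) : R := ffall (INR (S n)) k / INR (S n) ^ k.

Lemma papp_series (n : nat) (nu z : R) : papp n nu z = Series (fun k => bcoef nu k * fratio n k * z ^ k).
Proof.
  unfold papp, lag, PSeries. apply Series_ext. intros k. unfold lagc, fratio.
  pose proof (INR_S_pos n).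
  replace (- z / (4 * INR (S n))) with (z * (/ (-4) * / INR (S n))) by (field; lra).
  rewrite !Rpow_mult_distr, !pow_inv. field. split; apply pow_nonzero; lra.
Qed.

Lemma fratio_S (n k : nat) : fratio n (S k) = fratio n k * (1 - INR k / INR (S n)).
Proof.
  unfold fratio. pose proof (INR_S_pos n). cbn [ffall pow]. field. repeat split; first [ lra | apply pow_nonzero; lra ].
Qed.

Lemma fratio_bound (n k : nat) : 0 <= fratio n k <= 1.
Proof.
  induction k as [ | k IH]; [ unfold fratio; simpl; lra | ].
  destruct (le_lt_dec k (S n)) as [Hk | Hk].
  - rewrite fratio_S. pose proof (INR_S_pos n). apply le_INR in Hk. pose proof (pos_INR k).
    assert (0 <= 1 - INR k / INR (S n) <= 1).
    { split.
      - apply (Rmult_le_reg_r (INR (S n))); auto. replace ((1 - INR k / INR (S n)) * INR (S n)) with (INR (S n) - INR k) by (field; lra). lra.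
      - assert (0 <= INR k / INR (S n)) by (apply Rdiv_le_0_compat; lra). lra. }
    nra.
  - unfold fratio. rewrite ffall_zero by lia. unfold Rdiv. rewrite Rmult_0_l. lra.
Qed.

Lemma fratio_lim (k : nat) : is_lim_seq (fun n => fratio n k) 1.
Proof.
  induction k as [ | k IH].
  - apply (is_lim_seq_ext (fun _ => 1)); [ intros; unfold fratio; simpl; field | apply is_lim_seq_const ].
  - apply (is_lim_seq_ext (fun n => fratio n k * (1 - INR k / INR (S n)))); [ intros; symmetry; apply fratio_S | ].
    replace (Finite 1) with (Rbar_mult 1 (1 - INR k * 0)) by (simpl; f_equal; ring).
    apply (is_lim_seq_mult' _ _ 1 (1 - INR k * 0)); auto.
    apply is_lim_seq_minus'; [ apply is_lim_seq_const | ].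
    apply (is_lim_seq_scal_l (fun n => / INR (S n)) (INR k) 0).
    apply (is_lim_seq_incr_1 (fun n => / INR n)).
    apply (is_lim_seq_inv INR p_infty); [ apply is_lim_seq_INR | discriminate ].
Qed.

Lemma bess_Rabs_series (nu z : R) : 0 <= nu -> ex_series (fun k => bcoef nu k * Rabs z ^ k).
Proof. intros. apply bess_ex_series; auto. Qed.

Lemma papp_lim (nu z : R) : 0 <= nu -> is_lim_seq (fun n => papp n nu z) (bess nu z).
Proof.
  intros Hnu.
  apply (is_lim_seq_ext (fun n => Series (fun k => bcoef nu k * fratio n k * z ^ k))); [ intros; symmetry; apply papp_series | ].
  apply (tannery (fun n k => bcoef nu k * fratio n k * z ^ k) (fun k => bcoef nu k * z ^ k) (fun k => bcoef nu k * Rabs z ^ k)).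
  - intros k. replace (bcoef nu k * z ^ k) with (bcoef nu k * 1 * z ^ k) by ring.
    apply (is_lim_seq_scal_r (fun n => bcoef nu k * fratio n k) (z ^ k) (bcoef nu k * 1)).
    apply (is_lim_seq_scal_l (fun n => fratio n k) (bcoef nu k) 1). apply fratio_lim.
  - intros n k. rewrite !Rabs_mult, RPow_abs. pose proof (bcoef_pos nu k Hnu). pose proof (fratio_bound n k).
    rewrite (Rabs_right (bcoef nu k)), (Rabs_right (fratio n k)) by lra.
    apply Rmult_le_compat_r; [ apply Rabs_pos | nra ].
  - apply bess_Rabs_series; auto.
Qed.

Definition dpapp (n : nat) (nu z : R) : R := Series (fun k => bcoef (nu + 1) k * fratio n (S k) * z ^ k) / (4 * (nu + 1)).

Lemma papp_derive (n : nat) (nu z : R) : 0 <= nu -> is_derive (papp n nu) z (dpapp n nu z).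
Proof.
  intros Hnu. pose proof (INR_S_pos n).
  apply (is_derive_ext (PSeries (fun k => bcoef nu k * fratio n k))).
  { intros t. rewrite papp_series. reflexivity. }
  replace (dpapp n nu z) with (PSeries (PS_derive (fun k => bcoef nu k * fratio n k)) z).
  - apply is_derive_PSeries. rewrite (CV_radius_finite (S n)); [ exact I | ].
    intros k Hk. unfold fratio. rewrite ffall_zero by auto. unfold Rdiv. ring.
  - unfold dpapp, Rdiv. rewrite Rmult_comm. rewrite <- Series_scal_l. unfold PSeries. apply Series_ext.
    intros k. unfold PS_derive. rewrite S_INR.
    replace ((INR k + 1) * (bcoef nu (S k) * fratio n (S k))) with ((INR k + 1) * bcoef nu (S k) * fratio n (S k)) by ring.
    rewrite bcoef_derive by auto. field. lra.
Qed.

Lemma dpapp_lim (nu z : R) : 0 <= nu -> is_lim_seq (fun n => dpapp n nu z) (bess (nu + 1) z / (4 * (nu + 1))).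
Proof.
  intros Hnu. unfold dpapp, Rdiv.
  apply (is_lim_seq_scal_r (fun n => Series (fun k => bcoef (nu + 1) k * fratio n (S k) * z ^ k)) _ (bess (nu + 1) z)).
  apply (tannery (fun n k => bcoef (nu + 1) k * fratio n (S k) * z ^ k) (fun k => bcoef (nu + 1) k * z ^ k) (fun k => bcoef (nu + 1) k * Rabs z ^ k)).
  - intros k. replace (bcoef (nu + 1) k * z ^ k) with (bcoef (nu + 1) k * 1 * z ^ k) by ring.
    apply (is_lim_seq_scal_r (fun n => bcoef (nu + 1) k * fratio n (S k)) (z ^ k) (bcoef (nu + 1) k * 1)).
    apply (is_lim_seq_scal_l (fun n => fratio n (S k)) (bcoef (nu + 1) k) 1). apply fratio_lim.
  - intros n k. rewrite !Rabs_mult, RPow_abs. pose proof (bcoef_pos (nu + 1) k ltac:(lra)). pose proof (fratio_bound n (S k)).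
    rewrite (Rabs_right (bcoef (nu + 1) k)), (Rabs_right (fratio n (S k))) by lra.
    apply Rmult_le_compat_r; [ apply Rabs_pos | nra ].
  - apply bess_Rabs_series; lra.
Qed.

(** The sum of the a_i is the derivative at 0, that is the coefficient of z, and [fratio n 1] = 1
    makes it independent of n. This uniform mass is the compactness input. Beyond the degree the a_i
    are set to 0. *)
Lemma papp_factored (n : nat) (nu : R) : 0 <= nu -> exists a : nat -> R,
  (forall k, 0 <= a k) /\ (forall i j, (i <= j)%nat -> a j <= a i) /\ (forall k, (n < k)%nat -> a k = 0) /\
  (forall z, papp n nu z = fprod (S n) (fun i => 1 + a i * z)) /\
  fsum (S n) a = / (4 * (nu + 1)).
Proof.
  intros Hnu. pose proof (INR_S_pos n) as Hn.
  destruct (lag_roots (S n) nu Hnu) as [r [Hr [Hinc Hf]]].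
  exists (fun i => if le_dec i n then / (4 * INR (S n) * r i) else 0).
  assert (Hp : forall i, (i <= n)%nat -> 0 < / (4 * INR (S n) * r i)).
  { intros i Hi. apply Rinv_0_lt_compat, Rmult_lt_0_compat; [ lra | apply Hr; lia ]. }
  assert (HF : forall z, papp n nu z = fprod (S n) (fun i => 1 + (if le_dec i n then / (4 * INR (S n) * r i) else 0) * z)).
  { intros z. unfold papp. rewrite Hf. apply fprod_ext. intros i Hi.
    destruct (le_dec i n); [ | lia ]. specialize (Hr i Hi). field. lra. }
  split; [ | split; [ | split; [ | split ] ] ]; auto.
  - intros k. destruct (le_dec k n); [ left; auto | lra ].
  - intros i j Hij. destruct (le_dec j n); destruct (le_dec i n); try lia; try lra.
    + destruct (Nat.eq_dec i j) as [-> | Hne]; [ lra | ].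
      assert (r i < r j) by (apply Hinc; lia). assert (0 < r i) by (apply Hr; lia).
      apply Rinv_le_contravar; [ apply Rmult_lt_0_compat; lra | apply Rmult_le_compat_l; lra ].
    + left; auto.
  - intros k Hk. destruct (le_dec k n); [ lia | auto ].
  - set (a := fun i => if le_dec i n then / (4 * INR (S n) * r i) else 0) in *.
    assert (D := papp_derive n nu 0 Hnu).
    assert (D2 := fprod_derive (S n) a 0 ltac:(intros; lra)).
    assert (D3 : is_derive (papp n nu) 0 (fprod (S n) (fun i => 1 + a i * 0) * fsum (S n) (fun i => a i / (1 + a i * 0)))).
    { eapply is_derive_ext; [ intros t; symmetry; apply HF | exact D2 ]. }
    assert (E := is_derive_unique _ _ _ D3). rewrite (is_derive_unique _ _ _ D) in E.
    assert (E1 : forall k, fprod k (fun i => 1 + a i * 0) = 1).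
    { induction k as [ | k IH]; cbn [fprod]; [ auto | rewrite IH; ring ]. }
    rewrite E1, Rmult_1_l in E.
    rewrite (fsum_ext _ _ a) in E by (intros; field).
    rewrite <- E. unfold dpapp. 
    replace (Series (fun k => bcoef (nu + 1) k * fratio n (S k) * 0 ^ k)) with 1; [ field; lra | ].
    change (1 = PSeries (fun k => bcoef (nu + 1) k * fratio n (S k)) 0).
    rewrite PSeries_0. rewrite fratio_S. unfold fratio, Rdiv. cbn [ffall pow bcoef]. change (INR 0) with 0. rewrite Rinv_1. ring.
Qed.

Lemma fsum_nonneg (n : nat) (f : nat -> R) : (forall i, (i < n)%nat -> 0 <= f i) -> 0 <= fsum n f.
Proof.
  induction n as [ | n IH]; intros H; simpl; [ lra | ]. apply Rplus_le_le_0_compat; auto.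
Qed.

(** For a decreasing sequence (k+1) a_k is at most the sum of the first k + 1 terms, hence at most
    s; the bound does not depend on the approximant. *)
Lemma fsum_decr_bound (a : nat -> R) (n : nat) (s : R) : (forall k, 0 <= a k) ->
  (forall i j, (i <= j)%nat -> a j <= a i) -> (forall k, (n <= k)%nat -> a k = 0) -> fsum n a = s ->
  (forall K, fsum K a <= s) /\ forall k, a k <= s / (INR k + 1).
Proof.
  intros H0 Hd Hz Hs.
  assert (Hmono : forall K, fsum K a <= s).
  { intros K. destruct (le_lt_dec K n) as [Hk | Hk].
    - rewrite <- Hs. induction Hk as [ | m Hk IH]; [ lra | ]. simpl.
      assert (Hm : forall p q, (p <= q)%nat -> fsum p a <= fsum q a).
      { intros p q Hpq. induction Hpq as [ | q Hpq IHq]; [ lra | ]. simpl. specialize (H0 q). lra. }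
      specialize (Hm K m Hk). specialize (H0 m). lra.
    - rewrite <- Hs. induction Hk as [ | m Hk IH]; simpl; [ rewrite Hz by lia; lra | ].
      rewrite (Hz m) by lia. lra. }
  split; auto. intros k.
  assert (H : INR (S k) * a k <= fsum (S k) a).
  { rewrite <- fsum_const. apply fsum_le. intros i Hi. apply Hd. lia. }
  specialize (Hmono (S k)). rewrite S_INR in H. pose proof (pos_INR k).
  apply (Rmult_le_reg_r (INR k + 1)); [ lra | ]. unfold Rdiv. rewrite Rmult_assoc, Rinv_l by lra. lra.
Qed.

Lemma ex_series_inv_sqr : ex_series (fun k => / (INR k + 1) ^ 2).
Proof.
  assert (H : ex_series (fun k => 2 * (/ (INR k + 1) - / (INR k + 2)))).
  { apply (ex_series_scal (K:=R_AbsRing) 2 (fun k => / (INR k + 1) - / (INR k + 2))).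
    exists 1. change (is_lim_seq (sum_n (fun k => / (INR k + 1) - / (INR k + 2))) 1).
    apply (is_lim_seq_ext (fun n => 1 - / INR (S (S n)))).
    - intros n. induction n as [ | n IH].
      + rewrite sum_O. simpl. field.
      + rewrite sum_Sn, <- IH. unfold plus; simpl (_ + _). 
        change (1 - / INR (S (S (S n))) = 1 - / INR (S (S n)) + (/ (INR (S n) + 1) - / (INR (S n) + 2))).
        rewrite !S_INR. replace (INR n + 1 + 2) with (INR n + 1 + 1 + 1) by ring. ring.
    - replace (Finite 1) with (Finite (1 - 0)) by (f_equal; ring).
      apply is_lim_seq_minus'; [ apply is_lim_seq_const | ].
      apply (is_lim_seq_ext (fun n => / INR (n + 2))); [ intros n; do 2 f_equal; lia | ].
      apply (is_lim_seq_incr_n (fun n => / INR n) 2).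
      apply (is_lim_seq_inv INR p_infty); [ apply is_lim_seq_INR | discriminate ]. }
  apply (ex_series_le (K:=R_AbsRing) (V:=R_CompleteNormedModule)) with (2 := H).
  intros k. pose proof (pos_INR k).
  change (Rabs (/ (INR k + 1) ^ 2) <= 2 * (/ (INR k + 1) - / (INR k + 2))).
  rewrite Rabs_right by (left; apply Rinv_0_lt_compat, pow_lt; lra).
  replace (2 * (/ (INR k + 1) - / (INR k + 2))) with (/ ((INR k + 1) * (INR k + 2) / 2)) by (field; lra).
  apply Rinv_le_contravar; nra.
Qed.

Lemma fsum_Series (n : nat) (a : nat -> R) : (forall k, (n <= k)%nat -> a k = 0) -> Series a = fsum n a.
Proof.
  intros H. apply is_series_unique.
  apply filterlim_ext_loc with (fun _ => fsum n a); [ | apply filterlim_const ].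
  exists n. intros m Hm.
  assert (E : forall m, sum_n a m = fsum (S m) a).
  { clear. induction m as [ | m IH]; [ rewrite sum_O; simpl; ring | rewrite sum_Sn, IH; reflexivity ]. }
  rewrite E. induction Hm as [ | m Hm IH]; [ simpl; rewrite H by lia; ring | ].
  rewrite IH. change (fsum (S (S m)) a) with (fsum (S m) a + a (S m)). rewrite (H (S m)) by lia. ring.
Qed.

Lemma fprod_lim (K : nat) (u : nat -> nat -> R) (l : nat -> R) :
  (forall k, is_lim_seq (fun n => u n k) (l k)) -> is_lim_seq (fun n => fprod K (u n)) (fprod K l).
Proof.
  intros H. induction K as [ | K IH]; simpl; [ apply is_lim_seq_const | ].
  apply (is_lim_seq_mult' (fun n => fprod K (u n)) (fun n => u n K)); auto.
Qed.

Lemma fsum_lim (K : nat) (u : nat -> nat -> R) (l : nat -> R) :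
  (forall k, is_lim_seq (fun n => u n k) (l k)) -> is_lim_seq (fun n => fsum K (u n)) (fsum K l).
Proof.
  intros H. induction K as [ | K IH]; simpl; [ apply is_lim_seq_const | ].
  apply (is_lim_seq_plus' (fun n => fsum K (u n)) (fun n => u n K)); auto.
Qed.

(** The lower bound rests on e^{-2t} <= 1 - t for 0 <= t <= 1/2. It keeps the tail of a product away
    from 0, whatever the number of factors. *)
Lemma fprod_exp_bounds (m : nat) (x : nat -> R) : (forall i, (i < m)%nat -> Rabs (x i) <= 1 / 2) ->
  exp (- (2 * fsum m (fun i => Rabs (x i)))) <= fprod m (fun i => 1 + x i) <= exp (fsum m (fun i => Rabs (x i))).
Proof.
  induction m as [ | m IH]; intros H; simpl.
  - rewrite Rmult_0_r, Ropp_0, exp_0. lra.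
  - destruct IH as [I1 I2]; [ intros; apply H; lia | ].
    specialize (H m ltac:(lia)).
    assert (Hb := Rabs_le_between (x m) (Rabs (x m))). destruct Hb as [Hb _]. specialize (Hb (Rle_refl _)).
    rewrite exp_plus. replace (- (2 * (fsum m (fun i => Rabs (x i)) + Rabs (x m))))
      with (- (2 * fsum m (fun i => Rabs (x i))) + - (2 * Rabs (x m))) by ring.
    rewrite exp_plus. pose proof (exp_pos (- (2 * fsum m (fun i => Rabs (x i))))).
    pose proof (exp_pos (- (2 * Rabs (x m)))).
    assert (L : exp (- (2 * Rabs (x m))) <= 1 - Rabs (x m)).
    { rewrite exp_Ropp. assert (E := exp_ineq1_le (2 * Rabs (x m))). pose proof (Rabs_pos (x m)).
      apply Rle_trans with (/ (1 + 2 * Rabs (x m))); [ apply Rinv_le_contravar; lra | ].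
      apply (Rmult_le_reg_r (1 + 2 * Rabs (x m))); [ lra | ]. rewrite Rinv_l by lra. nra. }
    assert (U := exp_ineq1_le (Rabs (x m))).
    split; apply Rmult_le_compat; lra.
Qed.

Definition bsum (nu : R) : R := / (4 * (nu + 1)).

(** What survives the limit unconditionally. The sum of [al] may drop below [bsum], and an [al k]
    may vanish, so the logarithmic derivative keeps [bsum] as its constant and the product keeps an
    unspecified positive remainder. [hadamard_genus_0] and [hadamard_infinite] remove both
    defects. *)
Record hadamard_seq (nu : R) (al : nat -> R) : Prop := {
  hs_pos : forall k, 0 <= al k;
  hs_decr : forall i j, (i <= j)%nat -> al j <= al i;
  hs_bound : forall k, al k <= bsum nu / (INR k + 1);
  hs_sum : forall K, fsum K al <= bsum nu;
  hs_logder : forall z, 0 <= z ->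
    bess (nu + 1) z / (4 * (nu + 1)) / bess nu z = bsum nu - z * Series (fun k => al k ^ 2 / (1 + al k * z));
  hs_prod : forall z K, bsum nu * Rabs z / (INR K + 1) <= 1 / 2 -> exists rho,
    0 < rho <= exp (bsum nu * Rabs z) /\ bess nu z = fprod K (fun i => 1 + al i * z) * rho }.

Lemma hadamard_exists (nu : R) : 0 <= nu -> exists al, hadamard_seq nu al.
Proof.
  intros Hnu. set (s := bsum nu).
  assert (Hs : 0 < s) by (apply Rinv_0_lt_compat; lra).
  assert (Hch : forall n, exists a : nat -> R,
    (forall k, 0 <= a k) /\ (forall i j, (i <= j)%nat -> a j <= a i) /\ (forall k, (S n <= k)%nat -> a k = 0) /\
    (forall z, papp n nu z = fprod (S n) (fun i => 1 + a i * z)) /\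
    (forall K, fsum K a <= s) /\ (forall k, a k <= s / (INR k + 1)) /\ fsum (S n) a = s).
  { intros n. destruct (papp_factored n nu Hnu) as [a [H1 [H2 [H3 [H4 H5]]]]].
    destruct (fsum_decr_bound a (S n) s H1 H2 H3 H5) as [H6 H7]. exists a. repeat split; auto. }
  set (u := fun n => proj1_sig (constructive_indefinite_description _ (Hch n))).
  assert (Hu : forall n, (forall k, 0 <= u n k) /\ (forall i j, (i <= j)%nat -> u n j <= u n i) /\
    (forall k, (S n <= k)%nat -> u n k = 0) /\
    (forall z, papp n nu z = fprod (S n) (fun i => 1 + u n i * z)) /\
    (forall K, fsum K (u n) <= s) /\ (forall k, u n k <= s / (INR k + 1)) /\ fsum (S n) (u n) = s).
  { intros n. unfold u. destruct (constructive_indefinite_description _ (Hch n)). auto. }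
  destruct (diagonal_extraction u (fun k => s / (INR k + 1))) as [al [phi Hphi]].
  { intros n k. split; apply Hu. }
  assert (Hlim := fun k => proj1 (Hphi k)).
  assert (Hphi2 : forall n, (n <= phi n)%nat) by (apply (Hphi 0%nat)).
  assert (Hsub : forall (x : nat -> R) l, is_lim_seq x l -> is_lim_seq (fun n => x (phi n)) l).
  { intros x l Hx. apply is_lim_seq_spec in Hx. apply is_lim_seq_spec.
    assert (Hev : filterlim phi eventually eventually).
    { intros P [N HN]. exists N. intros n Hn. apply HN. specialize (Hphi2 n). lia. }
    apply is_lim_seq_spec in Hx. apply is_lim_seq_spec. 
    apply (filterlim_comp _ _ _ phi x _ _ _ Hev Hx). }
  assert (Hal0 : forall k, 0 <= al k).
  { intros k. apply (is_lim_seq_le (fun _ => 0) (fun n => u (phi n) k) 0 (al k)); auto.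
    - intros n. apply Hu. 
    - apply is_lim_seq_const. }
  assert (Halb : forall k, al k <= s / (INR k + 1)).
  { intros k. apply (is_lim_seq_le (fun n => u (phi n) k) (fun _ => s / (INR k + 1)) (al k) (s / (INR k + 1))); auto.
    - intros n. apply Hu. 
    - apply is_lim_seq_const. }
  exists al. split; fold s; auto.
  - intros i j Hij. apply (is_lim_seq_le (fun n => u (phi n) j) (fun n => u (phi n) i) (al j) (al i)); auto.
    intros n. apply Hu; auto.
  - intros K. apply (is_lim_seq_le (fun n => fsum K (u (phi n))) (fun _ => s) (fsum K al) s); auto.
    + intros n. apply Hu.
    + apply (fsum_lim K (fun n => u (phi n)) al); auto.
    + apply is_lim_seq_const.
  - intros z Hz.
    (* Termwise limits of the sum of u_k/(1 + u_k z) are not dominated, since only u_k <= s/(k+1) is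
       known. Subtracting the exact mass s leaves squares, dominated by s^2/(k+1)^2. *)
    assert (HT : is_lim_seq (fun n => s - z * Series (fun k => u (phi n) k ^ 2 / (1 + u (phi n) k * z)))
       (s - z * Series (fun k => al k ^ 2 / (1 + al k * z)))).
    { apply is_lim_seq_minus'; [ apply is_lim_seq_const | ].
      apply (is_lim_seq_scal_l _ z (Series (fun k => al k ^ 2 / (1 + al k * z)))).
      apply (tannery (fun n k => u (phi n) k ^ 2 / (1 + u (phi n) k * z)) _ (fun k => s ^ 2 * / (INR k + 1) ^ 2)).
      - intros k. assert (0 <= al k * z) by (apply Rmult_le_pos; auto).
        apply is_lim_seq_div'; [ | | lra ].
        + simpl. apply is_lim_seq_mult'; auto. apply is_lim_seq_mult'; auto. apply is_lim_seq_const.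
        + apply is_lim_seq_plus'; [ apply is_lim_seq_const | ]. apply is_lim_seq_mult'; auto. apply is_lim_seq_const.
      - intros n k. destruct (Hu (phi n)) as (h1&_&_&_&_&h6&_). specialize (h1 k). specialize (h6 k).
        assert (0 <= u (phi n) k * z) by (apply Rmult_le_pos; auto).
        rewrite Rabs_right.
        2: { apply Rle_ge, Rdiv_le_0_compat; [ apply pow2_ge_0 | lra ]. }
        apply Rle_trans with (u (phi n) k ^ 2).
        + apply (Rmult_le_reg_r (1 + u (phi n) k * z)); [ lra | ].
          unfold Rdiv. rewrite Rmult_assoc, Rinv_l by lra. pose proof (pow2_ge_0 (u (phi n) k)). nra.
        + rewrite <- pow_inv, <- Rpow_mult_distr. apply pow_incr. split; auto.
      - apply (ex_series_scal (K:=R_AbsRing) (s ^ 2) (fun k => / (INR k + 1) ^ 2)). apply ex_series_inv_sqr. }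
    assert (HL : is_lim_seq (fun n => dpapp (phi n) nu z / papp (phi n) nu z)
       (bess (nu + 1) z / (4 * (nu + 1)) / bess nu z)).
    { pose proof (bess_ge_1 nu z Hnu Hz). apply is_lim_seq_div'; [ | | lra ].
      - apply (Hsub (fun n => dpapp n nu z)), dpapp_lim; auto.
      - apply (Hsub (fun n => papp n nu z)), papp_lim; auto. }
    assert (HE : forall n, dpapp n nu z / papp n nu z = s - z * Series (fun k => u n k ^ 2 / (1 + u n k * z))).
    { intros n. destruct (Hu n) as (h1&h2&h3&h4&h5&h6&h7).
      assert (Hp : forall i, 0 < 1 + u n i * z) by (intros i; specialize (h1 i); nra).
      assert (D := papp_derive n nu z Hnu).
      assert (D2 := fprod_derive (S n) (u n) z ltac:(intros i _; specialize (Hp i); lra)).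
      assert (D3 : is_derive (papp n nu) z (fprod (S n) (fun i => 1 + u n i * z) * fsum (S n) (fun i => u n i / (1 + u n i * z)))).
      { eapply is_derive_ext; [ intros t; symmetry; apply h4 | exact D2 ]. }
      assert (E := is_derive_unique _ _ _ D3). rewrite (is_derive_unique _ _ _ D) in E.
      rewrite E, h4.
      assert (P0 : 0 < fprod (S n) (fun i => 1 + u n i * z)) by (apply fprod_pos; auto).
      rewrite (fsum_Series (S n)).
      2: { intros k Hk. rewrite h3 by auto. simpl. unfold Rdiv. ring. }
      assert (Es : fsum (S n) (u n) = fsum (S n) (fun i => u n i / (1 + u n i * z)) + z * fsum (S n) (fun i => u n i ^ 2 / (1 + u n i * z))).
      { rewrite <- (fsum_scal (S n) z), <- fsum_plus. apply fsum_ext. intros i _. specialize (Hp i). field. lra. }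
      rewrite h7 in Es. rewrite Es. field. lra. }
    assert (HL2 : is_lim_seq (fun n => dpapp (phi n) nu z / papp (phi n) nu z) (s - z * Series (fun k => al k ^ 2 / (1 + al k * z)))).
    { apply (is_lim_seq_ext (fun n => s - z * Series (fun k => u (phi n) k ^ 2 / (1 + u (phi n) k * z)))); [ intros n; rewrite HE; reflexivity | exact HT ]. }
    apply is_lim_seq_unique in HL. apply is_lim_seq_unique in HL2. rewrite HL in HL2. injection HL2. auto.
  - intros z K HK.
    set (w := s * Rabs z) in *. assert (Hw : 0 <= w) by (apply Rmult_le_pos; [ lra | apply Rabs_pos ]).
    (* The shift by K makes the degree of every approximant at least K, so K factors can be split
       off. *)
    assert (HR : forall n, exists r, exp (- (2 * w)) <= r <= exp w /\
       papp (phi (n + K)%nat) nu z = fprod K (fun i => 1 + u (phi (n + K)%nat) i * z) * r).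
    { intros n. set (N := phi (n + K)%nat).
      assert (HN : (K <= N)%nat) by (specialize (Hphi2 (n + K)%nat); unfold N; lia).
      destruct (Hu N) as (h1&h2&h3&h4&h5&h6&h7).
      set (m := (S N - K)%nat).
      exists (fprod m (fun j => 1 + u N (K + j)%nat * z)).
      assert (Esum : fsum m (fun j => Rabs (u N (K + j)%nat * z)) <= w).
      { assert (E : forall p, fsum p (fun j => u N (K + j)%nat) = fsum (K + p) (u N) - fsum K (u N)).
        { induction p as [ | p IH]; [ rewrite Nat.add_0_r; simpl; ring | ].
          rewrite Nat.add_succ_r. simpl. rewrite IH. ring. }
        rewrite (fsum_ext _ _ (fun j => Rabs z * u N (K + j)%nat)).
        2: { intros j _. rewrite Rabs_mult, (Rabs_right (u N _)); [ ring | apply Rle_ge, h1 ]. }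
        rewrite fsum_scal, E. unfold w. rewrite Rmult_comm.
        apply Rmult_le_compat_r; [ apply Rabs_pos | ].
        specialize (h5 (K + m)%nat).
        assert (0 <= fsum K (u N)); [ | lra ].
        apply fsum_nonneg. intros i _. apply h1. }
      split.
      - assert (B := fprod_exp_bounds m (fun j => u N (K + j)%nat * z)).
        destruct B as [B1 B2].
        + intros j Hj. rewrite Rabs_mult, (Rabs_right (u N _)) by (apply Rle_ge, h1).
          eapply Rle_trans; [ | exact HK ]. unfold Rdiv, w. rewrite (Rmult_comm s), Rmult_assoc, (Rmult_comm (Rabs z)).
          apply Rmult_le_compat_r; [ apply Rabs_pos | ].
          eapply Rle_trans; [ apply (h2 K (K + j)%nat); lia | apply h6 ].
        + split; eapply Rle_trans; try eassumption; apply exp_le_compat; lra.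
      - rewrite h4. replace (S N) with (K + m)%nat by (unfold m; lia).
        generalize m. clear. intros m. induction m as [ | m IH]; [ rewrite Nat.add_0_r; simpl; ring | ].
        rewrite Nat.add_succ_r. simpl. rewrite IH. ring. }
    assert (L1 : is_lim_seq (fun n => papp (phi (n + K)%nat) nu z) (bess nu z)).
    { apply (is_lim_seq_incr_n (fun n => papp (phi n) nu z)). apply (Hsub (fun n => papp n nu z)), papp_lim; auto. }
    assert (L2 : is_lim_seq (fun n => fprod K (fun i => 1 + u (phi (n + K)%nat) i * z)) (fprod K (fun i => 1 + al i * z))).
    { apply (is_lim_seq_incr_n (fun n => fprod K (fun i => 1 + u (phi n) i * z))).
      apply (fprod_lim K (fun n i => 1 + u (phi n) i * z)). intros k.
      apply is_lim_seq_plus'; [ apply is_lim_seq_const | ]. apply is_lim_seq_mult'; auto. apply is_lim_seq_const. }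
    pose proof (exp_pos (- (2 * w))) as He1. pose proof (exp_pos w) as He2.
    destruct (Req_dec (fprod K (fun i => 1 + al i * z)) 0) as [E0 | E0].
    (* When one of the K limit factors vanishes, the bounded remainders force [bess nu z] = 0 and
       any admissible rho will do. *)
    + exists (exp w). split; [ lra | ]. rewrite E0, Rmult_0_l.
      rewrite E0 in L2.
      assert (L3 : is_lim_seq (fun n => papp (phi (n + K)%nat) nu z) 0).
      { apply is_lim_seq_abs_0.
        apply (is_lim_seq_le_le (fun _ => 0) _ (fun n => exp w * Rabs (fprod K (fun i => 1 + u (phi (n + K)%nat) i * z)))).
        - intros n. split; [ apply Rabs_pos | ]. destruct (HR n) as [r [Hr ->]].
          rewrite Rabs_mult, (Rabs_right r), Rmult_comm by lra.
          apply Rmult_le_compat_r; [ apply Rabs_pos | lra ].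
        - apply is_lim_seq_const.
        - replace (Finite 0) with (Rbar_mult (exp w) 0) by (simpl; f_equal; ring).
          apply is_lim_seq_scal_l. apply (proj1 (is_lim_seq_abs_0 _)). exact L2. }
      apply is_lim_seq_unique in L1. apply is_lim_seq_unique in L3. rewrite L1 in L3. injection L3. auto.
    + exists (bess nu z / fprod K (fun i => 1 + al i * z)).
      split; [ | field; auto ].
      assert (L3 : is_lim_seq (fun n => papp (phi (n + K)%nat) nu z / fprod K (fun i => 1 + u (phi (n + K)%nat) i * z))
        (bess nu z / fprod K (fun i => 1 + al i * z))) by (apply is_lim_seq_div'; auto).
      assert (Hev : exists N, forall n, (N <= n)%nat -> fprod K (fun i => 1 + u (phi (n + K)%nat) i * z) <> 0).
      { destruct (proj2 (is_lim_seq_spec _ _) L2 (mkposreal _ (Rabs_pos_lt _ E0))) as [N HN]. simpl in HN.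
        exists N. intros n Hn E. specialize (HN n Hn). rewrite E in HN.
        rewrite Rminus_0_l, Rabs_Ropp in HN. lra. }
      destruct Hev as [N HN].
      assert (Hb : forall n, (N <= n)%nat -> exp (- (2 * w)) <= papp (phi (n + K)%nat) nu z / fprod K (fun i => 1 + u (phi (n + K)%nat) i * z) <= exp w).
      { intros n Hn. destruct (HR n) as [r [Hr ->]]. specialize (HN n Hn).
        replace (fprod K (fun i => 1 + u (phi (n + K)%nat) i * z) * r / fprod K (fun i => 1 + u (phi (n + K)%nat) i * z)) with r by (field; auto).
        auto. }
      split.
      * apply Rlt_le_trans with (exp (- (2 * w))); auto.
        apply (is_lim_seq_le_loc (fun _ => exp (- (2 * w))) _ (exp (- (2 * w))) _ (ex_intro _ N (fun n Hn => proj1 (Hb n Hn)))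
          (is_lim_seq_const _) L3).
      * apply (is_lim_seq_le_loc _ (fun _ => exp w) _ (exp w) (ex_intro _ N (fun n Hn => proj2 (Hb n Hn))) L3 (is_lim_seq_const _)).
Qed.

(** * Asymptotic expansion of the logarithmic derivative *)

Definition theta (nu v : R) : R := exp v * (bess (nu + 1) (exp v) / (4 * (nu + 1))) / bess nu (exp v).

Lemma bess_exp_pos (nu v : R) : 0 <= nu -> 0 < bess nu (exp v).
Proof. intros H. pose proof (bess_ge_1 nu (exp v) H (Rlt_le _ _ (exp_pos v))). lra. Qed.

Lemma theta_pos (nu v : R) : 0 <= nu -> 0 < theta nu v.
Proof.
  intros H. pose proof (bess_exp_pos nu v H). pose proof (bess_exp_pos (nu + 1) v ltac:(lra)).
  apply Rdiv_lt_0_compat; auto. apply Rmult_lt_0_compat; [ apply exp_pos | apply Rdiv_lt_0_compat; lra ].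
Qed.

Lemma bess_exp_derive (nu v : R) : 0 <= nu ->
  is_derive (fun v => bess nu (exp v)) v (exp v * (bess (nu + 1) (exp v) / (4 * (nu + 1)))).
Proof.
  intros H. apply (is_derive_comp (bess nu) exp); [ apply bess_derive; auto | ].
  auto_derive; auto. ring.
Qed.

Lemma is_derive_div_R (f g : R -> R) (x df dg : R) : is_derive f x df -> is_derive g x dg -> g x <> 0 ->
  is_derive (fun t => f t / g t) x ((df * g x - f x * dg) / g x ^ 2).
Proof. intros Hf Hg H. apply is_derive_div; auto. Qed.

(** The quotient rule brings in [bess (nu + 2)], which the contiguous relation expresses by the two
    lower orders. *)
Lemma theta_derive (nu v : R) : 0 <= nu ->
  is_derive (theta nu) v (exp v / 4 - nu * theta nu v - theta nu v ^ 2).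
Proof.
  intros H.
  assert (H0 := bess_exp_pos nu v H).
  assert (Hc := bess_contiguous nu (exp v) H).
  assert (D0 := bess_exp_derive nu v H).
  assert (D1 := bess_exp_derive (nu + 1) v ltac:(lra)).
  assert (D2 : is_derive (fun v => exp v * (bess (nu + 1) (exp v) / (4 * (nu + 1)))) v
     (exp v * (bess (nu + 1) (exp v) / (4 * (nu + 1))) +
      exp v * (exp v * (bess (nu + 1 + 1) (exp v) / (4 * (nu + 1 + 1))) / (4 * (nu + 1))))).
  { apply (is_derive_mult exp (fun v => bess (nu + 1) (exp v) / (4 * (nu + 1)))).
    - auto_derive; auto. ring.
    - apply (is_derive_ext (fun v => / (4 * (nu + 1)) * bess (nu + 1) (exp v))); [ intros t; apply Rmult_comm | ].
      replace (exp v * (bess (nu + 1 + 1) (exp v) / (4 * (nu + 1 + 1))) / (4 * (nu + 1)))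
        with (/ (4 * (nu + 1)) * (exp v * (bess (nu + 1 + 1) (exp v) / (4 * (nu + 1 + 1))))) by apply Rmult_comm.
      apply is_derive_scal. exact D1.
    - intros; apply Rmult_comm. }
  assert (D := is_derive_div_R _ _ v _ _ D2 D0 ltac:(lra)).
  replace (nu + 1 + 1) with (nu + 2) in D by ring.
  eapply is_derive_ext in D; [ | intros t; reflexivity ].
  replace (exp v / 4 - nu * theta nu v - theta nu v ^ 2) with
   (((exp v * (bess (nu + 1) (exp v) / (4 * (nu + 1))) +
      exp v * (exp v * (bess (nu + 2) (exp v) / (4 * (nu + 2))) / (4 * (nu + 1)))) * bess nu (exp v) -
     exp v * (bess (nu + 1) (exp v) / (4 * (nu + 1))) * (exp v * (bess (nu + 1) (exp v) / (4 * (nu + 1))))) /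
    bess nu (exp v) ^ 2); [ exact D | ].
  unfold theta.
  set (g0 := bess nu (exp v)) in *. set (g1 := bess (nu + 1) (exp v)) in *. set (g2 := bess (nu + 2) (exp v)) in *.
  set (e := exp v) in *.
  assert (E : e * g2 = (g0 - g1) * (4 * (nu + 1) * (nu + 2))) by (rewrite Hc; field; lra).
  replace (e * (e * (g2 / (4 * (nu + 2))) / (4 * (nu + 1)))) with (e * ((e * g2) / (4 * (nu + 2)) / (4 * (nu + 1)))) by (field; lra).
  rewrite E. field. lra.
Qed.

Lemma theta_continuous (nu v : R) : 0 <= nu -> continuous (theta nu) v.
Proof. intros H. apply (ex_derive_continuous (V:=R_NormedModule)). eexists. apply theta_derive; auto. Qed.

(** The contiguous relation shows bess (nu+1) <= bess nu on the positive axis. The resulting decay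
    e^v at -oo makes the reflected transform converge for Re s < 1. *)
Lemma theta_le_exp (nu v : R) : 0 <= nu -> theta nu v <= exp v * (/ (4 * (nu + 1))).
Proof.
  intros H. unfold theta.
  assert (Hc := bess_contiguous nu (exp v) H).
  pose proof (bess_exp_pos nu v H). pose proof (bess_exp_pos (nu + 1) v ltac:(lra)).
  pose proof (bess_exp_pos (nu + 2) v ltac:(lra)). pose proof (exp_pos v).
  assert (0 <= exp v * bess (nu + 2) (exp v) / (4 * (nu + 1) * (nu + 2))).
  { apply Rdiv_le_0_compat; [ | apply Rmult_lt_0_compat; lra ]. apply Rmult_le_pos; lra. }
  apply (Rmult_le_reg_r (bess nu (exp v))); auto.
  unfold Rdiv at 1. rewrite Rmult_assoc, Rinv_l, Rmult_1_r by lra. rewrite Rmult_assoc.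
  apply Rmult_le_compat_l; [ lra | ]. unfold Rdiv. rewrite Rmult_comm.
  apply Rmult_le_compat_l; [ left; apply Rinv_0_lt_compat; lra | ]. lra.
Qed.

Lemma theta_neg_bounded (nu : R) : 0 <= nu -> exp_bounded (fun v => theta nu (- v)) (/ (4 * (nu + 1))) 1.
Proof.
  intros H. split; [ intros; apply continuous_reflect; intros; apply theta_continuous; auto | ].
  split; [ left; apply Rinv_0_lt_compat; lra | ]. intros u _.
  rewrite Rabs_right by (left; apply theta_pos; auto).
  rewrite Rmult_1_l, Rmult_comm. apply theta_le_exp; auto.
Qed.

Fixpoint peval (l : list R) (y : R) : R := match l with nil => 0 | a :: l' => a + y * peval l' y end.
Fixpoint poly_add (l m : list R) : list R := match l, m with
  | nil, _ => m | _, nil => l | a :: l', b :: m' => (a + b) :: poly_add l' m' end.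
Fixpoint pmono (n : nat) (c : R) : list R := match n with O => c :: nil | S n' => 0 :: pmono n' c end.

Lemma peval_add (l m : list R) (y : R) : peval (poly_add l m) y = peval l y + peval m y.
Proof.
  revert m. induction l as [ | a l IH]; intros [ | b m]; simpl; try ring. rewrite IH. ring.
Qed.

Lemma peval_scal (c : R) (l : list R) (y : R) : peval (map (Rmult c) l) y = c * peval l y.
Proof. induction l as [ | a l IH]; simpl; [ ring | rewrite IH; ring ]. Qed.

Lemma peval_mono (n : nat) (c y : R) : peval (pmono n c) y = c * y ^ n.
Proof. induction n as [ | n IH]; simpl; [ ring | rewrite IH; ring ]. Qed.

Lemma peval_bounded (l : list R) : exists M, 0 <= M /\ forall y, 0 <= y <= 1 -> Rabs (peval l y) <= M.
Proof.
  induction l as [ | a l [M [HM IH]]].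
  - exists 0. split; [ lra | ]. intros; simpl. rewrite Rabs_R0. lra.
  - exists (Rabs a + M). split; [ pose proof (Rabs_pos a); lra | ]. intros y Hy. simpl.
    eapply Rle_trans; [ apply Rabs_triang | ]. apply Rplus_le_compat_l.
    rewrite Rabs_mult, (Rabs_right y) by lra. specialize (IH y Hy). pose proof (Rabs_pos (peval l y)). nra.
Qed.

(* With y = e^{-v/2} and theta = P(y)/(2y), the Riccati equation theta' = e^v/4 - nu theta - theta^2 becomes
   - y^2 P' + P^2 + (2nu+1) y P = 1.  expst holds the pair (P1, Q) where P = 1 + y P1 is the partial sum of
   order N and its residual is y^(N+1) Q. *)
Fixpoint expst (nu : R) (N : nat) : list R * list R := match N with
  | O => (nil, (2 * nu + 1) :: nil)
  | S n => let P1 := fst (expst nu n) in let Q := snd (expst nu n) in let c := - hd 0 Q / 2 in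
     (poly_add P1 (pmono n c),
      poly_add (tl Q) (poly_add (map (Rmult (2 * c)) P1) (poly_add (pmono n (c ^ 2)) (((2 * nu + 1) * c - INR (S n) * c) :: nil))))
  end.

(** Adding c y^{N+1} to P changes the residual by 2c y^{N+1} to leading order, so c = -Q(0)/2 raises
    its order by one. *)
Definition expc (nu : R) (j : nat) : R := match j with O => 1 | S n => - hd 0 (snd (expst nu n)) / 2 end.

Definition expP (nu : R) (N : nat) (y : R) : R := fsum (S N) (fun j => expc nu j * y ^ j).
(** This is y^2 P'(y). *)
Definition expD (nu : R) (N : nat) (y : R) : R := fsum (S N) (fun j => INR j * expc nu j * y ^ (S j)).

Lemma expc_1 (nu : R) : expc nu 1 = - (2 * nu + 1) / 2.
Proof. reflexivity. Qed.

Lemma expst_P (nu : R) (N : nat) (y : R) : expP nu N y = 1 + y * peval (fst (expst nu N)) y.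
Proof.
  induction N as [ | N IH].
  - unfold expP. simpl. ring.
  - change (expP nu (S N) y) with (expP nu N y + expc nu (S N) * y ^ S N). rewrite IH.
    cbn [expst fst]. rewrite peval_add, peval_mono. unfold expc. simpl. ring.
Qed.

Lemma expst_Q (nu : R) (N : nat) (y : R) :
  - expD nu N y + expP nu N y ^ 2 + (2 * nu + 1) * y * expP nu N y - 1 = y ^ S N * peval (snd (expst nu N)) y.
Proof.
  induction N as [ | N IH].
  - unfold expP, expD. simpl. ring.
  - change (expD nu (S N) y) with (expD nu N y + INR (S N) * expc nu (S N) * y ^ S (S N)).
    change (expP nu (S N) y) with (expP nu N y + expc nu (S N) * y ^ S N).
    set (c := expc nu (S N)).
    replace (- (expD nu N y + INR (S N) * c * y ^ S (S N)) + (expP nu N y + c * y ^ S N) ^ 2 +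
       (2 * nu + 1) * y * (expP nu N y + c * y ^ S N) - 1)
     with ((- expD nu N y + expP nu N y ^ 2 + (2 * nu + 1) * y * expP nu N y - 1)
       + (2 * c * y ^ S N * expP nu N y + c ^ 2 * y ^ S N * y ^ S N + ((2 * nu + 1) * c - INR (S N) * c) * y ^ S (S N)))
     by (cbn [pow]; ring).
    rewrite IH, expst_P. cbn [expst snd]. rewrite !peval_add, peval_scal, peval_mono.
    fold (expc nu (S N)). change (- hd 0 (snd (expst nu N)) / 2) with c.
    assert (Hc : hd 0 (snd (expst nu N)) = - (2 * c)).
    { unfold c, expc. field. }
    assert (HQ : peval (snd (expst nu N)) y = - (2 * c) + y * peval (tl (snd (expst nu N))) y).
    { rewrite <- Hc. destruct (snd (expst nu N)); simpl; ring. }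
    rewrite HQ. cbn [peval pow]. fold c. ring.
Qed.

(** P(y)/(2y) at y = e^{-v/2}. The j-th term is an exponential of rate (j-1)/2, whose transform has
    its only pole at s = (1-j)/2. *)
Definition thetaN (nu : R) (N : nat) (v : R) : R :=
  fsum (S N) (fun j => expc nu j / 2 * exp (- ((INR j - 1) / 2 * v))).

Definition dthetaN (nu : R) (N : nat) (v : R) : R :=
  fsum (S N) (fun j => expc nu j / 2 * (- ((INR j - 1) / 2) * exp (- ((INR j - 1) / 2 * v)))).

Lemma thetaN_derive (nu : R) (N : nat) (v : R) : is_derive (thetaN nu N) v (dthetaN nu N v).
Proof.
  unfold thetaN, dthetaN. generalize (S N). clear N. intros N. induction N as [ | N IH]; cbn [fsum].
  - apply (is_derive_const (K:=R_AbsRing) (V:=R_NormedModule)).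
  - apply (is_derive_plus (fun v => fsum N (fun j => expc nu j / 2 * exp (- ((INR j - 1) / 2 * v)))) (fun v => expc nu N / 2 * exp (- ((INR N - 1) / 2 * v)))); auto.
    auto_derive; auto. ring.
Qed.

Lemma exp_pow (x : R) (n : nat) : exp x ^ n = exp (INR n * x).
Proof.
  induction n as [ | n IH]; [ simpl; rewrite Rmult_0_l, exp_0; auto | ].
  rewrite S_INR. simpl. rewrite IH, <- exp_plus. f_equal. ring.
Qed.

Lemma thetaN_residual (nu : R) (N : nat) (v : R) : 
  dthetaN nu N v + thetaN nu N v ^ 2 + nu * thetaN nu N v - exp v / 4 =
  exp (- ((INR N - 1) / 2 * v)) * peval (snd (expst nu N)) (exp (- (v / 2))) / 4.
Proof.
  set (y := exp (- (v / 2))).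
  assert (Hy : 0 < y) by apply exp_pos.
  assert (Hexp : forall j, exp (- ((INR j - 1) / 2 * v)) = y ^ j / y).
  { intros j. unfold y. rewrite exp_pow. unfold Rdiv at 2. rewrite <- exp_Ropp, <- exp_plus. f_equal. field. }
  assert (Hev : exp v = / y ^ 2).
  { unfold y. rewrite exp_pow, <- exp_Ropp. f_equal. simpl. field. }
  assert (E1 : thetaN nu N v = expP nu N y / (2 * y)).
  { transitivity (/ (2 * y) * expP nu N y); [ | field; lra ].
    unfold thetaN, expP. rewrite <- fsum_scal. apply fsum_ext. intros j _. rewrite Hexp. field. lra. }
  assert (E2 : dthetaN nu N v = (- expD nu N y + y * expP nu N y) / (4 * y ^ 2)).
  { transitivity (/ (4 * y ^ 2) * (- expD nu N y + y * expP nu N y)); [ | field; lra ].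
    unfold dthetaN, expP, expD.
    replace (- fsum (S N) (fun j => INR j * expc nu j * y ^ S j) + y * fsum (S N) (fun j => expc nu j * y ^ j))
      with (-1 * fsum (S N) (fun j => INR j * expc nu j * y ^ S j) + y * fsum (S N) (fun j => expc nu j * y ^ j)) by ring.
    rewrite <- (fsum_scal _ (-1)), <- (fsum_scal _ y), <- fsum_plus, <- fsum_scal.
    apply fsum_ext. intros j _. rewrite Hexp. simpl. field. lra. }
  assert (R := expst_Q nu N y).
  rewrite E1, E2, Hev, Hexp. fold y.
  replace (y ^ N / y * peval (snd (expst nu N)) y / 4) with ((y ^ S N * peval (snd (expst nu N)) y) / (4 * y ^ 2)) by (simpl; field; lra).
  rewrite <- R. field. lra.
Qed.

Lemma thetaN_large (nu : R) (N : nat) (B : R) : exists v0, 0 <= v0 /\ forall v, v0 <= v -> B <= thetaN nu N v.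
Proof.
  set (M := fsum (S N) (fun j => Rabs (expc nu j))).
  assert (H : forall v, 0 <= v -> exp (v / 2) / 2 - M <= thetaN nu N v).
  { intros v Hv. unfold thetaN, M. clear M.
    induction N as [ | N IH].
    - cbn [fsum expc]. rewrite Rabs_R1. simpl INR. 
      replace (- ((0 - 1) / 2 * v)) with (v / 2) by field. lra.
    - change (exp (v / 2) / 2 - (fsum (S N) (fun j => Rabs (expc nu j)) + Rabs (expc nu (S N))) <=
        fsum (S N) (fun j => expc nu j / 2 * exp (- ((INR j - 1) / 2 * v))) + expc nu (S N) / 2 * exp (- ((INR (S N) - 1) / 2 * v))).
      assert (K : - Rabs (expc nu (S N)) <= expc nu (S N) / 2 * exp (- ((INR (S N) - 1) / 2 * v))); [ | lra ].
      assert (K2 : exp (- ((INR (S N) - 1) / 2 * v)) <= 1).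
      { apply Rle_trans with (exp 0); [ apply exp_le_compat | rewrite exp_0; lra ]. rewrite S_INR. pose proof (pos_INR N). replace (- ((INR N + 1 - 1) / 2 * v)) with (- (INR N * v / 2)) by field. assert (0 <= INR N * v) by (apply Rmult_le_pos; auto). lra. }
      pose proof (exp_pos (- ((INR (S N) - 1) / 2 * v))).
      assert (Hb := Rabs_le_between (expc nu (S N)) (Rabs (expc nu (S N)))). destruct Hb as [Hb _].
      specialize (Hb (Rle_refl _)). pose proof (Rabs_pos (expc nu (S N))). nra. }
  exists (Rmax 0 (4 * (B + M))). split; [ apply Rmax_l | ]. intros v Hv.
  assert (V0 := Rle_trans _ _ _ (Rmax_l _ _) Hv). assert (V1 := Rle_trans _ _ _ (Rmax_r _ _) Hv).
  specialize (H v V0). assert (E := exp_ineq1_le (v / 2)). lra.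
Qed.

(* Gronwall for delta^2 e^{(N-1)v}, delta = theta - thetaN, using that thetaN tends to infinity. *)
Lemma theta_expansion (nu : R) (N : nat) : 0 <= nu ->
  exists K, exp_bounded (fun v => theta nu v - thetaN nu N v) K ((INR N - 1) / 2).
Proof.
  intros Hnu. set (del := fun v => theta nu v - thetaN nu N v). set (k := INR N - 1).
  set (res := fun v => exp (- (k / 2 * v)) * peval (snd (expst nu N)) (exp (- (v / 2))) / 4).
  assert (Dd : forall v, is_derive del v (- (theta nu v + thetaN nu N v + nu) * del v - res v)).
  { intros v. replace (- (theta nu v + thetaN nu N v + nu) * del v - res v) with
      (minus (exp v / 4 - nu * theta nu v - theta nu v ^ 2) (dthetaN nu N v)).
    - apply (is_derive_minus (theta nu) (thetaN nu N)); [ apply theta_derive; auto | apply thetaN_derive ].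
    - unfold res, k. rewrite <- thetaN_residual. unfold del, minus, plus, opp; simpl. ring. }
  assert (Cd : forall v, continuous del v).
  { intros v. apply (ex_derive_continuous (V:=R_NormedModule)). eexists. apply Dd. }
  destruct (peval_bounded (snd (expst nu N))) as [C [HC0 HC]].
  assert (Hres : forall v, 0 <= v -> res v ^ 2 * exp (k * v) <= C ^ 2).
  { intros v Hv. unfold res.
    assert (Hy : 0 <= exp (- (v / 2)) <= 1).
    { split; [ left; apply exp_pos | rewrite <- exp_0; apply exp_le_compat; lra ]. }
    specialize (HC _ Hy). set (q := peval (snd (expst nu N)) (exp (- (v / 2)))) in *.
    assert (Hq : q ^ 2 <= C ^ 2).
    { rewrite <- (pow2_abs q). apply pow_incr. split; [ apply Rabs_pos | auto ]. }
    replace ((exp (- (k / 2 * v)) * q / 4) ^ 2 * exp (k * v))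
      with (q ^ 2 / 16 * (exp (- (k / 2 * v)) * exp (- (k / 2 * v)) * exp (k * v))) by field.
    rewrite <- !exp_plus. replace (- (k / 2 * v) + - (k / 2 * v) + k * v) with 0 by field. rewrite exp_0.
    pose proof (pow2_ge_0 q). lra. }
  set (E := fun v => del v ^ 2 * exp (k * v)).
  (* The damping 2(theta + thetaN + nu) has to absorb k from the weight e^{kv}, 1 from the estimate
     -2 d r <= d^2 + r^2 and 1 from the factor e^v in [H]. *)
  destruct (thetaN_large nu N ((k + 2) / 2)) as [v0 [Hv0 HT]].
  set (H := fun v => (E v - C ^ 2) * exp v).
  assert (DH : forall v, is_derive H v
     ((2 * del v * (- (theta nu v + thetaN nu N v + nu) * del v - res v) * exp (k * v)
       + del v ^ 2 * (k * exp (k * v))) * exp v + (E v - C ^ 2) * exp v)).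
  { intros v. apply (is_derive_mult (fun v => E v - C ^ 2) exp).
    - unfold E. replace (2 * del v * (- (theta nu v + thetaN nu N v + nu) * del v - res v) * exp (k * v) + del v ^ 2 * (k * exp (k * v)))
        with (minus (2 * del v * (- (theta nu v + thetaN nu N v + nu) * del v - res v) * exp (k * v) + del v ^ 2 * (k * exp (k * v))) 0)
        by (unfold minus, plus, opp; simpl; ring).
      apply (is_derive_minus (fun v => del v ^ 2 * exp (k * v)) (fun _ => C ^ 2)).
      2: apply (is_derive_const (K:=R_AbsRing) (V:=R_NormedModule)).
      apply (is_derive_mult (fun v => del v ^ 2) (fun v => exp (k * v))).
      + replace (2 * del v * (- (theta nu v + thetaN nu N v + nu) * del v - res v))
          with (INR 2 * (- (theta nu v + thetaN nu N v + nu) * del v - res v) * del v ^ 1) by (simpl; ring).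
        apply (is_derive_pow del 2). apply Dd.
      + auto_derive; auto. ring.
      + intros; apply Rmult_comm.
    - auto_derive; auto. ring.
    - intros; apply Rmult_comm. }
  assert (Hneg : forall v, v0 <= v ->
     (2 * del v * (- (theta nu v + thetaN nu N v + nu) * del v - res v) * exp (k * v)
       + del v ^ 2 * (k * exp (k * v))) * exp v + (E v - C ^ 2) * exp v <= 0).
  { intros v Hv. specialize (HT v Hv). specialize (Hres v ltac:(lra)).
    pose proof (theta_pos nu v Hnu). pose proof (exp_pos v). pose proof (exp_pos (k * v)).
    unfold E.
    set (a := theta nu v + thetaN nu N v + nu) in *. set (d := del v) in *. set (r := res v) in *. set (x := exp (k * v)) in *.
    assert (Ha : k + 2 <= 2 * a) by (unfold a; lra).
    assert (A1 : 2 * d * (- a * d - r) * x + d ^ 2 * (k * x) + (d ^ 2 * x - C ^ 2) <= 0).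
    { assert (B1 : - 2 * d * r * x <= d ^ 2 * x + r ^ 2 * x).
      { assert (0 <= (d + r) ^ 2 * x) by (apply Rmult_le_pos; [ apply pow2_ge_0 | lra ]). nra. }
      assert (B2 : 0 <= (2 * a - (k + 2)) * (d ^ 2 * x)).
      { apply Rmult_le_pos; [ lra | apply Rmult_le_pos; [ apply pow2_ge_0 | lra ] ]. }
      nra. }
    rewrite <- Rmult_plus_distr_r. nra. }
  assert (Hdec : forall v, v0 <= v -> H v <= H v0).
  { intros v Hv. destruct (Req_dec v v0) as [-> | Hne]; [ lra | ].
    destruct (MVT_gen H v0 v (fun v => (2 * del v * (- (theta nu v + thetaN nu N v + nu) * del v - res v) * exp (k * v)
       + del v ^ 2 * (k * exp (k * v))) * exp v + (E v - C ^ 2) * exp v)) as [c [Hc Ec]].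
    - intros x _. apply DH.
    - intros x _. apply continuity_pt_filterlim, (ex_derive_continuous (V:=R_NormedModule)). eexists. apply DH.
    - rewrite Rmin_left, Rmax_right in Hc by lra. specialize (Hneg c ltac:(lra)). cbn beta in Ec. nra. }
  assert (CE : forall v, continuous E v).
  { intros v. apply (continuous_mult (fun v => del v ^ 2) (fun v => exp (k * v))).
    - simpl. apply (continuous_mult del (fun v => del v * 1)); auto.
      apply (continuous_mult del (fun _ => 1)); auto. apply continuous_const.
    - apply (ex_derive_continuous (V:=R_NormedModule)). auto_derive. auto. }
  (* Damping is only available beyond v0; on [0, v0] continuity gives the bound. *)
  destruct (continuity_ab_maj E 0 v0 Hv0) as [vm [Hvm _]].
  { intros c _. apply continuity_pt_filterlim, CE. }
  set (B := Rmax (E vm) (C ^ 2 + Rabs (E v0 - C ^ 2))).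
  assert (HE : forall v, 0 <= v -> E v <= B).
  { intros v Hv. destruct (Rle_lt_dec v v0) as [Hle | Hlt].
    - eapply Rle_trans; [ apply Hvm; lra | apply Rmax_l ].
    - eapply Rle_trans; [ | apply Rmax_r ].
      specialize (Hdec v ltac:(lra)). unfold H in Hdec.
      assert (Hee : exp v0 <= exp v) by (apply exp_le_compat; lra).
      pose proof (exp_pos v0). pose proof (Rle_abs (E v0 - C ^ 2)). pose proof (Rabs_pos (E v0 - C ^ 2)).
      assert ((E v - C ^ 2) * exp v <= Rabs (E v0 - C ^ 2) * exp v) by nra.
      apply Rmult_le_reg_r in H3; lra. }
  assert (HB : 0 <= B).
  { eapply Rle_trans; [ | apply (HE 0); lra ]. unfold E. apply Rmult_le_pos; [ apply pow2_ge_0 | left; apply exp_pos ]. }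
  exists (sqrt B). split; [ exact Cd | ]. split; [ apply sqrt_pos | ].
  intros v Hv. specialize (HE v Hv). unfold E in HE.
  fold (del v). 
  apply Rsqr_incr_0_var.
  - rewrite <- Rsqr_abs. unfold Rsqr.
    replace (sqrt B * exp (- (k / 2 * v)) * (sqrt B * exp (- (k / 2 * v))))
      with ((sqrt B * sqrt B) * (exp (- (k / 2 * v)) * exp (- (k / 2 * v)))) by ring.
    rewrite sqrt_sqrt, <- exp_plus by auto.
    apply (Rmult_le_reg_r (exp (k * v))); [ apply exp_pos | ].
    replace (B * exp (- (k / 2 * v) + - (k / 2 * v)) * exp (k * v)) with B.
    + simpl in HE. lra.
    + rewrite Rmult_assoc, <- exp_plus. replace (- (k / 2 * v) + - (k / 2 * v) + k * v) with 0 by field.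
      rewrite exp_0. ring.
  - apply Rmult_le_pos; [ apply sqrt_pos | left; apply exp_pos ].
Qed.

(** * Genus, growth and simplicity of the zeros *)

Lemma ex_series_bounded (a : nat -> R) (s : R) : (forall k, 0 <= a k) -> (forall K, fsum K a <= s) ->
  ex_series a /\ Series a <= s.
Proof.
  intros H0 Hs.
  assert (E : forall m, sum_n a m = fsum (S m) a).
  { induction m as [ | m IH]; [ rewrite sum_O; simpl; ring | rewrite sum_Sn, IH; reflexivity ]. }
  destruct (ex_finite_lim_seq_incr (sum_n a) s) as [l Hl].
  - intros n. rewrite !E. cbn [fsum]. specialize (H0 (S n)). lra.
  - intros n. rewrite E. apply Hs.
  - split; [ exists l; exact Hl | ]. rewrite (is_series_unique a l Hl).
    apply (is_lim_seq_le (sum_n a) (fun _ => s) l s); auto; [ | apply is_lim_seq_const ].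
    intros n. rewrite E. apply Hs.
Qed.

(** The expansion at order N = 1, that is theta = e^{v/2}/2 + O(1); the genus, the infinitude and
    the growth of the zeros all rest on it. *)
Lemma theta_half_expansion (nu : R) : 0 <= nu -> exists M, 0 <= M /\
  forall v, 0 <= v -> exp (v / 2) / 2 - M <= theta nu v <= exp (v / 2) / 2 + M.
Proof.
  intros Hnu. destruct (theta_expansion nu 1 Hnu) as [K [_ [HK H]]].
  exists (K + Rabs (expc nu 1 / 2)). pose proof (Rabs_pos (expc nu 1 / 2)). split; [ lra | ].
  intros v Hv. specialize (H v Hv).
  replace (thetaN nu 1 v) with (exp (v / 2) / 2 + expc nu 1 / 2) in H.
  2: { unfold thetaN. cbn [fsum]. simpl INR. replace (- ((0 - 1) / 2 * v)) with (v / 2) by field.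
       replace (- ((1 - 1) / 2 * v)) with 0 by field. rewrite exp_0. unfold expc at 2. field. }
  replace (- ((INR 1 - 1) / 2 * v)) with 0 in H by (simpl; field). rewrite exp_0, Rmult_1_r in H.
  apply Rabs_le_between in H.
  assert (Hb := Rabs_le_between (expc nu 1 / 2) (Rabs (expc nu 1 / 2))). destruct Hb as [Hb _]. specialize (Hb (Rle_refl _)). lra.
Qed.

(** Once [al] is known to be summable, the squares can be undone; the missing mass
    [bsum nu - Series al] then appears as the coefficient of e^v. *)
Lemma hadamard_logder (nu : R) (al : nat -> R) : 0 <= nu -> hadamard_seq nu al -> ex_series al /\
  forall v, theta nu v = (bsum nu - Series al) * exp v + Series (fun k => al k * exp v / (1 + al k * exp v)) /\
    ex_series (fun k => al k * exp v / (1 + al k * exp v)).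
Proof.
  intros Hnu [h1 h2 h3 h4 h5 h6].
  destruct (ex_series_bounded al (bsum nu) h1 h4) as [Hex Hle]. split; auto. intros v.
  set (z := exp v). assert (Hz : 0 < z) by apply exp_pos.
  assert (Hp : forall k, 0 <= al k * z) by (intros k; apply Rmult_le_pos; [ auto | lra ]).
  assert (Hq : forall k, 0 <= al k ^ 2 / (1 + al k * z)).
  { intros k. apply Rdiv_le_0_compat; [ apply pow2_ge_0 | specialize (Hp k); lra ]. }
  assert (E2 : ex_series (fun k => al k ^ 2 / (1 + al k * z))).
  { apply (ex_series_le (K:=R_AbsRing) (V:=R_CompleteNormedModule)) with (fun k => bsum nu * al k).
    - intros k. change (Rabs (al k ^ 2 / (1 + al k * z)) <= bsum nu * al k). rewrite Rabs_right by (apply Rle_ge; auto).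
      assert (Hb : al k <= bsum nu).
      { eapply Rle_trans; [ apply (h2 0%nat k); lia | ]. specialize (h3 0%nat). simpl in h3.
        replace (bsum nu / (0 + 1)) with (bsum nu) in h3 by field. exact h3. }
      specialize (Hp k). specialize (h1 k). apply (Rmult_le_reg_r (1 + al k * z)); [ lra | ].
      unfold Rdiv. rewrite Rmult_assoc, Rinv_l by lra.
      assert (al k * al k <= bsum nu * al k) by (apply Rmult_le_compat_r; auto).
      assert (0 <= bsum nu * al k * (al k * z)) by (apply Rmult_le_pos; auto; nra). nra.
    - apply (ex_series_scal (K:=R_AbsRing) (bsum nu) al); auto. }
  assert (E3 : ex_series (fun k => z * (al k ^ 2 / (1 + al k * z)))).
  { apply (ex_series_scal (K:=R_AbsRing) z (fun k => al k ^ 2 / (1 + al k * z))); auto. }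
  assert (E4 : forall k, al k / (1 + al k * z) = al k - z * (al k ^ 2 / (1 + al k * z))).
  { intros k. specialize (Hp k). field. lra. }
  assert (E5 : ex_series (fun k => al k / (1 + al k * z))).
  { apply (ex_series_ext (fun k => al k - z * (al k ^ 2 / (1 + al k * z)))); [ intros; symmetry; apply E4 | ].
    apply (ex_series_minus al (fun k => z * (al k ^ 2 / (1 + al k * z)))); auto. }
  split.
  - assert (L := h5 z ltac:(lra)).
    unfold theta. fold z.
    replace (z * (bess (nu + 1) z / (4 * (nu + 1))) / bess nu z) with (z * (bess (nu + 1) z / (4 * (nu + 1)) / bess nu z))
      by (unfold Rdiv; ring).
    rewrite L. rewrite <- Series_scal_l.
    rewrite (Series_ext (fun k => al k * z / (1 + al k * z)) (fun k => z * (al k / (1 + al k * z)))) by (intros; unfold Rdiv; ring).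
    rewrite (Series_scal_l z (fun k => al k / (1 + al k * z))), (Series_ext (fun k => al k / (1 + al k * z)) _ E4), Series_minus by auto. ring.
  - assert (E6 : forall k, z * (al k / (1 + al k * z)) = al k * z / (1 + al k * z)) by (intros; unfold Rdiv; ring).
    apply (ex_series_ext (fun k => z * (al k / (1 + al k * z))) _ E6).
    apply (ex_series_scal (K:=R_AbsRing) z (fun k => al k / (1 + al k * z))); auto.
Qed.

(* A surplus in the exponent would make theta grow like e^v; its true growth is e^(v/2)/2. *)
Lemma hadamard_genus_0 (nu : R) (al : nat -> R) : 0 <= nu -> hadamard_seq nu al -> Series al = bsum nu.
Proof.
  intros Hnu H. destruct (hadamard_logder nu al Hnu H) as [Hex HT]. destruct H as [h1 h2 h3 h4 h5 h6].
  destruct (ex_series_bounded al (bsum nu) h1 h4) as [_ Hle].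
  apply Rle_antisym; auto. apply Rnot_lt_le. intros Hlt.
  set (c := bsum nu - Series al). assert (Hc : 0 < c) by (unfold c; lra).
  destruct (theta_half_expansion nu Hnu) as [M [HM Hb]].
  (* With e = e^{v/2} this gives c e = c + 1 + M, so c e^2 already exceeds the upper bound e/2 + M
     for theta. *)
  set (v := 2 * (ln (1 + (1 + M) / c))). set (e := 1 + (1 + M) / c).
  assert (He : 1 < e) by (unfold e; assert (0 < (1 + M) / c) by (apply Rdiv_lt_0_compat; lra); lra).
  assert (Hv : 0 <= v).
  { unfold v. fold e. assert (0 < ln e) by (rewrite <- ln_1; apply ln_increasing; lra). lra. }
  destruct (Hb v Hv) as [_ Hu].
  destruct (HT v) as [ET ES].
  assert (Hev : exp (v / 2) = e) by (unfold v; fold e; replace (2 * ln e / 2) with (ln e) by field; apply exp_ln; lra).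
  assert (Hev2 : exp v = e * e) by (rewrite <- Hev, <- exp_plus; f_equal; field).
  assert (Hs : 0 <= Series (fun k => al k * exp v / (1 + al k * exp v))).
  { rewrite <- (Series_zero (fun _ => 0)) by auto. apply Series_le; auto. intros k. split; [ lra | ].
    pose proof (exp_pos v). specialize (h1 k). apply Rdiv_le_0_compat; nra. }
  fold c in ET. rewrite Hev in Hu. rewrite Hev2 in *. rewrite ET in Hu.
  assert (c * e = c + 1 + M) by (unfold e; field; lra).
  assert (c * (e * e) = (c + 1 + M) * e) by (rewrite <- H; ring). nra.
Qed.

Lemma theta_series (nu : R) (al : nat -> R) (v : R) : 0 <= nu -> hadamard_seq nu al ->
  is_series (fun k => al k * exp v / (1 + al k * exp v)) (theta nu v).
Proof.
  intros Hnu H. destruct (hadamard_logder nu al Hnu H) as [_ HT]. destruct (HT v) as [-> ES].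
  rewrite (hadamard_genus_0 nu al Hnu H). replace (bsum nu - bsum nu) with 0 by ring. rewrite Rmult_0_l, Rplus_0_l.
  apply Series_correct; auto.
Qed.

(** Every term of the series of theta is at most 1, so k terms cannot follow the growth
    e^{v/2}/2. *)
Lemma hadamard_infinite (nu : R) (al : nat -> R) (k : nat) : 0 <= nu -> hadamard_seq nu al -> 0 < al k.
Proof.
  intros Hnu H. destruct (Rle_lt_dec (al k) 0) as [Hk | Hk]; auto. exfalso.
  assert (HT := fun v => theta_series nu al v Hnu H). destruct H as [h1 h2 h3 h4 h5 h6].
  assert (Hz : forall j, (k <= j)%nat -> al j = 0).
  { intros j Hj. specialize (h2 k j Hj). specialize (h1 j). lra. }
  destruct (theta_half_expansion nu Hnu) as [M [HM Hb]].
  pose proof (pos_INR k) as Hk0.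
  set (e := 2 * (INR k + M + 1)). set (v := 2 * ln e).
  assert (He : 1 < e) by (unfold e; lra).
  assert (Hv : 0 <= v).
  { unfold v. assert (0 < ln e) by (rewrite <- ln_1; apply ln_increasing; lra). lra. }
  destruct (Hb v Hv) as [Hl _].
  assert (Hev : exp (v / 2) = e) by (unfold v; replace (2 * ln e / 2) with (ln e) by field; apply exp_ln; lra).
  rewrite Hev in Hl.
  assert (E := is_series_unique _ _ (HT v)).
  rewrite (fsum_Series k) in E by (intros j Hj; rewrite Hz by auto; unfold Rdiv; ring).
  assert (fsum k (fun i => al i * exp v / (1 + al i * exp v)) <= INR k * 1).
  { rewrite <- fsum_const. apply fsum_le. intros i _. pose proof (exp_pos v). specialize (h1 i).
    assert (0 <= al i * exp v) by (apply Rmult_le_pos; lra).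
    apply (Rmult_le_reg_r (1 + al i * exp v)); [ lra | ]. unfold Rdiv. rewrite Rmult_assoc, Rinv_l by lra. lra. }
  unfold e in Hl. lra.
Qed.

(** At v = ln(1/al k) each of the first k + 1 terms of theta is at least 1/2, whereas theta <= (1/2
    + M) e^{v/2}. Hence k + 1 <= (1 + 2M) / sqrt(al k). *)
Lemma hadamard_growth (nu : R) (al : nat -> R) : 0 <= nu -> hadamard_seq nu al ->
  exists Cst, 0 < Cst /\ forall k, (INR k + 1) ^ 2 <= Cst * / al k.
Proof.
  intros Hnu H. destruct (theta_half_expansion nu Hnu) as [M [HM Hb]].
  exists (4 * (1 / 2 + M) ^ 2). split; [ nra | ]. intros k.
  assert (Hk := hadamard_infinite nu al k Hnu H).
  assert (HT := fun v => theta_series nu al v Hnu H). destruct H as [h1 h2 h3 h4 h5 h6].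
  assert (Hb4 : al k <= 1).
  { eapply Rle_trans; [ apply (h2 0%nat k); lia | ]. specialize (h3 0%nat). simpl in h3.
    assert (bsum nu <= 1) by (unfold bsum; rewrite <- Rinv_1; apply Rinv_le_contravar; lra).
    replace (bsum nu / (0 + 1)) with (bsum nu) in h3 by field. lra. }
  set (v := ln (/ al k)).
  assert (Hi : 1 <= / al k) by (rewrite <- Rinv_1; apply Rinv_le_contravar; lra).
  assert (Hev : exp v = / al k) by (apply exp_ln; lra).
  assert (Hv : 0 <= v) by (unfold v; rewrite <- ln_1; destruct (Rle_lt_or_eq_dec _ _ Hi) as [h | <-]; [ left; apply ln_increasing; lra | lra ]).
  destruct (Hb v Hv) as [_ Hu]. set (e := exp (v / 2)) in *.
  assert (He2 : e * e = / al k) by (unfold e; rewrite <- exp_plus, <- Hev; f_equal; field).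
  assert (He1 : 1 <= e) by (unfold e; rewrite <- exp_0; apply exp_le_compat; lra).
  assert (Hs : INR (S k) * (1 / 2) <= theta nu v).
  { set (b := fun i => al i * exp v / (1 + al i * exp v)).
    assert (Hpos : forall i, 0 <= al i * exp v) by (intros i; apply Rmult_le_pos; [ auto | left; apply exp_pos ]).
    assert (Hb0 : forall i, 0 <= b i) by (intros i; specialize (Hpos i); apply Rdiv_le_0_compat; lra).
    apply Rle_trans with (fsum (S k) b).
    - rewrite <- fsum_const. apply fsum_le. intros i Hi2. unfold b.
      assert (1 <= al i * exp v).
      { rewrite Hev. specialize (h2 i k ltac:(lia)). apply (Rmult_le_reg_r (al k)); auto.
        rewrite Rmult_assoc, Rinv_l by lra. lra. }
      apply (Rmult_le_reg_r (1 + al i * exp v)); [ lra | ].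
      unfold Rdiv at 2. rewrite Rmult_assoc, Rinv_l by lra. lra.
    - assert (E : forall m, sum_n b m = fsum (S m) b).
      { induction m as [ | m IH]; [ rewrite sum_O; simpl; ring | rewrite sum_Sn, IH; reflexivity ]. }
      rewrite <- E. apply (is_lim_seq_incr_compare (sum_n b)); [ apply HT | ].
      intros n. rewrite !E. cbn [fsum]. specialize (Hb0 (S n)). lra. }
  rewrite S_INR in Hs. pose proof (pos_INR k).
  assert (INR k + 1 <= 2 * (1 / 2 + M) * e) by nra.
  rewrite <- He2. replace (4 * (1 / 2 + M) ^ 2 * (e * e)) with ((2 * (1 / 2 + M) * e) ^ 2) by ring.
  apply pow_incr. lra.
Qed.

(** The contiguous relation would pass a common zero on to all orders nu + m, but bess mu z tends to
    1 as mu grows. *)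
Lemma bess_common_zero (nu z : R) : 0 <= nu -> bess nu z = 0 -> bess (nu + 1) z = 0 -> False.
Proof.
  intros Hnu H0 H1.
  assert (Hall : forall m, bess (nu + INR m) z = 0 /\ bess (nu + INR m + 1) z = 0).
  { induction m as [ | m [I1 I2]]; [ simpl; rewrite Rplus_0_r; auto | ].
    pose proof (pos_INR m). rewrite S_INR. replace (nu + (INR m + 1)) with (nu + INR m + 1) by ring. split; auto.
    assert (Hc := bess_contiguous (nu + INR m) z ltac:(lra)). rewrite I1, I2, Rplus_0_l in Hc.
    replace (nu + INR m + 1 + 1) with (nu + INR m + 2) by ring.
    destruct (Req_dec z 0) as [-> | Hz]; [ rewrite bess_0 in I1; lra | ].
    symmetry in Hc. unfold Rdiv in Hc. apply Rmult_integral in Hc. destruct Hc as [Hc | Hc].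
    - apply Rmult_integral in Hc. destruct Hc; [ contradiction | auto ].
    - assert (0 < / (4 * (nu + INR m + 1) * (nu + INR m + 2))); [ | lra ].
      apply Rinv_0_lt_compat. apply Rmult_lt_0_compat; lra. }
  assert (Hnear : forall mu, 0 <= mu -> Rabs (bess mu z - 1) <= / (mu + 1) * (Rabs z * exp (Rabs z))).
  { intros mu Hmu. unfold bess. rewrite PSeries_decr_1 by (apply ex_pseries_R, bess_ex_series; auto).
    replace (bcoef mu 0 + z * PSeries (PS_decr_1 (bcoef mu)) z - 1) with (z * PSeries (PS_decr_1 (bcoef mu)) z) by (simpl; ring).
    rewrite Rabs_mult. replace (/ (mu + 1) * (Rabs z * exp (Rabs z))) with (Rabs z * (/ (mu + 1) * exp (Rabs z))) by ring.
    apply Rmult_le_compat_l; [ apply Rabs_pos | ].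
    assert (Hexp : Series (fun k => / INR (fact k) * Rabs z ^ k) = exp (Rabs z)).
    { apply is_series_unique. apply is_pseries_R. apply is_exp_Reals. }
    rewrite <- Hexp, <- Series_scal_l. unfold PSeries.
    assert (Hbd : forall n, Rabs (PS_decr_1 (bcoef mu) n * z ^ n) <= / (mu + 1) * (/ INR (fact n) * Rabs z ^ n)).
    { intros n. rewrite Rabs_mult, RPow_abs, <- Rmult_assoc. apply Rmult_le_compat_r; [ apply Rabs_pos | ].
      unfold PS_decr_1. cbn [bcoef]. pose proof (bcoef_pos mu n Hmu). pose proof (bcoef_le mu n Hmu). pose proof (pos_INR n).
      assert (0 < 4 * (INR n + 1) * (mu + 1 + INR n)) by (apply Rmult_lt_0_compat; lra).
      rewrite Rabs_right by (left; apply Rdiv_lt_0_compat; auto).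
      unfold Rdiv. rewrite Rmult_comm. apply Rmult_le_compat; try lra.
      - left; apply Rinv_0_lt_compat; auto.
      - apply Rinv_le_contravar; nra. }
    assert (Hex : ex_series (fun n => / (mu + 1) * (/ INR (fact n) * Rabs z ^ n))).
    { apply (ex_series_scal (K:=R_AbsRing) (/ (mu + 1)) (fun n => / INR (fact n) * Rabs z ^ n)). apply ex_series_exp. }
    eapply Rle_trans; [ apply Series_Rabs, (ex_series_le_abs _ _ Hbd Hex) | ].
    apply Series_le; auto. intros n. split; [ apply Rabs_pos | auto ]. }
  set (B := Rabs z * exp (Rabs z)) in *.
  assert (HB : 0 <= B) by (apply Rmult_le_pos; [ apply Rabs_pos | left; apply exp_pos ]).
  destruct (INR_unbounded (B + 1)) as [m Hm].
  destruct (Hall m) as [Hm0 _]. specialize (Hnear (nu + INR m) ltac:(lra)). rewrite Hm0 in Hnear.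
  replace (Rabs (0 - 1)) with 1 in Hnear by (rewrite Rabs_left; lra).
  apply (Rmult_le_compat_l (nu + INR m + 1)) in Hnear; [ | lra ].
  rewrite <- Rmult_assoc, Rinv_r in Hnear by lra. lra.
Qed.

Lemma fprod_abs_le (K : nat) (f g : nat -> R) : (forall i, (i < K)%nat -> Rabs (f i) <= g i) -> Rabs (fprod K f) <= fprod K g.
Proof.
  induction K as [ | K IH]; intros H; simpl; [ rewrite Rabs_R1; lra | ].
  rewrite Rabs_mult. apply Rmult_le_compat; try apply Rabs_pos; auto.
Qed.

Lemma big_index (x : R) : exists K, forall j, x / (INR (K + j) + 1) <= 1 / 2.
Proof.
  destruct (INR_unbounded (2 * Rabs x)) as [K HK]. exists K. intros j.
  rewrite plus_INR. pose proof (pos_INR j). pose proof (pos_INR K). pose proof (Rle_abs x).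
  apply (Rmult_le_reg_r (INR K + INR j + 1)); [ lra | ]. unfold Rdiv. rewrite Rmult_assoc, Rinv_l by lra. lra.
Qed.

(* A repeated factor would give |bess| <= C (z - z0)^2, hence a common zero with the derivative. *)
Lemma hadamard_strict (nu : R) (al : nat -> R) (k : nat) : 0 <= nu -> hadamard_seq nu al -> al (S k) < al k.
Proof.
  intros Hnu H. assert (Hk := hadamard_infinite nu al k Hnu H).
  destruct H as [h1 h2 h3 h4 h5 h6].
  destruct (Rle_lt_or_eq_dec _ _ (h2 k (S k) ltac:(lia))) as [Hlt | Heq]; auto. exfalso.
  set (z0 := - / al k). set (B := Rabs z0 + 1).
  assert (Hs : 0 < bsum nu) by (apply Rinv_0_lt_compat; lra).
  destruct (big_index (bsum nu * B)) as [K0 HK0].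
  set (K := (K0 + S (S k))%nat).
  assert (HB : 0 < B) by (unfold B; pose proof (Rabs_pos z0); lra).
  destruct (Nat.le_exists_sub (S (S k)) K ltac:(unfold K; lia)) as [m [Em _]]. rewrite Nat.add_comm in Em.
  set (P := fprod k (fun i => 1 + al i * B) * al k * al k * fprod m (fun j => 1 + al (S (S k) + j)%nat * B)).
  assert (Hq : forall z, Rabs z <= B -> Rabs (bess nu z) <= P * exp (bsum nu * B) * (z - z0) ^ 2).
  { intros z Hz. destruct (h6 z K) as [rho [Hr E]].
    { eapply Rle_trans; [ | apply (HK0 (S (S k))) ]. fold K. unfold Rdiv. apply Rmult_le_compat_r.
      - left; apply Rinv_0_lt_compat. pose proof (pos_INR K). lra.
      - apply Rmult_le_compat_l; lra. }
    rewrite E, Rabs_mult, (Rabs_right rho) by lra.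
    assert (Hrho : rho <= exp (bsum nu * B)).
    { eapply Rle_trans; [ apply Hr | apply exp_le_compat, Rmult_le_compat_l; lra ]. }
    assert (Hfac : forall i, Rabs (1 + al i * z) <= 1 + al i * B).
    { intros i. eapply Rle_trans; [ apply Rabs_triang | ]. rewrite Rabs_R1, Rabs_mult, (Rabs_right (al i)) by (apply Rle_ge; auto).
      apply Rplus_le_compat_l, Rmult_le_compat_l; auto. }
    assert (Hprod : Rabs (fprod K (fun i => 1 + al i * z)) <= P * (z - z0) ^ 2).
    { rewrite Em. change (S (S k) + m)%nat with (S (S k + m))%nat.
      replace (S (S k + m)) with (S k + S m)%nat by lia.
      rewrite fprod_split.
      replace (S m) with (S 0 + m)%nat by lia. rewrite fprod_split. cbn [fprod].
      rewrite Nat.add_0_r, Heq.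
      replace (1 + al k * z) with (al k * (z - z0)) by (unfold z0; field; lra).
      replace (fprod k (fun i => 1 + al i * z) * (al k * (z - z0)) * (1 * (al k * (z - z0)) * fprod m (fun j => 1 + al (S k + (1 + j))%nat * z)))
        with (fprod k (fun i => 1 + al i * z) * al k * al k * fprod m (fun j => 1 + al (S k + (1 + j))%nat * z) * (z - z0) ^ 2) by ring.
      rewrite Rabs_mult, (Rabs_right ((z - z0) ^ 2)) by (apply Rle_ge, pow2_ge_0).
      apply Rmult_le_compat_r; [ apply pow2_ge_0 | ]. rewrite !Rabs_mult, (Rabs_right (al k)) by lra. unfold P.
      apply Rmult_le_compat; [ | apply Rabs_pos | | ].
      - repeat apply Rmult_le_pos; try apply Rabs_pos; lra.
      - apply Rmult_le_compat_r; [ lra | ]. apply Rmult_le_compat_r; [ lra | ]. apply fprod_abs_le. intros; apply Hfac.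
      - apply fprod_abs_le. intros j _. replace (S k + (1 + j))%nat with (S (S k) + j)%nat by lia. apply Hfac. }
    assert (HP0 : 0 <= P * (z - z0) ^ 2) by (eapply Rle_trans; [ apply Rabs_pos | exact Hprod ]).
    apply Rle_trans with (P * (z - z0) ^ 2 * exp (bsum nu * B)); [ | right; ring ].
    apply Rmult_le_compat; try lra. apply Rabs_pos. }
  assert (Hz0B : Rabs z0 <= B) by (unfold B; lra).
  assert (E0 : bess nu z0 = 0).
  { specialize (Hq z0 Hz0B). replace ((z0 - z0) ^ 2) with 0 in Hq by ring. rewrite Rmult_0_r in Hq.
    pose proof (Rabs_pos (bess nu z0)). apply Rabs_eq_0. lra. }
  set (C0 := P * exp (bsum nu * B)) in *.
  assert (D : is_derive (bess nu) z0 0).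
  { apply is_derive_Reals. intros eps He.
    assert (HC1 : 0 <= Rabs C0) by apply Rabs_pos.
    assert (Hd : 0 < Rmin 1 (eps / (Rabs C0 + 1))) by (apply Rmin_pos; [ lra | apply Rdiv_lt_0_compat; lra ]).
    exists (mkposreal _ Hd). intros h Hh0 Hh. simpl in Hh.
    assert (Hh1 := Rlt_le_trans _ _ _ Hh (Rmin_l _ _)). assert (Hh2 := Rlt_le_trans _ _ _ Hh (Rmin_r _ _)).
    rewrite E0. replace ((bess nu (z0 + h) - 0) / h - 0) with (bess nu (z0 + h) / h) by (field; auto).
    assert (Hhp : 0 < Rabs h) by (apply Rabs_pos_lt; auto).
    unfold Rdiv. rewrite Rabs_mult, Rabs_inv.
    apply (Rmult_lt_reg_r (Rabs h)); auto. rewrite Rmult_assoc, Rinv_l, Rmult_1_r by lra.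
    assert (Hqq := Hq (z0 + h)). replace ((z0 + h - z0) ^ 2) with (h ^ 2) in Hqq by ring.
    eapply Rle_lt_trans; [ apply Hqq | ].
    - eapply Rle_trans; [ apply Rabs_triang | ]. unfold B. lra.
    - rewrite <- (pow2_abs h). simpl. rewrite Rmult_1_r, <- Rmult_assoc. apply Rmult_lt_compat_r; auto.
      apply (Rmult_lt_compat_l (Rabs C0 + 1)) in Hh2; [ | lra ].
      replace ((Rabs C0 + 1) * (eps / (Rabs C0 + 1))) with eps in Hh2 by (field; lra).
      pose proof (Rle_abs C0). nra. }
  assert (E1 := is_derive_unique _ _ _ D). rewrite (is_derive_unique _ _ _ (bess_derive nu z0 Hnu)) in E1.
  apply (bess_common_zero nu z0 Hnu E0).
  apply (Rmult_eq_compat_r (4 * (nu + 1))) in E1.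
  replace (bess (nu + 1) z0 / (4 * (nu + 1)) * (4 * (nu + 1))) with (bess (nu + 1) z0) in E1 by (field; lra). lra.
Qed.

Lemma hadamard_zeros (nu : R) (al : nat -> R) (z : R) : 0 <= nu -> hadamard_seq nu al ->
  (bess nu z = 0 <-> exists k, 1 + al k * z = 0).
Proof.
  intros Hnu [h1 h2 h3 h4 h5 h6].
  destruct (big_index (bsum nu * Rabs z)) as [K0 HK0]. split.
  - intros E. destruct (h6 z (K0 + 0)%nat (HK0 0%nat)) as [rho [Hr Er]]. rewrite E in Er.
    apply NNPP. intros Hn. symmetry in Er. apply Rmult_integral in Er. destruct Er as [Er | Er]; [ | lra ].
    revert Er. apply fprod_neq_0. intros i _ Ei. apply Hn. exists i; auto.
  - intros [k Hk]. destruct (h6 z (K0 + S k)%nat (HK0 (S k))) as [rho [_ ->]].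
    replace (K0 + S k)%nat with (S k + K0)%nat by lia. rewrite fprod_split, Hk. ring.
Qed.

(** Here lam k = 1/al k. Since [bsum] <= 1, all lam k are at least 1 and their logarithms are
    nonnegative. *)
Record bessel_spectrum (nu : R) (lam : nat -> R) : Prop := {
  bs_ge_1 : forall k, 1 <= lam k;
  bs_incr : forall k, lam k < lam (S k);
  bs_zeros : forall l, bess nu (- l) = 0 <-> exists k, l = lam k;
  bs_growth : exists Cst, 0 < Cst /\ forall k, (INR k + 1) ^ 2 <= Cst * lam k;
  bs_theta : forall v, is_series (fun k => kap (v - ln (lam k))) (theta nu v) }.

Lemma bessel_spectrum_exists (nu : R) : 0 <= nu -> exists lam, bessel_spectrum nu lam.
Proof.
  intros Hnu. destruct (hadamard_exists nu Hnu) as [al H].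
  assert (Hp := fun k => hadamard_infinite nu al k Hnu H).
  exists (fun k => / al k). split.
  - intros k. destruct H as [h1 h2 h3 h4 h5 h6]. rewrite <- Rinv_1. apply Rinv_le_contravar; auto.
    eapply Rle_trans; [ apply (h2 0%nat k); lia | ]. specialize (h3 0%nat). simpl in h3.
    assert (bsum nu <= 1) by (unfold bsum; rewrite <- Rinv_1; apply Rinv_le_contravar; lra).
    replace (bsum nu / (0 + 1)) with (bsum nu) in h3 by field. lra.
  - intros k. apply Rinv_lt_contravar; [ apply Rmult_lt_0_compat; auto | apply hadamard_strict with nu; auto ].
  - intros l. rewrite (hadamard_zeros nu al (- l) Hnu H). split; intros [k Hk]; exists k; specialize (Hp k).
    + apply (Rmult_eq_reg_l (al k)); [ | lra ]. rewrite Rinv_r by lra. lra.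
    + rewrite Hk. field. lra.
  - apply hadamard_growth with nu; auto.
  - intros v. apply (is_series_ext (fun k => al k * exp v / (1 + al k * exp v))); [ | apply theta_series; auto ].
    intros k. specialize (Hp k).
    assert (E : al k * exp v / (1 + al k * exp v) = kap (v - ln (/ al k))); [ | exact E ].
    unfold kap. rewrite ln_Rinv by auto.
    replace (- (v - - ln (al k))) with (- v + - ln (al k)) by ring.
    rewrite exp_plus, !exp_Ropp, exp_ln by auto. pose proof (exp_pos v).
    assert (0 < al k * exp v) by (apply Rmult_lt_0_compat; auto). field. repeat split; lra.
Qed.

(** * Eigenfunctions *)

(** A multiple of sqrt(x) J_nu(sqrt(l) x), the solution regular at 0; written through [bess] it
    makes sense for l of either sign. *)
Definition eigf (nu l x : R) : R := exp ((nu + 1 / 2) * ln x) * bess nu (- (l * x ^ 2)).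
Definition eigf1 (nu l x : R) : R :=
  (nu + 1 / 2) / x * eigf nu l x
  + exp ((nu + 1 / 2) * ln x) * (- (2 * l * x) * (bess (nu + 1) (- (l * x ^ 2)) / (4 * (nu + 1)))).

Lemma bess_sqr_derive (nu l x : R) : 0 <= nu ->
  is_derive (fun x => bess nu (- (l * x ^ 2))) x (- (2 * l * x) * (bess (nu + 1) (- (l * x ^ 2)) / (4 * (nu + 1)))).
Proof.
  intros H. apply (is_derive_comp (bess nu) (fun x => - (l * x ^ 2))); [ apply bess_derive; auto | ].
  auto_derive; auto. ring.
Qed.

Lemma rpow_derive (a x : R) : 0 < x -> is_derive (fun x => exp (a * ln x)) x (a / x * exp (a * ln x)).
Proof. intros H. auto_derive; auto. field. lra. Qed.

Lemma eigf_derive (nu l x : R) : 0 <= nu -> 0 < x -> is_derive (eigf nu l) x (eigf1 nu l x).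
Proof.
  intros Hnu Hx. unfold eigf1, eigf.
  rewrite <- Rmult_assoc.
  apply (is_derive_mult (fun x => exp ((nu + 1 / 2) * ln x)) (fun x => bess nu (- (l * x ^ 2)))).
  - apply rpow_derive; auto.
  - apply bess_sqr_derive; auto.
  - intros; apply Rmult_comm.
Qed.

Lemma eigf1_derive (nu l x : R) : 0 <= nu -> 0 < x ->
  is_derive (eigf1 nu l) x ((nu ^ 2 - 1 / 4) / x ^ 2 * eigf nu l x - l * eigf nu l x).
Proof.
  intros Hnu Hx.
  set (a := nu + 1 / 2). set (p := exp (a * ln x)).
  set (z := - (l * x ^ 2)). set (g0 := bess nu z). set (g1 := bess (nu + 1) z). set (g2 := bess (nu + 2) z).
  assert (D1 : is_derive (fun x => a / x) x (- a / x ^ 2)).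
  { auto_derive; [ lra | ]. field. lra. }
  assert (D2 := is_derive_mult _ _ x _ _ D1 (eigf_derive nu l x Hnu Hx) Rmult_comm).
  assert (D3 : is_derive (fun x => - (2 * l * x)) x (- (2 * l))) by (auto_derive; auto; ring).
  assert (D4 : is_derive (fun x => bess (nu + 1) (- (l * x ^ 2)) / (4 * (nu + 1))) x
      (/ (4 * (nu + 1)) * (- (2 * l * x) * (bess (nu + 1 + 1) z / (4 * (nu + 1 + 1)))))).
  { apply (is_derive_ext (fun x => / (4 * (nu + 1)) * bess (nu + 1) (- (l * x ^ 2)))); [ intros t; apply Rmult_comm | ].
    apply is_derive_scal. apply bess_sqr_derive. lra. }
  assert (D5 := is_derive_mult _ _ x _ _ D3 D4 Rmult_comm).
  assert (D6 := is_derive_mult _ _ x _ _ (rpow_derive a x Hx) D5 Rmult_comm).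
  assert (D7 := is_derive_plus _ _ x _ _ D2 D6).
  assert (Hc := bess_contiguous nu z Hnu). fold g0 g1 g2 in Hc.
  match type of D7 with is_derive _ _ ?v => replace ((nu ^ 2 - 1 / 4) / x ^ 2 * eigf nu l x - l * eigf nu l x) with v end.
  - exact D7.
  - unfold plus, mult; simpl. change (x * (x * 1)) with (x ^ 2). change (nu * (nu * 1)) with (nu ^ 2).
    fold z. replace (nu + 1 + 1) with (nu + 2) by ring. fold g2.
    unfold eigf1, eigf. fold a. fold p. fold z. fold g0 g1.
    match goal with |- ?L = ?R => enough (E : L - R = 0) by lra end.
    (* Both sides differ by a multiple of the contiguous relation at z = -l x^2. *)
    transitivity (p * l * (g0 - g1 - z * g2 / (4 * (nu + 1) * (nu + 2)))).
    + unfold z, a. field. repeat split; lra.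
    + rewrite Hc. ring.
Qed.

Lemma nonincreasing_of_derive (f df : R -> R) (a b : R) : a <= b ->
  (forall x, a <= x <= b -> is_derive f x (df x)) -> (forall x, a <= x <= b -> df x <= 0) -> f b <= f a.
Proof.
  intros Hab Hd Hn. destruct (Req_dec a b) as [-> | Hne]; [ lra | ].
  destruct (MVT_gen f a b df) as [c [Hc E]].
  - intros x Hx. rewrite Rmin_left, Rmax_right in Hx by lra. apply Hd; lra.
  - intros x Hx. rewrite Rmin_left, Rmax_right in Hx by lra.
    apply continuity_pt_filterlim, (ex_derive_continuous (V:=R_NormedModule)). eexists. apply Hd; lra.
  - rewrite Rmin_left, Rmax_right in Hc by lra. specialize (Hn c Hc). nra.
Qed.

(* Gronwall for h^2 + h'^2. *)
Lemma ode_unique (h h1 q : R -> R) (x0 x : R) : 0 < x0 < 1 -> 0 < x < 1 ->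
  (forall t, 0 < t < 1 -> is_derive h t (h1 t)) ->
  (forall t, 0 < t < 1 -> is_derive h1 t (q t * h t)) ->
  (forall c, 0 < c -> exists M, 0 <= M /\ forall t, c <= t < 1 -> Rabs (q t) <= M) ->
  h x0 = 0 -> h1 x0 = 0 -> h x = 0.
Proof.
  intros H0 Hx D1 D2 Hq E0 E1.
  destruct (Hq (Rmin x0 x)) as [M [HM HqM]]; [ apply Rmin_pos; lra | ].
  (* The weight with sg = -1 serves for x to the right of x0, that with sg = 1 for x to the left. *)
  assert (K : forall sg, (sg = 1 \/ sg = -1) -> forall t, 0 < t < 1 ->
    is_derive (fun t => (h t ^ 2 + h1 t ^ 2) * exp (sg * (1 + M) * t)) t
      ((2 * h t * h1 t * (1 + q t) + sg * (1 + M) * (h t ^ 2 + h1 t ^ 2)) * exp (sg * (1 + M) * t))).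
  { intros sg _ t Ht.
    assert (P1 := is_derive_pow h 2 t _ (D1 t Ht)). assert (P2 := is_derive_pow h1 2 t _ (D2 t Ht)).
    assert (P3 := is_derive_plus _ _ t _ _ P1 P2).
    assert (P4 : is_derive (fun t => exp (sg * (1 + M) * t)) t (sg * (1 + M) * exp (sg * (1 + M) * t))).
    { auto_derive; auto. ring. }
    assert (P5 := is_derive_mult _ _ t _ _ P3 P4 Rmult_comm).
    match type of P5 with is_derive _ _ ?v =>
      replace ((2 * h t * h1 t * (1 + q t) + sg * (1 + M) * (h t ^ 2 + h1 t ^ 2)) * exp (sg * (1 + M) * t)) with v end.
    - exact P5.
    - unfold plus, mult; simpl. ring. }
  assert (HE : forall t, Rmin x0 x <= t < 1 -> Rabs (2 * h t * h1 t * (1 + q t)) <= (1 + M) * (h t ^ 2 + h1 t ^ 2)).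
  { intros t Ht. specialize (HqM t Ht). rewrite Rabs_mult.
    assert (A1 : Rabs (2 * h t * h1 t) <= h t ^ 2 + h1 t ^ 2).
    { apply Rabs_le. pose proof (pow2_ge_0 (h t + h1 t)). pose proof (pow2_ge_0 (h t - h1 t)). nra. }
    assert (A2 : Rabs (1 + q t) <= 1 + M).
    { eapply Rle_trans; [ apply Rabs_triang | ]. rewrite Rabs_R1. lra. }
    rewrite Rmult_comm. apply Rmult_le_compat; auto; apply Rabs_pos. }
  assert (Hsum : h x ^ 2 + h1 x ^ 2 <= 0).
  { destruct (Rle_lt_dec x0 x) as [Hle | Hlt].
    - rewrite Rmin_left in HE by lra.
      assert (Z := nonincreasing_of_derive _ _ x0 x Hle (fun t Ht => K (-1) (or_intror eq_refl) t ltac:(lra))).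
      cbn beta in Z. rewrite E0, E1 in Z.
      assert (Z2 : (h x ^ 2 + h1 x ^ 2) * exp (-1 * (1 + M) * x) <= (0 ^ 2 + 0 ^ 2) * exp (-1 * (1 + M) * x0)).
      { apply Z. intros t Ht. specialize (HE t ltac:(lra)). apply Rabs_le_between in HE.
        pose proof (exp_pos (-1 * (1 + M) * t)). nra. }
      pose proof (exp_pos (-1 * (1 + M) * x)). nra.
    - rewrite Rmin_right in HE by lra.
      assert (Z := nonincreasing_of_derive (fun t => - ((h t ^ 2 + h1 t ^ 2) * exp (1 * (1 + M) * t)))
         (fun t => - ((2 * h t * h1 t * (1 + q t) + 1 * (1 + M) * (h t ^ 2 + h1 t ^ 2)) * exp (1 * (1 + M) * t))) x x0).
      assert (Z2 : - ((h x0 ^ 2 + h1 x0 ^ 2) * exp (1 * (1 + M) * x0)) <= - ((h x ^ 2 + h1 x ^ 2) * exp (1 * (1 + M) * x))).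
      { apply Z; [ lra | | ].
        - intros t Ht. apply (is_derive_opp (fun t => (h t ^ 2 + h1 t ^ 2) * exp (1 * (1 + M) * t))). apply K; [ auto | lra ].
        - intros t Ht. specialize (HE t ltac:(lra)). apply Rabs_le_between in HE.
          pose proof (exp_pos (1 * (1 + M) * t)). nra. }
      rewrite E0, E1 in Z2. pose proof (exp_pos (1 * (1 + M) * x)). nra. }
  pose proof (pow2_ge_0 (h x)). pose proof (pow2_ge_0 (h1 x)).
  assert (Hz : h x ^ 2 = 0) by lra. simpl in Hz. rewrite Rmult_1_r in Hz. apply Rmult_integral in Hz. tauto.
Qed.

Lemma eigf_near_0 (nu l : R) : 0 <= nu -> exists d, 0 < d < 1 /\ forall x, 0 < x < d ->
  exp ((nu + 1 / 2) * ln x) / 2 <= eigf nu l x <= 2 * exp ((nu + 1 / 2) * ln x).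
Proof.
  intros Hnu.
  assert (C : continuous (fun x => bess nu (- (l * x ^ 2))) 0).
  { apply (ex_derive_continuous (V:=R_NormedModule)). eexists. apply bess_sqr_derive; auto. }
  destruct (proj1 (continuous_eps _ _) C (1 / 2) ltac:(lra)) as [d [Hd K]].
  exists (Rmin d (1 / 2)). split; [ split; [ apply Rmin_pos; lra | eapply Rle_lt_trans; [ apply Rmin_r | lra ] ] | ].
  intros x Hx. assert (Hxd := Rlt_le_trans _ _ _ (proj2 Hx) (Rmin_l _ _)).
  specialize (K x). rewrite Rminus_0_r, Rabs_right in K by lra. specialize (K Hxd).
  replace (- (l * 0 ^ 2)) with 0 in K by ring. rewrite bess_0 in K. apply Rabs_def2 in K.
  unfold eigf. pose proof (exp_pos ((nu + 1 / 2) * ln x)). nra.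
Qed.

(** The Wronskian with the regular solution phi is constant. If it were w <> 0, then f/phi would
    have derivative -w/phi^2 with 1/phi^2 >= 1/(4x) near 0 and would diverge logarithmically,
    against f = O(x^{nu+1/2}). With w = 0, uniqueness for the equation finishes. No case distinction
    on nu is made. *)
Lemma bessel_sol_multiple (nu l : R) (f : R -> R) : 0 <= nu -> bessel_sol nu l f ->
  exists c, forall x, 0 < x < 1 -> f x = c * eigf nu l x.
Proof.
  intros Hnu [Hode [Hlim [H1 [K [delta [Hdelta HK]]]]]].
  set (phi := eigf nu l). set (phi1 := eigf1 nu l).
  assert (Dp : forall x, 0 < x < 1 -> is_derive phi x (phi1 x)) by (intros; apply eigf_derive; lra).
  assert (Dp1 : forall x, 0 < x < 1 -> is_derive phi1 x (((nu ^ 2 - 1 / 4) / x ^ 2 - l) * phi x)).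
  { intros x Hx. replace (((nu ^ 2 - 1 / 4) / x ^ 2 - l) * phi x) with ((nu ^ 2 - 1 / 4) / x ^ 2 * phi x - l * phi x) by ring.
    apply eigf1_derive; lra. }
  assert (Df : forall x, 0 < x < 1 -> is_derive f x (Derive f x)).
  { intros x Hx. apply Derive_correct, Hode; auto. }
  assert (Df1 : forall x, 0 < x < 1 -> is_derive (Derive f) x (((nu ^ 2 - 1 / 4) / x ^ 2 - l) * f x)).
  { intros x Hx. destruct (Hode x Hx) as [_ [h2 h3]].
    replace (((nu ^ 2 - 1 / 4) / x ^ 2 - l) * f x) with (Derive (Derive f) x) by lra.
    apply Derive_correct; auto. }
  set (W := fun x => f x * phi1 x - Derive f x * phi x).
  assert (DW : forall x, 0 < x < 1 -> is_derive W x 0).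
  { intros x Hx.
    assert (P1 := is_derive_mult _ _ x _ _ (Df x Hx) (Dp1 x Hx) Rmult_comm).
    assert (P2 := is_derive_mult _ _ x _ _ (Df1 x Hx) (Dp x Hx) Rmult_comm).
    assert (P3 := is_derive_minus _ _ x _ _ P1 P2).
    match type of P3 with is_derive _ _ ?v => replace 0 with v end; [ exact P3 | ].
    unfold minus, plus, opp, mult; simpl. ring. }
  destruct (eigf_near_0 nu l Hnu) as [d0 [Hd0 Hphi]]. fold phi in Hphi.
  set (x1 := Rmin d0 delta / 2).
  assert (Hm : 0 < Rmin d0 delta) by (apply Rmin_pos; lra).
  pose proof (Rmin_l d0 delta) as Hm1. pose proof (Rmin_r d0 delta) as Hm2.
  assert (Hx1 : 0 < x1 < 1 /\ x1 < d0 /\ x1 < delta) by (unfold x1; lra).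
  destruct Hx1 as [Hx1 [Hx1a Hx1b]].
  assert (Hpos : forall x, 0 < x <= x1 -> 0 < phi x).
  { intros x Hx. specialize (Hphi x ltac:(lra)). pose proof (exp_pos ((nu + 1 / 2) * ln x)). lra. }
  set (w := W x1).
  assert (HW : forall x, 0 < x <= x1 -> W x = w).
  { intros x Hx. apply Rle_antisym.
    - assert (Z := nonincreasing_of_derive (fun x => - W x) (fun _ => - 0) x x1 ltac:(lra)).
      assert (- W x1 <= - W x); [ | unfold w; lra ]. apply Z; [ | intros; lra ].
      intros t Ht. apply (is_derive_opp W). apply DW. lra.
    - apply (nonincreasing_of_derive W (fun _ => 0) x x1); [ lra | | intros; lra ]. intros t Ht. apply DW. lra. }
  assert (Hw0 : w = 0).
  { apply NNPP. intros Hw.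
    (* The factor -w makes the derivative w^2/phi^2 positive; phi^2 <= 4 x^{2 nu + 1} <= 4x bounds
       it below by c/x with c = w^2/4. *)
    set (s := fun x => - w * (f x / phi x)). set (c := w ^ 2 / 4).
    assert (Hc : 0 < c) by (unfold c; pose proof (pow2_gt_0 w Hw); lra).
    assert (Ds : forall x, 0 < x <= x1 -> is_derive s x (w ^ 2 / phi x ^ 2)).
    { intros x Hx. specialize (Hpos x Hx).
      assert (P := is_derive_scal _ x (- w) _ (is_derive_div_R f phi x _ _ (Df x ltac:(lra)) (Dp x ltac:(lra)) ltac:(lra))).
      replace (w ^ 2 / phi x ^ 2) with (- w * ((Derive f x * phi x - f x * phi1 x) / phi x ^ 2)); [ exact P | ].
      replace (Derive f x * phi x - f x * phi1 x) with (- w) by (rewrite <- (HW x Hx); unfold W; ring).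
      field. lra. }
    assert (Hlow : forall x, 0 < x <= x1 -> c / x <= w ^ 2 / phi x ^ 2).
    { intros x Hx. assert (Hpx := Hpos x Hx). specialize (Hphi x ltac:(lra)).
      assert (Hp2 : phi x ^ 2 <= 4 * x).
      { apply Rle_trans with ((2 * exp ((nu + 1 / 2) * ln x)) ^ 2); [ apply pow_incr; lra | ].
        replace ((2 * exp ((nu + 1 / 2) * ln x)) ^ 2) with (4 * (exp ((nu + 1 / 2) * ln x) * exp ((nu + 1 / 2) * ln x))) by ring.
        rewrite <- exp_plus. apply Rmult_le_compat_l; [ lra | ].
        rewrite <- (exp_ln x) at 3 by lra. apply exp_le_compat.
        assert (ln x < 0) by (rewrite <- ln_1; apply ln_increasing; lra). nra. }
      unfold c, Rdiv. rewrite Rmult_assoc. apply Rmult_le_compat_l; [ apply pow2_ge_0 | ].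
      rewrite <- Rinv_mult. apply Rinv_le_contravar; [ apply pow_lt; auto | lra ]. }
    assert (Hs : forall x, 0 < x <= x1 -> s x <= s x1 - c * (ln x1 - ln x)).
    { intros x Hx.
      assert (Z := nonincreasing_of_derive (fun x => c * ln x - s x) (fun x => c / x - w ^ 2 / phi x ^ 2) x x1 ltac:(lra)).
      assert (Z2 : c * ln x1 - s x1 <= c * ln x - s x); [ | lra ]. apply Z.
      - intros t Ht. apply (is_derive_minus (fun x => c * ln x) s); [ | apply Ds; lra ].
        auto_derive; [ lra | ]. field. lra.
      - intros t Ht. specialize (Hlow t ltac:(lra)). lra. }
    assert (Hbd : forall x, 0 < x <= x1 -> Rabs (s x) <= Rabs w * (2 * Rabs K)).
    { intros x Hx. unfold s. rewrite Rabs_mult, Rabs_Ropp. apply Rmult_le_compat_l; [ apply Rabs_pos | ].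
      assert (Hpx := Hpos x Hx). specialize (Hphi x ltac:(lra)). specialize (HK x ltac:(lra)).
      unfold Rpower in HK. unfold Rdiv. rewrite Rabs_mult, (Rabs_right (/ phi x)) by (apply Rle_ge; left; apply Rinv_0_lt_compat; auto).
      apply (Rmult_le_reg_r (phi x)); auto. rewrite Rmult_assoc, Rinv_l by lra.
      pose proof (exp_pos ((nu + 1 / 2) * ln x)). pose proof (Rle_abs K). pose proof (Rabs_pos K). nra. }
    set (B := Rabs w * (2 * Rabs K)) in *.
    assert (HB : 0 <= B) by (eapply Rle_trans; [ apply Rabs_pos | apply (Hbd x1); lra ]).
    (* Chosen so that c (ln x1 - ln x) = 2B + 1, more than two values of absolute value at most B
       can differ by. *)
    set (x := x1 * exp (- ((2 * B + 1) / c))).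
    assert (Hex : exp (- ((2 * B + 1) / c)) <= 1).
    { apply Rle_trans with (exp 0); [ apply exp_le_compat | rewrite exp_0; lra ]. assert (0 < (2 * B + 1) / c) by (apply Rdiv_lt_0_compat; lra). lra. }
    pose proof (exp_pos (- ((2 * B + 1) / c))).
    assert (Hx : 0 < x <= x1) by (unfold x; split; [ apply Rmult_lt_0_compat; lra | nra ]).
    specialize (Hs x Hx).
    assert (Hln : ln x = ln x1 - (2 * B + 1) / c).
    { unfold x. rewrite ln_mult, ln_exp by lra. ring. }
    rewrite Hln in Hs. replace (c * (ln x1 - (ln x1 - (2 * B + 1) / c))) with (2 * B + 1) in Hs by (field; lra).
    assert (b1 := Hbd x Hx). assert (b2 := Hbd x1 ltac:(lra)).
    apply Rabs_le_between in b1. apply Rabs_le_between in b2. lra. }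
  assert (Hpx1 : 0 < phi x1) by (apply Hpos; lra).
  (* f - c phi vanishes at x1 by the choice of c, and so does its derivative because the Wronskian
     is 0. *)
  set (c := f x1 / phi x1). exists c. intros x Hx.
  assert (E : (fun x => f x - c * phi x) x = 0).
  { apply (ode_unique (fun x => f x - c * phi x) (fun x => Derive f x - c * phi1 x) (fun x => (nu ^ 2 - 1 / 4) / x ^ 2 - l) x1 x); auto.
    - intros t Ht. apply (is_derive_minus f (fun x => c * phi x)); auto. apply is_derive_scal; auto.
    - intros t Ht. replace (((nu ^ 2 - 1 / 4) / t ^ 2 - l) * (f t - c * phi t))
        with (minus (((nu ^ 2 - 1 / 4) / t ^ 2 - l) * f t) (c * (((nu ^ 2 - 1 / 4) / t ^ 2 - l) * phi t)))
        by (unfold minus, plus, opp; simpl; ring).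
      apply (is_derive_minus (Derive f) (fun x => c * phi1 x)); auto. apply is_derive_scal; auto.
    - intros e He. exists (Rabs (nu ^ 2 - 1 / 4) * / e ^ 2 + Rabs l).
      assert (0 < / e ^ 2) by (apply Rinv_0_lt_compat, pow_lt; auto).
      pose proof (Rabs_pos (nu ^ 2 - 1 / 4)). pose proof (Rabs_pos l).
      split; [ assert (0 <= Rabs (nu ^ 2 - 1 / 4) * / e ^ 2) by (apply Rmult_le_pos; lra); lra | ].
      intros t Ht. eapply Rle_trans; [ apply Rabs_triang | ]. rewrite Rabs_Ropp. apply Rplus_le_compat_r.
      unfold Rdiv. rewrite Rabs_mult. apply Rmult_le_compat_l; auto.
      rewrite Rabs_right by (apply Rle_ge; left; apply Rinv_0_lt_compat, pow_lt; lra).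
      apply Rinv_le_contravar; [ apply pow_lt; auto | apply pow_incr; lra ].
    - unfold c. field. lra.
    - unfold w, W in Hw0. unfold c.
      replace (Derive f x1 - f x1 / phi x1 * phi1 x1) with (- (f x1 * phi1 x1 - Derive f x1 * phi x1) / phi x1) by (field; lra).
      rewrite Hw0. field. lra. }
  cbn beta in E. lra.
Qed.

Lemma eigf_1 (nu l : R) : eigf nu l 1 = bess nu (- l).
Proof. unfold eigf. rewrite ln_1, Rmult_0_r, exp_0, Rmult_1_l. do 2 f_equal. ring. Qed.

(** Continuity from the left carries f = c eigf to the endpoint 1, where the Dirichlet condition
    becomes c bess(nu, -l) = 0. *)
Lemma bessel_sol_trivial (nu l : R) (f : R -> R) : 0 <= nu -> bess nu (- l) <> 0 -> bessel_sol nu l f ->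
  forall x, 0 < x < 1 -> f x = 0.
Proof.
  intros Hnu Hne Hf. destruct (bessel_sol_multiple nu l f Hnu Hf) as [c Hc].
  destruct Hf as [_ [Hlim [H1 _]]].
  assert (Hc0 : c * eigf nu l 1 = 0).
  { assert (C : continuous (fun x => c * eigf nu l x) 1).
    { apply (ex_derive_continuous (V:=R_NormedModule)). eexists. apply is_derive_scal, eigf_derive; lra. }
    assert (L : filterlim (fun x => c * eigf nu l x) (at_left 1) (locally (c * eigf nu l 1))).
    { intros P HP. specialize (C P HP). destruct C as [d Hd]. exists d. intros y Hy _. apply Hd; auto. }
    assert (L2 : filterlim (fun x => c * eigf nu l x) (at_left 1) (locally (f 1))).
    { apply (filterlim_ext_loc f); auto. exists (mkposreal 1 Rlt_0_1). intros y Hy Hy1.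
      apply Hc. split; auto. apply Rabs_def2 in Hy. unfold minus, plus, opp in Hy; simpl in Hy. lra. }
    rewrite H1 in L2. symmetry.
    apply (filterlim_locally_unique (F := at_left 1) (fun x => c * eigf nu l x)); auto. }
  rewrite eigf_1 in Hc0. apply Rmult_integral in Hc0. destruct Hc0 as [-> | ]; [ | contradiction ].
  intros x Hx. rewrite Hc by auto. ring.
Qed.

Lemma eigf_sol (nu l : R) : 0 <= nu -> bess nu (- l) = 0 -> bessel_sol nu l (eigf nu l).
Proof.
  intros Hnu H0. split; [ | split; [ | split ] ].
  - intros x Hx.
    assert (D1 : forall t, 0 < t -> Derive (eigf nu l) t = eigf1 nu l t) by (intros; apply is_derive_unique, eigf_derive; auto).
    assert (D2 : is_derive (Derive (eigf nu l)) x ((nu ^ 2 - 1 / 4) / x ^ 2 * eigf nu l x - l * eigf nu l x)).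
    { apply (is_derive_ext_loc (eigf1 nu l)); [ | apply eigf1_derive; lra ].
      exists (mkposreal x (proj1 Hx)). intros t Ht. symmetry. apply D1.
      unfold ball in Ht; simpl in Ht. unfold AbsRing_ball, abs, minus, plus, opp in Ht; simpl in Ht. apply Rabs_def2 in Ht. lra. }
    split; [ eexists; apply eigf_derive; lra | ]. split; [ eexists; exact D2 | ].
    rewrite (is_derive_unique _ _ _ D2). ring.
  - assert (C : continuous (eigf nu l) 1).
    { apply (ex_derive_continuous (V:=R_NormedModule)). eexists. apply eigf_derive; lra. }
    intros P HP. specialize (C P HP). destruct C as [d Hd]. exists d. intros y Hy _. apply Hd; auto.
  - rewrite eigf_1; auto.
  - destruct (eigf_near_0 nu l Hnu) as [d [Hd K]]. exists 2, d. split; [ lra | ].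
    intros x Hx. specialize (K x Hx). unfold Rpower. pose proof (exp_pos ((nu + 1 / 2) * ln x)).
    rewrite Rabs_right; lra.
Qed.

Lemma eigf_nontrivial (nu l : R) : 0 <= nu -> exists x, 0 < x < 1 /\ eigf nu l x <> 0.
Proof.
  intros Hnu. destruct (eigf_near_0 nu l Hnu) as [d [Hd K]]. exists (d / 2). split; [ lra | ].
  specialize (K (d / 2) ltac:(lra)). pose proof (exp_pos ((nu + 1 / 2) * ln (d / 2))). lra.
Qed.

(** * Multiplicities and the enumeration of the spectrum *)

Lemma fsum_zero (n : nat) (f : nat -> R) : (forall i, (i < n)%nat -> f i = 0) -> fsum n f = 0.
Proof. induction n as [ | n IH]; intros H; simpl; auto. rewrite IH, H by auto. ring. Qed.

(** Two solutions c0 phi and c1 phi satisfy the relation with coefficients c1 and -c0; if both of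
    these vanish, the first solution is itself zero. *)
Lemma no_pair (nu l : R) (k : nat) (f : nat -> R -> R) : 0 <= nu ->
  (forall i, (i < S (S k))%nat -> bessel_sol nu l (f i)) -> lin_indep (S (S k)) f -> False.
Proof.
  intros Hnu Hf Hi.
  destruct (bessel_sol_multiple nu l (f 0%nat) Hnu (Hf 0%nat ltac:(lia))) as [c0 H0].
  destruct (bessel_sol_multiple nu l (f 1%nat) Hnu (Hf 1%nat ltac:(lia))) as [c1 H1].
  assert (Hz : forall a b, (forall x, 0 < x < 1 -> a * f 0%nat x + b * f 1%nat x = 0) -> a = 0 /\ b = 0).
  { intros a b Hab. set (c := fun i => match i with O => a | S O => b | _ => 0 end).
    assert (K := Hi c). split.
    - apply (K) with (i := 0%nat); [ | lia ]. intros x Hx.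
      transitivity (a * f 0%nat x + b * f 1%nat x); [ | auto ].
      clear - c. induction k as [ | k IH]; [ simpl; ring | ].
      change (fsum (S (S (S k))) (fun i => c i * f i x)) with (fsum (S (S k)) (fun i => c i * f i x) + c (S (S k)) * f (S (S k)) x).
      rewrite IH. simpl. ring.
    - apply (K) with (i := 1%nat); [ | lia ]. intros x Hx.
      transitivity (a * f 0%nat x + b * f 1%nat x); [ | auto ].
      clear - c. induction k as [ | k IH]; [ simpl; ring | ].
      change (fsum (S (S (S k))) (fun i => c i * f i x)) with (fsum (S (S k)) (fun i => c i * f i x) + c (S (S k)) * f (S (S k)) x).
      rewrite IH. simpl. ring. }
  destruct (Hz c1 (- c0)) as [E1 E0].
  - intros x Hx. rewrite H0, H1 by auto. ring.
  - destruct (Hz 1 0) as [E _]; [ | lra ].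
    intros x Hx. rewrite H0 by auto. replace c0 with 0 by lra. ring.
Qed.

Lemma eig_mult_1 (nu l : R) : 0 <= nu -> bess nu (- l) = 0 -> eig_mult nu l 1.
Proof.
  intros Hnu H0. split.
  - exists (fun _ => eigf nu l). split; [ intros; apply eigf_sol; auto | ].
    intros c Hc i Hi. replace i with 0%nat by lia.
    destruct (eigf_nontrivial nu l Hnu) as [x [Hx Hne]]. specialize (Hc x Hx). simpl in Hc.
    rewrite Rplus_0_l in Hc. apply Rmult_integral in Hc. tauto.
  - intros [f [Hf Hi]]. apply (no_pair nu l 0 f); auto.
Qed.

Lemma eig_mult_pos_zero (nu l : R) (k : nat) : 0 <= nu -> bess nu (- l) <> 0 -> eig_mult nu l k -> k = 0%nat.
Proof.
  intros Hnu Hne [[f [Hf Hi]] _]. destruct k as [ | k]; auto. exfalso.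
  assert (Hz := bessel_sol_trivial nu l (f 0%nat) Hnu Hne (Hf 0%nat ltac:(lia))).
  assert (K := Hi (fun i => match i with O => 1 | _ => 0 end)).
  assert (E := fun H => K H 0%nat ltac:(lia)). cbn beta iota in E.
  assert (1 = 0); [ | lra ]. apply E. intros x Hx. apply fsum_zero.
  intros [ | i] _; [ rewrite Hz by auto; ring | ring ].
Qed.

Lemma eig_mult_0 (nu l : R) : 0 <= nu -> bess nu (- l) <> 0 -> eig_mult nu l 0.
Proof.
  intros Hnu Hne. split.
  - exists (fun _ _ => 0). split; [ intros; lia | intros c _ i Hi; lia ].
  - intros [f [Hf Hi]].
    assert (Hz := bessel_sol_trivial nu l (f 0%nat) Hnu Hne (Hf 0%nat ltac:(lia))).
    assert (E := fun H => Hi (fun _ => 1) H 0%nat ltac:(lia)). cbn beta in E.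
    assert (1 = 0); [ | lra ]. apply E. intros x Hx. simpl. rewrite Hz by auto. ring.
Qed.

Lemma eig_mult_eq_1 (nu l : R) (k : nat) : 0 <= nu -> bess nu (- l) = 0 -> eig_mult nu l k -> k = 1%nat.
Proof.
  intros Hnu H0 [[f [Hf Hi]] Hn]. destruct k as [ | [ | k]]; auto; exfalso.
  - apply Hn. apply (eig_mult_1 nu l Hnu H0).
  - apply (no_pair nu l k f); auto.
Qed.

Lemma incr_lt (lam : nat -> R) : (forall k, lam k < lam (S k)) -> forall i j, (i < j)%nat -> lam i < lam j.
Proof. intros H i j Hij. induction Hij as [ | j Hij IH]; auto. specialize (H j). lra. Qed.

Lemma spectrum_enum (nu : R) (lam : nat -> R) : 0 <= nu -> bessel_spectrum nu lam -> spec_enum nu lam.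
Proof.
  intros Hnu [h1 h2 h3 h4 h5]. assert (Hlt := incr_lt lam h2). split; [ intros; left; auto | ].
  intros l. destruct (Req_dec (bess nu (- l)) 0) as [H0 | Hne].
  - destruct (proj1 (h3 l) H0) as [m Hm]. exists 1%nat, m. split; [ apply eig_mult_1; auto | ].
    intros n. split.
    + intros E. destruct (Nat.lt_trichotomy n m) as [h | [h | h]]; [ | lia | ]; specialize (Hlt _ _ h); lra.
    + intros h. replace n with m by lia. auto.
  - exists 0%nat, 0%nat. split; [ apply eig_mult_0; auto | ]. intros n. split; [ | lia ].
    intros E. exfalso. apply Hne, h3. exists n; auto.
Qed.

(** All multiplicities are 0 or 1, so both sequences are strictly increasing with the same range;
    strong induction identifies them term by term. Different continuations may be given with
    different enumerations, hence the need. *)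
Lemma spectrum_enum_unique (nu : R) (lam lam' : nat -> R) : 0 <= nu -> bessel_spectrum nu lam -> spec_enum nu lam' ->
  forall n, lam' n = lam n.
Proof.
  intros Hnu [h1 h2 h3 h4 h5] [Hmono Henum]. assert (Hlt := incr_lt lam h2).
  assert (Hin : forall n, exists j, lam' n = lam j).
  { intros n. apply h3. apply NNPP. intros Hne. destruct (Henum (lam' n)) as [k [m [Hk Hn]]].
    rewrite (eig_mult_pos_zero nu (lam' n) k Hnu Hne Hk) in Hn. assert (K := proj1 (Hn n) eq_refl). lia. }
  assert (Hone : forall j, exists m, forall n, lam' n = lam j <-> n = m).
  { intros j. destruct (Henum (lam j)) as [k [m [Hk Hn]]].
    rewrite (eig_mult_eq_1 nu (lam j) k Hnu (proj2 (h3 (lam j)) (ex_intro _ j eq_refl)) Hk) in Hn.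
    exists m. intros n. rewrite Hn. lia. }
  assert (Hinj : forall a b, lam' a = lam' b -> a = b).
  { intros a b E. destruct (Hin a) as [j Hj]. destruct (Hone j) as [m Hm].
    assert (a = m) by (apply Hm; auto). assert (b = m) by (apply Hm; congruence). congruence. }
  assert (Hlt' : forall i j, (i < j)%nat -> lam' i < lam' j).
  { apply incr_lt. intros k. destruct (Rle_lt_or_eq_dec _ _ (Hmono k)) as [h | h]; auto. apply Hinj in h. lia. }
  intros n. induction n as [n IH] using (well_founded_induction lt_wf).
  apply Rle_antisym.
  - destruct (Hone n) as [m Hm]. assert (Em : lam' m = lam n) by (apply Hm; auto).
    destruct (le_lt_dec n m) as [Hle | Hgt].
    + rewrite <- Em. destruct (Nat.eq_dec n m) as [-> | Hne]; [ lra | left; apply Hlt'; lia ].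
    + exfalso. rewrite (IH m Hgt) in Em. specialize (Hlt m n Hgt). lra.
  - destruct (Hin n) as [j Hj]. destruct (le_lt_dec n j) as [Hle | Hgt].
    + rewrite Hj. destruct (Nat.eq_dec n j) as [-> | Hne]; [ lra | left; apply Hlt; lia ].
    + exfalso. rewrite <- (IH j Hgt) in Hj. specialize (Hlt' j n Hgt). lra.
Qed.

(** * The Dirichlet series *)

Fixpoint csum (n : nat) (a : nat -> C) : C := match n with O => RtoC 0 | S m => (csum m a + a m)%C end.

Definition is_cs (a : nat -> C) (l : C) : Prop :=
  forall eps, 0 < eps -> exists N, forall n, (N <= n)%nat -> Cmod (csum n a - l) < eps.

Lemma csum_sum_n (a : nat -> C) (n : nat) : @sum_n (NormedModule.AbelianMonoid C_AbsRing C_NormedModule) a n = csum (S n) a.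
Proof.
  induction n as [ | n IH].
  - rewrite sum_O. simpl. symmetry. apply Cplus_0_l.
  - rewrite sum_Sn, IH. reflexivity.
Qed.

(** The uniform structure on C is that of a product, so closeness is tested on real and imaginary
    parts, whence eps/2 in one direction. [sum_n] includes its last index, [csum] does not. *)
Lemma is_cs_is_series (a : nat -> C) (l : C) : is_cs a l <-> @is_series C_AbsRing C_NormedModule a l.
Proof.
  split.
  - intros H. apply (filterlim_locally (U := C_UniformSpace)). intros eps.
    destruct (H eps (cond_pos eps)) as [N HN]. exists N. intros n Hn.
    rewrite csum_sum_n. specialize (HN (S n) ltac:(lia)). split.
    + eapply Rle_lt_trans; [ | exact HN ]. apply (re_le_Cmod (csum (S n) a - l)).
    + eapply Rle_lt_trans; [ | exact HN ]. apply (im_le_Cmod (csum (S n) a - l)).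
  - intros H eps He.
    destruct (proj1 (filterlim_locally (U := C_UniformSpace) _ _) H (mkposreal (eps / 2) ltac:(lra))) as [N HN].
    exists (S N). intros n Hn. destruct n as [ | n]; [ lia | ].
    specialize (HN n ltac:(lia)). rewrite csum_sum_n in HN. destruct HN as [H1 H2].
    change (Rabs (Re (csum (S n) a - l)) < eps / 2) in H1.
    change (Rabs (Im (csum (S n) a - l)) < eps / 2) in H2.
    eapply Rle_lt_trans; [ apply Cmod_le_abs | ]. lra.
Qed.

Lemma is_cs_unique (a : nat -> C) (l m : C) : is_cs a l -> is_cs a m -> l = m.
Proof.
  intros H1 H2. apply Ceq_minus, Cmod_eq_0, Rle_antisym; [ | apply Cmod_ge_0 ].
  apply le_epsilon. intros eps He. rewrite Rplus_0_l.
  destruct (H1 (eps / 2) ltac:(lra)) as [N1 K1]. destruct (H2 (eps / 2) ltac:(lra)) as [N2 K2].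
  specialize (K1 (max N1 N2) ltac:(lia)). specialize (K2 (max N1 N2) ltac:(lia)).
  set (S := csum (max N1 N2) a) in *.
  replace (l - m)%C with ((S - m) + - (S - l))%C by ring.
  eapply Rle_trans; [ apply Cmod_triangle | ]. rewrite Cmod_opp. lra.
Qed.

Lemma csum_bound (a : nat -> C) (b : nat -> R) (n : nat) : (forall k, Cmod (a k) <= b k) -> Cmod (csum n a) <= fsum n b.
Proof.
  intros H. induction n as [ | n IH]; simpl; [ rewrite Cmod_0; lra | ].
  eapply Rle_trans; [ apply Cmod_triangle | ]. apply Rplus_le_compat; auto.
Qed.

Lemma fsum_le_Series (b : nat -> R) (n : nat) : (forall k, 0 <= b k) -> ex_series b -> fsum n b <= Series b.
Proof.
  intros H0 [l Hl]. rewrite (is_series_unique b l Hl).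
  assert (E : forall m, sum_n b m = fsum (S m) b).
  { induction m as [ | m IH]; [ rewrite sum_O; simpl; ring | rewrite sum_Sn, IH; reflexivity ]. }
  apply Rle_trans with (sum_n b n).
  - rewrite E. cbn [fsum]. specialize (H0 n). lra.
  - apply (is_lim_seq_incr_compare (sum_n b)); auto. intros m. rewrite !E. cbn [fsum]. specialize (H0 (S m)). lra.
Qed.

Lemma is_cs_exists (a : nat -> C) (b : nat -> R) : (forall k, Cmod (a k) <= b k) -> ex_series b -> exists l, is_cs a l.
Proof.
  intros H Hb.
  destruct (ex_series_le (K:=C_AbsRing) (V:=C_CompleteNormedModule) a b) as [l Hl]; auto.
  exists l. apply is_cs_is_series. exact Hl.
Qed.

(** The integral test by telescoping: by the mean value theorem (k+2)^{-p} is at most 1/q times the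
    decrease of x^{-q} from k + 1 to k + 2, with q = p - 1. *)
Lemma ex_series_power (p : R) : 1 < p -> ex_series (fun k => exp (- (p * ln (INR k + 1)))).
Proof.
  intros Hp. set (q := p - 1). assert (Hq : 0 < q) by (unfold q; lra).
  set (g := fun x => exp (- (q * ln x))).
  apply (ex_series_incr_1 (fun k => exp (- (p * ln (INR k + 1))))).
  assert (Hterm : forall k, exp (- (p * ln (INR (S k) + 1))) <= / q * (g (INR k + 1) - g (INR (S k) + 1))).
  { intros k. pose proof (pos_INR k). rewrite S_INR.
    destruct (MVT_gen g (INR k + 1) (INR k + 1 + 1) (fun x => - (q / x) * exp (- (q * ln x)))) as [c [Hc E]].
    - intros x Hx. rewrite Rmin_left in Hx by lra. unfold g. auto_derive; [ lra | ]. field. lra.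
    - intros x Hx. rewrite Rmin_left in Hx by lra. apply continuity_pt_filterlim, (ex_derive_continuous (V:=R_NormedModule)).
      unfold g. auto_derive. lra.
    - rewrite Rmin_left, Rmax_right in Hc by lra.
      replace (g (INR k + 1) - g (INR k + 1 + 1)) with (q / c * exp (- (q * ln c))) by lra.
      replace (/ q * (q / c * exp (- (q * ln c)))) with (exp (- ln c) * exp (- (q * ln c))).
      2: { rewrite exp_Ropp, exp_ln by lra. field. lra. }
      rewrite <- exp_plus. apply exp_le_compat.
      assert (ln c <= ln (INR k + 1 + 1)).
      { destruct (Rle_lt_or_eq_dec _ _ (proj2 Hc)) as [h | ->]; [ left; apply ln_increasing; lra | lra ]. }
      unfold q. nra. }
  assert (Hg : forall x, 0 < g x) by (intros; apply exp_pos).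
  apply (ex_series_le (K:=R_AbsRing) (V:=R_CompleteNormedModule)) with (fun k => / q * (g (INR k + 1) - g (INR (S k) + 1))).
  { intros k. change (Rabs (exp (- (p * ln (INR (S k) + 1)))) <= / q * (g (INR k + 1) - g (INR (S k) + 1))).
    rewrite Rabs_right; [ apply Hterm | left; apply exp_pos ]. }
  assert (H0 : forall k, 0 <= / q * (g (INR k + 1) - g (INR (S k) + 1))).
  { intros k. eapply Rle_trans; [ | apply Hterm ]. left; apply exp_pos. }
  apply (ex_series_bounded _ (/ q * g (INR 0 + 1)) H0).
  intros K. rewrite fsum_scal. apply Rmult_le_compat_l; [ left; apply Rinv_0_lt_compat; auto | ].
  assert (E : fsum K (fun k => g (INR k + 1) - g (INR (S k) + 1)) = g (INR 0 + 1) - g (INR K + 1)).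
  { induction K as [ | K IH]; cbn [fsum]; [ ring | rewrite IH; ring ]. }
  rewrite E. specialize (Hg (INR K + 1)). lra.
Qed.

Lemma ln_nonneg (x : R) : 1 <= x -> 0 <= ln x.
Proof.
  intros H. rewrite <- ln_1. destruct (Rle_lt_or_eq_dec _ _ H) as [h | <-]; [ left; apply ln_increasing; lra | lra ].
Qed.

Lemma lam_power_series (nu : R) (lam : nat -> R) (sg : R) : bessel_spectrum nu lam -> 1 / 2 < sg ->
  ex_series (fun k => exp (- (sg * ln (lam k)))).
Proof.
  intros [h1 h2 h3 [Cst [HC Hg]] h5] Hs.
  assert (Hex := ex_series_power (2 * sg) ltac:(lra)).
  apply (ex_series_le (K:=R_AbsRing) (V:=R_CompleteNormedModule)) with
    (fun k => exp (sg * ln Cst) * exp (- (2 * sg * ln (INR k + 1)))).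
  2: apply (ex_series_scal (K:=R_AbsRing) (exp (sg * ln Cst)) (fun k => exp (- (2 * sg * ln (INR k + 1))))); auto.
  intros k. change (Rabs (exp (- (sg * ln (lam k)))) <= exp (sg * ln Cst) * exp (- (2 * sg * ln (INR k + 1)))).
  rewrite Rabs_right by (left; apply exp_pos). rewrite <- exp_plus. apply exp_le_compat.
  pose proof (pos_INR k). specialize (h1 k). specialize (Hg k).
  apply ln_le in Hg; [ | apply pow_lt; lra ].
  rewrite ln_mult in Hg by lra. simpl in Hg. rewrite Rmult_1_r, ln_mult in Hg by lra. nra.
Qed.

Lemma Cmod_cpow (l : R) (s : C) : Cmod (cpow_neg l s) = exp (- (Re s * ln l)).
Proof. unfold cpow_neg. rewrite Cmod_cexp. f_equal. unfold Re; simpl. ring. Qed.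

Lemma cpow_converges (nu : R) (lam : nat -> R) (s : C) : bessel_spectrum nu lam -> 1 / 2 < Re s ->
  exists l, is_cs (fun k => cpow_neg (lam k) s) l.
Proof.
  intros H Hs. apply (is_cs_exists _ (fun k => exp (- (Re s * ln (lam k))))).
  - intros k. rewrite Cmod_cpow. lra.
  - apply (lam_power_series nu); auto.
Qed.

Definition zeta (lam : nat -> R) (s : C) : C := epsilon (inhabits (RtoC 0)) (is_cs (fun k => cpow_neg (lam k) s)).

Lemma zeta_correct (nu : R) (lam : nat -> R) (s : C) : bessel_spectrum nu lam -> 1 / 2 < Re s ->
  is_cs (fun k => cpow_neg (lam k) s) (zeta lam s).
Proof.
  intros H Hs. apply (epsilon_spec (inhabits (RtoC 0)) (is_cs (fun k => cpow_neg (lam k) s))).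
  apply (cpow_converges nu); auto.
Qed.

Lemma csum_plus (n : nat) (a b : nat -> C) : csum n (fun k => a k + b k)%C = (csum n a + csum n b)%C.
Proof. induction n as [ | n IH]; simpl; [ ring | rewrite IH; ring ]. Qed.

Lemma csum_scal (n : nat) (c : C) (a : nat -> C) : csum n (fun k => c * a k)%C = (c * csum n a)%C.
Proof. induction n as [ | n IH]; simpl; [ ring | rewrite IH; ring ]. Qed.

Lemma zeta_cder (nu : R) (lam : nat -> R) (s : C) : bessel_spectrum nu lam -> 1 / 2 < Re s ->
  exists l, cder (zeta lam) s l.
Proof.
  intros H Hs. set (sg := Re s) in *.
  (* Two portions e pay for (ln lam)^2 and one for exp(|w - s| ln lam); the exponent sg - 3e is
     still above 1/2. *)
  set (e := (sg - 1 / 2) / 4). assert (He : 0 < e) by (unfold e; lra).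
  assert (h1 := bs_ge_1 nu lam H).
  set (u := fun k => ln (lam k)). assert (Hu : forall k, 0 <= u k) by (intros; apply ln_nonneg; auto).
  assert (Hser := lam_power_series nu lam (sg - 3 * e) H ltac:(unfold e; lra)). fold u in Hser.
  change (fun k => exp (- ((sg - 3 * e) * ln (lam k)))) with (fun k => exp (- ((sg - 3 * e) * u k))) in Hser.
  assert (Hd1 : exists D, is_cs (fun k => - RtoC (u k) * cpow_neg (lam k) s)%C D).
  { apply (is_cs_exists _ (fun k => / e * exp (- ((sg - 3 * e) * u k)))).
    - intros k. rewrite Cmod_mult, Cmod_opp, Cmod_R, (Rabs_right (u k)), Cmod_cpow by (apply Rle_ge; auto). fold sg (u k).
      apply Rle_trans with ((/ e * exp (e * u k)) * exp (- (sg * u k))).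
      + apply Rmult_le_compat_r; [ left; apply exp_pos | apply mult_exp_le; auto ].
      + rewrite Rmult_assoc, <- exp_plus. apply Rmult_le_compat_l; [ left; apply Rinv_0_lt_compat; auto | ].
        apply exp_le_compat. specialize (Hu k). nra.
    - apply (ex_series_scal (K:=R_AbsRing) (/ e) (fun k => exp (- ((sg - 3 * e) * u k)))); auto. }
  destruct Hd1 as [D HD]. exists D. intros eps Hep.
  set (b := fun k => / e * / e * exp (- ((sg - 3 * e) * u k))).
  assert (Hb0 : forall k, 0 <= b k).
  { intros k. unfold b. pose proof (exp_pos (- ((sg - 3 * e) * u k))). assert (0 < / e) by (apply Rinv_0_lt_compat; auto).
    apply Rmult_le_pos; [ nra | lra ]. }
  assert (Hbex : ex_series b) by (apply (ex_series_scal (K:=R_AbsRing) (/ e * / e) (fun k => exp (- ((sg - 3 * e) * u k)))); auto).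
  set (M := Series b). assert (HM : 0 <= M) by (eapply Rle_trans; [ | apply (fsum_le_Series b 0 Hb0 Hbex) ]; simpl; lra).
  exists (Rmin e (eps / (M + 1))). split; [ apply Rmin_pos; [ auto | apply Rdiv_lt_0_compat; lra ] | ].
  intros w Hw. assert (A1 := Rlt_le_trans _ _ _ Hw (Rmin_l _ _)). assert (A2 := Rlt_le_trans _ _ _ Hw (Rmin_r _ _)).
  set (d := (w - s)%C) in *. assert (Hd := Cmod_ge_0 d).
  assert (Hw2 : 1 / 2 < Re w).
  { assert (T := re_le_Cmod d). apply Rabs_le_between in T. change (Re d) with (Re w - Re s) in T. fold sg in T. unfold e in A1. lra. }
  assert (Zw := zeta_correct nu lam w H Hw2). assert (Zs := zeta_correct nu lam s H Hs).
  apply Rle_trans with (M * Cmod d ^ 2).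
  2: { simpl. rewrite Rmult_1_r, <- Rmult_assoc. apply Rmult_le_compat_r; auto.
       apply (Rmult_lt_compat_l (M + 1)) in A2; [ | lra ]. replace ((M + 1) * (eps / (M + 1))) with eps in A2 by (field; lra). nra. }
  apply le_epsilon. intros t Ht.
  destruct (Zw (t / 3) ltac:(lra)) as [N1 K1]. destruct (Zs (t / 3) ltac:(lra)) as [N2 K2].
  destruct (HD (t / (3 * (Cmod d + 1))) ltac:(apply Rdiv_lt_0_compat; lra)) as [N3 K3].
  set (n := max N1 (max N2 N3)). specialize (K1 n ltac:(lia)). specialize (K2 n ltac:(lia)). specialize (K3 n ltac:(lia)).
  set (Sw := csum n (fun k => cpow_neg (lam k) w)) in *. set (Ss := csum n (fun k => cpow_neg (lam k) s)) in *.
  set (Sd := csum n (fun k => - RtoC (u k) * cpow_neg (lam k) s)%C) in *.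
  assert (Hmain : Cmod (Sw - Ss - d * Sd) <= M * Cmod d ^ 2).
  { replace (Sw - Ss - d * Sd)%C with (csum n (fun k => cpow_neg (lam k) w + ((-1) * cpow_neg (lam k) s + (- d) * (- RtoC (u k) * cpow_neg (lam k) s)))%C).
    2: { rewrite csum_plus, (csum_plus n (fun k => (-1) * cpow_neg (lam k) s)%C), !csum_scal. fold Sw Ss Sd. ring. }
    apply Rle_trans with (fsum n (fun k => Cmod d ^ 2 * b k)).
    - apply csum_bound. intros k. set (x := (- (d * RtoC (u k)))%C).
      replace (cpow_neg (lam k) w + (-1 * cpow_neg (lam k) s + - d * (- RtoC (u k) * cpow_neg (lam k) s)))%C
        with (cpow_neg (lam k) s * (cexp x - 1 - x))%C.
      2: { unfold cpow_neg. fold (u k). replace (- w * RtoC (u k))%C with (- s * RtoC (u k) + x)%C by (unfold x, d; ring).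
           rewrite cexp_plus. unfold x. ring. }
      rewrite Cmod_mult, Cmod_cpow. fold sg (u k). specialize (Hu k).
      assert (Ex : Cmod x = Cmod d * u k) by (unfold x; rewrite Cmod_opp, Cmod_mult, Cmod_R, Rabs_right; lra).
      assert (B2 := cexp_bound2 x). rewrite Ex in B2.
      assert (U := mult_exp_le (u k) e Hu He).
      apply Rle_trans with (exp (- (sg * u k)) * ((Cmod d ^ 2 * ((/ e * exp (e * u k)) * (/ e * exp (e * u k)))) * exp (e * u k))).
      + apply Rmult_le_compat_l; [ left; apply exp_pos | ]. eapply Rle_trans; [ exact B2 | ].
        apply Rmult_le_compat; [ apply pow2_ge_0 | left; apply exp_pos | | ].
        * rewrite Rpow_mult_distr. apply Rmult_le_compat_l; [ apply pow2_ge_0 | ].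
          simpl. rewrite Rmult_1_r. apply Rmult_le_compat; auto.
        * apply exp_le_compat. apply Rmult_le_compat_r; lra.
      + unfold b. replace (- ((sg - 3 * e) * u k)) with (- (sg * u k) + (e * u k + e * u k + e * u k)) by ring.
        rewrite !exp_plus. right. ring.
    - rewrite fsum_scal, Rmult_comm. apply Rmult_le_compat_r; [ apply pow2_ge_0 | apply fsum_le_Series; auto ]. }
  replace (zeta lam w - zeta lam s - D * d)%C with
    ((Sw - Ss - d * Sd) + - (Sw - zeta lam w) + ((Ss - zeta lam s) + d * (Sd - D)))%C by ring.
  eapply Rle_trans; [ apply Cmod_triangle3 | ]. rewrite Cmod_opp.
  assert (T := Cmod_triangle (Ss - zeta lam s) (d * (Sd - D))). rewrite Cmod_mult in T.
  assert (T3 : Cmod d * Cmod (Sd - D) <= t / 3).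
  { apply Rle_trans with ((Cmod d + 1) * (t / (3 * (Cmod d + 1)))); [ | right; field; lra ].
    apply Rmult_le_compat; try lra. apply Cmod_ge_0. }
  lra.
Qed.

(** * Interchange of sum and integral *)

(** An interpolation between the bounds 1 and e^u. The exponent th can then be placed on either side
    of Re s. *)
Lemma kap_le_power (th u : R) : 0 <= th <= 1 -> kap u <= exp (th * u).
Proof.
  intros Ht. destruct (Rle_lt_dec 0 u) as [Hu | Hu].
  - apply Rle_trans with 1; [ apply kap_le_1 | ]. rewrite <- exp_0. apply exp_le_compat. nra.
  - apply Rle_trans with (exp u); [ apply kap_le_exp | ]. apply exp_le_compat. nra.
Qed.

Definition kapsum (lam : nat -> R) (n : nat) (v : R) : R := fsum n (fun k => kap (v - ln (lam k))).

Lemma kapsum_continuous (lam : nat -> R) (n : nat) (v : R) : continuous (kapsum lam n) v.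
Proof.
  unfold kapsum. induction n as [ | n IH]; cbn [fsum]; [ apply continuous_const | ].
  apply (continuous_plus (fun v => fsum n (fun k => kap (v - ln (lam k)))) (fun v => kap (v - ln (lam n)))); auto.
  apply continuous_shift, kap_continuous.
Qed.

Lemma is_BL_zero (s : C) : is_BL (fun _ => 0) s 0.
Proof.
  assert (K : forall s, is_LT (fun _ => 0) s 0).
  { clear s. intros s eps He. exists 0. intros X HX.
    rewrite (CInt_ext _ (fun _ => RtoC 0)) by (intros; unfold lker; ring).
    rewrite CInt_const. replace (RtoC (X - 0) * 0 - 0)%C with (RtoC 0) by ring. rewrite Cmod_0. auto. }
  exists (RtoC 0), (RtoC 0). split; [ apply K | split; [ apply (K (- s)%C) | ring ] ].
Qed.

Lemma kapsum_BL (lam : nat -> R) (n : nat) (s b : C) : is_BL kap s b ->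
  is_BL (kapsum lam n) s (csum n (fun k => cpow_neg (lam k) s) * b)%C.
Proof.
  intros Hb. induction n as [ | n IH].
  - simpl. rewrite Cmult_0_l. apply is_BL_zero.
  - cbn [csum]. rewrite Cmult_plus_distr_r.
    apply (is_BL_plus (kapsum lam n) (fun v => kap (v - ln (lam n)))).
    + apply kapsum_continuous.
    + intros; apply continuous_shift, kap_continuous.
    + exact IH.
    + replace (cpow_neg (lam n) s) with (cexp (- (s * RtoC (ln (lam n))))) by (unfold cpow_neg; f_equal; ring).
      apply is_BL_shift; auto. apply kap_continuous.
Qed.

Lemma kapsum_remainder (nu : R) (lam : nat -> R) (n : nat) (th v : R) : bessel_spectrum nu lam -> 1 / 2 < th <= 1 ->
  0 <= theta nu v - kapsum lam n v <= Series (fun k => exp (- (th * ln (lam (n + k)%nat)))) * exp (th * v).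
Proof.
  intros H Hth. assert (Hs := bs_theta nu lam H v).
  assert (Hex := lam_power_series nu lam th H ltac:(lra)).
  assert (Hexk : ex_series (fun k => kap (v - ln (lam k)))) by (eexists; exact Hs).
  assert (E : theta nu v = kapsum lam n v + Series (fun k => kap (v - ln (lam (n + k)%nat)))).
  { rewrite <- (is_series_unique _ _ Hs). unfold kapsum. clear Hs. induction n as [ | n IH]; [ simpl; rewrite Rplus_0_l; reflexivity | ].
    rewrite IH. rewrite (Series_incr_1 (fun k => kap (v - ln (lam (n + k)%nat)))).
    - cbn [fsum]. rewrite Nat.add_0_r, Rplus_assoc. do 2 f_equal. apply Series_ext. intros k. do 3 f_equal. f_equal. lia.
    - apply (ex_series_incr_n (fun k => kap (v - ln (lam k))) n); auto. }
  rewrite E. replace (kapsum lam n v + Series (fun k => kap (v - ln (lam (n + k)%nat))) - kapsum lam n v)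
    with (Series (fun k => kap (v - ln (lam (n + k)%nat)))) by ring.
  assert (Hb : forall k, 0 <= kap (v - ln (lam (n + k)%nat)) <= exp (- (th * ln (lam (n + k)%nat))) * exp (th * v)).
  { intros k. split; [ left; apply kap_pos | ]. rewrite <- exp_plus.
    replace (- (th * ln (lam (n + k)%nat)) + th * v) with (th * (v - ln (lam (n + k)%nat))) by ring.
    apply kap_le_power. lra. }
  split.
  - rewrite <- (Series_zero (fun _ => 0)) by auto. apply Series_le; [ intros k; split; [ lra | apply Hb ] | ].
    apply (ex_series_incr_n (fun k => kap (v - ln (lam k))) n); auto.
  - rewrite <- Series_scal_r. apply Series_le; auto.
    apply (ex_series_scal_r (exp (th * v)) (fun k => exp (- (th * ln (lam (n + k)%nat))))).
    apply (ex_series_incr_n (fun k => exp (- (th * ln (lam k)))) n); auto.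
Qed.

Lemma theta_pos_bounded (nu : R) : 0 <= nu -> exists K, exp_bounded (theta nu) K (- (1 / 2)).
Proof.
  intros Hnu. destruct (theta_half_expansion nu Hnu) as [M [HM Hb]]. exists (1 / 2 + M).
  split; [ intros; apply theta_continuous; auto | ]. split; [ lra | ]. intros u Hu.
  specialize (Hb u Hu). rewrite Rabs_right by (left; apply theta_pos; auto).
  replace (- (- (1 / 2) * u)) with (u / 2) by field.
  assert (1 <= exp (u / 2)) by (apply Rle_trans with (exp 0); [ rewrite exp_0; lra | apply exp_le_compat; lra ]). nra.
Qed.

Definition Bth (nu : R) (s : C) : C := (LT (theta nu) s + LT (fun v => theta nu (- v)) (- s))%C.

Lemma theta_BL (nu : R) (s : C) : 0 <= nu -> 1 / 2 < Re s < 1 -> is_BL (theta nu) s (Bth nu s).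
Proof.
  intros Hnu Hs. destruct (theta_pos_bounded nu Hnu) as [K HK].
  exists (LT (theta nu) s), (LT (fun v => theta nu (- v)) (- s)). split; [ | split ]; auto.
  - apply (LT_exists _ K (- (1 / 2))); auto; lra.
  - apply (LT_exists _ (/ (4 * (nu + 1))) 1); [ apply theta_neg_bounded; auto | rewrite Re_opp_C; lra ].
Qed.

(** Sum and integral are interchanged by estimating the transform of theta minus its n-th partial
    sum. The remainder is bounded by a multiple of e^{t1 v} on the right half-line, t1 < Re s, and
    of e^{t2 v} on the left, t2 > Re s. Both exponents exceed 1/2, so the multiples are tails of
    convergent series. *)
Lemma zeta_strip (nu : R) (lam : nat -> R) (s b : C) : 0 <= nu -> bessel_spectrum nu lam -> 1 / 2 < Re s < 1 ->
  is_BL kap s b -> (zeta lam s * b)%C = Bth nu s.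
Proof.
  intros Hnu H Hs Hb. set (sg := Re s) in *.
  set (t1 := (1 / 2 + sg) / 2). set (t2 := (1 + sg) / 2).
  assert (Ht1 : 1 / 2 < t1 < sg) by (unfold t1; lra). assert (Ht2 : sg < t2 < 1) by (unfold t2; lra).
  assert (HB := theta_BL nu s Hnu Hs).
  assert (Ztail : forall th, 1 / 2 < th -> forall eps, 0 < eps -> exists N, Series (fun k => exp (- (th * ln (lam (N + k)%nat)))) < eps).
  { intros th Hth eps He. apply (Series_tail (fun k => exp (- (th * ln (lam k))))); auto.
    - apply (lam_power_series nu); auto.
    - intros; left; apply exp_pos. }
  assert (Hrem : forall n, Cmod (Bth nu s - csum n (fun k => cpow_neg (lam k) s) * b) <=
     Series (fun k => exp (- (t1 * ln (lam (n + k)%nat)))) / (sg - t1) + Series (fun k => exp (- (t2 * ln (lam (n + k)%nat)))) / (t2 - sg)).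
  { intros n.
    set (r := fun v => theta nu v + -1 * kapsum lam n v).
    assert (Cr : forall v, continuous r v).
    { intros v. apply (continuous_plus (theta nu) (fun v => -1 * kapsum lam n v)); [ apply theta_continuous; auto | ].
      apply (continuous_mult (fun _ => -1) (kapsum lam n)); [ apply continuous_const | apply kapsum_continuous ]. }
    destruct (kapsum_BL lam n s b Hb) as [k1 [k2 [P1 [P2 P3]]]].
    destruct HB as [l1 [l2 [Q1 [Q2 Q3]]]].
    assert (L1 : is_LT r s (l1 + RtoC (-1) * k1)%C).
    { apply (is_LT_plus (theta nu) (fun v => -1 * kapsum lam n v)); auto.
      - intros; apply theta_continuous; auto.
      - intros t. apply (continuous_mult (fun _ => -1) (kapsum lam n)); [ apply continuous_const | apply kapsum_continuous ].
      - apply is_LT_scal; auto. apply kapsum_continuous. }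
    assert (L2 : is_LT (fun v => r (- v)) (- s) (l2 + RtoC (-1) * k2)%C).
    { apply (is_LT_plus (fun v => theta nu (- v)) (fun v => -1 * kapsum lam n (- v))); auto.
      - intros; apply continuous_reflect; intros; apply theta_continuous; auto.
      - intros t. apply (continuous_mult (fun _ => -1) (fun v => kapsum lam n (- v))); [ apply continuous_const | ].
        apply continuous_reflect, kapsum_continuous.
      - apply (is_LT_scal (-1) (fun v => kapsum lam n (- v))); auto. intros; apply continuous_reflect, kapsum_continuous. }
    assert (Hr : forall th v, 1 / 2 < th <= 1 -> 0 <= r v <= Series (fun k => exp (- (th * ln (lam (n + k)%nat)))) * exp (th * v)).
    { intros th v Hth. unfold r. replace (theta nu v + -1 * kapsum lam n v) with (theta nu v - kapsum lam n v) by ring.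
      apply (kapsum_remainder nu); auto. }
    assert (Hpos : forall th, 1 / 2 < th <= 1 -> 0 <= Series (fun k => exp (- (th * ln (lam (n + k)%nat))))).
    { intros th Hth. specialize (Hr th 0 Hth). rewrite Rmult_0_r, exp_0, Rmult_1_r in Hr. lra. }
    assert (B1 : Cmod (l1 + RtoC (-1) * k1) <= Series (fun k => exp (- (t1 * ln (lam (n + k)%nat)))) / (Re s + - t1)).
    { apply (LT_bound r _ (- t1) s); auto; [ | fold sg; lra ].
      split; [ exact Cr | ]. split; [ apply Hpos; lra | ]. intros u Hu.
      destruct (Hr t1 u ltac:(lra)) as [r1 r2]. rewrite Rabs_right by lra.
      replace (- (- t1 * u)) with (t1 * u) by ring. exact r2. }
    assert (B2 : Cmod (l2 + RtoC (-1) * k2) <= Series (fun k => exp (- (t2 * ln (lam (n + k)%nat)))) / (Re (- s) + t2)).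
    { apply (LT_bound (fun v => r (- v)) _ t2 (- s)%C); auto; [ | rewrite Re_opp_C; fold sg; lra ].
      split; [ intros; apply continuous_reflect; auto | ]. split; [ apply Hpos; lra | ]. intros u Hu.
      destruct (Hr t2 (- u) ltac:(lra)) as [r1 r2]. rewrite Rabs_right by lra.
      replace (- (t2 * u)) with (t2 * - u) by ring. exact r2. }
    rewrite P3, Q3.
    replace (l1 + l2 - (k1 + k2))%C with ((l1 + RtoC (-1) * k1) + (l2 + RtoC (-1) * k2))%C.
    2: { replace (RtoC (-1)) with (- RtoC 1)%C by (ceq; ring). ring. }
    eapply Rle_trans; [ apply Cmod_triangle | ]. rewrite Re_opp_C in B2. fold sg in B1, B2.
    replace (sg + - t1) with (sg - t1) in B1 by ring. replace (- sg + t2) with (t2 - sg) in B2 by ring. lra. }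
  assert (Hz := zeta_correct nu lam s H ltac:(fold sg; lra)).
  apply Ceq_minus, Cmod_eq_0, Rle_antisym; [ | apply Cmod_ge_0 ].
  apply le_epsilon. intros eps He. rewrite Rplus_0_l.
  pose proof (Cmod_ge_0 b).
  destruct (Hz (eps / (3 * (Cmod b + 1))) ltac:(apply Rdiv_lt_0_compat; lra)) as [N1 K1].
  assert (Hmono : forall th n m, 1 / 2 < th -> (n <= m)%nat ->
    Series (fun k => exp (- (th * ln (lam (m + k)%nat)))) <= Series (fun k => exp (- (th * ln (lam (n + k)%nat))))).
  { intros th n m Hth Hnm. assert (Hex := lam_power_series nu lam th H Hth).
    induction Hnm as [ | m Hnm IH]; [ lra | ]. eapply Rle_trans; [ | exact IH ].
    rewrite (Series_incr_1 (fun k => exp (- (th * ln (lam (m + k)%nat))))).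
    - rewrite (Series_ext (fun k => exp (- (th * ln (lam (S m + k)%nat)))) (fun k => exp (- (th * ln (lam (m + S k)%nat))))).
      + pose proof (exp_pos (- (th * ln (lam (m + 0)%nat)))). lra.
      + intros k. do 5 f_equal. lia.
    - apply (ex_series_incr_n (fun k => exp (- (th * ln (lam k)))) m); auto. }
  destruct (Ztail t1 ltac:(lra) (eps / 3 * (sg - t1)) ltac:(apply Rmult_lt_0_compat; lra)) as [N2 K2].
  destruct (Ztail t2 ltac:(lra) (eps / 3 * (t2 - sg)) ltac:(apply Rmult_lt_0_compat; lra)) as [N3 K3].
  set (n := max N1 (max N2 N3)). specialize (K1 n ltac:(lia)). specialize (Hrem n).
  assert (M2 := Hmono t1 N2 n ltac:(lra) ltac:(lia)). assert (M3 := Hmono t2 N3 n ltac:(lra) ltac:(lia)).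
  assert (R2 : Series (fun k => exp (- (t1 * ln (lam (n + k)%nat)))) / (sg - t1) <= eps / 3).
  { apply (Rmult_le_reg_r (sg - t1)); [ lra | ]. unfold Rdiv at 1. rewrite Rmult_assoc, Rinv_l by lra. lra. }
  assert (R3 : Series (fun k => exp (- (t2 * ln (lam (n + k)%nat)))) / (t2 - sg) <= eps / 3).
  { apply (Rmult_le_reg_r (t2 - sg)); [ lra | ]. unfold Rdiv at 1. rewrite Rmult_assoc, Rinv_l by lra. lra. }
  set (Sn := csum n (fun k => cpow_neg (lam k) s)) in *.
  replace (zeta lam s * b - Bth nu s)%C with (- ((Sn - zeta lam s) * b) + - (Bth nu s - Sn * b))%C by ring.
  eapply Rle_trans; [ apply Cmod_triangle | ]. rewrite !Cmod_opp, Cmod_mult.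
  assert (R1 : Cmod (Sn - zeta lam s) * Cmod b <= eps / 3).
  { apply Rle_trans with ((eps / (3 * (Cmod b + 1))) * (Cmod b + 1)); [ | right; field; lra ].
    apply Rmult_le_compat; try lra; apply Cmod_ge_0. }
  lra.
Qed.

(** * Meromorphic continuation *)

(** The transform over v > 0 of the j-th term of [thetaN], which continues to the plane as a
    rational function. *)
Definition polar (nu : R) (j : nat) (s : C) : C := (RtoC (expc nu j / 2) * / (s + RtoC ((INR j - 1) / 2)))%C.

Definition thetaR (nu : R) (N : nat) (v : R) : R := theta nu v - thetaN nu N v.

(** Holomorphic for (1-N)/2 < Re s < 1: the left bound comes from the decay of the remainder at +oo,
    the right one from that of theta at -oo. *)
Definition Hreg (nu : R) (N : nat) (s : C) : C :=
  (LT (thetaR nu N) s + LT (fun v => theta nu (- v)) (- s))%C.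

Definition Hcont (nu : R) (N : nat) (s : C) : C := (Hreg nu N s + csum (S N) (fun j => polar nu j s))%C.

Lemma thetaN_continuous (nu : R) (N : nat) (v : R) : continuous (thetaN nu N) v.
Proof. apply (ex_derive_continuous (V:=R_NormedModule)). eexists. apply thetaN_derive. Qed.

Lemma exp_lin_continuous (a v : R) : continuous (fun v => exp (- (a * v))) v.
Proof. apply (ex_derive_continuous (V:=R_NormedModule)). auto_derive. auto. Qed.

Lemma remainder_LT (nu : R) (N : nat) (s : C) : 0 <= nu -> 0 < Re s + (INR N - 1) / 2 ->
  is_LT (thetaR nu N) s (LT (thetaR nu N) s).
Proof.
  intros Hnu Hs. destruct (theta_expansion nu N Hnu) as [K HK]. apply (LT_exists _ K ((INR N - 1) / 2)); auto.
Qed.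

Lemma polar_LT (nu : R) (j : nat) (s : C) : 0 < Re s + (INR j - 1) / 2 ->
  is_LT (fun v => expc nu j / 2 * exp (- ((INR j - 1) / 2 * v))) s (polar nu j s).
Proof.
  intros H. apply (is_LT_scal (expc nu j / 2) (fun v => exp (- ((INR j - 1) / 2 * v)))).
  - apply exp_lin_continuous.
  - apply is_LT_exp; auto.
Qed.

(** One more term moved from the remainder to the polar part changes nothing where both transforms
    converge; so the formulas of all orders define one function. *)
Lemma Hcont_step (nu : R) (N : nat) (s : C) : 0 <= nu -> 0 < Re s + (INR N - 1) / 2 ->
  Hcont nu N s = Hcont nu (S N) s.
Proof.
  intros Hnu Hs. unfold Hcont, Hreg.
  change (csum (S (S N)) (fun j => polar nu j s)) with (csum (S N) (fun j => polar nu j s) + polar nu (S N) s)%C.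
  rewrite (LT_eq (thetaR nu N) s (LT (thetaR nu (S N)) s + polar nu (S N) s)%C).
  - ring.
  - apply (is_LT_ext (fun v => thetaR nu (S N) v + expc nu (S N) / 2 * exp (- ((INR (S N) - 1) / 2 * v)))).
    + intros u _.
      unfold thetaR. change (thetaN nu (S N) u) with (thetaN nu N u + expc nu (S N) / 2 * exp (- ((INR (S N) - 1) / 2 * u))). ring.
    + apply (is_LT_plus (thetaR nu (S N)) (fun v => expc nu (S N) / 2 * exp (- ((INR (S N) - 1) / 2 * v)))).
      * intros t. apply (continuous_minus (theta nu) (thetaN nu (S N))); [ apply theta_continuous; auto | apply thetaN_continuous ].
      * intros t. apply (continuous_mult (fun _ => expc nu (S N) / 2) (fun v => exp (- ((INR (S N) - 1) / 2 * v)))); [ apply continuous_const | apply exp_lin_continuous ].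
      * apply remainder_LT; auto. rewrite S_INR. lra.
      * apply polar_LT. rewrite S_INR. lra.
Qed.

Lemma Hcont_indep (nu : R) (N M : nat) (s : C) : 0 <= nu -> (N <= M)%nat -> 0 < Re s + (INR N - 1) / 2 ->
  Hcont nu N s = Hcont nu M s.
Proof.
  intros Hnu HNM Hs. induction HNM as [ | M HNM IH]; auto. rewrite IH. apply Hcont_step; auto.
  apply le_INR in HNM. lra.
Qed.

Lemma Hcont_strip (nu : R) (N : nat) (s : C) : 0 <= nu -> 1 / 2 < Re s < 1 -> Hcont nu N s = Bth nu s.
Proof.
  intros Hnu Hs. rewrite <- (Hcont_indep nu 0 N s Hnu) by (try lia; simpl; lra).
  unfold Hcont, Hreg, Bth.
  rewrite (LT_eq (theta nu) s (LT (thetaR nu 0) s + polar nu 0 s)%C).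
  - simpl. ring.
  - apply (is_LT_ext (fun v => thetaR nu 0 v + expc nu 0 / 2 * exp (- ((INR 0 - 1) / 2 * v)))).
    + intros u _. unfold thetaR, thetaN. cbn [fsum]. ring.
    + apply (is_LT_plus (thetaR nu 0) (fun v => expc nu 0 / 2 * exp (- ((INR 0 - 1) / 2 * v)))).
      * intros t. apply (continuous_minus (theta nu) (thetaN nu 0)); [ apply theta_continuous; auto | apply thetaN_continuous ].
      * intros t. apply (continuous_mult (fun _ => expc nu 0 / 2) (fun v => exp (- ((INR 0 - 1) / 2 * v)))); [ apply continuous_const | apply exp_lin_continuous ].
      * apply remainder_LT; auto. simpl. lra.
      * apply polar_LT. simpl. lra.
Qed.

Lemma cder_opp_comp (f : C -> C) (s l : C) : cder f (- s) l -> cder (fun s => f (- s)%C) s (- l)%C.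
Proof.
  intros H. replace (- l)%C with (l * (- (1)))%C by ring. apply (cder_comp f (fun s => - s)%C); auto.
  apply (cder_ext (fun s => (- (1)) * s)%C); [ intros; ring | apply cder_lin ].
Qed.

Lemma Hreg_cder (nu : R) (N : nat) (s : C) : 0 <= nu -> Re s < 1 -> 0 < Re s + (INR N - 1) / 2 ->
  exists l, cder (Hreg nu N) s l.
Proof.
  intros Hnu H1 H2. destruct (theta_expansion nu N Hnu) as [K HK].
  eexists. apply (cder_plus (LT (thetaR nu N)) (fun s => LT (fun v => theta nu (- v)) (- s)%C)).
  - apply (LT_cder _ K ((INR N - 1) / 2)); auto.
  - apply cder_opp_comp. apply (LT_cder _ (/ (4 * (nu + 1))) 1); [ apply theta_neg_bounded; auto | rewrite Re_opp_C; lra ].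
Qed.

Definition half_pole (j : nat) : C := RtoC ((1 - INR j) / 2).

Lemma polar_cder (nu : R) (j : nat) (s : C) : s <> half_pole j -> exists l, cder (polar nu j) s l.
Proof.
  intros H. eexists. unfold polar. apply cder_scal, cder_inv_comp.
  - apply cder_plus; [ apply cder_id | apply cder_const ].
  - intros E. apply H. unfold half_pole.
    replace s with ((s + RtoC ((INR j - 1) / 2)) - RtoC ((INR j - 1) / 2))%C by ring. rewrite E.
    ceq; field.
Qed.

Lemma csum_cder (n : nat) (f : nat -> C -> C) (s : C) : (forall j, (j < n)%nat -> exists l, cder (f j) s l) ->
  exists l, cder (fun s => csum n (fun j => f j s)) s l.
Proof.
  induction n as [ | n IH]; intros H; cbn [csum].
  - eexists. apply cder_const.
  - destruct IH as [l Hl]; [ intros; apply H; lia | ]. destruct (H n ltac:(lia)) as [m Hm].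
    eexists. apply (cder_plus (fun s => csum n (fun j => f j s)) (f n)); eassumption.
Qed.

Lemma Hcont_cder (nu : R) (N : nat) (s : C) : 0 <= nu -> Re s < 1 -> 0 < Re s + (INR N - 1) / 2 ->
  (forall j, s <> half_pole j) -> exists l, cder (Hcont nu N) s l.
Proof.
  intros Hnu H1 H2 Hp. destruct (Hreg_cder nu N s Hnu H1 H2) as [l Hl].
  destruct (csum_cder (S N) (fun j => polar nu j) s) as [m Hm]; [ intros; apply polar_cder; auto | ].
  eexists. apply (cder_plus (Hreg nu N) (fun s => csum (S N) (fun j => polar nu j s))); eassumption.
Qed.

(** Any N > 1 - 2 Re s would do; starting from 2 - 2 Re s leaves a margin. *)
Definition zeta_order (s : C) : nat := Z.to_nat (up (2 - 2 * Re s)).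

Lemma zeta_order_spec (s : C) : Re s < 1 -> 0 < Re s + (INR (zeta_order s) - 1) / 2.
Proof.
  intros H. destruct (archimed (2 - 2 * Re s)) as [H1 _]. unfold zeta_order. rewrite INR_IZR_INZ, Z2Nat.id; [ lra | ].
  apply le_IZR. lra.
Qed.

(** For 1/2 < Re s < 1 both formulas agree, so each point has a neighbourhood where a single one can
    be used. At 0 the pole of [Hcont], of residue c_1/2, meets the zero of sin(pi s)/pi, and the
    limit c_1/2 is entered by hand. *)
Definition zeta_cont (nu : R) (lam : nat -> R) (s : C) : C :=
  if Rlt_dec (Re s) 1 then
    if Ceq_dec s 0 then RtoC (expc nu 1 / 2) else (csin (RtoC PI * s) / RtoC PI * Hcont nu (zeta_order s) s)%C
  else zeta lam s.

Lemma CPI_neq_0 : RtoC PI <> RtoC 0.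
Proof. intros E. apply RtoC_inj in E. pose proof PI_RGT_0. lra. Qed.

Lemma zeta_cont_right (nu : R) (lam : nat -> R) (s : C) : 0 <= nu -> bessel_spectrum nu lam -> 1 / 2 < Re s ->
  zeta_cont nu lam s = zeta lam s.
Proof.
  intros Hnu H Hs. unfold zeta_cont. destruct (Rlt_dec (Re s) 1) as [H1 | H1]; auto.
  destruct (Ceq_dec s 0) as [-> | _]; [ simpl in Hs; lra | ].
  rewrite Hcont_strip by (auto; lra).
  destruct (kap_transform s ltac:(lra)) as [b [Hb E]].
  rewrite <- (zeta_strip nu lam s b) by (auto; lra).
  transitivity (csin (RtoC PI * s) * b / RtoC PI * zeta lam s)%C; [ unfold Cdiv; ring | ].
  rewrite E. field. apply CPI_neq_0.
Qed.

Lemma zeta_cont_left (nu : R) (lam : nat -> R) (N : nat) (s : C) : 0 <= nu -> Re s < 1 -> s <> RtoC 0 ->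
  0 < Re s + (INR N - 1) / 2 ->
  zeta_cont nu lam s = (csin (RtoC PI * s) / RtoC PI * Hcont nu N s)%C.
Proof.
  intros Hnu H1 H0 HN. unfold zeta_cont. destruct (Rlt_dec (Re s) 1) as [_ | n]; [ | contradiction ].
  destruct (Ceq_dec s 0) as [ | _]; [ contradiction | ]. f_equal.
  assert (Ho := zeta_order_spec s H1).
  destruct (Nat.le_ge_cases N (zeta_order s)) as [h | h].
  - symmetry. apply Hcont_indep; auto.
  - apply Hcont_indep; auto.
Qed.

Lemma Re_near (w s : C) (d : R) : Cmod (w - s) < d -> Re s - d < Re w < Re s + d.
Proof.
  intros H. assert (T := re_le_Cmod (w - s)). change (Re (w - s)) with (Re w - Re s) in T.
  apply Rabs_le_between in T. lra.
Qed.

Lemma zeta_cont_cder (nu : R) (lam : nat -> R) (s : C) : 0 <= nu -> bessel_spectrum nu lam ->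
  s <> RtoC 0 -> (forall j, s <> half_pole j) -> exists l, cder (zeta_cont nu lam) s l.
Proof.
  intros Hnu H H0 Hp. destruct (Rlt_le_dec (1 / 2) (Re s)) as [Hs | Hs].
  - destruct (zeta_cder nu lam s H Hs) as [l Hl]. exists l.
    apply (cder_ext_loc (zeta lam) _ s l (Re s - 1 / 2)); auto; [ lra | ].
    intros w Hw. symmetry. apply zeta_cont_right; auto. apply Re_near in Hw. lra.
  (* One order more than s requires, so that N remains admissible in a disc of radius 1/2 about
     s. *)
  - set (N := S (zeta_order s)). assert (Ho := zeta_order_spec s ltac:(lra)).
    assert (HN : / 2 < Re s + (INR N - 1) / 2) by (unfold N; rewrite S_INR; lra).
    destruct (Hcont_cder nu N s Hnu ltac:(lra) ltac:(lra) Hp) as [l Hl].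
    assert (Hd : 0 < Rmin (/ 2) (Cmod s)) by (apply Rmin_pos; [ lra | apply Cmod_gt_0; auto ]).
    eexists. apply (cder_ext_loc (fun s => csin (RtoC PI * s) * / RtoC PI * Hcont nu N s)%C _ s _ _ Hd).
    + intros w Hw. symmetry.
      assert (W1 := Re_near _ _ _ (Rlt_le_trans _ _ _ Hw (Rmin_l _ _))).
      assert (W2 := Rlt_le_trans _ _ _ Hw (Rmin_r _ _)).
      apply zeta_cont_left; auto; try lra.
      intros ->. replace (0 - s)%C with (- s)%C in W2 by ring. rewrite Cmod_opp in W2. lra.
    + apply cder_mult; [ | exact Hl ]. apply (cder_mult (fun s => csin (RtoC PI * s))%C (fun _ => / RtoC PI)%C).
      * apply (cder_comp csin (fun s => RtoC PI * s)%C); [ apply cder_lin | apply cder_csin ].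
      * apply cder_const.
Qed.

Definition sinc (w : C) : C := if Ceq_dec w 0 then RtoC 1 else (csin w / w)%C.

Lemma cder_sinc_0 : cder sinc 0 0.
Proof.
  intros eps He. exists (Rmin 1 (eps / exp 1)).
  split; [ apply Rmin_pos; [ lra | apply Rdiv_lt_0_compat; auto; apply exp_pos ] | ].
  intros w Hw. replace (w - 0)%C with w in * by ring.
  assert (A1 := Rlt_le_trans _ _ _ Hw (Rmin_l _ _)). assert (A2 := Rlt_le_trans _ _ _ Hw (Rmin_r _ _)).
  unfold sinc. destruct (Ceq_dec 0 0) as [_ | n]; [ | congruence ].
  destruct (Ceq_dec w 0) as [-> | Hw0].
  - replace (1 - 1 - 0 * 0)%C with (RtoC 0) by ring. rewrite Cmod_0. lra.
  - assert (Hwp : 0 < Cmod w) by (apply Cmod_gt_0; auto).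
    (* The constant and quadratic terms are even and cancel in the sine, and the linear term gives
       the 1; what is left is of third order. *)
    set (r3 := fun z => (cexp z - 1 - z - z * z / 2)%C).
    replace (csin w / w - 1 - 0 * w)%C with ((r3 (Ci * w) - r3 (- (Ci * w))) / (2 * Ci * w))%C.
    2: { unfold csin, r3. field. repeat split; auto using C2_neq_0, Ci_nz. }
    rewrite Cmod_div by (apply Cmult_neq_0; [ apply C2i_neq_0 | auto ]).
    rewrite !Cmod_mult, Cmod_Ci, Cmod_R, (Rabs_right 2) by lra.
    assert (R1 := cexp_bound3 (Ci * w)). assert (R2 := cexp_bound3 (- (Ci * w))).
    rewrite Cmod_opp in R2. rewrite Cmod_mult, Cmod_Ci, Rmult_1_l in R1, R2.
    assert (T : Cmod (r3 (Ci * w)%C - r3 (- (Ci * w))%C) <= 2 * (Cmod w ^ 3 * exp (Cmod w))).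
    { unfold Cminus at 1. eapply Rle_trans; [ apply Cmod_triangle | ]. rewrite Cmod_opp. unfold r3. lra. }
    apply (Rmult_le_reg_r (2 * 1 * Cmod w)); [ lra | ]. unfold Rdiv. rewrite Rmult_assoc, Rinv_l, Rmult_1_r by lra.
    eapply Rle_trans; [ exact T | ].
    assert (E1 : exp (Cmod w) <= exp 1) by (apply exp_le_compat; lra).
    apply (Rmult_lt_compat_r (exp 1)) in A2; [ | apply exp_pos ]. pose proof (exp_pos 1).
    replace (eps / exp 1 * exp 1) with eps in A2 by (field; lra).
    assert (E2 : Cmod w * exp (Cmod w) <= eps).
    { apply Rle_trans with (Cmod w * exp 1); [ apply Rmult_le_compat_l; lra | lra ]. }
    replace (2 * (Cmod w ^ 3 * exp (Cmod w))) with (2 * (Cmod w * Cmod w) * (Cmod w * exp (Cmod w))) by ring.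
    replace (eps * Cmod w * (2 * 1 * Cmod w)) with (2 * (Cmod w * Cmod w) * eps) by ring.
    apply Rmult_le_compat_l; nra.
Qed.

(* zeta = sin(pi s)/pi * Hcont, so zeta'(0) is the finite part of Hcont at its simple pole 0. *)
Definition zeta0' (nu : R) : C :=
  (Hreg nu 2 0 - RtoC (expc nu 0) + RtoC (expc nu 2))%C.

Lemma zeta_cont_cder_0 (nu : R) (lam : nat -> R) : 0 <= nu -> cder (zeta_cont nu lam) 0 (zeta0' nu).
Proof.
  intros Hnu.
  (* [Hcont] without its polar term at 0, so that zeta = sinc(pi s) (s A(s) + c_1/2). Order 2 is the
     first at which (N-1)/2 > 0, that is, at which the remainder decays. *)
  set (A := fun s => (Hreg nu 2 s + polar nu 0 s + polar nu 2 s)%C).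
  assert (HA0 : A 0 = zeta0' nu).
  { unfold A, zeta0', polar. simpl INR.
    replace (0 + RtoC ((0 - 1) / 2))%C with (RtoC (- (1 / 2))) by (ceq; field).
    replace (0 + RtoC ((1 + 1 - 1) / 2))%C with (RtoC (1 / 2)) by (ceq; field).
    rewrite <- !RtoC_inv, <- !RtoC_mult by lra.
    replace (expc nu 0 / 2 * / - (1 / 2)) with (- expc nu 0) by field.
    replace (expc nu 2 / 2 * / (1 / 2)) with (expc nu 2) by field. rewrite RtoC_opp. reflexivity. }
  assert (HAd : exists l, cder A 0 l).
  { destruct (Hreg_cder nu 2 0 Hnu) as [l1 h1]; [ simpl; lra | simpl; lra | ].
    destruct (polar_cder nu 0 0) as [l2 h2].
    { unfold half_pole. intros E. apply RtoC_inj in E. simpl in E. lra. }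
    destruct (polar_cder nu 2 0) as [l3 h3].
    { unfold half_pole. intros E. apply RtoC_inj in E. simpl in E. lra. }
    eexists. apply cder_plus; [ apply cder_plus; eassumption | eassumption ]. }
  destruct HAd as [l Hl].
  assert (Hs : cder (fun s => sinc (RtoC PI * s)%C) 0 (0 * RtoC PI)%C).
  { apply (cder_comp sinc (fun s => RtoC PI * s)%C); [ apply cder_lin | rewrite Cmult_0_r; apply cder_sinc_0 ]. }
  assert (Hg : cder (fun s => s * A s + RtoC (expc nu 1 / 2))%C 0 (1 * A 0 + 0 * l + 0)%C).
  { apply cder_plus; [ apply cder_mult; [ apply cder_id | exact Hl ] | apply cder_const ]. }
  assert (Hm := cder_mult _ _ _ _ _ Hs Hg). cbn beta in Hm.
  replace (zeta0' nu) with (0 * PI * (0 * A 0 + RtoC (expc nu 1 / 2)) + sinc (PI * 0) * (1 * A 0 + 0 * l + 0))%C.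
  2: { rewrite Cmult_0_r. unfold sinc at 1. destruct (Ceq_dec 0 0) as [_ | n]; [ | congruence ]. rewrite HA0. ring. }
  apply (cder_ext_loc _ _ 0 _ (1 / 2)) with (3 := Hm); [ lra | ].
  intros w Hw. assert (W := Re_near _ _ _ Hw). simpl in W.
  destruct (Ceq_dec w 0) as [-> | Hw0].
  - rewrite Cmult_0_r. unfold sinc, zeta_cont. destruct (Ceq_dec 0 0) as [_ | n]; [ | congruence ].
    destruct (Rlt_dec (Re 0) 1) as [_ | n]; [ ring | simpl in n; lra ].
  - rewrite (zeta_cont_left nu lam 2 w) by (auto; simpl; lra).
    unfold Hcont. cbn [csum].
    replace (polar nu 1 w) with (RtoC (expc nu 1 / 2) * / w)%C.
    2: { unfold polar. replace (RtoC ((INR 1 - 1) / 2)) with (RtoC 0) by (f_equal; simpl; field). rewrite Cplus_0_r. reflexivity. }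
    assert (Hpw : (RtoC PI * w)%C <> RtoC 0) by (apply Cmult_neq_0; [ apply CPI_neq_0 | auto ]).
    unfold sinc. destruct (Ceq_dec (RtoC PI * w) 0) as [ | _]; [ contradiction | ].
    unfold A. field. split; auto using CPI_neq_0.
Qed.

Lemma zeta_cont_is_continuation (nu : R) (lam : nat -> R) : 0 <= nu -> bessel_spectrum nu lam -> spec_enum nu lam ->
  zeta_continuation nu (zeta_cont nu lam).
Proof.
  intros Hnu H He. exists lam. split; auto. split.
  - exists (1 / 2). intros s Hs. apply is_cs_is_series. rewrite (zeta_cont_right nu lam s) by auto.
    apply (zeta_correct nu); auto.
  (* All half-integer poles except 0, where the value has been repaired. They are 1/2 apart, so at
     most one lies within 1/4 of a given point. *)
  - exists (fun s => s <> RtoC 0 /\ exists j, s = half_pole j). split; [ tauto | ]. split.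
    + intros z.
      assert (Hsep : forall i j, i <> j -> 1 / 2 <= Cmod (half_pole i - half_pole j)).
      { intros i j Hij. unfold half_pole. rewrite <- RtoC_minus, Cmod_R.
        replace ((1 - INR i) / 2 - (1 - INR j) / 2) with ((INR j - INR i) / 2) by field.
        destruct (Nat.lt_gt_cases i j) as [K _]. destruct (K Hij) as [h | h]; apply le_INR in h; rewrite S_INR in h.
        - rewrite Rabs_right; lra.
        - rewrite Rabs_left; lra. }
      destruct (classic (exists j, Cmod (half_pole j - z) < 1 / 4)) as [[j Hj] | Hn].
      * destruct (Ceq_dec (half_pole j) z) as [<- | Hne].
        -- exists (1 / 2). split; [ lra | ]. intros w [_ [i ->]] Hw.
           destruct (Nat.eq_dec i j) as [-> | Hij]; auto. specialize (Hsep i j Hij). lra.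
        -- assert (Hpz : 0 < Cmod (half_pole j - z)) by (apply Cmod_gt_0; apply Cminus_eq_contra; auto).
           exists (Cmod (half_pole j - z)). split; auto. intros w [_ [i ->]] Hw.
           destruct (Nat.eq_dec i j) as [-> | Hij]; [ lra | ]. specialize (Hsep i j Hij).
           assert (T := Cmod_triangle (half_pole i - z) (z - half_pole j)).
           replace (half_pole i - z + (z - half_pole j))%C with (half_pole i - half_pole j)%C in T by ring.
           rewrite (Cmod_minus_sym z) in T. lra.
      * exists (1 / 4). split; [ lra | ]. intros w [_ [i ->]] Hw. exfalso. apply Hn. exists i; auto.
    + intros z Hz. apply ex_cder_ex_derive. destruct (Ceq_dec z 0) as [-> | H0].
      * eexists. apply zeta_cont_cder_0; auto.
      * apply zeta_cont_cder; auto. intros j Hj. apply Hz. split; eauto.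
Qed.

(** * The finite part *)

Definition logdet (nu X : R) : R := ln (bess nu (exp X)) - exp (X / 2) - expc nu 1 / 2 * X.

Lemma lker_0 (h : R -> R) (u : R) : lker h 0 u = RtoC (h u).
Proof. unfold lker. replace (- (0 * RtoC u))%C with (RtoC 0) by ring. rewrite cexp_0. ring. Qed.

Lemma ln_bess_derive (nu v : R) : 0 <= nu -> is_derive (fun v => ln (bess nu (exp v))) v (theta nu v).
Proof.
  intros Hnu. assert (Hb := bess_exp_pos nu v Hnu).
  replace (theta nu v) with (exp v * (bess (nu + 1) (exp v) / (4 * (nu + 1))) * / bess nu (exp v)) by reflexivity.
  apply (is_derive_comp ln (fun v => bess nu (exp v))); [ | apply bess_exp_derive; auto ].
  auto_derive; auto. field. lra.
Qed.

Lemma RInt_theta_neg (nu X : R) : 0 <= nu -> RInt (fun v => theta nu (- v)) 0 X = ln (bess nu 1) - ln (bess nu (exp (- X))).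
Proof.
  intros Hnu. apply is_RInt_unique.
  replace (ln (bess nu 1) - ln (bess nu (exp (- X)))) with
    (minus ((fun v => - ln (bess nu (exp (- v)))) X) ((fun v => - ln (bess nu (exp (- v)))) 0)).
  2: { unfold minus, plus, opp; simpl. rewrite Ropp_0, exp_0. ring. }
  apply (is_RInt_derive (V:=R_CompleteNormedModule) (fun v => - ln (bess nu (exp (- v))))).
  - intros x _. replace (theta nu (- x)) with (- (-1 * theta nu (- x))) by ring.
    apply (is_derive_opp (fun v => ln (bess nu (exp (- v))))).
    apply (is_derive_comp (fun v => ln (bess nu (exp v))) (fun v => - v)); [ apply ln_bess_derive; auto | ].
    auto_derive; auto. 
  - intros x _. apply continuous_reflect. intros; apply theta_continuous; auto.
Qed.

Lemma RInt_theta_rem (nu X : R) : 0 <= nu -> RInt (thetaR nu 2) 0 X =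
  logdet nu X + expc nu 2 * exp (- (X / 2)) - (ln (bess nu 1) - 1 + expc nu 2).
Proof.
  intros Hnu. apply is_RInt_unique.
  set (F := fun v => ln (bess nu (exp v)) - exp (v / 2) - expc nu 1 / 2 * v + expc nu 2 * exp (- (v / 2))).
  replace (logdet nu X + expc nu 2 * exp (- (X / 2)) - (ln (bess nu 1) - 1 + expc nu 2)) with (minus (F X) (F 0)).
  2: { unfold F, logdet, minus, plus, opp; simpl. replace (0 / 2) with 0 by field. rewrite Ropp_0, exp_0. ring. }
  apply (is_RInt_derive (V:=R_CompleteNormedModule) F).
  - intros x _. 
    assert (D2 : is_derive (fun v => - exp (v / 2) - expc nu 1 / 2 * v + expc nu 2 * exp (- (v / 2))) x (- thetaN nu 2 x)).
    { assert (Gd : forall c1 c2, is_derive (fun v => - exp (v / 2) - c1 / 2 * v + c2 * exp (- (v / 2))) x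
         (- (1 / 2 * exp (x / 2) + c1 / 2 + c2 / 2 * exp (- (x / 2))))).
      { intros c1 c2. auto_derive; auto. unfold Rdiv. field. }
      replace (thetaN nu 2 x) with (1 / 2 * exp (x / 2) + expc nu 1 / 2 + expc nu 2 / 2 * exp (- (x / 2))); [ apply Gd | ].
      unfold thetaN. cbn [fsum]. simpl INR.
      replace (- ((0 - 1) / 2 * x)) with (x / 2) by field.
      replace (- ((1 - 1) / 2 * x)) with 0 by field.
      replace (- ((1 + 1 - 1) / 2 * x)) with (- (x / 2)) by field.
      rewrite exp_0. change (expc nu 0) with 1. ring. }
    assert (D := is_derive_plus _ _ x _ _ (ln_bess_derive nu x Hnu) D2).
    apply (is_derive_ext (fun v => ln (bess nu (exp v)) + (- exp (v / 2) - expc nu 1 / 2 * v + expc nu 2 * exp (- (v / 2))))).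
    + intros t. unfold F. match goal with |- ?a = ?b => change (a = b :> R) end. ring.
    + exact D.
  - intros x _. apply (continuous_minus (theta nu) (thetaN nu 2)); [ apply theta_continuous; auto | apply thetaN_continuous ].
Qed.

(** At s = 0 both transforms are plain integrals with logarithmic primitives. Adding them, ln
    bess(nu, 1) cancels, and the constants left at v = 0 are the values -1 and c_2 of the polar
    terms 0 and 2 in [zeta0']. The limit is real because [logdet] is. *)
Lemma logdet_limit (nu : R) : 0 <= nu -> exists l, zeta0' nu = RtoC l /\
  forall eps, 0 < eps -> exists M, forall X, M <= X -> Rabs (logdet nu X - l) < eps.
Proof.
  intros Hnu.
  set (l1 := LT (thetaR nu 2) 0). set (l2 := LT (fun v => theta nu (- v)) (- 0)).
  assert (P1 : is_LT (thetaR nu 2) 0 l1) by (apply remainder_LT; auto; simpl; lra).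
  assert (P2 : is_LT (fun v => theta nu (- v)) (- 0) l2).
  { apply (LT_exists _ (/ (4 * (nu + 1))) 1); [ apply theta_neg_bounded; auto | simpl; lra ]. }
  assert (Z : zeta0' nu = (l1 + l2 - 1 + RtoC (expc nu 2))%C) by reflexivity.
  assert (Hc : continuous (bess nu) 0).
  { apply (ex_derive_continuous (V:=R_NormedModule)). eexists. apply bess_derive; auto. }
  assert (Hln : forall eps, 0 < eps -> exists M, forall X, M <= X -> Rabs (ln (bess nu (exp (- X)))) < eps).
  { assert (C2 : continuous (fun z => ln (bess nu z)) 0).
    { apply (ex_derive_continuous (V:=R_NormedModule)). eexists.
      apply (is_derive_comp ln (bess nu)); [ | apply bess_derive; auto ].
      rewrite bess_0. auto_derive; [ lra | reflexivity ]. }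
    intros eps He. destruct (proj1 (continuous_eps _ _) C2 eps He) as [d [Hd K]].
    destruct (exp_small 1 1 d ltac:(lra) ltac:(lra) Hd) as [M [_ HM]]. exists M. intros X HX.
    specialize (HM X HX). rewrite !Rmult_1_l in HM. specialize (K (exp (- X))).
    rewrite bess_0, ln_1, !Rminus_0_r in K. apply K. rewrite Rabs_right; [ auto | left; apply exp_pos ]. }
  assert (Hlim : forall eps, 0 < eps -> exists M, forall X, M <= X -> Cmod (RtoC (logdet nu X) - zeta0' nu) < eps).
  { intros eps He.
    destruct (P1 (eps / 4) ltac:(lra)) as [M1 K1]. destruct (P2 (eps / 4) ltac:(lra)) as [M2 K2].
    destruct (Hln (eps / 4) ltac:(lra)) as [M3 K3].
    destruct (exp_small (Rabs (expc nu 2)) (1 / 2) (eps / 4) (Rabs_pos _) ltac:(lra) ltac:(lra)) as [M4 [_ K4]].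
    exists (Rmax (Rmax M1 M2) (Rmax M3 M4)). intros X HX.
    assert (X1 := Rle_trans _ _ _ (Rmax_l _ _) HX). assert (X2 := Rle_trans _ _ _ (Rmax_r _ _) HX).
    specialize (K1 X (Rle_trans _ _ _ (Rmax_l _ _) X1)). specialize (K2 X (Rle_trans _ _ _ (Rmax_r _ _) X1)).
    specialize (K3 X (Rle_trans _ _ _ (Rmax_l _ _) X2)). specialize (K4 X (Rle_trans _ _ _ (Rmax_r _ _) X2)).
    rewrite (CInt_ext _ (fun v => RtoC (thetaR nu 2 v))) in K1 by (intros; apply (lker_0 (thetaR nu 2))).
    assert (E0 : forall v, lker (fun v => theta nu (- v)) (- 0) v = RtoC (theta nu (- v))).
    { intros v. replace (- 0)%C with (RtoC 0) by ring. apply (lker_0 (fun v => theta nu (- v))). }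
    rewrite (CInt_ext _ (fun v => RtoC (theta nu (- v)))) in K2 by (intros; apply E0).
    rewrite CInt_RtoC, RInt_theta_rem in K1 by auto. rewrite CInt_RtoC, RInt_theta_neg in K2 by auto.
    set (a := logdet nu X + expc nu 2 * exp (- (X / 2)) - (ln (bess nu 1) - 1 + expc nu 2)) in *.
    set (b := ln (bess nu 1) - ln (bess nu (exp (- X)))) in *.
    rewrite Z.
    replace (RtoC (logdet nu X) - (l1 + l2 - 1 + RtoC (expc nu 2)))%C with
      ((RtoC a - l1) + (RtoC b - l2) + RtoC (ln (bess nu (exp (- X))) - expc nu 2 * exp (- (X / 2))))%C.
    2: { replace (logdet nu X) with (a + b + ln (bess nu (exp (- X))) - expc nu 2 * exp (- (X / 2)) - 1 + expc nu 2)
           by (unfold a, b; ring).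
         rewrite !RtoC_plus, !RtoC_minus, !RtoC_plus. ring. }
    eapply Rle_lt_trans; [ apply Cmod_triangle3 | ]. rewrite Cmod_R.
    assert (K5 : Rabs (ln (bess nu (exp (- X))) - expc nu 2 * exp (- (X / 2))) < eps / 2).
    { eapply Rle_lt_trans; [ apply Rabs_triang | ]. rewrite Rabs_Ropp, Rabs_mult, (Rabs_right (exp _)) by (left; apply exp_pos).
      replace (1 / 2 * X) with (X / 2) in K4 by field. lra. }
    lra. }
  exists (Re (zeta0' nu)). split.
  - apply C_eq; [ reflexivity | ]. change (Im (zeta0' nu) = 0).
    assert (Him : Rabs (Im (zeta0' nu)) <= 0).
    { apply le_epsilon. intros eps He. rewrite Rplus_0_l. destruct (Hlim eps He) as [M K]. specialize (K M (Rle_refl _)).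
      assert (T := im_le_Cmod (RtoC (logdet nu M) - zeta0' nu)).
      change (Im (RtoC (logdet nu M) - zeta0' nu)) with (0 - Im (zeta0' nu)) in T.
      rewrite Rminus_0_l, Rabs_Ropp in T. lra. }
    apply Rabs_eq_0. apply Rle_antisym; [ exact Him | apply Rabs_pos ].
  - intros eps He. destruct (Hlim eps He) as [M K]. exists M. intros X HX. specialize (K X HX).
    eapply Rle_lt_trans; [ | exact K ]. apply (re_le_Cmod (RtoC (logdet nu X) - zeta0' nu)).
Qed.

(** * Functions characterised by the Bohr-Mollerup theorem *)

(** The model is f(m) = Gamma(m+1). Given the recurrence, [gl_conv] is the inequality f(m+s) <=
    f(m)^{1-s} f(m+1)^s, the only part of log-convexity that is used. *)
Record gamma_like (f : R -> R) : Prop := {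
  gl_pos : 0 < f 0;
  gl_rec : forall m, 0 <= m -> f (m + 1) = (m + 1) * f m;
  gl_conv : forall m s, 0 <= m -> 0 <= s <= 1 -> f (m + s) <= exp (s * ln (m + 1)) * f m }.

Lemma gamma_like_rising (f : R -> R) (s : R) (n : nat) : gamma_like f -> 0 <= s ->
  f (INR n + s) = fprod n (fun i => INR i + s + 1) * f s.
Proof.
  intros [_ Hr _] Hs. induction n as [ | n IH].
  - simpl. rewrite Rplus_0_l. ring.
  - rewrite S_INR. replace (INR n + 1 + s) with (INR n + s + 1) by ring.
    pose proof (pos_INR n). rewrite Hr, IH by lra. simpl. ring.
Qed.

(** The first bound steps from n up by s; the second steps from n + s up by 1 - s to n + 1. *)
Lemma gamma_like_bounds (f : R -> R) (s : R) (n : nat) : gamma_like f -> 0 <= s <= 1 ->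
  fprod n (fun i => INR i + s + 1) * f s <= exp (s * ln (INR n + 1)) * (fprod n (fun i => INR i + 0 + 1) * f 0) /\
  (INR n + 1) * (fprod n (fun i => INR i + 0 + 1) * f 0) <= exp ((1 - s) * ln (INR n + s + 1)) * (fprod n (fun i => INR i + s + 1) * f s).
Proof.
  intros H Hs. pose proof (pos_INR n).
  rewrite <- (gamma_like_rising f s n H) by lra. rewrite <- (gamma_like_rising f 0 n H) by lra.
  rewrite Rplus_0_r. destruct H as [Hp Hr Hc]. split; [ apply Hc; lra | ].
  rewrite <- Hr by lra.
  replace (INR n + 1) with (INR n + s + (1 - s)) at 1 by ring. apply Hc; lra.
Qed.

Lemma fprod_INR_pos (n : nat) (s : R) : 0 <= s -> 0 < fprod n (fun i => INR i + s + 1).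
Proof. intros Hs. apply fprod_pos. intros i _. pose proof (pos_INR i). lra. Qed.

Lemma gamma_like_pos_unit (f : R -> R) (s : R) : gamma_like f -> 0 <= s <= 1 -> 0 < f s.
Proof.
  intros H Hs. destruct (gamma_like_bounds f s 0 H Hs) as [_ H2]. destruct H as [Hp _ _]. simpl in H2.
  pose proof (exp_pos ((1 - s) * ln (0 + s + 1))). nra.
Qed.

(** Multiplying the upper bound for f by the lower bound for g cancels the rising products and
    leaves the ratio (n+2)/(n+1), which tends to 1. *)
Lemma gamma_like_ratio_le (f g : R -> R) (s : R) : gamma_like f -> gamma_like g -> 0 <= s <= 1 ->
  f s * g 0 <= g s * f 0.
Proof.
  intros Hf Hg Hs.
  assert (f0 := gl_pos f Hf). assert (g0 := gl_pos g Hg).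
  assert (fs := gamma_like_pos_unit f s Hf Hs). assert (gs := gamma_like_pos_unit g s Hg Hs).
  assert (K : forall n, (INR n + 1) * (f s * g 0) <= (INR n + 2) * (g s * f 0)).
  { intros n. destruct (gamma_like_bounds f s n Hf Hs) as [F1 _]. destruct (gamma_like_bounds g s n Hg Hs) as [_ G2].
    pose proof (pos_INR n) as Hn. assert (Ps := fprod_INR_pos n s ltac:(lra)). assert (P0 := fprod_INR_pos n 0 ltac:(lra)).
    set (ps := fprod n (fun i => INR i + s + 1)) in *. set (p0 := fprod n (fun i => INR i + 0 + 1)) in *.
    set (a := exp (s * ln (INR n + 1))) in *. set (b := exp ((1 - s) * ln (INR n + s + 1))) in *.
    assert (Hab : a * b <= INR n + 2).
    { unfold a, b. rewrite <- exp_plus. rewrite <- (exp_ln (INR n + 2)) by lra. apply exp_le_compat.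
      assert (ln (INR n + 1) <= ln (INR n + 2)) by (apply ln_le; lra).
      assert (ln (INR n + s + 1) <= ln (INR n + 2)) by (apply ln_le; lra). nra. }
    assert (Ha : 0 < a) by apply exp_pos. assert (Hb : 0 < b) by apply exp_pos.
    assert (M1 : (ps * f s) * ((INR n + 1) * (p0 * g 0)) <= (a * (p0 * f 0)) * (b * (ps * g s))).
    { apply Rmult_le_compat; auto; apply Rmult_le_pos; try lra; apply Rmult_le_pos; lra. }
    apply (Rmult_le_reg_l (ps * p0)); [ apply Rmult_lt_0_compat; auto | ].
    apply Rle_trans with ((a * b) * (ps * p0 * (g s * f 0))).
    - replace (ps * p0 * ((INR n + 1) * (f s * g 0))) with (ps * f s * ((INR n + 1) * (p0 * g 0))) by ring.
      eapply Rle_trans; [ exact M1 | right; ring ].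
    - replace (ps * p0 * ((INR n + 2) * (g s * f 0))) with ((INR n + 2) * (ps * p0 * (g s * f 0))) by ring.
      apply Rmult_le_compat_r; auto. apply Rmult_le_pos; [ | apply Rmult_le_pos; lra ]. apply Rmult_le_pos; lra. }
  apply Rnot_lt_le. intros Hlt.
  destruct (INR_unbounded (g s * f 0 / (f s * g 0 - g s * f 0))) as [n Hn]. specialize (K n).
  apply (Rmult_lt_compat_r (f s * g 0 - g s * f 0)) in Hn; [ | lra ].
  unfold Rdiv in Hn. rewrite Rmult_assoc, Rinv_l, Rmult_1_r in Hn by lra. nra.
Qed.

Lemma gamma_like_unique (f g : R -> R) (x : R) : gamma_like f -> gamma_like g -> 0 <= x ->
  f x * g 0 = g x * f 0.
Proof.
  intros Hf Hg Hx.
  assert (Hint : exists (n : nat) (s : R), 0 <= s <= 1 /\ x = INR n + s).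
  { destruct (archimed x) as [h1 h2]. exists (Z.to_nat (up x - 1)), (x - INR (Z.to_nat (up x - 1))).
    rewrite INR_IZR_INZ, Z2Nat.id.
    - rewrite minus_IZR. split; lra.
    - assert (0 < up x)%Z by (apply lt_IZR; lra). lia. }
  destruct Hint as [n [s [Hs ->]]].
  rewrite (gamma_like_rising f s n Hf), (gamma_like_rising g s n Hg) by lra.
  rewrite !Rmult_assoc. f_equal. apply Rle_antisym; apply gamma_like_ratio_le; auto.
Qed.

(** The tangent at the intermediate point lies below the graph at both ends. *)
Lemma exp_convex (s x y : R) : 0 <= s <= 1 -> exp ((1 - s) * x + s * y) <= (1 - s) * exp x + s * exp y.
Proof.
  intros Hs. set (z := (1 - s) * x + s * y).
  assert (T : forall t, exp z * (1 + (t - z)) <= exp t).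
  { intros t. replace (exp t) with (exp z * exp (t - z)) by (rewrite <- exp_plus; f_equal; ring).
    apply Rmult_le_compat_l; [ left; apply exp_pos | apply exp_ineq1_le ]. }
  assert (A1 := T x). assert (A2 := T y).
  apply Rle_trans with ((1 - s) * (exp z * (1 + (x - z))) + s * (exp z * (1 + (y - z)))).
  - right. unfold z. ring.
  - apply Rplus_le_compat; apply Rmult_le_compat_l; lra.
Qed.

(** * The Bessel constant is gamma-like *)

Definition blim (nu l : R) : Prop := forall eps, 0 < eps -> exists M, forall X, M <= X -> Rabs (logdet nu X - l) < eps.

Lemma blim_exists (nu : R) : 0 <= nu -> exists l, blim nu l.
Proof. intros H. destruct (logdet_limit nu H) as [l [_ Hl]]. exists l. exact Hl. Qed.

Definition bconst (nu : R) : R := epsilon (inhabits 0) (blim nu).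

Lemma bconst_spec (nu : R) : 0 <= nu -> blim nu (bconst nu).
Proof. intros H. apply (epsilon_spec (inhabits 0) (blim nu)), blim_exists; auto. Qed.

Lemma lim_oo_le (f g : R -> R) (a b : R) :
  (forall eps, 0 < eps -> exists M, forall X, M <= X -> Rabs (f X - a) < eps) ->
  (forall eps, 0 < eps -> exists M, forall X, M <= X -> Rabs (g X - b) < eps) ->
  (exists M, forall X, M <= X -> f X <= g X) -> a <= b.
Proof.
  intros Hf Hg [M HM]. apply le_epsilon. intros eps He.
  destruct (Hf (eps / 2) ltac:(lra)) as [M1 K1]. destruct (Hg (eps / 2) ltac:(lra)) as [M2 K2].
  set (X := Rmax M (Rmax M1 M2)).
  specialize (HM X (Rmax_l _ _)).
  specialize (K1 X (Rle_trans _ _ _ (Rmax_l _ _) (Rmax_r _ _))).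
  specialize (K2 X (Rle_trans _ _ _ (Rmax_r _ _) (Rmax_r _ _))).
  apply Rabs_def2 in K1. apply Rabs_def2 in K2. lra.
Qed.

Lemma lim_oo_eq (f g : R -> R) (a b : R) :
  (forall eps, 0 < eps -> exists M, forall X, M <= X -> Rabs (f X - a) < eps) ->
  (forall eps, 0 < eps -> exists M, forall X, M <= X -> Rabs (g X - b) < eps) ->
  (exists M, forall X, M <= X -> f X = g X) -> a = b.
Proof.
  intros Hf Hg [M HM]. apply Rle_antisym.
  - apply (lim_oo_le f g); auto. exists M. intros X HX. rewrite HM; auto; lra.
  - apply (lim_oo_le g f); auto. exists M. intros X HX. rewrite HM; auto; lra.
Qed.

Lemma lim_oo_comp (f h : R -> R) (a : R) : continuous h a ->
  (forall eps, 0 < eps -> exists M, forall X, M <= X -> Rabs (f X - a) < eps) ->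
  (forall eps, 0 < eps -> exists M, forall X, M <= X -> Rabs (h (f X) - h a) < eps).
Proof.
  intros Hh Hf eps He. destruct (proj1 (continuous_eps _ _) Hh eps He) as [d [Hd K]].
  destruct (Hf d Hd) as [M HM]. exists M. auto.
Qed.

Lemma lim_oo_plus (f g : R -> R) (a b : R) :
  (forall eps, 0 < eps -> exists M, forall X, M <= X -> Rabs (f X - a) < eps) ->
  (forall eps, 0 < eps -> exists M, forall X, M <= X -> Rabs (g X - b) < eps) ->
  (forall eps, 0 < eps -> exists M, forall X, M <= X -> Rabs (f X + g X - (a + b)) < eps).
Proof.
  intros Hf Hg eps He.
  destruct (Hf (eps / 2) ltac:(lra)) as [M1 K1]. destruct (Hg (eps / 2) ltac:(lra)) as [M2 K2].
  exists (Rmax M1 M2). intros X HX.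
  specialize (K1 X (Rle_trans _ _ _ (Rmax_l _ _) HX)). specialize (K2 X (Rle_trans _ _ _ (Rmax_r _ _) HX)).
  replace (f X + g X - (a + b)) with ((f X - a) + (g X - b)) by ring.
  eapply Rle_lt_trans; [ apply Rabs_triang | ]. lra.
Qed.

Lemma lim_oo_scal (c : R) (f : R -> R) (a : R) :
  (forall eps, 0 < eps -> exists M, forall X, M <= X -> Rabs (f X - a) < eps) ->
  (forall eps, 0 < eps -> exists M, forall X, M <= X -> Rabs (c * f X - c * a) < eps).
Proof.
  intros Hf. apply (lim_oo_comp f (fun x => c * x)); auto.
  apply (continuous_mult (fun _ => c) (fun x : R => x)); [ apply continuous_const | apply continuous_id ].
Qed.

Lemma lim_oo_const (a : R) : forall eps, 0 < eps -> exists M, forall X : R, M <= X -> Rabs (a - a) < eps.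
Proof. intros eps He. exists 0. intros X _. replace (a - a) with 0 by ring. rewrite Rabs_R0. auto. Qed.

Lemma theta_exp_limit (nu : R) : 0 <= nu ->
  forall eps, 0 < eps -> exists M, forall X, M <= X -> Rabs (theta nu X * exp (- (X / 2)) - / 2) < eps.
Proof.
  intros Hnu eps He. destruct (theta_half_expansion nu Hnu) as [K [HK Hb]].
  destruct (exp_small K (1 / 2) eps HK ltac:(lra) He) as [M [HM0 HM]].
  exists M. intros X HX. specialize (HM X HX). specialize (Hb X ltac:(lra)).
  replace (1 / 2 * X) with (X / 2) in HM by field.
  assert (E : exp (X / 2) * exp (- (X / 2)) = 1) by (rewrite <- exp_plus, <- exp_0; f_equal; ring).
  pose proof (exp_pos (- (X / 2))). apply Rabs_def1; nra.
Qed.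

(** By definition theta is e^v times the quotient of the orders nu + 1 and nu, divided by 4(nu+1);
    as theta ~ e^{v/2}/2, taking logarithms leaves ln(4(nu+1)/2). *)
Lemma bconst_rec (nu : R) : 0 <= nu -> bconst (nu + 1) = bconst nu + ln (2 * (nu + 1)).
Proof.
  intros Hnu.
  apply (lim_oo_eq (logdet (nu + 1)) (fun X => logdet nu X + (ln (theta nu X * exp (- (X / 2))) + ln (4 * (nu + 1))))).
  - apply bconst_spec. lra.
  - assert (Hl : ln (2 * (nu + 1)) = ln (/ 2) + ln (4 * (nu + 1))).
    { rewrite <- ln_mult by lra. f_equal. field. }
    rewrite Hl. apply lim_oo_plus; [ apply bconst_spec; auto | ].
    apply (lim_oo_plus _ (fun _ => ln (4 * (nu + 1)))); [ | apply lim_oo_const ].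
    apply (lim_oo_comp (fun X => theta nu X * exp (- (X / 2))) ln); [ | apply theta_exp_limit; auto ].
    apply (ex_derive_continuous (V:=R_NormedModule)). auto_derive. lra.
  - exists 0. intros X _. unfold logdet.
    pose proof (bess_exp_pos nu X Hnu) as H0. pose proof (bess_exp_pos (nu + 1) X ltac:(lra)) as H1. pose proof (exp_pos X) as HX.
    assert (Hq : 0 < bess (nu + 1) (exp X) / (4 * (nu + 1))) by (apply Rdiv_lt_0_compat; lra).
    pose proof (theta_pos nu X Hnu) as Ht.
    assert (Hln : ln (theta nu X) = X + (ln (bess (nu + 1) (exp X)) - ln (4 * (nu + 1))) - ln (bess nu (exp X))).
    { unfold theta. rewrite ln_div, ln_mult, ln_exp, ln_div by (auto; try apply Rmult_lt_0_compat; lra). reflexivity. }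
    rewrite ln_mult by (auto; apply exp_pos). rewrite ln_exp, Hln, !expc_1. field.
Qed.

(** The coefficient is a product of factors 1/(4(i+1)(nu+1+i)), each log-convex in nu because the
    logarithm is concave. *)
Lemma bcoef_logconvex (m s : R) (k : nat) : 0 <= m -> 0 <= s <= 1 ->
  ln (bcoef (m + s) k) <= (1 - s) * ln (bcoef m k) + s * ln (bcoef (m + 1) k).
Proof.
  intros Hm Hs. induction k as [ | k IH].
  - simpl. rewrite ln_1. lra.
  - cbn [bcoef]. pose proof (pos_INR k).
    assert (Hl : forall x, 0 <= x -> ln (bcoef x k / (4 * (INR k + 1) * (x + 1 + INR k))) = ln (bcoef x k) - ln (4 * (INR k + 1)) - ln (x + 1 + INR k)).
    { intros x Hx. pose proof (bcoef_pos x k Hx). unfold Rdiv.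
      rewrite ln_mult, ln_Rinv, ln_mult by (auto; try apply Rinv_0_lt_compat; try apply Rmult_lt_0_compat; lra). ring. }
    rewrite !Hl by lra.
    assert (Hc : (1 - s) * ln (m + 1 + INR k) + s * ln (m + 1 + 1 + INR k) <= ln (m + s + 1 + INR k)).
    { assert (E := exp_convex s (ln (m + 1 + INR k)) (ln (m + 1 + 1 + INR k)) Hs). rewrite !exp_ln in E by lra.
      apply ln_le in E; [ | apply exp_pos ]. rewrite ln_exp in E. eapply Rle_trans; [ exact E | ].
      right. f_equal. ring. }
    nra.
Qed.

Lemma logdet_exp (nu X : R) : 0 <= nu -> exp (logdet nu X) = bess nu (exp X) * (exp (- exp (X / 2)) * exp ((2 * nu + 1) / 4 * X)).
Proof.
  intros Hnu. unfold logdet. rewrite expc_1.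
  replace (ln (bess nu (exp X)) - exp (X / 2) - - (2 * nu + 1) / 2 / 2 * X)
    with (ln (bess nu (exp X)) + (- exp (X / 2) + (2 * nu + 1) / 4 * X)) by field.
  rewrite !exp_plus, exp_ln by (apply bess_exp_pos; auto). reflexivity.
Qed.

(** Hölder's inequality for the series in linear form: x^{1-s} y^s is at most (1-s) e^{sb} x + s
    e^{(s-1)b} y for every b, with equality at e^b = y/x. The linear form can be summed term by term
    and passes to the limit; b is fixed afterwards. *)
Lemma logdet_convex (m s b X : R) : 0 <= m -> 0 <= s <= 1 ->
  exp (logdet (m + s) X) <= (1 - s) * exp (s * b) * exp (logdet m X) + s * exp ((s - 1) * b) * exp (logdet (m + 1) X).
Proof.
  intros Hm Hs. rewrite !logdet_exp by lra.
  set (w := exp (- exp (X / 2)) * exp ((2 * m + 1) / 4 * X)).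
  assert (Hw : 0 < w) by (apply Rmult_lt_0_compat; apply exp_pos).
  replace (exp (- exp (X / 2)) * exp ((2 * (m + s) + 1) / 4 * X)) with (w * exp (s * (X / 2))).
  2: { unfold w. rewrite Rmult_assoc, <- exp_plus. do 2 f_equal. field. }
  replace (exp (- exp (X / 2)) * exp ((2 * (m + 1) + 1) / 4 * X)) with (w * exp (X / 2)).
  2: { unfold w. rewrite Rmult_assoc, <- exp_plus. do 2 f_equal. field. }
  set (z := exp X). assert (Hz : 0 < z) by apply exp_pos.
  assert (Hser : forall mu, 0 <= mu -> bess mu z = Series (fun k => bcoef mu k * z ^ k)) by reflexivity.
  assert (Hex : forall c mu, 0 <= mu -> ex_series (fun k => c * (bcoef mu k * z ^ k))).
  { intros c mu Hmu. apply (ex_series_scal (K:=R_AbsRing) c (fun n => bcoef mu n * z ^ n)), bess_ex_series; auto. }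
  assert (K : bess (m + s) z * exp (s * (X / 2)) <= (1 - s) * exp (s * b) * bess m z + s * exp ((s - 1) * b) * exp (X / 2) * bess (m + 1) z).
  { rewrite !Hser by lra. rewrite <- Series_scal_r, <- !Series_scal_l, <- Series_plus.
    2, 3: apply Hex; lra.
    apply Series_le.
    - intros k. assert (Hzk : 0 < z ^ k) by (apply pow_lt; auto).
      assert (P0 := bcoef_pos m k Hm). assert (P1 := bcoef_pos (m + 1) k ltac:(lra)). assert (Ps := bcoef_pos (m + s) k ltac:(lra)).
      split; [ apply Rmult_le_pos; [ apply Rmult_le_pos; lra | left; apply exp_pos ] | ].
      replace (bcoef (m + s) k * z ^ k * exp (s * (X / 2))) with (bcoef (m + s) k * exp (s * (X / 2)) * z ^ k) by ring.
      replace ((1 - s) * exp (s * b) * (bcoef m k * z ^ k) + s * exp ((s - 1) * b) * exp (X / 2) * (bcoef (m + 1) k * z ^ k))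
        with (((1 - s) * (exp (s * b) * bcoef m k) + s * (exp ((s - 1) * b) * exp (X / 2) * bcoef (m + 1) k)) * z ^ k) by ring.
      apply Rmult_le_compat_r; [ lra | ].
      assert (L := bcoef_logconvex m s k Hm Hs).
      assert (Cv := exp_convex s (s * b + ln (bcoef m k)) ((s - 1) * b + X / 2 + ln (bcoef (m + 1) k)) Hs).
      rewrite !exp_plus, !exp_ln in Cv by auto.
      eapply Rle_trans; [ | exact Cv ].
      rewrite <- (exp_ln (bcoef (m + s) k)) by auto. rewrite <- !exp_plus. apply exp_le_compat. lra.
    - apply (ex_series_plus (fun n => (1 - s) * exp (s * b) * (bcoef m n * z ^ n)) (fun n => s * exp ((s - 1) * b) * exp (X / 2) * (bcoef (m + 1) n * z ^ n)));
        apply Hex; lra. }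
  apply (Rmult_le_compat_r w) in K; [ | lra ].
  eapply Rle_trans; [ | eapply Rle_trans; [ exact K | ] ]; right; ring.
Qed.

(** Dividing by 2^nu turns the factor 2(nu+1) of the recurrence into nu + 1. *)
Definition bgamma (nu : R) : R := exp (bconst nu - nu * ln 2).

Lemma bgamma_like : gamma_like bgamma.
Proof.
  split.
  - apply exp_pos.
  - intros m Hm. unfold bgamma. rewrite bconst_rec, ln_mult by lra.
    replace (bconst m + (ln 2 + ln (m + 1)) - (m + 1) * ln 2) with (ln (m + 1) + (bconst m - m * ln 2)) by ring.
    rewrite exp_plus, exp_ln by lra. reflexivity.
  - intros m s Hm Hs. unfold bgamma.
    (* This is bconst(m+1) - bconst(m), the value of b for which the linear form is sharp in the
       limit. *)
    set (b := ln (2 * (m + 1))).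
    assert (K : exp (bconst (m + s)) <= exp (s * b) * exp (bconst m)).
    { apply Rle_trans with ((1 - s) * exp (s * b) * exp (bconst m) + s * exp ((s - 1) * b) * exp (bconst (m + 1))).
      - assert (Ce : forall x, continuous exp x) by (intros x; apply (ex_derive_continuous (V:=R_NormedModule)); auto_derive; auto).
        assert (L : forall mu, 0 <= mu -> forall eps, 0 < eps -> exists M, forall X, M <= X -> Rabs (exp (logdet mu X) - exp (bconst mu)) < eps).
        { intros mu Hmu. apply (lim_oo_comp (logdet mu) exp); auto. apply bconst_spec; auto. }
        apply (lim_oo_le (fun X => exp (logdet (m + s) X)) (fun X => (1 - s) * exp (s * b) * exp (logdet m X) + s * exp ((s - 1) * b) * exp (logdet (m + 1) X))).
        + apply L. lra.
        + apply lim_oo_plus; apply lim_oo_scal; apply L; lra.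
        + exists 0. intros X _. apply logdet_convex; auto.
      - rewrite bconst_rec by auto. fold b. rewrite exp_plus.
        replace (s * exp ((s - 1) * b) * (exp (bconst m) * exp b)) with (s * (exp ((s - 1) * b) * exp b) * exp (bconst m)) by ring.
        rewrite <- exp_plus. replace ((s - 1) * b + b) with (s * b) by ring. right; ring. }
    unfold Rminus at 1 2. rewrite !exp_plus.
    replace (- ((m + s) * ln 2)) with (- (m * ln 2) + - (s * ln 2)) by ring. rewrite exp_plus.
    unfold b in K. rewrite ln_mult in K by lra. rewrite Rmult_plus_distr_l, exp_plus in K.
    pose proof (exp_pos (- (m * ln 2))). pose proof (exp_pos (- (s * ln 2))).
    apply Rle_trans with ((exp (s * ln 2) * exp (s * ln (m + 1)) * exp (bconst m)) * (exp (- (m * ln 2)) * exp (- (s * ln 2)))).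
    + apply Rmult_le_compat_r; [ nra | exact K ].
    + replace (exp (s * ln 2) * exp (s * ln (m + 1)) * exp (bconst m) * (exp (- (m * ln 2)) * exp (- (s * ln 2))))
        with ((exp (s * ln 2) * exp (- (s * ln 2))) * (exp (s * ln (m + 1)) * (exp (bconst m) * exp (- (m * ln 2))))) by ring.
      rewrite <- exp_plus. replace (s * ln 2 + - (s * ln 2)) with 0 by ring. rewrite exp_0. right; ring.
Qed.

(** * The value at nu = 1/2 *)

Lemma bcoef_half (k : nat) : bcoef (1 / 2) k = / INR (fact (2 * k + 1)).
Proof.
  induction k as [ | k IH]; [ simpl; field | ].
  replace (2 * S k + 1)%nat with (S (S (2 * k + 1))) by lia.
  cbn [bcoef]. rewrite IH, !fact_simpl, !mult_INR, !S_INR, plus_INR, mult_INR. simpl (INR 2). simpl (INR 1).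
  pose proof (pos_INR k). pose proof (INR_fact_lt_0 (2 * k + 1)). field. repeat split; lra.
Qed.

(** At order 1/2 the coefficients are 1/(2k+1)!, the odd part of the exponential series, so x bess
    is sinh x. *)
Lemma bess_half (x : R) : x * bess (1 / 2) (x ^ 2) = (exp x - exp (- x)) / 2.
Proof.
  set (a := fun n => / INR (fact n)).
  assert (Ha : forall y, exp y = PSeries a y).
  { intros y. symmetry. apply is_pseries_unique, is_exp_Reals. }
  assert (Hex : forall y, ex_pseries a y) by (intros y; eexists; apply is_exp_Reals).
  assert (Eo : bess (1 / 2) (x ^ 2) = PSeries (fun n => a (2 * n + 1)%nat) (x ^ 2)).
  { apply PSeries_ext. intros n. apply bcoef_half. }
  assert (CVo : ex_pseries (fun n => a (2 * n + 1)%nat) (x ^ 2)).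
  { apply (ex_pseries_ext (bcoef (1 / 2))); [ intros; apply bcoef_half | apply ex_pseries_R, bess_ex_series; lra ]. }
  assert (CVe : ex_pseries (fun n => a (2 * n)%nat) (x ^ 2)).
  { apply ex_pseries_R. apply (ex_series_le (K:=R_AbsRing) (V:=R_CompleteNormedModule)) with (fun k => / INR (fact k) * (x ^ 2) ^ k); [ | apply ex_series_exp ].
    intros n. change (Rabs (a (2 * n)%nat * (x ^ 2) ^ n) <= / INR (fact n) * (x ^ 2) ^ n).
    assert (0 <= (x ^ 2) ^ n) by (apply pow_le, pow2_ge_0).
    rewrite Rabs_mult, (Rabs_right ((x ^ 2) ^ n)) by lra. apply Rmult_le_compat_r; auto. unfold a.
    rewrite Rabs_right by (apply Rle_ge; left; apply Rinv_0_lt_compat, INR_fact_lt_0).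
    apply Rinv_le_contravar; [ apply INR_fact_lt_0 | apply le_INR, fact_le; lia ]. }
  rewrite Eo, !Ha. rewrite (PSeries_odd_even a x), (PSeries_odd_even a (- x)); auto; replace ((- x) ^ 2) with (x ^ 2) by ring; auto.
  field.
Qed.

Lemma bconst_half : bconst (1 / 2) = ln (1 / 2).
Proof.
  apply (lim_oo_eq (logdet (1 / 2)) (fun X => ln ((1 - exp (- (2 * exp (X / 2)))) / 2))).
  - apply bconst_spec. lra.
  - assert (L0 : forall eps, 0 < eps -> exists M, forall X, M <= X -> Rabs (exp (- (2 * exp (X / 2))) - 0) < eps).
    { intros eps He. destruct (exp_small 1 1 eps ltac:(lra) ltac:(lra) He) as [M [HM0 HM]]. exists M. intros X HX.
      specialize (HM X HX). rewrite !Rmult_1_l in HM. rewrite Rminus_0_r, Rabs_right by (left; apply exp_pos).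
      eapply Rle_lt_trans; [ | exact HM ]. apply exp_le_compat. pose proof (exp_ineq1_le (X / 2)). lra. }
    replace (1 / 2) with ((1 - 0) / 2) by field.
    apply (lim_oo_comp (fun X => exp (- (2 * exp (X / 2)))) (fun y => ln ((1 - y) / 2))); auto.
    apply (ex_derive_continuous (V:=R_NormedModule)). auto_derive. lra.
  - exists 0. intros X HX. unfold logdet. rewrite expc_1.
    set (x := exp (X / 2)). assert (Hx : 0 < x) by apply exp_pos.
    assert (Ex : exp X = x ^ 2) by (unfold x; simpl; rewrite Rmult_1_r, <- exp_plus; f_equal; field).
    assert (El : X / 2 = ln x) by (unfold x; rewrite ln_exp; auto).
    assert (Hb := bess_half x).
    assert (Hbp : 0 < bess (1 / 2) (x ^ 2)) by (rewrite <- Ex; apply bess_exp_pos; lra).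
    rewrite Ex.
    replace (ln (bess (1 / 2) (x ^ 2)) - x - - (2 * (1 / 2) + 1) / 2 / 2 * X) with (ln x + ln (bess (1 / 2) (x ^ 2)) + - x) by (rewrite <- El; field).
    rewrite <- ln_mult by auto. rewrite Hb. rewrite <- (ln_exp (- x)) at 2. rewrite <- ln_mult.
    + f_equal. replace (- (2 * x)) with (- x + - x) by ring. rewrite exp_plus.
      assert (E1 : exp x * exp (- x) = 1) by (rewrite <- exp_plus, <- exp_0; f_equal; ring).
      replace ((exp x - exp (- x)) / 2 * exp (- x)) with ((exp x * exp (- x) - exp (- x) * exp (- x)) / 2) by field.
      rewrite E1. reflexivity.
    + rewrite <- Hb. apply Rmult_lt_0_compat; auto.
    + apply exp_pos.
Qed.

(** * The Gamma function *)

(* Unlike Rpower, which is 1 for t <= 0, this is continuous on the whole line. *)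
Definition pw (nu t : R) : R :=
  if Rlt_dec 0 t then exp (nu * ln t) else if Req_dec_T nu 0 then 1 else 0.

Lemma pw_pos (nu t : R) : 0 < t -> pw nu t = exp (nu * ln t).
Proof. intros H. unfold pw. destruct (Rlt_dec 0 t); [ reflexivity | lra ]. Qed.

Lemma pw_0 (t : R) : pw 0 t = 1.
Proof.
  unfold pw. destruct (Rlt_dec 0 t); [ rewrite Rmult_0_l; apply exp_0 | ].
  destruct (Req_dec_T 0 0); lra.
Qed.

Lemma pw_nonpos (nu t : R) : 0 < nu -> t <= 0 -> pw nu t = 0.
Proof. intros H Ht. unfold pw. destruct (Rlt_dec 0 t); [ lra | ]. destruct (Req_dec_T nu 0); lra. Qed.

Lemma pw_continuous (nu t : R) : 0 <= nu -> continuous (pw nu) t.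
Proof.
  intros [Hnu | <-].
  2: { apply (continuous_ext (fun _ => 1)); [ intros; rewrite pw_0; auto | apply continuous_const ]. }
  destruct (Rlt_le_dec 0 t) as [Ht | Ht].
  - apply (continuous_ext_loc _ (fun t => exp (nu * ln t))).
    + exists (mkposreal t Ht). intros y Hy. apply Rabs_def2 in Hy. unfold minus, plus, opp in Hy; simpl in Hy. rewrite pw_pos; auto; lra.
    + apply (ex_derive_continuous (V:=R_NormedModule)). auto_derive. auto.
  - apply continuous_eps. intros eps He. rewrite (pw_nonpos nu t) by lra.
    exists (exp (ln eps / nu)). split; [ apply exp_pos | ]. intros y Hy. rewrite Rminus_0_r.
    destruct (Rlt_le_dec 0 y) as [H | H].
    + rewrite pw_pos, Rabs_right by (auto; left; apply exp_pos). apply Rabs_def2 in Hy.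
      rewrite <- (exp_ln eps He) at 1. apply exp_increasing.
      assert (ln y < ln eps / nu) by (rewrite <- (ln_exp (ln eps / nu)); apply ln_increasing; lra).
      apply (Rmult_lt_compat_l nu) in H0; auto. replace (nu * (ln eps / nu)) with (ln eps) in H0 by (field; lra). lra.
    + rewrite pw_nonpos, Rabs_R0 by auto. auto.
Qed.

(** The lower incomplete gamma function with parameter nu + 1. *)
Definition gint (nu b : R) : R := RInt (fun t => pw nu t * exp (- t)) 0 b.

Lemma gint_integrand_continuous (nu t : R) : 0 <= nu -> continuous (fun t => pw nu t * exp (- t)) t.
Proof.
  intros H. apply (continuous_mult (pw nu) (fun t => exp (- t))); [ apply pw_continuous; auto | ].
  apply (ex_derive_continuous (V:=R_NormedModule)). auto_derive. auto.
Qed.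

Lemma gint_ex_RInt (nu a b : R) : 0 <= nu -> ex_RInt (fun t => pw nu t * exp (- t)) a b.
Proof. intros H. apply (ex_RInt_continuous (V:=R_CompleteNormedModule)). intros z _. apply gint_integrand_continuous; auto. Qed.

Lemma gint_derive (nu b : R) : 0 <= nu -> is_derive (gint nu) b (pw nu b * exp (- b)).
Proof.
  intros H. apply (is_derive_RInt (V:=R_CompleteNormedModule) (fun t => pw nu t * exp (- t)) (gint nu) 0 b).
  - exists (mkposreal 1 Rlt_0_1). intros y _. apply (RInt_correct (V:=R_CompleteNormedModule)), gint_ex_RInt; auto.
  - apply gint_integrand_continuous; auto.
Qed.

Lemma gint_0 (nu : R) : gint nu 0 = 0.
Proof. apply (RInt_point (V:=R_CompleteNormedModule)). Qed.

(** Differentiability is asked only in the open interval, since the power t^nu need not be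
    differentiable at 0. *)
Lemma eq_of_derive_0 (f : R -> R) (b : R) : 0 <= b -> (forall x, 0 < x < b -> is_derive f x 0) ->
  (forall x, 0 <= x <= b -> continuous f x) -> f b = f 0.
Proof.
  intros Hb Hd Hc. destruct (MVT_gen f 0 b (fun _ => 0)) as [c [_ Hm]]; rewrite ?Rmin_left, ?Rmax_right by auto; auto.
  - intros x Hx. apply continuity_pt_filterlim. apply Hc. lra.
  - lra.
Qed.

(** Integration by parts, carried out by differentiating the identity in b. *)
Lemma gint_rec (nu b : R) : 0 <= nu -> 0 <= b -> gint (nu + 1) b + pw (nu + 1) b * exp (- b) = (nu + 1) * gint nu b.
Proof.
  intros Hnu Hb.
  assert (E := eq_of_derive_0 (fun b => gint (nu + 1) b + pw (nu + 1) b * exp (- b) - (nu + 1) * gint nu b) b Hb).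
  cbv beta in E. rewrite !gint_0, (pw_nonpos (nu + 1) 0), Ropp_0, exp_0 in E by lra.
  assert (Hc : forall mu x, 0 <= mu -> continuous (gint mu) x).
  { intros mu x Hmu. apply (ex_derive_continuous (V:=R_NormedModule)). eexists. apply gint_derive; auto. }
  enough (gint (nu + 1) b + pw (nu + 1) b * exp (- b) - (nu + 1) * gint nu b = 0 + 0 * 1 - (nu + 1) * 0) by lra.
  apply E.
  - intros x Hx.
    assert (D : is_derive (fun b => gint (nu + 1) b + exp ((nu + 1) * ln b) * exp (- b) - (nu + 1) * gint nu b) x 0).
    { assert (D1 := gint_derive (nu + 1) x ltac:(lra)). assert (D2 := gint_derive nu x Hnu).
      assert (D3 : is_derive (fun b => exp ((nu + 1) * ln b) * exp (- b)) x ((nu + 1) * (pw nu x * exp (- x)) - pw (nu + 1) x * exp (- x))).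
      { auto_derive; [ lra | ]. rewrite !pw_pos by lra.
        replace ((nu + 1) * ln x) with (nu * ln x + ln x) by ring. rewrite exp_plus, exp_ln by lra. field. lra. }
      evar_last.
      - apply (is_derive_minus (V:=R_NormedModule)); [ apply (is_derive_plus (V:=R_NormedModule)); [ exact D1 | exact D3 ] | ].
        apply is_derive_scal. exact D2.
      - unfold minus, plus, opp; simpl. ring. }
    apply (is_derive_ext_loc (fun b => gint (nu + 1) b + exp ((nu + 1) * ln b) * exp (- b) - (nu + 1) * gint nu b)); auto.
    exists (mkposreal x (proj1 Hx)). intros y Hy. apply Rabs_def2 in Hy. unfold minus, plus, opp in Hy; simpl in Hy.
    rewrite (pw_pos (nu + 1) y); auto; lra.
  - intros x _. apply (continuous_minus (fun b => gint (nu + 1) b + pw (nu + 1) b * exp (- b)) (fun b => (nu + 1) * gint nu b)).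
    + apply (continuous_plus (gint (nu + 1)) (fun b => pw (nu + 1) b * exp (- b))); [ apply Hc; lra | apply gint_integrand_continuous; lra ].
    + apply (continuous_mult (fun _ => nu + 1) (gint nu)); [ apply continuous_const | apply Hc; lra ].
Qed.

Lemma gint_le (c1 c2 mu nu1 nu2 b : R) : 0 <= mu -> 0 <= nu1 -> 0 <= nu2 -> 0 <= b ->
  (forall t, 0 < t -> pw mu t <= c1 * pw nu1 t + c2 * pw nu2 t) -> gint mu b <= c1 * gint nu1 b + c2 * gint nu2 b.
Proof.
  intros Hmu H1 H2 Hb H.
  assert (I1 := RInt_correct (V:=R_CompleteNormedModule) _ _ _ (gint_ex_RInt nu1 0 b H1)).
  assert (I2 := RInt_correct (V:=R_CompleteNormedModule) _ _ _ (gint_ex_RInt nu2 0 b H2)).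
  apply (is_RInt_scal (V:=R_CompleteNormedModule) _ _ _ c1) in I1. apply (is_RInt_scal (V:=R_CompleteNormedModule) _ _ _ c2) in I2.
  assert (I := is_RInt_plus (V:=R_CompleteNormedModule) _ _ _ _ _ _ I1 I2).
  apply Rle_trans with (RInt (fun t => c1 * (pw nu1 t * exp (- t)) + c2 * (pw nu2 t * exp (- t))) 0 b);
    [ | right; apply (is_RInt_unique (V:=R_CompleteNormedModule) _ _ _ _ I) ].
  apply RInt_le; auto.
  - apply gint_ex_RInt; auto.
  - eexists; exact I.
  - intros t Ht. change (pw mu t * exp (- t) <= c1 * (pw nu1 t * exp (- t)) + c2 * (pw nu2 t * exp (- t))).
    specialize (H t (proj1 Ht)). apply (Rmult_le_compat_r (exp (- t))) in H; [ lra | left; apply exp_pos ].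
Qed.

(** The tangent to the logarithm at 2 nu + 1, a point that stays positive for nu = 0 and gives t the
    slope nu/(2 nu + 1) <= 1/2. *)
Lemma pw_le_exp (nu t : R) : 0 <= nu -> 0 < t -> pw nu t <= exp (nu * ln (2 * nu + 1)) * exp (t / 2).
Proof.
  intros Hnu Ht. rewrite pw_pos by auto. rewrite <- exp_plus. apply exp_le_compat.
  assert (0 < t / (2 * nu + 1)) by (apply Rdiv_lt_0_compat; lra).
  assert (L : ln t <= ln (2 * nu + 1) + (t / (2 * nu + 1) - 1)).
  { replace (ln t) with (ln (2 * nu + 1) + ln (t / (2 * nu + 1))).
    - apply Rplus_le_compat_l. rewrite <- (ln_exp (t / (2 * nu + 1) - 1)). apply ln_le; auto.
      pose proof (exp_ineq1_le (t / (2 * nu + 1) - 1)). lra.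
    - rewrite <- ln_mult by lra. f_equal. field. lra. }
  apply (Rmult_le_compat_l nu) in L; auto.
  assert (nu * (t / (2 * nu + 1) - 1) <= t / 2); [ | lra ].
  replace (nu * (t / (2 * nu + 1) - 1)) with (t / 2 - t / (2 * nu + 1) / 2 - nu) by (field; lra). lra.
Qed.

Lemma gint_bounded (nu b : R) : 0 <= nu -> 0 <= b -> gint nu b <= 2 * exp (nu * ln (2 * nu + 1)).
Proof.
  intros Hnu Hb. set (K := exp (nu * ln (2 * nu + 1))). assert (HK : 0 < K) by apply exp_pos.
  assert (I : is_RInt (fun t => K * exp (- (t / 2))) 0 b (- 2 * K * exp (- (b / 2)) - - 2 * K * exp (- (0 / 2)))).
  { apply (is_RInt_derive (V:=R_CompleteNormedModule) (fun t => - 2 * K * exp (- (t / 2)))).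
    - intros x _. auto_derive; auto. unfold Rdiv. field.
    - intros x _. apply (ex_derive_continuous (V:=R_NormedModule)). auto_derive. auto. }
  apply Rle_trans with (- 2 * K * exp (- (b / 2)) - - 2 * K * exp (- (0 / 2))).
  - rewrite <- (is_RInt_unique (V:=R_CompleteNormedModule) _ _ _ _ I). apply RInt_le; auto.
    + apply gint_ex_RInt; auto.
    + eexists; exact I.
    + intros t Ht. assert (L := pw_le_exp nu t Hnu (proj1 Ht)). fold K in L.
      replace (- (t / 2)) with (t / 2 + - t) by field. rewrite exp_plus, <- Rmult_assoc.
      apply Rmult_le_compat_r; [ left; apply exp_pos | exact L ].
  - replace (- (0 / 2)) with 0 by field. rewrite exp_0. pose proof (exp_pos (- (b / 2))). nra.
Qed.

Lemma pw_nonneg (nu t : R) : 0 <= pw nu t.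
Proof.
  unfold pw. destruct (Rlt_dec 0 t); [ left; apply exp_pos | ]. destruct (Req_dec_T nu 0); lra.
Qed.

Lemma gint_incr (nu a b : R) : 0 <= nu -> 0 <= a <= b -> gint nu a <= gint nu b.
Proof.
  intros Hnu Hab. unfold gint.
  rewrite <- (RInt_Chasles (V:=R_CompleteNormedModule) (fun t => pw nu t * exp (- t)) 0 a b) by (apply gint_ex_RInt; auto).
  enough (0 <= RInt (fun t => pw nu t * exp (- t)) a b) by (unfold plus; simpl; lra).
  apply RInt_ge_0; [ lra | apply gint_ex_RInt; auto | ].
  intros t _. apply Rmult_le_pos; [ apply pw_nonneg | left; apply exp_pos ].
Qed.

(** [Gamma] denotes the improper integral only once convergence is shown: [gint] is increasing and
    bounded on the positive axis, and its limit is then recognised as the value of [RInt_gen]. *)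
Lemma gint_limit (nu : R) : 0 <= nu ->
  forall eps, 0 < eps -> exists M, forall X, M <= X -> Rabs (gint nu X - Gamma (nu + 1)) < eps.
Proof.
  intros Hnu.
  assert (Hl : exists l, forall eps, 0 < eps -> exists M, 0 <= M /\ forall X, M <= X -> Rabs (gint nu X - l) < eps).
  { destruct (completeness (fun y => exists b, 0 <= b /\ y = gint nu b)) as [l [Hu Hm]].
    - exists (2 * exp (nu * ln (2 * nu + 1))). intros y [b [Hb ->]]. apply gint_bounded; auto.
    - exists (gint nu 0), 0. split; [ lra | auto ].
    - exists l. intros eps He. apply NNPP. intros Hn.
      assert (l <= l - eps / 2); [ | lra ]. apply Hm. intros y [b [Hb ->]]. apply Rnot_lt_le. intros Hlt.
      apply Hn. exists b. split; auto. intros X HX.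
      assert (gint nu b <= gint nu X) by (apply gint_incr; lra).
      assert (gint nu X <= l) by (apply Hu; exists X; split; [ lra | auto ]).
      apply Rabs_def1; lra. }
  destruct Hl as [l Hl].
  assert (E : Gamma (nu + 1) = l).
  { unfold Gamma. apply (is_RInt_gen_unique (V:=R_CompleteNormedModule) (Fa:=at_point 0) (Fb:=Rbar_locally p_infty) (fun t => Rpower t (nu + 1 - 1) * exp (- t))). intros P [d HP].
    destruct (Hl d (cond_pos d)) as [M [HM0 HM]].
    exists (fun a => a = 0) (fun b => M < b); [ reflexivity | exists M; auto | ].
    intros a b -> Hb. exists (gint nu b). split.
    - simpl. apply (is_RInt_ext (V:=R_CompleteNormedModule) (fun t => pw nu t * exp (- t))).
      + intros t Ht. rewrite Rmin_left in Ht by lra. rewrite pw_pos by lra. unfold Rpower. replace (nu + 1 - 1) with nu by ring. reflexivity.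
      + apply (RInt_correct (V:=R_CompleteNormedModule)), gint_ex_RInt; auto.
    - apply HP. apply HM. lra. }
  intros eps He. rewrite E. destruct (Hl eps He) as [M [_ HM]]. exists M. auto.
Qed.

Lemma Gamma_1 : Gamma (0 + 1) = 1.
Proof.
  apply (lim_oo_eq (gint 0) (fun b => 1 - exp (- b))).
  - apply gint_limit. lra.
  - intros eps He. destruct (exp_small 1 1 eps ltac:(lra) ltac:(lra) He) as [M [HM0 HM]]. exists M. intros X HX.
    specialize (HM X HX). rewrite !Rmult_1_l in HM. pose proof (exp_pos (- X)). apply Rabs_def1; lra.
  - exists 0. intros b Hb.
    assert (E := eq_of_derive_0 (fun b => gint 0 b + exp (- b)) b Hb). cbv beta in E.
    rewrite gint_0, Ropp_0, exp_0 in E. enough (gint 0 b + exp (- b) = 0 + 1) by lra.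
    assert (D : forall x, is_derive (fun b => gint 0 b + exp (- b)) x 0).
    { intros x. assert (D1 := gint_derive 0 x ltac:(lra)). rewrite pw_0 in D1.
      assert (D2 : is_derive (fun b => exp (- b)) x (- exp (- x))) by (auto_derive; auto; ring).
      evar_last; [ apply (is_derive_plus (V:=R_NormedModule)); [ exact D1 | exact D2 ] | unfold plus; simpl; ring ]. }
    apply E; auto. intros x _. apply (ex_derive_continuous (V:=R_NormedModule)). eexists. apply D.
Qed.

Lemma Gamma_like : gamma_like (fun nu => Gamma (nu + 1)).
Proof.
  assert (Hrec : forall m, 0 <= m -> Gamma (m + 1 + 1) = (m + 1) * Gamma (m + 1)).
  { intros m Hm. apply (lim_oo_eq (fun b => gint (m + 1) b + pw (m + 1) b * exp (- b)) (fun b => (m + 1) * gint m b)).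
    - rewrite <- (Rplus_0_r (Gamma (m + 1 + 1))). apply lim_oo_plus; [ apply gint_limit; lra | ].
      intros eps He. set (K := exp ((m + 1) * ln (2 * (m + 1) + 1))).
      destruct (exp_small K (1 / 2) eps ltac:(left; apply exp_pos) ltac:(lra) He) as [M [HM0 HM]].
      exists (Rmax 1 M). intros X HX. assert (HX1 := Rle_trans _ _ _ (Rmax_l _ _) HX). assert (HX2 := Rle_trans _ _ _ (Rmax_r _ _) HX).
      specialize (HM X HX2). assert (L := pw_le_exp (m + 1) X ltac:(lra) ltac:(lra)). fold K in L.
      rewrite Rminus_0_r, Rabs_right by (apply Rle_ge, Rmult_le_pos; [ apply pw_nonneg | left; apply exp_pos ]).
      eapply Rle_lt_trans; [ | exact HM ].
      replace (- (1 / 2 * X)) with (X / 2 + - X) by field. rewrite exp_plus, <- Rmult_assoc.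
      apply Rmult_le_compat_r; [ left; apply exp_pos | exact L ].
    - apply lim_oo_scal, gint_limit. auto.
    - exists 0. intros X HX. apply gint_rec; auto. }
  split.
  - rewrite Gamma_1. lra.
  - exact Hrec.
  (* The linear form of Hölder's inequality again, now under the integral; a is the logarithm of
     Gamma(m+2)/Gamma(m+1). *)
  - intros m s Hm Hs. set (a := ln (m + 1)).
    apply Rle_trans with ((1 - s) * exp (s * a) * Gamma (m + 1) + s * exp ((s - 1) * a) * Gamma (m + 1 + 1)).
    + apply (lim_oo_le (gint (m + s)) (fun b => (1 - s) * exp (s * a) * gint m b + s * exp ((s - 1) * a) * gint (m + 1) b)).
      * apply gint_limit. lra.
      * apply lim_oo_plus; apply lim_oo_scal; apply gint_limit; lra.
      * exists 0. intros X HX. apply gint_le; try lra. intros t Ht. rewrite !pw_pos by auto.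
        assert (Cv := exp_convex s (s * a) ((s - 1) * a + ln t) Hs).
        replace ((1 - s) * (s * a) + s * ((s - 1) * a + ln t)) with (s * ln t) in Cv by ring.
        apply (Rmult_le_compat_l (exp (m * ln t))) in Cv; [ | left; apply exp_pos ].
        rewrite <- exp_plus in Cv. replace ((m + s) * ln t) with (m * ln t + s * ln t) by ring.
        eapply Rle_trans; [ exact Cv | ]. rewrite exp_plus.
        replace ((m + 1) * ln t) with (m * ln t + ln t) by ring. rewrite exp_plus. right; ring.
    + rewrite Hrec by auto. replace ((s - 1) * a) with (s * a + - a) by ring. rewrite exp_plus.
      unfold a at 3. rewrite exp_Ropp, exp_ln by lra. right. field. lra.
Qed.

(** * Wallis integrals and the normalising constant *)

Definition wallis (m : nat) : R := RInt (fun t => sin t ^ m) 0 (PI / 2).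

Lemma wallis_ex_RInt (m : nat) : ex_RInt (fun t => sin t ^ m) 0 (PI / 2).
Proof.
  apply (ex_RInt_continuous (V:=R_CompleteNormedModule)). intros z _.
  apply (ex_derive_continuous (V:=R_NormedModule)). auto_derive. auto.
Qed.

(** The integral over [0, pi/2] of the derivative of cos t sin^{m+1} t, whose boundary values
    vanish. *)
Lemma wallis_rec (m : nat) : (INR m + 2) * wallis (S (S m)) = (INR m + 1) * wallis m.
Proof.
  assert (I : is_RInt (fun t => (INR m + 1) * sin t ^ m - (INR m + 2) * sin t ^ (S (S m))) 0 (PI / 2)
                (cos (PI / 2) * sin (PI / 2) ^ S m - cos 0 * sin 0 ^ S m)).
  { apply (is_RInt_derive (V:=R_CompleteNormedModule) (fun t => cos t * sin t ^ S m)).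
    - intros x _. auto_derive; auto. pose proof (sin2_cos2 x) as H. unfold Rsqr in H.
      change (match m with 0%nat => 1 | S _ => INR m + 1 end) with (INR (S m)). rewrite S_INR. simpl.
      assert (Hc : cos x * cos x = 1 - sin x * sin x) by lra.
      transitivity ((INR m + 1) * (cos x * cos x) * sin x ^ m - sin x * (sin x * sin x ^ m)); [ ring | rewrite Hc; ring ].
    - intros x _. apply (ex_derive_continuous (V:=R_NormedModule)). auto_derive. auto. }
  rewrite cos_PI2, sin_0 in I. rewrite pow_i in I by lia.
  assert (J1 := is_RInt_scal (V:=R_NormedModule) _ _ _ (INR m + 1) _ (RInt_correct (V:=R_CompleteNormedModule) _ _ _ (wallis_ex_RInt m))).
  assert (J2 := is_RInt_scal (V:=R_NormedModule) _ _ _ (INR m + 2) _ (RInt_correct (V:=R_CompleteNormedModule) _ _ _ (wallis_ex_RInt (S (S m))))).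
  assert (J := is_RInt_minus (V:=R_NormedModule) _ _ _ _ _ _ J1 J2).
  apply (is_RInt_unique (V:=R_CompleteNormedModule)) in J. apply (is_RInt_unique (V:=R_CompleteNormedModule)) in I.
  assert (E := eq_trans (eq_sym I) J). unfold minus, plus, opp, scal in E; simpl in E. unfold mult in E; simpl in E.
  unfold wallis. simpl. lra.
Qed.

Lemma wallis_decr (m : nat) : wallis (S m) <= wallis m.
Proof.
  pose proof PI_RGT_0. apply RInt_le; [ lra | apply wallis_ex_RInt | apply wallis_ex_RInt | ].
  intros t Ht. pose proof (SIN_bound t). assert (0 <= sin t) by (apply sin_ge_0; lra).
  pose proof (pow_le (sin t) m). simpl. nra.
Qed.

Lemma wallis_0 : wallis 0 = PI / 2.
Proof.
  unfold wallis. simpl. rewrite (RInt_const (V:=R_CompleteNormedModule)). unfold scal; simpl. unfold mult; simpl. ring.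
Qed.

Lemma wallis_1 : wallis 1 = 1.
Proof.
  replace 1 with (- cos (PI / 2) - - cos 0) by (rewrite cos_PI2, cos_0; ring).
  apply (is_RInt_unique (V:=R_CompleteNormedModule)).
  apply (is_RInt_derive (V:=R_CompleteNormedModule) (fun t => - cos t)).
  - intros x _. auto_derive; auto. ring.
  - intros x _. apply (ex_derive_continuous (V:=R_NormedModule)). auto_derive. auto.
Qed.

(** The closed forms of the Wallis integrals are written with the rising products that occur in
    [gamma_like_bounds] at s = 1/2 and s = 0. *)
Lemma wallis_odd (n : nat) : wallis (2 * n + 1) * fprod n (fun i => INR i + 1 / 2 + 1) = fprod n (fun i => INR i + 0 + 1).
Proof.
  induction n as [ | n IH]; [ simpl; rewrite wallis_1; ring | ].
  replace (2 * S n + 1)%nat with (S (S (2 * n + 1))) by lia. cbn [fprod].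
  assert (E := wallis_rec (2 * n + 1)). rewrite plus_INR, mult_INR in E. simpl (INR 2) in E. simpl (INR 1) in E.
  rewrite <- IH. pose proof (pos_INR n).
  replace (wallis (S (S (2 * n + 1)))) with ((INR n + 0 + 1) / (INR n + 1 / 2 + 1) * wallis (2 * n + 1)).
  - field. lra.
  - apply (Rmult_eq_reg_l ((1 + 1) * INR n + 1 + 2)); [ | lra ]. rewrite E. field. lra.
Qed.

Lemma wallis_even (n : nat) : wallis (2 * n) * ((2 * INR n + 1) * fprod n (fun i => INR i + 0 + 1)) = PI / 2 * fprod n (fun i => INR i + 1 / 2 + 1).
Proof.
  induction n as [ | n IH]; [ simpl; rewrite wallis_0; ring | ].
  replace (2 * S n)%nat with (S (S (2 * n))) by lia. cbn [fprod].
  assert (E := wallis_rec (2 * n)). rewrite mult_INR in E. simpl (INR 2) in E. pose proof (pos_INR n).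
  replace (wallis (S (S (2 * n)))) with ((2 * INR n + 1) / (2 * INR n + 2) * wallis (2 * n)).
  - rewrite S_INR.
    replace (PI / 2 * (fprod n (fun i => INR i + 1 / 2 + 1) * (INR n + 1 / 2 + 1))) with (PI / 2 * fprod n (fun i => INR i + 1 / 2 + 1) * (INR n + 1 / 2 + 1)) by ring.
    rewrite <- IH. field. lra.
  - apply (Rmult_eq_reg_l ((1 + 1) * INR n + 2)); [ | lra ]. rewrite E. field. lra.
Qed.

Lemma le_of_forall_ratio (x y : R) : 0 <= y -> (forall n, (INR n + 1 / 2) * x <= (INR n + 3 / 2) * y) -> x <= y.
Proof.
  intros Hy H. apply Rnot_lt_le. intros Hlt. destruct (INR_unbounded (2 * y / (x - y))) as [n Hn].
  specialize (H n). apply (Rmult_lt_compat_r (x - y)) in Hn; [ | lra ].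
  unfold Rdiv in Hn. rewrite Rmult_assoc, Rinv_l, Rmult_1_r in Hn by lra. nra.
Qed.

(** For the Gamma function this is Gamma(3/2)^2 = pi/4. Monotonicity of the Wallis integrals
    encloses the squared quotient of the two rising products, the gamma-like bounds enclose
    g(1/2)/g(0) through the same quotient, and the gaps are factors (n+1/2)/(n+1) and (n+3/2)/(n+1),
    which tend to 1. *)
Lemma gamma_like_half (g : R -> R) : gamma_like g -> (g (1 / 2)) ^ 2 = PI / 4 * (g 0) ^ 2.
Proof.
  intros Hg. assert (g0 := gl_pos g Hg). assert (gh := gamma_like_pos_unit g (1 / 2) Hg ltac:(lra)). pose proof PI_RGT_0 as Hpi.
  assert (K : forall n, (INR n + 1 / 2) * g (1 / 2) ^ 2 <= (INR n + 1) * (PI / 4 * g 0 ^ 2) /\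
                        (INR n + 1) * (PI / 4 * g 0 ^ 2) <= (INR n + 3 / 2) * g (1 / 2) ^ 2).
  { intros n. destruct (gamma_like_bounds g (1 / 2) n Hg ltac:(lra)) as [B1 B2].
    assert (Wo := wallis_odd n). assert (We := wallis_even n). assert (We' := wallis_even (S n)).
    assert (D1 := wallis_decr (2 * n)). assert (D2 := wallis_decr (2 * n + 1)).
    replace (S (2 * n)) with (2 * n + 1)%nat in D1 by lia. replace (S (2 * n + 1)) with (2 * S n)%nat in D2 by lia.
    cbn [fprod] in We'. rewrite S_INR in We'.
    pose proof (pos_INR n) as Hn. assert (Pp := fprod_INR_pos n (1 / 2) ltac:(lra)). assert (Pq := fprod_INR_pos n 0 ltac:(lra)).
    set (p := fprod n (fun i => INR i + 1 / 2 + 1)) in *. set (q := fprod n (fun i => INR i + 0 + 1)) in *.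
    set (x := INR n) in *. set (a := g (1 / 2)) in *. set (b := g 0) in *.
    assert (S1 : forall y, 0 < y -> exp (1 / 2 * ln y) ^ 2 = y).
    { intros y Hy. simpl. rewrite Rmult_1_r, <- exp_plus. replace (1 / 2 * ln y + 1 / 2 * ln y) with (ln y) by field. apply exp_ln; auto. }
    replace (1 - 1 / 2) with (1 / 2) in B2 by field.
    assert (Q1 : (x + 1 / 2) * q ^ 2 <= PI / 4 * p ^ 2).
    { apply (Rmult_le_compat_r (p * ((2 * x + 1) * q))) in D1; [ | apply Rmult_le_pos; [ | apply Rmult_le_pos ]; lra ].
      replace (wallis (2 * n + 1) * (p * ((2 * x + 1) * q))) with ((wallis (2 * n + 1) * p) * ((2 * x + 1) * q)) in D1 by ring.
      replace (wallis (2 * n) * (p * ((2 * x + 1) * q))) with ((wallis (2 * n) * ((2 * x + 1) * q)) * p) in D1 by ring.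
      rewrite Wo, We in D1. nra. }
    assert (Q2 : PI / 4 * p ^ 2 <= (x + 1) * q ^ 2).
    { assert (We2 : wallis (2 * S n) * ((x + 1) * q) = PI / 4 * p).
      { apply (Rmult_eq_reg_r (2 * x + 3)); [ | lra ].
        replace (wallis (2 * S n) * ((x + 1) * q) * (2 * x + 3)) with (wallis (2 * S n) * ((2 * (x + 1) + 1) * (q * (x + 0 + 1)))) by ring.
        rewrite We'. field. }
      apply (Rmult_le_compat_r (p * ((x + 1) * q))) in D2; [ | apply Rmult_le_pos; [ | apply Rmult_le_pos ]; lra ].
      replace (wallis (2 * n + 1) * (p * ((x + 1) * q))) with ((wallis (2 * n + 1) * p) * ((x + 1) * q)) in D2 by ring.
      replace (wallis (2 * S n) * (p * ((x + 1) * q))) with ((wallis (2 * S n) * ((x + 1) * q)) * p) in D2 by ring.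
      rewrite Wo, We2 in D2. nra. }
    assert (B1' : (p * a) ^ 2 <= (exp (1 / 2 * ln (x + 1)) * (q * b)) ^ 2) by (apply pow_incr; split; [ apply Rmult_le_pos; lra | exact B1 ]).
    assert (B2' : ((x + 1) * (q * b)) ^ 2 <= (exp (1 / 2 * ln (x + 1 / 2 + 1)) * (p * a)) ^ 2).
    { apply pow_incr; split; [ apply Rmult_le_pos; [ lra | apply Rmult_le_pos; lra ] | exact B2 ]. }
    rewrite !Rpow_mult_distr, S1 in B1', B2' by lra.
    assert (Hp2 : 0 < p ^ 2) by (apply pow_lt; auto). assert (Hb2 : 0 < b ^ 2) by (apply pow_lt; auto).
    split; apply (Rmult_le_reg_l (p ^ 2)); auto.
    - apply (Rmult_le_compat_l (x + 1 / 2)) in B1'; [ | lra ].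
      apply (Rmult_le_compat_l ((x + 1) * b ^ 2)) in Q1; [ | apply Rmult_le_pos; lra ]. lra.
    - apply (Rmult_le_compat_l ((x + 1) * b ^ 2)) in Q2; [ | apply Rmult_le_pos; lra ]. lra. }
  apply Rle_antisym; apply le_of_forall_ratio; try (intros n; destruct (K n) as [K1 K2]; pose proof (pos_INR n)).
  - pose proof (pow_lt _ 2 g0). apply Rmult_le_pos; lra.
  - eapply Rle_trans; [ exact K1 | ]. apply Rmult_le_compat_r; [ | lra ]. pose proof (pow_lt _ 2 g0). apply Rmult_le_pos; lra.
  - apply pow2_ge_0.
  - eapply Rle_trans; [ | exact K2 ]. apply Rmult_le_compat_r; [ | lra ]. pose proof (pow_lt _ 2 g0). apply Rmult_le_pos; lra.
Qed.

Lemma exp_bconst (nu : R) : 0 <= nu -> exp (bconst nu) * sqrt (2 * PI) = Rpower 2 nu * Gamma (nu + 1).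
Proof.
  intros Hnu. pose proof PI_RGT_0 as Hpi.
  assert (B0 : bgamma 0 * sqrt (2 * PI) = 1).
  { assert (H0 := gl_pos _ bgamma_like).
    assert (E := gamma_like_half bgamma bgamma_like).
    (* From bconst(1/2) = ln(1/2) and the factor 2^{-1/2}. With [gamma_like_half] this gives
       bgamma(0)^2 = 1/(2 pi). *)
    assert (Eh : bgamma (1 / 2) ^ 2 = 1 / 8).
    { unfold bgamma. rewrite bconst_half. simpl. rewrite Rmult_1_r, <- exp_plus.
      replace (ln (1 / 2) - 1 / 2 * ln 2 + (ln (1 / 2) - 1 / 2 * ln 2)) with (ln (1 / 2) + (ln (1 / 2) + - ln 2)) by field.
      rewrite !exp_plus, exp_Ropp, !exp_ln by lra. field. }
    assert (Hs : 0 < sqrt (2 * PI)) by (apply sqrt_lt_R0; lra).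
    assert (Es := pow2_sqrt (2 * PI) ltac:(lra)).
    assert (P2 : (bgamma 0 * sqrt (2 * PI)) ^ 2 = 1) by (rewrite Rpow_mult_distr, Es; lra).
    assert (0 < bgamma 0 * sqrt (2 * PI)) by (apply Rmult_lt_0_compat; auto). nra. }
  assert (U := gamma_like_unique bgamma (fun nu => Gamma (nu + 1)) nu bgamma_like Gamma_like Hnu).
  cbv beta in U. rewrite Gamma_1, Rmult_1_r in U.
  unfold Rpower. replace (exp (bconst nu)) with (exp (nu * ln 2) * bgamma nu).
  - rewrite U. rewrite <- (Rmult_1_r (exp (nu * ln 2) * Gamma (nu + 1))), <- B0. ring.
  - unfold bgamma. rewrite <- exp_plus. f_equal. ring.
Qed.

(** * Uniqueness of the continuation and the determinant *)

Lemma discrete_union (P Q : C -> Prop) :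
  (forall z : C, exists eps, 0 < eps /\ forall w, P w -> Cmod (Cminus w z) < eps -> w = z) ->
  (forall z : C, exists eps, 0 < eps /\ forall w, Q w -> Cmod (Cminus w z) < eps -> w = z) ->
  forall z : C, exists eps, 0 < eps /\ forall w, (P w \/ Q w) -> Cmod (Cminus w z) < eps -> w = z.
Proof.
  intros HP HQ z. destruct (HP z) as [e1 [He1 H1]]. destruct (HQ z) as [e2 [He2 H2]].
  exists (Rmin e1 e2). split; [ apply Rmin_pos; auto | ]. intros w [Hw | Hw] Hd.
  - apply H1; auto. eapply Rlt_le_trans; [ exact Hd | apply Rmin_l ].
  - apply H2; auto. eapply Rlt_le_trans; [ exact Hd | apply Rmin_r ].
Qed.

(** Both enumerations are the Bessel zeros, so F - G vanishes far to the right. It is holomorphic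
    off the union of the two exceptional sets, and the identity theorem brings the zeros to a
    segment of the imaginary axis above 0. *)
Lemma zeta_continuation_cder_unique (nu : R) (F G : C -> C) (d e : C) : 0 <= nu ->
  zeta_continuation nu F -> zeta_continuation nu G -> cder F 0 d -> cder G 0 e -> d = e.
Proof.
  intros Hnu [lF [EF [[sF SF] [P [_ [DP HP]]]]]] [lG [EG [[sG SG] [Q [_ [DQ HQ]]]]]] HF HG.
  destruct (bessel_spectrum_exists nu Hnu) as [lam Hlam].
  assert (El : forall n, lF n = lG n).
  { intros n. rewrite (spectrum_enum_unique nu lam lF), (spectrum_enum_unique nu lam lG); auto. }
  destruct (identity_near_0 (fun z => F z - G z)%C (fun z => P z \/ Q z) (Rmax sF sG) (discrete_union P Q DP DQ)) as [t0 [Ht0 H0]].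
  - intros z Hz.
    destruct (proj2 (ex_cder_ex_derive F z) (HP z (fun h => Hz (or_introl h)))) as [l1 L1].
    destruct (proj2 (ex_cder_ex_derive G z) (HQ z (fun h => Hz (or_intror h)))) as [l2 L2].
    eexists. apply cder_minus; eauto.
  - intros z Hz.
    assert (S1 := proj2 (is_cs_is_series _ _) (SF z (Rle_lt_trans _ _ _ (Rmax_l _ _) Hz))).
    assert (S2 := proj2 (is_cs_is_series _ _) (SG z (Rle_lt_trans _ _ _ (Rmax_r _ _) Hz))).
    replace (fun n => cpow_neg (lF n) z) with (fun n => cpow_neg (lG n) z) in S1
      by (apply functional_extensionality; intros n; rewrite El; reflexivity).
    rewrite (is_cs_unique _ _ _ S1 S2). ring.
  - apply (cder_unique_axis F G d e t0); auto. intros t Ht. apply Ceq_minus. apply H0. exact Ht.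
Qed.

Theorem theorem2p3 (nu : R) (hnu : 0 <= nu) :
  (exists F : C -> C, zeta_continuation nu F) /\
  forall (F : C -> C) (d : C), zeta_continuation nu F ->
    @is_derive C_AbsRing C_NormedModule F (RtoC 0) d ->
    cexp (Copp d) = RtoC (sqrt (2 * PI) / (Rpower 2 nu * Gamma (nu + 1))).
Proof.
  destruct (bessel_spectrum_exists nu hnu) as [lam Hlam].
  assert (Hz := zeta_cont_is_continuation nu lam hnu Hlam (spectrum_enum nu lam hnu Hlam)).
  split; [ exists (zeta_cont nu lam); exact Hz | ].
  intros F d HF Hd. apply cder_is_derive in Hd.
  rewrite (zeta_continuation_cder_unique nu F (zeta_cont nu lam) d (zeta0' nu) hnu HF Hz Hd (zeta_cont_cder_0 nu lam hnu)).
  destruct (logdet_limit nu hnu) as [l [-> Hl]].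
  assert (E : l = bconst nu) by (apply (lim_oo_eq (logdet nu) (logdet nu)); [ exact Hl | apply bconst_spec; auto | exists 0; auto ]).
  rewrite E, <- RtoC_opp, cexp_RtoC, <- (exp_bconst nu hnu), exp_Ropp. f_equal.
  assert (0 < sqrt (2 * PI)) by (pose proof PI_RGT_0; apply sqrt_lt_R0; lra).
  pose proof (exp_pos (bconst nu)). field. lra.
Qed.
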